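(* Let $m\in\mathbb{R}$ and let $W_1,W_2$ be polynomial-type complex-valued functions of $(\phi_1,\overline\phi_1,\phi_2,\overline\phi_2)$ (pure power type) such that for some $C>0$ and some $p\ge3$, $$|W_1|+|W_2|\le C|\phi|^p .$$ Then there is $\delta>0$ such that the following holds. Let $\phi=(\phi_1,\phi_2)\in C^1_{loc}(\mathbb{R};L^2(\mathbb{R}^3;\mathbb{C})^2)\cap C_{loc}(\mathbb{R};H^1(\mathbb{R}^3;\mathbb{C})^2)$ be any radial global solution of $$i\partial_t\phi_1=\left(\partial_r+\frac2r\right)\phi_2+m\phi_1-W_1,\qquad i\partial_t\phi_2=-\partial_r\phi_1-m\phi_2+W_2,$$ with $\sup_{t\ge0}\|\phi(t)\|_{H^1\cap L^\infty}\le\delta$. Then, for any $R>0$, $$\lim_{t\to\infty}\|\phi(t)\|_{L^2(B(0,R))}=0.$$ Therefore, no small soliton nor breather solution exists for this equation inside the ball $|x|<R$.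
   Context: Here $r=|x|$, $x\in\mathbb{R}^3$, $\phi_j=\phi_j(t,r)\in\mathbb{C}$, $|\phi|^2=|\phi_1|^2+|\phi_2|^2$, and $B(0,R)\subset\mathbb{R}^3$ is the ball of radius $R$ centred at the origin. The system is the reduction of the 3D nonlinear Dirac equation to spinors and nonlinearities of the form $$\begin{pmatrix}\phi_1(t,r)\begin{pmatrix}1\\0\end{pmatrix}\\ i\phi_2(t,r)\begin{pmatrix}\cos\theta\\ e^{i\varphi}\sin\theta\end{pmatrix}\end{pmatrix},\qquad \begin{pmatrix}W_1\begin{pmatrix}1\\0\end{pmatrix}\\ iW_2\begin{pmatrix}\cos\theta\\ e^{i\varphi}\sin\theta\end{pmatrix}\end{pmatrix}$$ in spherical coordinates $(r,\theta,\varphi)$; ''radial solution'' means a pair $(\phi_1,\phi_2)(t,r)$ depending on space only through $r$. A soliton is a nonzero standing-wave solution $e^{i\omega t}\Phi(x)$; a breather is a nonzero, spatially localized, time-periodic solution; the last sentence is the immediate consequence of the limit. *)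

(* Defs.v *)
From HB Require Import structures.
From mathcomp Require Import all_boot all_order all_algebra complex.
From mathcomp Require Import all_classical all_reals all_analysis.
Set Implicit Arguments.
Unset Strict Implicit.
Unset Printing Implicit Defensive.
Import Order.TTheory GRing.Theory Num.Theory numFieldNormedType.Exports.
Local Open Scope classical_set_scope.
Local Open Scope ring_scope.

Notation E3 R := (R * R * R)%type.
Notation C2 R := (R[i] * R[i])%type.

Definition leb3 (R : realType) :
    {measure set (measurableTypeR R * measurableTypeR R * measurableTypeR R)%type
       -> \bar R} :=
  ((@lebesgue_measure R \x @lebesgue_measure R) \x @lebesgue_measure R)%E.

Definition coord3 (R : realType) (i : 'I_3) (x : E3 R) : R :=
  [:: x.1.1; x.1.2; x.2]`_i.

Definition basis3 (R : realType) (i : 'I_3) : E3 R :=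
  ((i == 0 :> nat)%:R, (i == 1 :> nat)%:R, (i == 2 :> nat)%:R).

(* The library's norm on a product type is the maximum of the norms of the
   components, so the Euclidean norms on R^3 and on C^2 are defined here. *)
Definition enorm (R : realType) (x : E3 R) : R :=
  Num.sqrt (\sum_(i < 3) coord3 i x ^+ 2).

Definition spnorm (R : realType) (z : C2 R) : R :=
  Num.sqrt (Normc.normc z.1 ^+ 2 + Normc.normc z.2 ^+ 2).

Definition eball (R : realType) (a : R) : set (E3 R) := [set x | enorm x < a].

Definition recomp (R : realType) (k : 'I_4) (z : C2 R) : R :=
  [:: complex.Re z.1; complex.Im z.1; complex.Re z.2; complex.Im z.2]`_k.

Definition inL2 (R : realType) (u : E3 R -> C2 R) : Prop :=
  forall k : 'I_4, recomp k \o u \in Lfun (leb3 R) 2%:E.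

Definition L2norm_on (R : realType) (D : set (E3 R)) (u : E3 R -> C2 R) : \bar R :=
  'N[leb3 R]_2%:E[(fun x => (spnorm (u x))%:E) \_ D]%E.

Definition L2norm (R : realType) (u : E3 R -> C2 R) : \bar R := L2norm_on setT u.

Definition Linfnorm (R : realType) (u : E3 R -> C2 R) : \bar R :=
  'N[leb3 R]_+oo[(fun x => (spnorm (u x))%:E)]%E.

Fixpoint Ck (R : realType) (n : nat) (f : E3 R -> R) : Prop :=
  continuous f /\
  if n is n'.+1 then
    forall i : 'I_3, (forall x, derivable f x (basis3 R i)) /\
                     Ck n' (fun x => 'D_(basis3 R i) f x)
  else True.

Definition test_function (R : realType) (f : E3 R -> R) : Prop :=
  (forall n, Ck n f) /\ compact (closure [set x | f x != 0]).

Definition weak_partial (R : realType) (i : 'I_3) (u v : E3 R -> C2 R) : Prop :=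
  forall (k : 'I_4) (f : E3 R -> R), test_function f ->
    (\int[leb3 R]_x (recomp k (u x) * 'D_(basis3 R i) f x) =
     - \int[leb3 R]_x (recomp k (v x) * f x))%R.

Definition inH1 (R : realType) (u : E3 R -> C2 R) : Prop :=
  inL2 u /\ forall i : 'I_3, exists2 v, inL2 v & weak_partial i u v.

(* A representative of the weak derivative of u in L^2, unique up to null
   sets; only meaningful when u satisfies inH1. *)
Definition partial (R : realType) (i : 'I_3) (u : E3 R -> C2 R) : E3 R -> C2 R :=
  xget (fun=> (0, 0)) [set v | inL2 v /\ weak_partial i u v].

Definition H1norm (R : realType) (u : E3 R -> C2 R) : \bar R :=
  ((L2norm u `^ 2 + \sum_(i < 3) L2norm (partial i u) `^ 2) `^ 2^-1)%E.

Definition H1Linfnorm (R : realType) (u : E3 R -> C2 R) : \bar R :=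
  maxe (H1norm u) (Linfnorm u).

(* The derivative in the direction x / |x|, in the weak sense. *)
Definition radial_deriv (R : realType) (u : E3 R -> C2 R) (x : E3 R) : C2 R :=
  (\sum_(i < 3) ((coord3 i x / enorm x)%:C)%C * (partial i u x).1,
   \sum_(i < 3) ((coord3 i x / enorm x)%:C)%C * (partial i u x).2).

Definition radial_ext (R : realType) (f : R -> C2 R) (x : E3 R) : C2 R :=
  f (enorm x).

Definition diff_quotient (R : realType) (u : R -> E3 R -> C2 R) (t h : R)
    (x : E3 R) : C2 R :=
  (((h^-1)%:C)%C * ((u (t + h) x).1 - (u t x).1),
   ((h^-1)%:C)%C * ((u (t + h) x).2 - (u t x).2)).

Definition C1_L2 (R : realType) (u du : R -> E3 R -> C2 R) : Prop :=
  forall t : R,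
    [/\ inL2 (u t),
        inL2 (du t),
        L2norm (diff_quotient u t h - du t) @[h --> 0^'] --> 0%E &
        L2norm (du s - du t) @[s --> t] --> 0%E].

Definition C_H1 (R : realType) (u : R -> E3 R -> C2 R) : Prop :=
  forall t : R, inH1 (u t) /\ H1norm (u s - u t) @[s --> t] --> 0%E.

(* Polynomials in (z, conj z, w, conj w), homogeneous of some degree d. *)
Definition pure_power_poly (R : realType) (W : R[i] -> R[i] -> R[i]) : Prop :=
  exists (d : nat) (c : nat -> nat -> nat -> nat -> R[i]), forall z w : R[i],
    W z w = \sum_(i < d.+1) \sum_(j < d.+1) \sum_(k < d.+1)
              \sum_(l < d.+1 | (i + j + k + l == d)%N)
                c i j k l * z ^+ i * (z^*)%C ^+ j * w ^+ k * (w^*)%C ^+ l.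

(* The unknown is the profile phi t r = (phi_1 (t, r), phi_2 (t, r)); its
   values at r < 0 are irrelevant. The equations hold in L^2 at every time,
   with du the time derivative. *)
Definition radial_solution (R : realType) (m : R) (W1 W2 : R[i] -> R[i] -> R[i])
    (phi : R -> R -> C2 R) : Prop :=
  let u t := radial_ext (phi t) in
  C_H1 u /\
  exists2 du : R -> E3 R -> C2 R, C1_L2 u du &
    forall t : R, {ae leb3 R, forall x : E3 R,
      let z := u t x in
      ('i)%C * (du t x).1 =
        (radial_deriv (u t) x).2 + ((2 / enorm x)%:C)%C * z.2
        + (m%:C)%C * z.1 - W1 z.1 z.2 /\
      ('i)%C * (du t x).2 =
        - (radial_deriv (u t) x).1 - (m%:C)%C * z.2 + W2 z.1 z.2}.

Definition cis (R : realType) (a : R) : R[i] := (cos a +i* sin a)%C.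

Definition nonzero_on (R : realType) (D : set (E3 R)) (u : R -> E3 R -> C2 R) :
    Prop :=
  exists t : R, ~ {ae leb3 R, forall x : E3 R, D x -> u t x = (0, 0)}.

Definition standing_wave (R : realType) (u : R -> E3 R -> C2 R) : Prop :=
  exists (omega : R) (Phi : E3 R -> C2 R), forall t : R,
    {ae leb3 R, forall x : E3 R,
      u t x = (cis (omega * t) * (Phi x).1, cis (omega * t) * (Phi x).2)}.

Definition time_periodic (R : realType) (u : R -> E3 R -> C2 R) : Prop :=
  exists2 T : R, 0 < T &
    forall t : R, {ae leb3 R, forall x : E3 R, u (t + T) x = u t x}.

Definition soliton_on (R : realType) (D : set (E3 R)) (u : R -> E3 R -> C2 R) :
    Prop :=
  standing_wave u /\ nonzero_on D u.

(* Spatial localization is square integrability at every time, the weakest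
   requirement in the class of solutions considered. *)
Definition breather_on (R : realType) (D : set (E3 R)) (u : R -> E3 R -> C2 R) :
    Prop :=
  [/\ time_periodic u, forall t, inL2 (u t) & nonzero_on D u].

(* Main.v *)
Require Import Defs.
From HB Require Import structures.
From mathcomp Require Import all_boot all_order all_algebra complex.
From mathcomp Require Import all_classical all_reals all_analysis.
From mathcomp Require Import measurable_realfun.
From mathcomp Require Import ring lra.
Set Implicit Arguments.
Unset Strict Implicit.
Unset Printing Implicit Defensive.
Import Order.TTheory GRing.Theory Num.Theory numFieldNormedType.Exports.
Local Open Scope classical_set_scope.
Local Open Scope ring_scope.

(** Write x for the radius and Y for the four real components of x times
    (phi_1, phi_2). In the profiles Y the weight x^2 of polar coordinates
    disappears, the boundedness of phi becomes |Y| <= d x, and the equation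
    becomes a first order system on the half-line in which d/dx + 1/x and
    d/dx - 1/x couple the components, with mass terms m Y and a nonlinearity
    x w(Y / x), where w vanishes to third order at 0.

    The decay comes from a virial argument. The multiplier
    B = a d/dx + a'/2 with a = 1 - rho and rho = 1 / (1 + x) is antisymmetric,
    so the time derivative of the pairing of dY/dt with B Y contains only the
    commutators of B with the operators of the system. The mass terms commute
    with B and cancel, and the linear part is at most - M + (3/2) J, with M the
    integral of rho^2 Y'^2 and J the integral of rho^4 Y^2. The weighted Hardy
    inequality J <= (4/9) M ([hardy_rho]) makes this at most - M / 3
    ([cform_virial]). As w is of third order, |w(Y / x)| carries two additional
    factors |Y / x|, which are bounded by a multiple of d rho (radial decay,
    [quot_rho_le]); hence the nonlinear contributions are at most a constant
    times d^2 M and are absorbed when d is small. The virial functional is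
    bounded, so M is integrable in time; J is at most M and Lipschitz in time,
    so J tends to 0 ([En_descent], [En_cvg]). On the ball of radius R the weight rho^4 is
    bounded below, so the mass in the ball tends to 0 ([local_mass_le]).

    A solution has only one derivative in time, with values in L^2, and one in
    space, so the functional cannot be differentiated directly. It is replaced
    by h^-1 times the sum of the pairings of Y_k (t + h) with B Y_k (t). By
    antisymmetry of B this is differentiable in t for each h > 0
    ([pair_derive]), it is bounded uniformly in h ([Kf_bnd]), and the virial
    inequality holds for it up to the error of the difference quotient
    ([core]), which is small uniformly on compact time intervals
    ([strict_diff], [Kf'_uniform]).

    The passage from R^3 to the half-line has three ingredients. Dilations
    determine the volume of balls up to a constant, hence the image of Lebesgue
    measure under the radius ([radius_law], [polar_integral]). The time
    derivative is radial as a limit in the mean of radial difference quotients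
    ([radial_limit]), and the equation then gives the radial derivative as a
    function of the radius. Testing the weak derivatives with the fields
    x_i th(|x|^2) yields a weak identity in one variable ([weak_radial]); taking
    smoothed indicators of intervals for th and sharpening them at Lebesgue
    points shows that x^3 phi has increments given by an integral
    ([lebesgue_increment]), so the profile has an absolutely continuous
    representative ([radial_representative], [snapshot]).

    Finally, a standing wave has constant mass in the ball and a time-periodic
    solution has periodic mass, so in both cases the mass is equal to its
    limit 0 and the solution vanishes there ([mass_constant_zero]). *)

(** * Square-integrable functions *)

Section SquareIntegrable.
Context d (T : measurableType d) (R : realType) (m : {measure set T -> \bar R}).
Variables (D : set T) (mD : measurable D).
Implicit Types f g h : T -> R.

Definition intg f : Prop := m.-integrable D (EFin \o f).
Definition Int f : R := Rintegral m D f.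
Definition L2 f : Prop := measurable_fun D f /\ intg (fun x => f x ^+ 2).
Definition nrm f : R := Num.sqrt (Int (fun x => f x ^+ 2)).

Lemma aeD_imp (P Q : T -> Prop) : (forall x, D x -> P x -> Q x) ->
  {ae m, forall x, D x -> P x} -> {ae m, forall x, D x -> Q x}.
Proof. by move=> PQ; apply: filterS => x Px Dx; exact/PQ/Px. Qed.

Lemma aeD_and (P Q : T -> Prop) : {ae m, forall x, D x -> P x} ->
  {ae m, forall x, D x -> Q x} -> {ae m, forall x, D x -> P x /\ Q x}.
Proof. by apply: filterS2 => x Px Qx Dx; split; [exact: Px|exact: Qx]. Qed.

Lemma aeDW (P : T -> Prop) : (forall x, D x -> P x) -> {ae m, forall x, D x -> P x}.
Proof. by move=> h; exact: aeW. Qed.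

Lemma intg_meas f : intg f -> measurable_fun D f.
Proof. by move=> /measurable_int /measurable_EFinP. Qed.

Lemma intgD f g : intg f -> intg g -> intg (fun x => f x + g x).
Proof. by move=> hf hg; apply: (integrableD mD hf hg). Qed.

Lemma intgB f g : intg f -> intg g -> intg (fun x => f x - g x).
Proof. by move=> hf hg; apply: (integrableB mD hf hg). Qed.

Lemma intgN f : intg f -> intg (fun x => - f x).
Proof. by move=> hf; apply: (integrableN hf). Qed.

Lemma intgZ c f : intg f -> intg (fun x => c * f x).
Proof. by move=> hf; apply: (integrableZl mD c hf). Qed.

Lemma intg_le g f : measurable_fun D f -> intg g ->
  (forall x, D x -> `|f x| <= g x) -> intg f.
Proof.
move=> mf ig fg; apply: (le_integrable mD _ _ ig).
  exact/measurable_EFinP.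
move=> x Dx /=; rewrite lee_fin; exact: le_trans (fg x Dx) (ler_norm _).
Qed.

Lemma intg_sum (I : finType) (F : I -> T -> R) : (forall i, intg (F i)) ->
  intg (fun x => \sum_i F i x).
Proof.
move=> hF; rewrite /intg.
rewrite (_ : _ \o _ = (fun x => \sum_(i <- index_enum I) (EFin \o F i) x)%E).
  by apply: (integrable_sum mD) => i _; exact: (hF i).
by apply/funext => x /=; rewrite sumEFin.
Qed.

Lemma IntD f g : intg f -> intg g -> Int (fun x => f x + g x) = Int f + Int g.
Proof. by move=> hf hg; rewrite /Int RintegralD. Qed.

Lemma IntB f g : intg f -> intg g -> Int (fun x => f x - g x) = Int f - Int g.
Proof. by move=> hf hg; rewrite /Int RintegralB. Qed.

Lemma IntZ c f : intg f -> Int (fun x => c * f x) = c * Int f.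
Proof. by move=> hf; rewrite /Int RintegralZl. Qed.

Lemma IntN f : intg f -> Int (fun x => - f x) = - Int f.
Proof.
move=> hf; rewrite -mulN1r -IntZ//.
by apply: eq_Rintegral => x _; rewrite mulN1r.
Qed.

Lemma Int_eq f g : (forall x, D x -> f x = g x) -> Int f = Int g.
Proof. by move=> fg; apply: eq_Rintegral => x /set_mem Dx; rewrite fg. Qed.

Lemma intg_eq f g : (forall x, D x -> f x = g x) -> intg f -> intg g.
Proof. by move=> fg; apply: eq_integrable => // x /set_mem Dx /=; rewrite fg. Qed.

Lemma Int_sum (I : finType) (F : I -> T -> R) : (forall i, intg (F i)) ->
  Int (fun x => \sum_i F i x) = \sum_i Int (F i).
Proof.
move=> hF; elim: (index_enum I) => [|i s IH].
  rewrite big_nil (@Int_eq _ (fun=> 0)); last by move=> x _; rewrite big_nil.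
  by rewrite /Int Rintegral_cst// mul0r.
rewrite big_cons -IH -IntD//; first by apply: Int_eq => x _; rewrite big_cons.
rewrite /intg (_ : _ \o _ = (fun x => \sum_(i <- s) (EFin \o F i) x)%E).
  by apply: (integrable_sum mD) => j _; exact: (hF j).
by apply/funext => x /=; rewrite sumEFin.
Qed.

Lemma Int_le f g : intg f -> intg g -> (forall x, D x -> f x <= g x) ->
  Int f <= Int g.
Proof. by move=> hf hg fg; apply: le_Rintegral. Qed.

Lemma Int_ge0 f : (forall x, D x -> 0 <= f x) -> 0 <= Int f.
Proof. exact: Rintegral_ge0. Qed.

Lemma Int_norm f : intg f -> `|Int f| <= Int (fun x => `|f x|).
Proof. by move=> hf; apply: le_normr_Rintegral. Qed.

Lemma intg_norm f : intg f -> intg (fun x => `|f x|).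
Proof. by move=> hf; apply: (integrable_norm hf). Qed.

Lemma Int_ae f g : measurable_fun D f -> measurable_fun D g ->
  {ae m, forall x, D x -> f x = g x} -> Int f = Int g.
Proof.
move=> mf mg fg; rewrite /Int /Rintegral; congr fine.
apply: ae_eq_integral => //.
- exact/measurable_EFinP.
- exact/measurable_EFinP.
- by apply: filterS fg => x h Dx; rewrite h.
Qed.

Lemma intg_ae f g : measurable_fun D f -> measurable_fun D g ->
  {ae m, forall x, D x -> `|f x| <= `|g x|} -> intg g -> intg f.
Proof.
move=> mf mg fg ig; apply/integrableP; split; first exact/measurable_EFinP.
move/integrableP : ig => [_]; apply: le_lt_trans.
apply: ae_ge0_le_integral => //=.
- by apply/measurable_EFinP; exact: measurableT_comp.
- by apply/measurable_EFinP; exact: measurableT_comp.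
Qed.

Lemma Int_le_ae f g : intg f -> intg g ->
  {ae m, forall x, D x -> f x <= g x} -> Int f <= Int g.
Proof.
move=> hf hg fg.
have mf := intg_meas hf; have mg := intg_meas hg.
have mM : measurable_fun D (fun x => Num.max (f x) (g x)).
  exact: measurable_maxr.
have E : {ae m, forall x, D x -> Num.max (f x) (g x) = g x}.
  by apply: filterS fg => x h Dx; apply/max_idPr/h.
have iM : intg (fun x => Num.max (f x) (g x)).
  by apply: intg_ae hg => //; apply: filterS E => x + Dx => ->.
rewrite -(Int_ae mM mg E); apply: Int_le => // x Dx.
by rewrite le_max lexx.
Qed.

Lemma L2_mulr f g : L2 f -> L2 g -> intg (fun x => f x * g x).
Proof.
move=> [mf f2] [mg g2].
apply: (@intg_le (fun x => f x ^+ 2 + g x ^+ 2)).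
- exact: measurable_funM.
- exact: intgD.
- move=> x _; rewrite normrM -[f x ^+ 2]real_normK ?num_real//.
  rewrite -[g x ^+ 2]real_normK ?num_real//.
  have := normr_ge0 (f x); have := normr_ge0 (g x).
  move: `|f x| `|g x| => a b a0 b0; nra.
Qed.

Lemma L2D f g : L2 f -> L2 g -> L2 (fun x => f x + g x).
Proof.
move=> hf hg; split; first by apply: measurable_funD; [apply hf.1|apply hg.1].
apply: (@intg_eq (fun x => f x ^+ 2 + (2 * (f x * g x) + g x ^+ 2))).
  by move=> x _; ring.
by apply: intgD; [exact: hf.2|apply: intgD; [apply: intgZ; apply: L2_mulr|exact: hg.2]].
Qed.

Lemma L2_bnd (b f : T -> R) (K : R) : measurable_fun D b -> (forall x, D x -> `|b x| <= K) ->
  L2 f -> L2 (fun x => b x * f x).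
Proof.
move=> mb bK [mf f2]; split; first exact: measurable_funM.
apply: (@intg_le (fun x => K ^+ 2 * f x ^+ 2)).
- by apply: measurable_funX; apply: measurable_funM.
- exact: intgZ.
- move=> x Dx; rewrite ger0_norm ?sqr_ge0// exprMn ler_wpM2r ?sqr_ge0//.
  rewrite -(real_normK (num_real (b x))) lerXn2r ?nnegrE//; last exact: bK.
  exact: le_trans (bK x Dx).
Qed.

Lemma L2Z c f : L2 f -> L2 (fun x => c * f x).
Proof. by move=> hf; apply: (@L2_bnd (fun=> c) f `|c|). Qed.

Lemma L2_eq f g : (forall x, D x -> f x = g x) -> L2 f -> L2 g.
Proof.
move=> fg [mf f2]; split; last first.
  by apply: intg_eq f2 => x Dx; rewrite fg.
by apply: eq_measurable_fun mf => x /set_mem Dx; rewrite fg.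
Qed.

Lemma L2N f : L2 f -> L2 (fun x => - f x).
Proof. by move=> hf; apply: L2_eq (L2Z (-1) hf) => x _; rewrite mulN1r. Qed.

Lemma L2B f g : L2 f -> L2 g -> L2 (fun x => f x - g x).
Proof. by move=> hf hg; apply: (L2D hf (L2N hg)). Qed.

Lemma L2_le g f : measurable_fun D f -> L2 g ->
  (forall x, D x -> `|f x| <= `|g x|) -> L2 f.
Proof.
move=> mf [mg g2] fg; split => //; apply: (intg_le _ g2).
  exact: measurable_funX.
move=> x Dx; rewrite ger0_norm ?sqr_ge0//.
rewrite -(real_normK (num_real (f x))) -(real_normK (num_real (g x))).
by rewrite lerXn2r ?nnegrE// fg.
Qed.

Lemma L2_ae g f : measurable_fun D f -> L2 g ->
  {ae m, forall x, D x -> f x = g x} -> L2 f.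
Proof.
move=> mf [mg g2] fg; split => //; apply: (intg_ae _ _ _ g2).
- exact: measurable_funX.
- exact: measurable_funX.
- by apply: filterS fg => x h Dx; rewrite h.
Qed.

Lemma L2_norm f : L2 f -> L2 (fun x => `|f x|).
Proof.
move=> hf; apply: (L2_le _ hf).
  by apply: measurableT_comp => //; exact: hf.1.
by move=> x _; rewrite normr_id.
Qed.

Lemma nrm_ge0 f : 0 <= nrm f. Proof. exact: sqrtr_ge0. Qed.

Lemma nrm_sqr f : nrm f ^+ 2 = Int (fun x => f x ^+ 2).
Proof. by rewrite sqr_sqrtr// Int_ge0// => x _; rewrite sqr_ge0. Qed.

Lemma eq_nrm f g : (forall x, D x -> f x = g x) -> nrm f = nrm g.
Proof. by move=> fg; congr Num.sqrt; apply: Int_eq => x Dx; rewrite fg. Qed.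

Lemma nrm_ae f g : measurable_fun D f -> measurable_fun D g ->
  {ae m, forall x, D x -> f x = g x} -> nrm f = nrm g.
Proof.
move=> mf mg fg; congr Num.sqrt; apply: Int_ae; try exact: measurable_funX.
by apply: filterS fg => x h Dx; rewrite h.
Qed.

Lemma Int_sqrD f g : L2 f -> L2 g -> Int (fun x => (f x + g x) ^+ 2) =
  nrm f ^+ 2 + 2 * Int (fun x => f x * g x) + nrm g ^+ 2.
Proof.
move=> hf hg; rewrite !nrm_sqr.
rewrite (@Int_eq _ (fun x => f x ^+ 2 + (2 * (f x * g x)) + g x ^+ 2)); last first.
  by move=> x _; ring.
have ifg := L2_mulr hf hg.
rewrite IntD; [|by apply: intgD; [exact: hf.2|exact: intgZ]|exact: hg.2].
by rewrite IntD; [|exact: hf.2|exact: intgZ]; rewrite IntZ.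
Qed.

Lemma nrmZ c f : L2 f -> nrm (fun x => c * f x) = `|c| * nrm f.
Proof.
move=> hf; rewrite /nrm (@Int_eq _ (fun x => c ^+ 2 * f x ^+ 2)).
  by rewrite IntZ; [rewrite sqrtrM ?sqr_ge0// sqrtr_sqr|exact: hf.2].
by move=> x _; rewrite exprMn.
Qed.

(** The quadratic polynomial [s |-> Int ((s * f + g) ^ 2)] is nonnegative. *)
Lemma cauchy_schwarz f g : L2 f -> L2 g ->
  `|Int (fun x => f x * g x)| <= nrm f * nrm g.
Proof.
move=> hf hg.
set I := Int _.
have key s : 0 <= s ^+ 2 * nrm f ^+ 2 + 2 * (s * I) + nrm g ^+ 2.
  have := Int_sqrD (L2Z s hf) hg.
  rewrite nrmZ// exprMn real_normK ?num_real//.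
  rewrite (@Int_eq (fun x => s * f x * g x) (fun x => s * (f x * g x))); last first.
    by move=> x _; rewrite mulrA.
  rewrite IntZ; last exact: L2_mulr.
  rewrite -/I => <-; apply: Int_ge0 => x _; exact: sqr_ge0.
have f0 := nrm_ge0 f; have g0 := nrm_ge0 g.
rewrite -(@ler_pXn2r _ 2) ?nnegrE ?mulr_ge0// real_normK ?num_real//.
rewrite exprMn.
move: key f0 g0; move: (nrm f) (nrm g) I => a b I key a0 b0.
have [a0E|an0] := eqVneq a 0.
  have [->|In0] := eqVneq I 0; first by rewrite expr0n/= a0E expr0n/= mul0r.
  have := key (- (b ^+ 2 + 1) / (2 * I)).
  have -> : - (b ^+ 2 + 1) / (2 * I) * I = - (b ^+ 2 + 1) / 2 by field.
  by rewrite a0E => h; exfalso; nra.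
have := key (- I / a ^+ 2).
have -> : (- I / a ^+ 2) ^+ 2 * a ^+ 2 = I ^+ 2 / a ^+ 2 by field.
have -> : 2 * (- I / a ^+ 2 * I) = - (2 * (I ^+ 2 / a ^+ 2)) by field.
move=> h; have h2 : I ^+ 2 / a ^+ 2 <= b ^+ 2 by lra.
by rewrite mulrC -ler_pdivrMr// exprn_gt0// lt_def an0.
Qed.

Lemma Int_mul_le f g : L2 f -> L2 g -> Int (fun x => f x * g x) <= nrm f * nrm g.
Proof. by move=> hf hg; exact: le_trans (ler_norm _) (cauchy_schwarz hf hg). Qed.

Lemma nrmD f g : L2 f -> L2 g -> nrm (fun x => f x + g x) <= nrm f + nrm g.
Proof.
move=> hf hg.
rewrite -(@ler_pXn2r _ 2) ?nnegrE ?nrm_ge0 ?addr_ge0 ?nrm_ge0//.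
rewrite [leLHS]nrm_sqr Int_sqrD//; have := Int_mul_le hf hg; nra.
Qed.

Lemma nrmN f : nrm (fun x => - f x) = nrm f.
Proof. by congr Num.sqrt; apply: Int_eq => x _; rewrite sqrrN. Qed.

Lemma nrmB f g : L2 f -> L2 g -> nrm (fun x => f x - g x) <= nrm f + nrm g.
Proof. by move=> hf hg; rewrite -(nrmN g); apply: nrmD => //; exact: L2N. Qed.

Lemma nrm_le f g : L2 f -> L2 g -> (forall x, D x -> `|f x| <= `|g x|) ->
  nrm f <= nrm g.
Proof.
move=> hf hg fg; apply: ler_wsqrtr; apply: Int_le; [exact: hf.2|exact: hg.2|].
move=> x Dx; rewrite -(real_normK (num_real (f x))).
by rewrite -(real_normK (num_real (g x))) lerXn2r ?nnegrE// fg.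
Qed.

End SquareIntegrable.

(** * Absolutely continuous functions on the half-line *)

Definition leb (R : realType) : {measure set (measurableTypeR R) -> \bar R} :=
  @lebesgue_measure R.

Section AbsolutelyContinuous.
Context (R : realType).
Local Notation mu := (leb R).
Local Notation H := [set` `](0 : R), +oo[].
Implicit Types (f g p q : R -> R) (a b x y : R).

(** Local absolute continuity, as the fundamental theorem of calculus on compact
    subintervals of the open half-line. The derivative is a parameter because
    an equation or a weak formulation supplies it, up to null sets. *)
Definition abscont f f' : Prop := forall a b : R, 0 < a -> a <= b ->
  intg mu `[a, b] f' /\ f b - f a = Int mu `[a, b] f'.

Lemma abscont_cst c : abscont (fun=> c) (fun=> 0).
Proof.
move=> a b a0 ab; split; first exact: integrable0.
by rewrite /Int Rintegral_cst// mul0r subrr.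
Qed.

Lemma abscontD f f' g g' : abscont f f' -> abscont g g' ->
  abscont (fun x => f x + g x) (fun x => f' x + g' x).
Proof.
move=> hf hg a b a0 ab; have [i1 e1] := hf a b a0 ab; have [i2 e2] := hg a b a0 ab.
by split; [exact: intgD|rewrite IntD// -e1 -e2; ring].
Qed.

Lemma abscontZ c f f' : abscont f f' -> abscont (fun x => c * f x) (fun x => c * f' x).
Proof.
move=> hf a b a0 ab; have [i1 e1] := hf a b a0 ab.
by split; [exact: intgZ|rewrite IntZ// -e1; ring].
Qed.

Lemma abscont_eq f f' g g' : (forall x, 0 < x -> f x = g x) ->
  (forall x, 0 < x -> f' x = g' x) -> abscont f f' -> abscont g g'.
Proof.
move=> fg fg' hf a b a0 ab; have [i1 e1] := hf a b a0 ab.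
have E x : `[a, b]%classic x -> f' x = g' x.
  by rewrite /= in_itv/= => /andP[ax _]; apply/fg'/(lt_le_trans a0).
split; first exact: intg_eq i1.
by rewrite -!fg// ?e1 ?(lt_le_trans a0)//; apply: Int_eq.
Qed.

Lemma abscontN f f' : abscont f f' -> abscont (fun x => - f x) (fun x => - f' x).
Proof. by move=> hf; apply: abscont_eq (abscontZ (-1) hf) => x _; rewrite mulN1r. Qed.

Lemma abscontB f f' g g' : abscont f f' -> abscont g g' ->
  abscont (fun x => f x - g x) (fun x => f' x - g' x).
Proof. by move=> hf hg; apply: (abscontD hf (abscontN hg)). Qed.

Lemma abscont_within f f' a b : abscont f f' -> 0 < a -> a <= b ->
  {within `[a, b], continuous f}.
Proof.
move=> hf a0 ab; have [i1 _] := hf a b a0 ab.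
have := parameterized_integral_continuous ab i1.
move=> h; apply: (@subspace_eq_continuous _ _ _
    (fun x => f a + parameterized_integral mu a x f')).
  move=> x; rewrite inE/= in_itv/= => /andP[ax xb].
  by rewrite /parameterized_integral; have [_] := hf a x a0 ax;
    rewrite /Int => <-; rewrite addrC subrK.
move=> x; apply: (@continuousD _ _ (subspace `[a, b]) (cst (f a)) (parameterized_integral mu a ^~ f')).
  exact: cst_continuous.
exact: h.
Qed.

Lemma abscont_meas_itv f f' a b : abscont f f' -> 0 < a -> measurable_fun `[a, b] f.
Proof.
move=> hf a0; have [ab|ba] := leP a b.
  by apply: subspace_continuous_measurable_fun => //; apply: abscont_within hf a0 ab.
by rewrite set_itv_ge ?bnd_simp -?ltNge//; exact: measurable_fun_set0.
Qed.

Lemma abscont_bnd f f' a b : abscont f f' -> 0 < a ->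
  exists2 M : R, 0 <= M & forall x, `[a, b]%classic x -> `|f x| <= M.
Proof.
move=> hf a0; have [ab|ba] := leP a b; last first.
  by exists 0 => // x; rewrite set_itv_ge ?bnd_simp -?ltNge.
have cw := abscont_within hf a0 ab.
have [c _ hc] := EVT_max ab cw; have [c' _ hc'] := EVT_min ab cw.
exists (`|f c| + `|f c'|); first by rewrite addr_ge0.
move=> x /= xab; have := hc x xab; have := hc' x xab.
rewrite ler_norml => h1 h2; have := ler_norm (f c); have := ler_norm (- f c').
rewrite normrN => h3 h4; have := normr_ge0 (f c); have := normr_ge0 (f c').
by move=> *; apply/andP; split; lra.
Qed.

Lemma itv0y_bigcup :
  H = \bigcup_n `[(n.+1%:R)^-1 : R, n.+1%:R]%classic.
Proof.
apply/seteqP; split => [x|x [n _]] /=; rewrite !in_itv/= ?andbT; last first.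
  by move=> /andP[h _]; apply: lt_le_trans h; rewrite invr_gt0.
move=> x0.
have h (y : R) : 0 <= y -> y <= (Num.bound y)%:R by move=> /archi_boundP/ltW.
exists (Num.bound x + Num.bound x^-1)%N => //=; rewrite in_itv/=.
have x1 := h x (ltW x0); have := h x^-1; rewrite invr_ge0 => /(_ (ltW x0)) x2.
apply/andP; split.
  rewrite -[leRHS]invrK lef_pV2 ?posrE ?invr_gt0//.
  by rewrite (le_trans x2)// ler_nat; apply/leqW/leq_addl.
by rewrite (le_trans x1)// ler_nat; apply/leqW/leq_addr.
Qed.

Lemma abscont_meas f f' : abscont f f' -> measurable_fun H f.
Proof.
move=> hf; rewrite itv0y_bigcup; apply/measurable_fun_bigcup => // n.
by apply: abscont_meas_itv hf _; rewrite invr_gt0.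
Qed.

Lemma abscont_meas' f f' : abscont f f' -> measurable_fun H f'.
Proof.
move=> hf; rewrite itv0y_bigcup; apply/measurable_fun_bigcup => // n.
apply: intg_meas (hf _ _ _ _).1; first by rewrite invr_gt0.
by rewrite (@le_trans _ _ 1)// ?ler1n// invf_le1// ler1n.
Qed.

Lemma abscont_intg_mul f f' g g' a b : abscont f f' -> abscont g g' -> 0 < a -> a <= b ->
  intg mu `[a, b] (fun x => f' x * g x).
Proof.
move=> hf hg a0 ab; have [i1 _] := hf a b a0 ab.
have [M M0 hM] := abscont_bnd b hg a0.
apply: (@intg_le _ _ _ mu _ _ (fun x => M * `|f' x|)) => //.
- by apply: measurable_funM; [exact: intg_meas i1|apply: abscont_meas_itv hg a0].
- exact/intgZ/intg_norm.
- by move=> x hx; rewrite normrM mulrC ler_wpM2r// hM.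
Qed.

(** Integrating [f' x * g' y] over the triangle [a <= y <= x <= b] in both
    orders. *)
Lemma abscont_triangle f f' g g' a b : abscont f f' -> abscont g g' -> 0 < a -> a <= b ->
  Int mu `[a, b] (fun x => f' x * (g x - g a)) =
  Int mu `[a, b] (fun y => g' y * (f b - f y)).
Proof.
move=> hf hg a0 ab; have [i1 e1] := hf a b a0 ab; have [i2 e2] := hg a b a0 ab.
pose p := f' \_ `[a, b]; pose q := g' \_ `[a, b].
have ip : mu.-integrable [set: measurableTypeR R] (EFin \o p).
  by rewrite /p -restrict_EFin; apply/integrable_restrict => //=; rewrite setTI.
have iq : mu.-integrable [set: measurableTypeR R] (EFin \o q).
  by rewrite /q -restrict_EFin; apply/integrable_restrict => //=; rewrite setTI.
have mp : measurable_fun [set: measurableTypeR R] p by exact: intg_meas ip.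
have mq : measurable_fun [set: measurableTypeR R] q by exact: intg_meas iq.
pose T2 := (measurableTypeR R * measurableTypeR R)%type.
pose L : set T2 := [set z | z.2 <= z.1].
have mL : measurable L.
  by rewrite -[L]setTI; apply: (measurable_fun_le measurableT).
pose k (z : T2) : R := p z.1 * q z.2 * \1_L z.
have mk : measurable_fun setT k.
  apply: measurable_funM => //; apply: measurable_funM.
  - exact: measurableT_comp mp _.
  - exact: measurableT_comp mq _.
have ik : (mu \x mu)%E.-integrable setT (EFin \o k).
  apply/integrable12ltyP; first exact/measurable_EFinP.
  apply: (@le_lt_trans _ _ (\int[mu]_x (`|p x|%:E * \int[mu]_y `|q y|%:E))%E).
    apply: ge0_le_integral => //=.
    - by move=> x _; apply: integral_ge0.
    - apply: (measurable_fun_fubini_tonelli_F (fun z : T2 => `|(k z)%:E|)%E) => //=.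
      by apply/measurable_EFinP; exact: measurableT_comp.
    - by apply: emeasurable_funM => //; apply/measurable_EFinP; exact: measurableT_comp.
    - move=> x _; rewrite -ge0_integralZl//=; last first.
        by apply/measurable_EFinP; exact: measurableT_comp.
      apply: ge0_le_integral => //=.
      + by apply/measurable_EFinP; apply: measurableT_comp => //; exact: measurableT_comp mk _.
      + by apply/measurable_EFinP; apply: measurable_funM => //; exact: measurableT_comp.
      + move=> y _; rewrite -EFinM lee_fin /k/= !normrM ler_piMr ?mulr_ge0//.
        by rewrite indicE; case: (_ \in _); rewrite ?normr1 ?normr0.
  have /integrableP[_ jp] := ip; have /integrableP[_ jq] := iq.
  rewrite ge0_integralZr//=; [|by apply/measurable_EFinP; exact: measurableT_comp|exact: integral_ge0].
  rewrite lte_mul_pinfty//; first exact: integral_ge0.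
  by rewrite ge0_fin_numE//; exact: integral_ge0.
have Fub := Fubini ik.
pose F x := f' x * (g x - g a); pose G y := g' y * (f b - f y).
have L1 x y : \1_L (x, y) = ((y <= x)%R : nat)%:R :> R.
  by rewrite indicE; congr (nat_of_bool _)%:R; apply/idP/idP; rewrite inE.
have EF x : (\int[mu]_y (EFin \o k) (x, y) = ((F \_ `[a, b]) x)%:E)%E.
  rewrite patchE; case: ifPn => [|xab]; last first.
    by apply: integral0_eq => y _; rewrite /k/= /p patchE (negbTE xab) !mul0r.
  rewrite inE/= in_itv/= => /andP[ax xb].
  have [i3 e3] := hg a x a0 ax.
  transitivity (\int[mu]_(y in `[a, x]) ((f' x)%:E * (g' y)%:E))%E; last first.
    rewrite (@integralZl _ _ _ mu _ (measurable_itv _) _ i3) /F e3 EFinM /Int /Rintegral.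
    by rewrite fineK; [|exact: (@integrable_fin_num _ _ _ mu _ (measurable_itv _) _ i3)].
  rewrite [RHS]integral_mkcond; apply: eq_integral => y _.
  rewrite /k/= /p /q !patchE !mem_setE !in_itv/= ax xb/= L1.
  have [yx|xy] := leP y x; last by rewrite mulr0 andbF.
  rewrite (le_trans yx xb) andbT mulr1; case: ifP => _; last by rewrite mulr0.
  by rewrite EFinM.
have EG y : (\int[mu]_x (EFin \o k) (x, y) = ((G \_ `[a, b]) y)%:E)%E.
  rewrite patchE; case: ifPn => [|yab]; last first.
    by apply: integral0_eq => x _; rewrite /k/= [q y]patchE (negbTE yab) mulr0 mul0r.
  rewrite inE/= in_itv/= => /andP[ay yb].
  have [i3 e3] := hf y b (lt_le_trans a0 ay) yb.
  transitivity (\int[mu]_(x in `[y, b]) ((g' y)%:E * (f' x)%:E))%E; last first.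
    rewrite (@integralZl _ _ _ mu _ (measurable_itv _) _ i3) /G e3 EFinM /Int /Rintegral.
    by rewrite fineK; [|exact: (@integrable_fin_num _ _ _ mu _ (measurable_itv _) _ i3)].
  rewrite [RHS]integral_mkcond; apply: eq_integral => x _.
  rewrite /k/= /p /q !patchE !mem_setE !in_itv/= ay yb/= L1.
  have [yx|xy] := leP y x; last by rewrite mulr0.
  rewrite (le_trans ay yx)/= mulr1; case: ifP => _; last by rewrite mul0r.
  by rewrite -EFinM (mulrC (f' x)).
rewrite /Int [LHS]Rintegral_mkcond [RHS]Rintegral_mkcond /Rintegral; congr fine.
transitivity (\int[mu]_x \int[mu]_y (EFin \o k) (x, y))%E.
  by apply: eq_integral => x _; rewrite EF.
by rewrite Fub; apply: eq_integral => y _; rewrite EG.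
Qed.

(** Expanding both sides of [abscont_triangle] leaves the increment of the
    product. *)
Lemma abscontM f f' g g' : abscont f f' -> abscont g g' ->
  abscont (fun x => f x * g x) (fun x => f' x * g x + f x * g' x).
Proof.
move=> hf hg a b a0 ab; have [i1 e1] := hf a b a0 ab; have [i2 e2] := hg a b a0 ab.
have j1 := abscont_intg_mul hf hg a0 ab; have j2 := abscont_intg_mul hg hf a0 ab.
have j2' : intg mu `[a, b] (fun x => f x * g' x).
  by apply: (@intg_eq _ _ _ mu _ (measurable_itv _) _ _ _ j2) => x _; rewrite mulrC.
have mI : measurable (`[a, b]%classic : set (measurableTypeR R)).
  exact: measurable_itv.
split; first exact: (intgD mI j1 j2').
rewrite (IntD mI j1 j2').
have := abscont_triangle hf hg a0 ab.
rewrite (@Int_eq _ _ _ mu _ _ (fun x => f' x * g x - g a * f' x)); last first.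
  by move=> x _; ring.
rewrite (IntB mI j1 (intgZ mI _ i1)).
rewrite (@Int_eq _ _ _ mu _ (fun y => g' y * (f b - f y)) (fun x => f b * g' x - f x * g' x)); last first.
  by move=> x _; ring.
rewrite (IntB mI (intgZ mI _ i2) j2') (IntZ mI _ i1) (IntZ mI _ i2) -e1 -e2.
by move: (Int _ _ _) (Int _ _ _) => I J h; lra.
Qed.

End AbsolutelyContinuous.

(** * Integrals over the half-line and boundary behaviour *)

Notation H R := ([set` `](0 : R), +oo[] : set (measurableTypeR R)).
Notation "\I f" := (Int (leb _) (H _) f) (at level 10, f at level 9).

Section HalfLine.
Context (R : realType).
Local Notation mu := (leb R).
Local Notation H := (H R).
Implicit Types (f g p q h : R -> R) (a b x y : R) (A B : set (measurableTypeR R)).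

Lemma mH : measurable H.
Proof. exact: measurable_itv. Qed.

Lemma mItv a b : measurable (`[a, b]%classic : set (measurableTypeR R)).
Proof. exact: measurable_itv. Qed.

Lemma inH x : H x <-> 0 < x.
Proof. by rewrite /= in_itv/= andbT. Qed.

Lemma subH a b : 0 < a -> `[a, b] `<=` H.
Proof.
by move=> a0 x /=; rewrite !in_itv/= andbT => /andP[/(lt_le_trans a0)].
Qed.

Lemma intg_sub A B f : measurable A -> measurable B ->
  A `<=` B -> intg mu B f -> intg mu A f.
Proof. by move=> mA mB AB iB; apply: integrableS iB. Qed.

Lemma Int_subset A B f : measurable A -> measurable B ->
  A `<=` B -> intg mu B f -> (forall x, B x -> 0 <= f x) ->
  Int mu A f <= Int mu B f.
Proof.
move=> mA mB AB iB f0.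
have iA := intg_sub mA mB AB iB.
rewrite /Int /Rintegral fine_le//.
- exact: (@integrable_fin_num _ _ _ mu _ mA _ iA).
- exact: (@integrable_fin_num _ _ _ mu _ mB _ iB).
- apply: ge0_subset_integral => //. by apply/measurable_EFinP; exact: intg_meas iB.
Qed.

Lemma Int_split a b c f : a <= b -> b <= c -> intg mu `[a, c] f ->
  Int mu `[a, c] f = Int mu `[a, b] f + Int mu `[b, c] f.
Proof.
move=> ab bc iac.
have ibc : intg mu `]b, c] f.
  apply: intg_sub iac; [exact: measurable_itv|exact: measurable_itv|].
  by apply: subset_itv; rewrite bnd_simp.
have := @Rintegral_itvB _ f (BLeft a) (BRight c) b iac.
rewrite !bnd_simp => /(_ ab bc); rewrite Rintegral_itv_obnd_cbnd// => E.
by apply/eqP; rewrite addrC -subr_eq; apply/eqP.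
Qed.

Definition exh n : set (measurableTypeR R) := `[(n.+1%:R)^-1, n.+1%:R]%classic.

Lemma exhH n : exh n `<=` H.
Proof. by apply: subH; rewrite invr_gt0. Qed.

Lemma exh_le n : (n.+1%:R)^-1 <= n.+1%:R :> R.
Proof. by rewrite (@le_trans _ _ 1)// ?invf_le1 ?ler1n. Qed.

Lemma Int_exhaust h : intg mu H h -> Int mu (exh n) h @[n --> \oo] --> \I h.
Proof.
move=> ih; have mh := intg_meas ih.
have [] := @dominated_convergence _ _ _ mu H mH
  (fun n => (EFin \o h) \_ (exh n)) (EFin \o h) (fun x => `|h x|%:E).
- move=> n; apply/(measurable_restrict _ (mItv _ _) mH).
  apply: (measurable_funS mH); first by apply: subIset; left.
  exact/measurable_EFinP.
- exact/measurable_EFinP.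
- apply/aeW => x /inH x0; apply: cvg_near_cst.
  have h1 (y : R) : 0 <= y -> y <= (Num.bound y)%:R by move=> /archi_boundP/ltW.
  exists (Num.bound x + Num.bound x^-1)%N => // n /= hn.
  have x1 := h1 x (ltW x0); have := h1 x^-1; rewrite invr_ge0 => /(_ (ltW x0)) x2.
  rewrite patchE ifT//; apply/mem_set; rewrite /exh/= in_itv/=; apply/andP; split.
    rewrite -[leRHS]invrK lef_pV2 ?posrE ?invr_gt0//.
    by rewrite (le_trans x2)// ler_nat; apply: leqW; apply: leq_trans hn; apply: leq_addl.
  by rewrite (le_trans x1)// ler_nat; apply: leqW; apply: leq_trans hn; apply: leq_addr.
- exact: (intg_norm ih).
- apply/aeW => x n _; rewrite patchE; case: ifP => //= _.
  by rewrite normr0 lee_fin normr_ge0.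
move=> _ _ cv.
have cv' : (\int[mu]_(x in exh n) (h x)%:E @[n --> \oo] --> \int[mu]_(x in H) (h x)%:E)%E.
  apply: cvg_trans cv; apply: near_eq_cvg; near=> n => /=.
  rewrite -integral_mkcondr setIidr//; exact: exhH.
have ifin := @integrable_fin_num _ _ _ mu _ mH _ ih.
by apply: fine_cvg; rewrite fineK.
Unshelve. all: end_near. Qed.

(** The linear bound makes [f] start from a nonpositive value at the origin. *)
Lemma abscont_sup f f' p K x : abscont f f' -> intg mu H p -> (forall y, 0 < y -> 0 <= p y) ->
  (forall y, 0 < y -> f' y <= p y) -> (forall y, 0 < y <= 1 -> f y <= K * y) ->
  0 < x -> f x <= \I p.
Proof.
move=> hf ip p0 f'p fK x0; apply/ler_addgt0Pr => e e0.
pose a := Num.min (Num.min x 1) (e / (`|K| + 1)).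
have K1 : 0 < `|K| + 1 by rewrite ltr_wpDl.
have a0 : 0 < a by rewrite !lt_min x0 ltr01 divr_gt0.
have ax : a <= x by rewrite !ge_min lexx.
have a1 : a <= 1 by rewrite !ge_min lexx orbT.
have ae : a <= e / (`|K| + 1) by rewrite !ge_min lexx !orbT.
have [i1 e1] := hf a x a0 ax.
have ip' := intg_sub (mItv a x) mH (subH (b := x) a0) ip.
have -> : f x = f a + Int mu `[a, x] f' by rewrite -e1; ring.
rewrite addrC lerD//.
  apply: (@le_trans _ _ (Int mu `[a, x] p)).
    apply: (@Int_le _ _ _ mu _ (mItv a x) _ _ i1 ip') => y /=.
    by rewrite in_itv/= => /andP[ay _]; apply/f'p/(lt_le_trans a0).
  by apply: (Int_subset (mItv a x) mH (subH (b := x) a0) ip) => y /inH /p0.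
rewrite (le_trans (fK a _)) ?a0//.
rewrite (@le_trans _ _ (`|K| * a))//; first by rewrite ler_wpM2r ?ler_norm// ltW.
rewrite (@le_trans _ _ ((`|K| + 1) * a))//; first by rewrite ler_wpM2r ?lerDl// ltW.
by rewrite mulrC -ler_pdivlMr.
Qed.

(** An absolutely continuous function that is integrable together with its
    derivative has a limit at infinity, and integrability forces it to be 0. *)
Lemma abscont_int0 f f' K : abscont f f' -> intg mu H f' -> intg mu H f ->
  (forall x, 0 < x <= 1 -> `|f x| <= K * x) -> \I f' = 0.
Proof.
move=> hf i1 i0 fK.
apply/eqP; apply: contrapT => /negP I0.
pose I := \I f'; pose J := \I (fun x => `|f' x|).
have e0 : 0 < `|I| / 4 by rewrite divr_gt0// normr_gt0.
have i1n := intg_norm i1.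
have c1 := Int_exhaust i1; have c2 := Int_exhaust i1n.
have c3 : K * ((n.+1%:R)^-1 : R) @[n --> \oo] --> 0.
  by rewrite -(mulr0 K); apply: cvgMr; exact: cvg_harmonic.
have [N [n1 n2 n3]] : exists N,
  [/\ `|I - Int mu (exh N) f'| <= `|I| / 4,
      `|J - Int mu (exh N) (fun x => `|f' x|)| <= `|I| / 4 &
      `|0 - K * (N.+1%:R)^-1| <= `|I| / 4].
  have : \forall N \near \oo, [/\ `|I - Int mu (exh N) f'| <= `|I| / 4,
      `|J - Int mu (exh N) (fun x => `|f' x|)| <= `|I| / 4 &
      `|0 - K * (N.+1%:R)^-1| <= `|I| / 4].
    near=> N; split; near: N.
    - by move/cvgrPdist_le : c1; apply.
    - by move/cvgrPdist_le : c2; apply.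
    - by move/cvgrPdist_le : c3; apply.
  by case=> N _ hN; exists N; apply: hN => /=.
(* If the integral of f' were nonzero, the increments of f beyond N would be too
   small to bring |f| below a fixed positive level. *)
have fb x : N.+1%:R <= x -> `|I| / 4 <= `|f x|.
  move=> Nx; pose a : R := (N.+1%:R)^-1; pose b : R := N.+1%:R.
  have a0 : 0 < a by rewrite invr_gt0.
  have b0 : 0 < b by [].
  have ab : a <= b by exact: exh_le.
  have [j1 e1] := hf a b a0 ab; have [j2 e2] := hf b x b0 Nx.
  have [j3 e3] := hf a x a0 (le_trans ab Nx).
  have mU : `]b, x] `<=` `[b, x] by apply: subset_itv_oc_cc.
  have h2 : `|f x - f b| <= `|I| / 4.
    rewrite e2; apply: le_trans (@Int_norm _ _ _ mu _ (mItv b x) _ j2) _.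
    have E := Int_split ab Nx (intg_norm j3).
    have : Int mu `[a, x] (fun x => `|f' x|) <= J.
      by apply: (Int_subset (mItv a x) mH (subH (b := x) a0) i1n).
    move: n2; rewrite E -/a -/b /exh -/a -/b ler_norml => /andP[_].
    by move: (Int _ _ _) (Int _ _ _) => u v; lra.
  have h3 : `|f a| <= `|I| / 4.
    apply: (le_trans (fK a _)); first by rewrite a0 invf_le1// ler1n.
    by move: n3; rewrite sub0r normrN; apply: le_trans; exact: ler_norm.
  move: n1; rewrite /exh -/a -/b -e1 => h1.
  have -> : f x = I - ((I - (f b - f a)) - (f x - f b) - f a) by ring.
  move: h1 h2 h3; set u := I - (f b - f a); set v := f x - f b; set w := f a.
  move=> h1 h2 h3; have := ler_normB u v; have := ler_normB (u - v) w.
  have := lerB_dist I (u - v - w).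
  move: h1 h2 h3; set x1 := `|I|; set x2 := `|u - v - w|; set x3 := `|u|.
  set x4 := `|I - _|; set x5 := `|u - v|; set x6 := `|v|; set x7 := `|w|.
  by move: x1 x2 x3 x4 x5 x6 x7 => *; lra.
have ifn := intg_norm i0.
pose n := (Num.bound (\I (fun x => `|f x|) / (`|I| / 4))).
have hn : \I (fun x => `|f x|) / (`|I| / 4) < n%:R.
  by rewrite archi_boundP// divr_ge0// ?(ltW e0)// Int_ge0.
pose b : R := N.+1%:R; have b0 : 0 < b by [].
have : Int mu `[b, b + n%:R] (fun=> `|I| / 4) <= \I (fun x => `|f x|).
  apply: le_trans (Int_subset (mItv b (b + n%:R)) mH (subH (b := b + n%:R) b0) ifn _) => //.
  apply: (@Int_le _ _ _ mu _ (mItv _ _)).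
  - apply: continuous_compact_integrable; first exact: segment_compact.
    exact: continuous_subspaceT (@cst_continuous _ _ _).
  - exact: intg_sub (mItv b (b + n%:R)) mH (subH (b := b + n%:R) b0) ifn.
  - by move=> x /=; rewrite in_itv/= => /andP[bx _]; exact: fb.
rewrite /Int Rintegral_cst; last exact: mItv.
rewrite (_ : mu _ = lebesgue_measure `[b, b + n%:R]%classic)// lebesgue_measure_itv/= lte_fin; case: ifP => [_|]; last first.
  move/negbT; rewrite -leNgt gerDl => n0; move: hn.
  by rewrite ltNge (le_trans n0)// divr_ge0// ?(ltW e0)// Int_ge0.
rewrite -EFinD/= [b + _]addrC addrK mulrC leNgt => /negP; apply.
by rewrite -ltr_pdivrMr.
Unshelve. all: end_near. Qed.

Lemma abscont_C1 f f' : (forall x, 0 < x -> is_derive x 1 f (f' x)) ->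
  (forall x, 0 < x -> {for x, continuous f'}) -> abscont f f'.
Proof.
move=> df cf' a b a0 ab0.
have pos x : a <= x -> 0 < x by exact: lt_le_trans.
have cw : {within `[a, b], continuous f'}.
  apply: continuous_in_subspaceT => x /set_mem/=; rewrite in_itv/= => /andP[ax _].
  exact/cf'/pos.
have cf x : a <= x -> {for x, continuous f}.
  move=> /pos /df h; apply/differentiable_continuous/derivable1_diffP.
  exact: ex_derive.
split; first by apply: continuous_compact_integrable => //; exact: segment_compact.
move: ab0; rewrite le_eqVlt => /predU1P[<-|ab].
  by rewrite set_itv1 subrr /Int Rintegral_set1.
rewrite /Int /Rintegral (continuous_FTC2 (F := f) ab cw) //.
  split.
  - by move=> x; rewrite in_itv/= => /andP[/ltW/pos/df h _]; exact: ex_derive.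
  - by apply: cvg_at_right_filter; exact: cf.
  - by apply: cvg_at_left_filter; exact/cf/ltW.
by move=> x; rewrite in_itv/= => /andP[/ltW/pos/df h _]; rewrite derive1E derive_val.
Qed.

End HalfLine.

(** * Square-integrable functions on the half-line, vanishing at the origin *)

Section HalfLineL2.
Context (R : realType).
Local Notation mu := (leb R).
Local Notation H := (H R).
Implicit Types (f g p q h : R -> R) (a b c x y : R).

Definition ih f : Prop := intg mu H f.
Definition I f : R := Int mu H f.
Definition l2 f : Prop := L2 mu H f.
Definition nm f : R := nrm mu H f.
Definition aeH (P : R -> Prop) : Prop := {ae mu, forall x, H x -> P x}.

Let cH (P : R -> Prop) : (forall x, 0 < x -> P x) -> forall x, H x -> P x.
Proof. by move=> h x /inH; exact: h. Qed.

Lemma aeH_imp (P Q : R -> Prop) : (forall x, 0 < x -> P x -> Q x) -> aeH P -> aeH Q.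
Proof. by move=> /cH; exact: (@aeD_imp _ _ _ mu H). Qed.

Lemma aeH_and (P Q : R -> Prop) : aeH P -> aeH Q -> aeH (fun x => P x /\ Q x).
Proof. exact: (@aeD_and _ _ _ mu H). Qed.

Lemma aeHW (P : R -> Prop) : (forall x, 0 < x -> P x) -> aeH P.
Proof. by move=> /cH; exact: (@aeDW _ _ _ mu H). Qed.

Lemma ihD f g : ih f -> ih g -> ih (fun x => f x + g x).
Proof. exact: (@intgD _ _ _ mu H (@mH R)). Qed.
Lemma ihB f g : ih f -> ih g -> ih (fun x => f x - g x).
Proof. exact: (@intgB _ _ _ mu H (@mH R)). Qed.
Lemma ihN f : ih f -> ih (fun x => - f x).
Proof. exact: (@intgN _ _ _ mu H). Qed.
Lemma ihZ c f : ih f -> ih (fun x => c * f x).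
Proof. exact: (@intgZ _ _ _ mu H (@mH R)). Qed.
Lemma ih_eq f g : (forall x, 0 < x -> f x = g x) -> ih f -> ih g.
Proof. by move=> /cH; exact: (@intg_eq _ _ _ mu H (@mH R)). Qed.
Lemma ih_le g f : measurable_fun H f -> ih g ->
  (forall x, 0 < x -> `|f x| <= g x) -> ih f.
Proof. by move=> mf ig /cH; exact: (@intg_le _ _ _ mu H (@mH R)). Qed.
Lemma ID f g : ih f -> ih g -> I (fun x => f x + g x) = I f + I g.
Proof. exact: (@IntD _ _ _ mu H (@mH R)). Qed.
Lemma IB f g : ih f -> ih g -> I (fun x => f x - g x) = I f - I g.
Proof. exact: (@IntB _ _ _ mu H (@mH R)). Qed.
Lemma IZ c f : ih f -> I (fun x => c * f x) = c * I f.
Proof. exact: (@IntZ _ _ _ mu H (@mH R)). Qed.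
Lemma IN f : ih f -> I (fun x => - f x) = - I f.
Proof. exact: (@IntN _ _ _ mu H (@mH R)). Qed.
Lemma I_eq f g : (forall x, 0 < x -> f x = g x) -> I f = I g.
Proof. by move=> /cH; exact: (@Int_eq _ _ _ mu H). Qed.
Lemma I_le f g : ih f -> ih g -> (forall x, 0 < x -> f x <= g x) -> I f <= I g.
Proof. by move=> i1 i2 /cH; exact: (@Int_le _ _ _ mu H (@mH R)). Qed.
Lemma I_le_ae f g : ih f -> ih g -> aeH (fun x => f x <= g x) -> I f <= I g.
Proof. exact: (@Int_le_ae _ _ _ mu H (@mH R)). Qed.
Lemma I_ae f g : measurable_fun H f -> measurable_fun H g ->
  aeH (fun x => f x = g x) -> I f = I g.
Proof. exact: (@Int_ae _ _ _ mu H (@mH R)). Qed.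
Lemma I_ge0 f : (forall x, 0 < x -> 0 <= f x) -> 0 <= I f.
Proof. by move=> /cH; exact: (@Int_ge0 _ _ _ mu H). Qed.
Lemma I_norm f : ih f -> `|I f| <= I (fun x => `|f x|).
Proof. exact: (@Int_norm _ _ _ mu H (@mH R)). Qed.

Lemma l2_meas f : l2 f -> measurable_fun H f. Proof. by case. Qed.
Lemma l2_sqr f : l2 f -> ih (fun x => f x ^+ 2). Proof. by case. Qed.
Lemma l2M f g : l2 f -> l2 g -> ih (fun x => f x * g x).
Proof. exact: (@L2_mulr _ _ _ mu H (@mH R)). Qed.
Lemma l2D f g : l2 f -> l2 g -> l2 (fun x => f x + g x).
Proof. exact: (@L2D _ _ _ mu H (@mH R)). Qed.
Lemma l2B f g : l2 f -> l2 g -> l2 (fun x => f x - g x).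
Proof. exact: (@L2B _ _ _ mu H (@mH R)). Qed.
Lemma l2N f : l2 f -> l2 (fun x => - f x).
Proof. exact: (@L2N _ _ _ mu H (@mH R)). Qed.
Lemma l2Z c f : l2 f -> l2 (fun x => c * f x).
Proof. exact: (@L2Z _ _ _ mu H (@mH R)). Qed.
Lemma l2_bnd (b f : R -> R) (K : R) : measurable_fun H b -> (forall x, 0 < x -> `|b x| <= K) ->
  l2 f -> l2 (fun x => b x * f x).
Proof. by move=> mb /cH; exact: (@L2_bnd _ _ _ mu H (@mH R)). Qed.
Lemma l2_eq f g : (forall x, 0 < x -> f x = g x) -> l2 f -> l2 g.
Proof. by move=> /cH; exact: (@L2_eq _ _ _ mu H (@mH R)). Qed.
Lemma l2_le g f : measurable_fun H f -> l2 g ->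
  (forall x, 0 < x -> `|f x| <= `|g x|) -> l2 f.
Proof. by move=> mf hg /cH; exact: (@L2_le _ _ _ mu H (@mH R)). Qed.
Lemma l2_norm f : l2 f -> l2 (fun x => `|f x|).
Proof. exact: (@L2_norm _ _ _ mu H (@mH R)). Qed.

Lemma nm_ge0 f : 0 <= nm f. Proof. exact: nrm_ge0. Qed.
Lemma nm_sqr f : nm f ^+ 2 = I (fun x => f x ^+ 2). Proof. exact: nrm_sqr. Qed.
Lemma eq_nm f g : (forall x, 0 < x -> f x = g x) -> nm f = nm g.
Proof. by move=> /cH; exact: (@eq_nrm _ _ _ mu H). Qed.
Lemma nm_ae f g : measurable_fun H f -> measurable_fun H g ->
  aeH (fun x => f x = g x) -> nm f = nm g.
Proof. exact: (@nrm_ae _ _ _ mu H (@mH R)). Qed.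
Lemma nmZ c f : l2 f -> nm (fun x => c * f x) = `|c| * nm f.
Proof. exact: (@nrmZ _ _ _ mu H (@mH R)). Qed.
Lemma nmN f : nm (fun x => - f x) = nm f.
Proof. exact: (@nrmN _ _ _ mu H). Qed.
Lemma nmD f g : l2 f -> l2 g -> nm (fun x => f x + g x) <= nm f + nm g.
Proof. exact: (@nrmD _ _ _ mu H (@mH R)). Qed.
Lemma nmB f g : l2 f -> l2 g -> nm (fun x => f x - g x) <= nm f + nm g.
Proof. exact: (@nrmB _ _ _ mu H (@mH R)). Qed.
Lemma nm_le f g : l2 f -> l2 g -> (forall x, 0 < x -> `|f x| <= `|g x|) ->
  nm f <= nm g.
Proof. by move=> hf hg /cH; exact: (@nrm_le _ _ _ mu H (@mH R)). Qed.
Lemma CS f g : l2 f -> l2 g -> `|I (fun x => f x * g x)| <= nm f * nm g.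
Proof. exact: (@cauchy_schwarz _ _ _ mu H (@mH R)). Qed.
Lemma CSle f g : l2 f -> l2 g -> I (fun x => f x * g x) <= nm f * nm g.
Proof. exact: (@Int_mul_le _ _ _ mu H (@mH R)). Qed.

(** The regularity of x times a bounded radial H^1 function. The pointwise linear
    bound removes boundary terms at the origin, also against the weight 1/x. *)
Definition H10 f f' : Prop :=
  [/\ abscont f f', l2 f, l2 f' & exists K, forall x, 0 < x -> `|f x| <= K * x].

Lemma H10B f f' g g' : H10 f f' -> H10 g g' ->
  H10 (fun x => f x - g x) (fun x => f' x - g' x).
Proof.
move=> [a1 b1 c1 [K h1]] [a2 b2 c2 [L h2]]; split.
- exact: abscontB.
- exact: l2B.
- exact: l2B.
- exists (K + L) => x x0; rewrite mulrDl (le_trans (ler_normB _ _))//.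
  by apply: lerD; [exact: h1|exact: h2].
Qed.

Lemma abscont_inv c : 0 <= c ->
  abscont (fun x => (c + x)^-1) (fun x => - (c + x) ^- 2).
Proof.
move=> c0; apply: abscont_C1 => x x0; have x1 : c + x != 0 by rewrite gt_eqF// ltr_wpDl.
  have d1 : is_derive x 1 (fun y => c + y) 1.
    by apply: is_derive_eq; rewrite add0r mulr1.
  have := @is_deriveV R (fun y => c + y) x 1 1 x1 d1.
  by move=> h; apply: (is_derive_eq h); rewrite /GRing.scale/= mulr1.
have cc : {for x, continuous (fun y => c + y)}.
  by apply: continuousD; [exact: cst_continuous|exact: cvg_id].
apply: continuousN; apply: continuousV; first by rewrite expf_neq0.
by apply: (@continuous_comp _ _ _ (fun y => c + y) (fun y => y ^+ 2)) => //; exact: exprn_continuous.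
Qed.

Lemma abscont_invx : abscont (fun x => x^-1) (fun x => - x ^- 2).
Proof. by apply: abscont_eq (abscont_inv (lexx 0)) => x _; rewrite add0r. Qed.

(** The linear bound is used below 1, and square integrability of [f] beyond. *)
Lemma H10_divx f f' : H10 f f' -> l2 (fun x => f x / x).
Proof.
move=> [a1 b1 c1 [K h1]].
pose i : R -> R := \1_(`]0, 1]%classic).
have li : l2 i.
  split; first by apply: measurable_indic; exact: measurable_itv.
  apply: (@ih_eq i); last first.
    apply: (@intg_sub _ H setT _ (@mH R) measurableT); first by [].
    exact: integrable_indic_itv.
  by move=> x _; rewrite /i indicE; case: (_ \in _); rewrite ?expr1n ?expr0n.
have [mi _] := li; have [mf _] := b1.
apply: (@l2_le (fun x => `|K| * i x + `|f x|)).
- apply: measurable_funM => //; exact: abscont_meas abscont_invx.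
- exact: l2D (l2Z _ li) (l2_norm b1).
- move=> x x0; rewrite [X in _ <= X]ger0_norm; last first.
    by rewrite addr_ge0// mulr_ge0// /i indicE; case: (_ \in _).
  rewrite normrM normfV (gtr0_norm x0) ler_pdivrMr//.
  have fx := h1 x x0; rewrite mulrDl.
  have [x1|x1] := leP x 1.
    rewrite /i indicE mem_set ?mulr1/=; last by rewrite in_itv/= x0 x1.
    rewrite (le_trans fx)// (@le_trans _ _ (`|K| * x))//.
      by rewrite ler_wpM2r ?ler_norm// ltW.
    by rewrite lerDl mulr_ge0// ltW.
  rewrite (@le_trans _ _ (`|f x| * x))//; first by rewrite ler_peMr// ltW.
  by rewrite lerDr; apply: mulr_ge0; [apply: mulr_ge0 => //; rewrite /i indicE; case: (_ \in _)|exact: ltW].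
Qed.

End HalfLineL2.

(** * Weights, integration by parts, Hardy and virial identities *)

Section Identities.
Context (R : realType).
Local Notation H := (H R).
Implicit Types (f g P Q F G : R -> R) (a b : nat) (x : R).

Definition rho x : R := (1 + x)^-1.

Lemma rho_gt0 x : 0 < x -> 0 < rho x.
Proof. by move=> x0; rewrite invr_gt0 addr_gt0. Qed.

Lemma rho_le1 x : 0 < x -> rho x <= 1.
Proof. by move=> x0; rewrite invf_le1 ?lerDl ?addr_gt0// ltW. Qed.

Lemma rhoX_le1 x n : 0 < x -> 0 <= rho x ^+ n <= 1.
Proof.
by move=> x0; rewrite exprn_ge0 ?exprn_ile1 ?(rho_le1 x0)// ltW// rho_gt0.
Qed.

Lemma abscont_rho : abscont rho (fun x => - rho x ^+ 2).
Proof.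
by apply: abscont_eq (@abscont_inv R 1 ler01) => x x0 //; rewrite /rho exprVn.
Qed.

Lemma abscontX f f' n : abscont f f' ->
  abscont (fun x => f x ^+ n) (fun x => n%:R * (f x ^+ n.-1 * f' x)).
Proof.
move=> hf; elim: n => [|n IH].
  by apply: abscont_eq (abscont_cst 1) => x _; rewrite ?expr0// mul0r.
apply: abscont_eq (abscontM hf IH) => x _; first by rewrite exprS.
case: n {IH} => [|n]; rewrite /= ?expr0 ?mulr0 ?mul0r; first by ring.
by rewrite -natr1 exprS; ring.
Qed.

Lemma meas_rhoX n : measurable_fun H (fun x => rho x ^+ n).
Proof. exact: abscont_meas (abscontX n abscont_rho). Qed.

(** The weights of the integrations by parts below; b is the order of the
    singularity at the origin. *)
Definition mono a b x : R := rho x ^+ a * x^-1 ^+ b.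

Definition mono' a b x : R :=
  - (a%:R * rho x ^+ a.+1 * x^-1 ^+ b + b%:R * rho x ^+ a * x^-1 ^+ b.+1).

Lemma abscont_mono a b : abscont (mono a b) (mono' a b).
Proof.
apply: abscont_eq (abscontM (abscontX a abscont_rho) (abscontX b (@abscont_invx R))) => x x0 //.
rewrite /mono' -exprVn; move: (rho x) (x^-1) => r i.
by case: a => [|a]; case: b => [|b] /=; rewrite !exprS; ring.
Qed.

Lemma mono_bnd a b x : (b <= 1)%N -> 0 < x -> `|mono a b x| <= 1 + x^-1.
Proof.
move=> b1 x0; have /andP[r0 r1] := rhoX_le1 a x0; have i0 : 0 < x^-1 by rewrite invr_gt0.
rewrite /mono normrM (ger0_norm r0) (@le_trans _ _ (1 * `|x^-1 ^+ b|))//.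
  by rewrite ler_wpM2r.
by case: b b1 => [|[|//]] _; rewrite mul1r ?expr0 ?normr1 ?lerDl ?expr1 ?gtr0_norm ?lerDr// ltW.
Qed.

Lemma mono'_bnd a b x : (b <= 1)%N -> 0 < x ->
  `|mono' a b x| <= a.+1%:R * (1 + x^-1) ^+ 2.
Proof.
move=> b1 x0; have /andP[r0 r1] := rhoX_le1 a x0; have i0 : 0 < x^-1 by rewrite invr_gt0.
have /andP[s0 s1] := rhoX_le1 a.+1 x0.
rewrite /mono' normrN -natr1; move: r0 r1 s0 s1 i0.
move: (rho x ^+ a) (rho x ^+ a.+1) x^-1 => r s i r0 r1 s0 s1 i0.
have an : 0 <= a%:R :> R by [].
have as' : 0 <= a%:R * s <= a%:R by rewrite mulr_ge0//= ler_piMr.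
move: as'; move: (a%:R * s) an; move: (a%:R) => A t A0 /andP[t0 tA].
case: b b1 => [|[|//]] _; rewrite ?expr0 ?mulr1 ?mul0r ?addr0 ?mul1r ?expr1.
  by rewrite ger0_norm//; nra.
rewrite ger0_norm; last by rewrite addr_ge0 ?mulr_ge0 ?sqr_ge0// ltW.
apply: (@le_trans _ _ (A * i + 1 * i ^+ 2)).
  by apply: lerD; [rewrite ler_wpM2r// ltW|rewrite ler_wpM2r ?sqr_ge0].
have : 0 <= A * i by rewrite mulr_ge0// ltW.
have : 0 <= A * i ^+ 2 by rewrite mulr_ge0 ?sqr_ge0.
by nra.
Qed.

(** The derivative of the product of the weight rho^a / x^b with P and Q. *)
Definition dmono a b P P' Q Q' x : R :=
  mono' a b x * (P x * Q x) + mono a b x * (P' x * Q x + P x * Q' x).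

(** There are no boundary terms: P Q is O(x^2) at the origin, against a weight of
    size at most 1 + 1/x, and at infinity [abscont_int0] applies. *)
Lemma dmono0 a b P P' Q Q' : (b <= 1)%N -> H10 P P' -> H10 Q Q' ->
  ih (dmono a b P P' Q Q') /\ I (dmono a b P P' Q Q') = 0.
Proof.
move=> b1 hP hQ.
have lPx := H10_divx hP; have lQx := H10_divx hQ.
case: hP hQ => [aP lP lP' [K hK]] [aQ lQ lQ' [L hL]].
have aw := abscont_mono a b.
have ap := abscontM aw (abscontM aP aQ).
pose u x := `|P x| + `|P x / x|; pose v x := `|Q x| + `|Q x / x|.
have lu : l2 u by apply: l2D; exact: l2_norm.
have lv : l2 v by apply: l2D; exact: l2_norm.
have uE x : 0 < x -> u x = (1 + x^-1) * `|P x|.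
  by move=> x0; rewrite /u normrM normfV (gtr0_norm x0); ring.
have vE x : 0 < x -> v x = (1 + x^-1) * `|Q x|.
  by move=> x0; rewrite /v normrM normfV (gtr0_norm x0); ring.
have l1 x : 0 < x -> 1 <= 1 + x^-1 by move=> x0; rewrite lerDl invr_ge0 ltW.
have i1 : ih (fun x => mono a b x * (P x * Q x)).
  apply: (@ih_le _ (fun x => u x * v x)); [exact: abscont_meas ap|exact: l2M|].
  move=> x x0; rewrite uE// vE// normrM (normrM (P x)).
  have := mono_bnd a b1 x0; have := l1 x x0; move: (1 + _) => w w1 h.
  have -> : w * `|P x| * (w * `|Q x|) = (w * w) * (`|P x| * `|Q x|) by ring.
  by apply: ler_wpM2r; [rewrite mulr_ge0|rewrite (le_trans h)// ler_peMr// (le_trans ler01)].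
have i2 : ih (fun x => mono' a b x * (P x * Q x) + mono a b x * (P' x * Q x + P x * Q' x)).
  apply: (@ih_le _ (fun x => a.+1%:R * (u x * v x) + (`|P' x| * v x + u x * `|Q' x|))).
  - exact: abscont_meas' ap.
  - apply: ihD; first by apply: ihZ; exact: l2M.
    by apply: ihD; apply: l2M => //; exact: l2_norm.
  - move=> x x0; rewrite uE// vE// (le_trans (ler_normD _ _))// lerD//.
      rewrite normrM (le_trans (ler_wpM2r _ (mono'_bnd a b1 x0)))// (normrM (P x)).
      by rewrite le_eqVlt; apply/orP; left; apply/eqP; ring.
    rewrite normrM (le_trans (ler_wpM2r _ (mono_bnd a b1 x0)))//.
    rewrite (le_trans (ler_wpM2l _ (ler_normD _ _)))//; last first.
      by rewrite (normrM (P x)) (normrM (P' x)) le_eqVlt; apply/orP; left; apply/eqP; ring.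
    by rewrite (le_trans ler01)// l1.
split => //.
apply: (@abscont_int0 _ _ _ (2 * (`|K| * `|L|)) ap i2 i1) => x /andP[x0 x1].
rewrite normrM (normrM (P x)) (le_trans (ler_wpM2r _ (mono_bnd a b1 x0)))// ?mulr_ge0//.
have hK' : `|P x| <= `|K| * x.
  by rewrite (le_trans (hK x x0))// ler_wpM2r ?ler_norm// ltW.
have hL' : `|Q x| <= `|L| * x.
  by rewrite (le_trans (hL x x0))// ler_wpM2r ?ler_norm// ltW.
apply: (@le_trans _ _ ((1 + x^-1) * ((`|K| * x) * (`|L| * x)))).
  by rewrite ler_wpM2l ?(le_trans ler01 (l1 _ _))// ler_pM.
have -> : (1 + x^-1) * ((`|K| * x) * (`|L| * x)) = (1 + x) * (`|K| * `|L|) * x.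
  by field; rewrite gt_eqF.
by rewrite ler_wpM2r ?(ltW x0)// ler_wpM2r ?mulr_ge0//; lra.
Qed.

(** The common form of all the integrations by parts below. Each of them is given
    by the coefficients and exponents of the derivatives involved, and then the
    pointwise identity is one of rational functions in x, P, P', Q, Q'. *)
Lemma ibp c1 a1 b1 c2 a2 b2 c3 a3 b3 P P' Q Q' F G :
  (b1 <= 1)%N -> (b2 <= 1)%N -> (b3 <= 1)%N -> H10 P P' -> H10 Q Q' -> ih G ->
  (forall x, 0 < x -> F x = G x + (c1 * dmono a1 b1 P P' Q Q' x +
     (c2 * dmono a2 b2 P P' Q Q' x + c3 * dmono a3 b3 P P' Q Q' x))) ->
  ih F /\ I F = I G.
Proof.
move=> h1 h2 h3 hP hQ iG FG.
have [i1 e1] := dmono0 a1 h1 hP hQ; have [i2 e2] := dmono0 a2 h2 hP hQ.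
have [i3 e3] := dmono0 a3 h3 hP hQ.
have j1 := ihZ c1 i1; have j2 := ihZ c2 i2; have j3 := ihZ c3 i3.
have j23 := ihD j2 j3; have j := ihD j1 j23.
split; first by apply: ih_eq (ihD iG j) => x x0; rewrite FG.
rewrite (I_eq FG) (ID iG j) (ID j1 j23) (ID j2 j3) !IZ// e1 e2 e3.
by ring.
Qed.

Lemma ibpE c1 a1 b1 c2 a2 b2 c3 a3 b3 P P' Q Q' F G :
  (b1 <= 1)%N -> (b2 <= 1)%N -> (b3 <= 1)%N -> H10 P P' -> H10 Q Q' -> ih G ->
  (forall x, 0 < x -> F x = G x + (c1 * dmono a1 b1 P P' Q Q' x +
     (c2 * dmono a2 b2 P P' Q Q' x + c3 * dmono a3 b3 P P' Q Q' x))) ->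
  I F = I G.
Proof. by move=> h1 h2 h3 hP hQ iG FG; exact: (ibp h1 h2 h3 hP hQ iG FG).2. Qed.

(** The multiplier a d/dx + a'/2 with a = 1 - rho, whose derivative is rho^2. *)
Definition bop f f' x : R := (1 - rho x) * f' x + 2^-1 * rho x ^+ 2 * f x.

(** The commutators of [bop] with [Lm] and [Lp], in the two forms which result from
    moving every derivative onto one of the two functions (see [g1_minus] and
    [g1_plus]). *)
Definition Gm f f' x : R := - rho x ^+ 2 * f' x + rho x ^+ 3 * f x + rho x * (f x / x).
Definition Gp f f' x : R := rho x ^+ 2 * f' x - rho x ^+ 3 * f x + rho x * (f x / x).

(** Conjugating d/dr + 2/r and d/dr by the multiplication by r gives d/dr + 1/r
    and d/dr - 1/r. *)
Definition Lp f f' x : R := f' x + f x / x.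
Definition Lm f f' x : R := f' x - f x / x.

Lemma l2_rhoX n f : l2 f -> l2 (fun x => rho x ^+ n * f x).
Proof.
move=> hf; apply: (@l2_bnd _ _ _ 1) => //; first exact: meas_rhoX.
by move=> x x0; have /andP[h1 h2] := rhoX_le1 n x0; rewrite ger0_norm.
Qed.

Lemma l2_rho f : l2 f -> l2 (fun x => rho x * f x).
Proof. by move=> /(l2_rhoX 1); apply: l2_eq => x _; rewrite expr1. Qed.

Lemma l2_bop P P' : H10 P P' -> l2 (bop P P').
Proof.
move=> [_ l l' _]; apply: l2D.
  by apply: l2_eq (l2B l' (l2_rho l')) => x _; ring.
by apply: l2_eq (l2Z 2^-1 (l2_rhoX 2 l)) => x _; ring.
Qed.

Lemma l2_Gm P P' : H10 P P' -> l2 (Gm P P').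
Proof.
move=> h; have lx := H10_divx h; case: h => [_ l l' _].
apply: l2D; [apply: l2D|exact: l2_rho]; last exact: l2_rhoX.
by apply: l2_eq (l2N (l2_rhoX 2 l')) => x _; ring.
Qed.

Lemma l2_Gp P P' : H10 P P' -> l2 (Gp P P').
Proof.
move=> h; have lx := H10_divx h; case: h => [_ l l' _].
by apply: l2D; [apply: l2B; exact: l2_rhoX|exact: l2_rho].
Qed.

Lemma l2_Lp P P' : H10 P P' -> l2 (Lp P P').
Proof. by move=> h; have lx := H10_divx h; case: h => [_ l l' _]; exact: l2D. Qed.

Lemma l2_Lm P P' : H10 P P' -> l2 (Lm P P').
Proof. by move=> h; have lx := H10_divx h; case: h => [_ l l' _]; exact: l2B. Qed.

Ltac wfield x0 := rewrite /dmono /mono /mono' /bop /Gm /Gp /Lp /Lm /rho /= ?exprS ?expr0;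
  field; repeat (apply/andP; split); by rewrite ?gt_eqF ?addr_gt0.

Lemma bop_antisym P P' Q Q' : H10 P P' -> H10 Q Q' ->
  I (fun x => bop P P' x * Q x) = - I (fun x => P x * bop Q Q' x).
Proof.
move=> hP hQ.
have lP : l2 P by case: hP. have lQ : l2 Q by case: hQ.
have iG : ih (fun x => - (P x * bop Q Q' x)).
  by apply: ihN; apply: l2M => //; exact: l2_bop.
rewrite (@ibpE 1 0 0 (-1) 1 0 0 0 0 P P' Q Q' (fun x => bop P P' x * Q x) _
  isT isT isT hP hQ iG (fun x px => ltac:(wfield px))).
by rewrite IN//; apply: l2M => //; exact: l2_bop.
Qed.

Lemma g1_minus P P' Q Q' : H10 P P' -> H10 Q Q' ->
  I (fun x => Lp P P' x * bop Q Q' x - bop P P' x * Lm Q Q' x) =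
  I (fun x => P x * Gm Q Q' x).
Proof.
move=> hP hQ; have lP : l2 P by case: hP.
have iG : ih (fun x => P x * Gm Q Q' x) by apply: l2M => //; exact: l2_Gm.
apply: (@ibpE 2^-1 2 0 1 1 0 0 0 0 P P' Q Q' _ _ isT isT isT hP hQ iG) => x x0; wfield x0.
Qed.

Lemma g1_plus P P' Q Q' : H10 P P' -> H10 Q Q' ->
  I (fun x => Lp P P' x * bop Q Q' x - bop P P' x * Lm Q Q' x) =
  I (fun x => Q x * Gp P P' x).
Proof.
move=> hP hQ; have lQ : l2 Q by case: hQ.
have iG : ih (fun x => Q x * Gp P P' x) by apply: l2M => //; exact: l2_Gp.
apply: (@ibpE (- 2^-1) 2 0 1 1 0 0 0 0 P P' Q Q' _ _ isT isT isT hP hQ iG) => x x0; wfield x0.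
Qed.

(** The quantity that the virial identity dissipates. *)
Definition Mw (P' : R -> R) : R := I (fun x => rho x ^+ 2 * P' x ^+ 2).

Lemma ih_rhoX_sqr n f : l2 f -> ih (fun x => rho x ^+ n * f x ^+ 2).
Proof. by move=> hf; apply: ih_eq (l2M (l2_rhoX n hf) hf) => x _; ring. Qed.

Lemma Mw_ge0 P' : 0 <= Mw P'.
Proof. by apply: I_ge0 => x x0; rewrite mulr_ge0 ?sqr_ge0. Qed.

(** From the nonnegative integral of (rho P' - c rho^2 P)^2, in which the cross
    term is - 3 c times the integral of rho^4 P^2; c = 3/2 is optimal. *)
Lemma hardy_rho P P' : H10 P P' -> I (fun x => rho x ^+ 4 * P x ^+ 2) <= 4 / 9 * Mw P'.
Proof.
move=> hP; have [_ lP lP' _] := hP.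
have i4 := ih_rhoX_sqr 4 lP; have i2 := ih_rhoX_sqr 2 lP'.
have e := @ibpE (- (3 / 2)) 3 0 0 0 0 0 0 0 P P' P P'
  (fun x => (rho x ^+ 1 * P' x - 3 / 2 * (rho x ^+ 2 * P x)) ^+ 2)
  (fun x => rho x ^+ 2 * P' x ^+ 2 - 9 / 4 * (rho x ^+ 4 * P x ^+ 2))
  isT isT isT hP hP (ihB i2 (ihZ (9 / 4) i4))
  (fun x px => ltac:(wfield px)).
have : 0 <= I (fun x => (rho x ^+ 1 * P' x - 3 / 2 * (rho x ^+ 2 * P x)) ^+ 2).
  by apply: I_ge0 => x _; exact: sqr_ge0.
rewrite e (IB i2 (ihZ (9 / 4) i4)) IZ// -/(Mw P').
by move: (I _) (Mw P') => u v; lra.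
Qed.

(** The same argument with c = 1/2 for the singular weight; the derivative of
    rho^2 contributes a term of favourable sign, which is discarded. *)
Lemma hardy_rhox P P' : H10 P P' ->
  I (fun x => rho x ^+ 2 * (P x / x) ^+ 2) <= 4 * Mw P'.
Proof.
move=> hP; have lx := H10_divx hP; have [_ lP lP' _] := hP.
have i4 := ih_rhoX_sqr 2 lx; have i2 := ih_rhoX_sqr 2 lP'.
have i3 : ih (fun x => (rho x ^+ 3 * P x) * (P x / x)).
  by apply: l2M => //; exact: l2_rhoX.
have j := ihB (ihB i2 (ihZ 4^-1 i4)) i3.
have e := @ibpE (- 2^-1) 2 1 0 0 0 0 0 0 P P' P P'
  (fun x => (rho x ^+ 1 * P' x - 2^-1 * (rho x ^+ 1 * (P x / x))) ^+ 2)
  (fun x => rho x ^+ 2 * P' x ^+ 2 - 4^-1 * (rho x ^+ 2 * (P x / x) ^+ 2) - (rho x ^+ 3 * P x) * (P x / x))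
  isT isT isT hP hP j
  (fun x px => ltac:(wfield px)).
have : 0 <= I (fun x => (rho x ^+ 1 * P' x - 2^-1 * (rho x ^+ 1 * (P x / x))) ^+ 2).
  by apply: I_ge0 => x _; exact: sqr_ge0.
have h3 : 0 <= I (fun x => (rho x ^+ 3 * P x) * (P x / x)).
  apply: I_ge0 => x x0; rewrite (_ : _ * _ = rho x ^+ 3 * (P x ^+ 2 / x)); last by ring.
  by rewrite mulr_ge0 ?divr_ge0 ?sqr_ge0 ?(ltW x0)//; case/andP: (rhoX_le1 3 x0).
rewrite e (IB (ihB i2 (ihZ 4^-1 i4)) i3) (IB i2 (ihZ 4^-1 i4)) IZ// -/(Mw P').
move: h3; move: (I _) (I _) (Mw P') => u v w; lra.
Qed.

Lemma hardy P P' : H10 P P' -> nm (fun x => P x / x) <= 2 * nm P'.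
Proof.
move=> hP; have lx := H10_divx hP; have [_ lP lP' _] := hP.
have i4 := l2_sqr lx; have i2 := l2_sqr lP'.
have e := @ibpE (- 2^-1) 0 1 0 0 0 0 0 0 P P' P P'
  (fun x => (P' x - 2^-1 * (P x / x)) ^+ 2)
  (fun x => P' x ^+ 2 - 4^-1 * (P x / x) ^+ 2)
  isT isT isT hP hP (ihB i2 (ihZ 4^-1 i4))
  (fun x px => ltac:(wfield px)).
have : 0 <= I (fun x => (P' x - 2^-1 * (P x / x)) ^+ 2).
  by apply: I_ge0 => x _; exact: sqr_ge0.
rewrite e (IB i2 (ihZ 4^-1 i4)) IZ// -!nm_sqr => h.
rewrite -(@ler_pXn2r _ 2) ?nnegrE ?mulr_ge0 ?nm_ge0//.
by move: h; move: (nm _) (nm P') => u v; nra.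
Qed.

Lemma virial_minus P P' : H10 P P' ->
  I (fun x => Lm P P' x * Gm P P' x) =
  3 / 2 * I (fun x => rho x ^+ 4 * P x ^+ 2) - Mw P'.
Proof.
move=> hP; have [_ lP lP' _] := hP.
have i4 := ihZ (3 / 2) (ih_rhoX_sqr 4 lP); have i2 := ih_rhoX_sqr 2 lP'.
rewrite (@ibpE 2^-1 3 0 2^-1 1 1 2^-1 2 1 P P' P P'
  (fun x => Lm P P' x * Gm P P' x)
  (fun x => 3 / 2 * (rho x ^+ 4 * P x ^+ 2) - rho x ^+ 2 * P' x ^+ 2)
  isT isT isT hP hP (ihB i4 i2)
  (fun x px => ltac:(wfield px))).
by rewrite IB// IZ//; exact: ih_rhoX_sqr.
Qed.

(** The sign of 1/x in [Lp] produces an additional positive term, which is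
    discarded. *)
Lemma virial_plus P P' : H10 P P' ->
  Mw P' - 3 / 2 * I (fun x => rho x ^+ 4 * P x ^+ 2) <=
  I (fun x => Lp P P' x * Gp P P' x).
Proof.
move=> hP; have lx := H10_divx hP; have [_ lP lP' _] := hP.
have i4 := ihZ (3 / 2) (ih_rhoX_sqr 4 lP); have i2 := ih_rhoX_sqr 2 lP'.
have i1 := ihZ 2 (ih_rhoX_sqr 1 lx).
rewrite (@ibpE (- 2^-1) 3 0 2^-1 1 1 2^-1 2 1 P P' P P'
  (fun x => Lp P P' x * Gp P P' x)
  (fun x => rho x ^+ 2 * P' x ^+ 2 - 3 / 2 * (rho x ^+ 4 * P x ^+ 2) +
     2 * (rho x ^+ 1 * (P x / x) ^+ 2))
  isT isT isT hP hP (ihD (ihB i2 i4) i1)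
  (fun x px => ltac:(wfield px))).
rewrite (ID (ihB i2 i4) i1) IB// IZ; last exact: ih_rhoX_sqr.
rewrite -/(Mw P') lerDl; apply: I_ge0 => x x0.
by apply: mulr_ge0 => //; apply: mulr_ge0; [case/andP: (rhoX_le1 1 x0)|exact: sqr_ge0].
Qed.

(** The cross term 2 P' P / x integrates to the integral of (P / x)^2, so the
    square of [Lp] is that of P' plus a positive term; in [Lm] the signs are
    such that the two terms cancel. *)
Lemma Lp_coercive P P' : H10 P P' -> nm P' <= nm (Lp P P').
Proof.
move=> hP; have lx := H10_divx hP; have [_ lP lP' _] := hP.
have i4 := ihZ 2 (l2_sqr lx); have i2 := l2_sqr lP'.
have e := @ibpE 1 0 1 0 0 0 0 0 0 P P' P P'
  (fun x => Lp P P' x ^+ 2)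
  (fun x => P' x ^+ 2 + 2 * (P x / x) ^+ 2)
  isT isT isT hP hP (ihD i2 i4)
  (fun x px => ltac:(wfield px)).
rewrite -(@ler_pXn2r _ 2) ?nnegrE ?nm_ge0// [leRHS]nm_sqr e (ID i2 i4).
by rewrite -nm_sqr lerDl; apply: I_ge0 => x _; rewrite mulr_ge0 ?sqr_ge0.
Qed.

Lemma Lm_coercive P P' : H10 P P' -> nm P' = nm (Lm P P').
Proof.
move=> hP; have lx := H10_divx hP; have [_ lP lP' _] := hP.
have i2 := l2_sqr lP'.
have e := @ibpE (-1) 0 1 0 0 0 0 0 0 P P' P P'
  (fun x => Lm P P' x ^+ 2) (fun x => P' x ^+ 2)
  isT isT isT hP hP i2
  (fun x px => ltac:(wfield px)).
by congr Num.sqrt; symmetry; exact: e.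
Qed.

End Identities.

(** * The linear system and its virial form *)

Section FixedTime.
Context (R : realType).
Local Notation H := (H R).
Implicit Types (f g h P Q : R -> R) (c x : R) (i j k : nat).

Definition ip f g : R := I (fun x => f x * g x).

Lemma ipC f g : ip f g = ip g f.
Proof. by apply: I_eq => x _; rewrite mulrC. Qed.

Lemma ipDl f g h : l2 f -> l2 g -> l2 h -> ip (fun x => f x + g x) h = ip f h + ip g h.
Proof.
move=> hf hg hh; rewrite /ip -ID; [|exact: l2M|exact: l2M].
by apply: I_eq => x _; rewrite mulrDl.
Qed.

Lemma ipZl c f h : l2 f -> l2 h -> ip (fun x => c * f x) h = c * ip f h.
Proof.
move=> hf hh; rewrite /ip -IZ; last exact: l2M.
by apply: I_eq => x _; rewrite mulrA.
Qed.

Lemma ipNl f h : l2 f -> l2 h -> ip (fun x => - f x) h = - ip f h.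
Proof.
move=> hf hh; rewrite /ip -IN; last exact: l2M.
by apply: I_eq => x _; rewrite mulNr.
Qed.

Lemma ipBl f g h : l2 f -> l2 g -> l2 h -> ip (fun x => f x - g x) h = ip f h - ip g h.
Proof. by move=> hf hg hh; rewrite ipDl ?ipNl//; exact: l2N. Qed.

Lemma ipDr f g h : l2 f -> l2 g -> l2 h -> ip h (fun x => f x + g x) = ip h f + ip h g.
Proof. by move=> *; rewrite ipC ipDl// !(ipC h). Qed.

Lemma ipBr f g h : l2 f -> l2 g -> l2 h -> ip h (fun x => f x - g x) = ip h f - ip h g.
Proof. by move=> *; rewrite ipC ipBl// !(ipC h). Qed.

Lemma ipNr f h : l2 f -> l2 h -> ip h (fun x => - f x) = - ip h f.
Proof. by move=> *; rewrite ipC ipNl// (ipC h). Qed.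

Lemma ipZr c f h : l2 f -> l2 h -> ip h (fun x => c * f x) = c * ip h f.
Proof. by move=> *; rewrite ipC ipZl// (ipC h). Qed.

Lemma ip_ael f g h : l2 f -> l2 g -> l2 h -> aeH (fun x => f x = g x) -> ip f h = ip g h.
Proof.
move=> hf hg hh fg; apply: I_ae.
- by apply: measurable_funM; exact: l2_meas.
- by apply: measurable_funM; exact: l2_meas.
- by apply: aeH_imp fg => x _ ->.
Qed.

Lemma ip_abs_le f g : l2 f -> l2 g -> `|ip f g| <= I (fun x => `|f x| * `|g x|).
Proof.
move=> hf hg; apply: le_trans (I_norm (l2M hf hg)) _.
by rewrite le_eqVlt; apply/orP; left; apply/eqP; apply: I_eq => x _; rewrite normrM.
Qed.

(** Integration of (P^2)' = 2 P P' from the origin. *)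
Lemma sup_sqr P P' : H10 P P' -> forall x, 0 < x -> P x ^+ 2 <= 2 * (nm P * nm P').
Proof.
move=> [aP lP lP' [K hK]] x x0.
have lp : ih (fun y => 2 * (`|P y| * `|P' y|)) by apply: ihZ; apply: l2M; exact: l2_norm.
have ap := abscontM aP aP.
rewrite expr2; apply: (@le_trans _ _ (I (fun y => 2 * (`|P y| * `|P' y|)))).
  apply: (@abscont_sup _ _ _ _ (K ^+ 2) x ap lp) => // y.
  - move=> _ /=; rewrite (le_trans (ler_norm _))// (le_trans (ler_normD _ _))//.
    by rewrite !normrM le_eqVlt; apply/orP; left; apply/eqP; ring.
  - move=> /andP[y0 y1]; have := hK y y0; have := normr_ge0 (P y).
    rewrite -expr2 -(real_normK (num_real (P y))); move: `|P y| => u u0 uK.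
    apply: (@le_trans _ _ ((K * y) ^+ 2)); first by rewrite lerXn2r ?nnegrE// (le_trans u0).
    by rewrite exprMn ler_wpM2l ?sqr_ge0// expr2 ler_piMr// ltW.
rewrite IZ; last by apply: l2M; exact: l2_norm.
rewrite ler_pM2l// (le_trans (CSle (l2_norm lP) (l2_norm lP')))//.
by rewrite le_eqVlt; apply/orP; left; apply/eqP; congr (_ * _); congr Num.sqrt;
  apply: I_eq => y _; rewrite real_normK ?num_real.
Qed.

Lemma nm_rho P' : nm (fun x => rho x * P' x) ^+ 2 = Mw P'.
Proof. by rewrite nm_sqr; apply: I_eq => x _; rewrite exprMn. Qed.

(** As rho is decreasing, (rho P^2)' <= 2 rho P P', so one factor of the weight may
    be put on the derivative. *)
Lemma sup_rho_sqr P P' : H10 P P' -> forall x, 0 < x ->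
  rho x ^+ 2 * P x ^+ 4 <= 4 * (nm P ^+ 2 * Mw P').
Proof.
move=> [aP lP lP' [K hK]] x x0.
have lr := l2_rho lP'.
have lp : ih (fun y => 2 * (`|P y| * `|rho y * P' y|)) by apply: ihZ; apply: l2M; exact: l2_norm.
have ap := abscontM (@abscont_rho R) (abscontM aP aP).
have : rho x * (P x * P x) <= 2 * (nm P * nm (fun y => rho y * P' y)).
  apply: (@le_trans _ _ (I (fun y => 2 * (`|P y| * `|rho y * P' y|)))).
    apply: (@abscont_sup _ _ _ _ (K ^+ 2) x ap lp) => // y.
      - move=> y0; have r0 := rho_gt0 y0; rewrite -[leRHS]add0r lerD//.
        by rewrite mulNr oppr_le0 mulr_ge0 ?sqr_ge0// -expr2 sqr_ge0.
      rewrite (le_trans (ler_norm _))// !normrM (le_trans (ler_wpM2l _ (ler_normD _ _)))//.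
      by rewrite !normrM le_eqVlt; apply/orP; left; apply/eqP; ring.
    - move=> /andP[y0 y1]; have := hK y y0; have := normr_ge0 (P y).
      rewrite -expr2 -(real_normK (num_real (P y))); move: `|P y| => u u0 uK.
      apply: (@le_trans _ _ (1 * (K * y) ^+ 2)).
        by rewrite ler_pM ?sqr_ge0 ?(ltW (rho_gt0 y0)) ?rho_le1// lerXn2r ?nnegrE// (le_trans u0).
      by rewrite mul1r exprMn ler_wpM2l ?sqr_ge0// expr2 ler_piMr// ltW.
  rewrite IZ; last by apply: l2M; exact: l2_norm.
  rewrite ler_pM2l// (le_trans (CSle (l2_norm lP) (l2_norm lr)))//.
  by rewrite le_eqVlt; apply/orP; left; apply/eqP; congr (_ * _); congr Num.sqrt;
    apply: I_eq => y _; rewrite real_normK ?num_real.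
move=> h; have r0 := rho_gt0 x0.
have -> : rho x ^+ 2 * P x ^+ 4 = (rho x * (P x * P x)) ^+ 2 by ring.
rewrite -nm_rho (_ : 4 * _ = (2 * (nm P * nm (fun y => rho y * P' y))) ^+ 2); last by ring.
have p0 : 0 <= rho x * (P x * P x) by rewrite mulr_ge0 ?(ltW r0)// -expr2 sqr_ge0.
by rewrite lerXn2r ?nnegrE//; exact: le_trans h.
Qed.

Variables (m : R).

(** The linear part of the equations for the real and imaginary parts of
    x phi_1 (components 0, 1) and x phi_2 (components 2, 3). *)
Definition Lin (Y Y' : nat -> R -> R) k x : R :=
  match k with
  | 0%N => Lp (Y 3%N) (Y' 3%N) x + m * Y 1%N x
  | 1%N => - Lp (Y 2%N) (Y' 2%N) x - m * Y 0%N x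
  | 2%N => - Lm (Y 1%N) (Y' 1%N) x - m * Y 3%N x
  | _ => Lm (Y 0%N) (Y' 0%N) x + m * Y 2%N x
  end.

(** The commutator of [Lin] with [bop] as a bilinear form without derivatives of
    the first argument, so that the latter may be a time derivative, which is
    only square-integrable. *)
Definition cform (X Y Y' : nat -> R -> R) : R :=
  ip (X 3%N) (Gm (Y 0%N) (Y' 0%N)) - ip (X 0%N) (Gp (Y 3%N) (Y' 3%N))
  - ip (X 2%N) (Gm (Y 1%N) (Y' 1%N)) + ip (X 1%N) (Gp (Y 2%N) (Y' 2%N)).

Definition H10v (Y Y' : nat -> R -> R) := forall k, (k < 4)%N -> H10 (Y k) (Y' k).

Definition bopv (Y Y' : nat -> R -> R) k : R -> R := bop (Y k) (Y' k).

Lemma sum4 (F : nat -> R) : \sum_(k < 4) F k = F 0%N + F 1%N + F 2%N + F 3%N.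
Proof. by rewrite !big_ord_recr big_ord0 /= add0r. Qed.

Lemma l2_Lin Y Y' k : H10v Y Y' -> l2 (Lin Y Y' k).
Proof.
move=> h.
have [[_ l0 _ _] [_ l1 _ _] [_ l2' _ _] [_ l3 _ _]] :=
  And4 (h 0%N isT) (h 1%N isT) (h 2%N isT) (h 3%N isT).
have p3 := l2_Lp (h 3%N isT); have p2 := l2_Lp (h 2%N isT).
have m1 := l2_Lm (h 1%N isT); have m0 := l2_Lm (h 0%N isT).
case: k => [|[|[|k]]] /=.
- by apply: l2D => //; exact: l2Z.
- by apply: l2B; [exact: l2N|exact: l2Z].
- by apply: l2B; [exact: l2N|exact: l2Z].
- by apply: l2D => //; exact: l2Z.
Qed.

(** The mass terms couple components by constants, so they commute with [bop] and
    cancel. What remains are commutators with [Lp] and [Lm], which [g1_minus]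
    and [g1_plus] write with all derivatives on [Y]. *)
Lemma cform_lin X X' Y Y' : H10v X X' -> H10v Y Y' ->
  \sum_(k < 4) (ip (Lin X X' k) (bopv Y Y' k) - ip (bopv X X' k) (Lin Y Y' k)) =
  cform X Y Y'.
Proof.
move=> hX hY; rewrite (sum4 (fun k => ip (Lin X X' k) (bopv Y Y' k) - ip (bopv X X' k) (Lin Y Y' k))).
have [x0 x1 x2 x3] := And4 (hX 0%N isT) (hX 1%N isT) (hX 2%N isT) (hX 3%N isT).
have [y0 y1 y2 y3] := And4 (hY 0%N isT) (hY 1%N isT) (hY 2%N isT) (hY 3%N isT).
have [[_ lx0 _ _] [_ lx1 _ _] [_ lx2 _ _] [_ lx3 _ _]] := And4 x0 x1 x2 x3.
have [[_ ly0 _ _] [_ ly1 _ _] [_ ly2 _ _] [_ ly3 _ _]] := And4 y0 y1 y2 y3.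
have [bx0 bx1 bx2 bx3] := And4 (l2_bop x0) (l2_bop x1) (l2_bop x2) (l2_bop x3).
have [by0 by1 by2 by3] := And4 (l2_bop y0) (l2_bop y1) (l2_bop y2) (l2_bop y3).
have [px3 px2 mx1 mx0] := And4 (l2_Lp x3) (l2_Lp x2) (l2_Lm x1) (l2_Lm x0).
have [py3 py2 my1 my0] := And4 (l2_Lp y3) (l2_Lp y2) (l2_Lm y1) (l2_Lm y0).
rewrite /Lin /bopv.
rewrite (ipDl px3 (l2Z m lx1) by0) (ipZl _ lx1 by0) (ipDr py3 (l2Z m ly1) bx0) (ipZr _ ly1 bx0).
rewrite (ipBl (l2N px2) (l2Z m lx0) by1) (ipNl px2 by1) (ipZl _ lx0 by1).
rewrite (ipBr (l2N py2) (l2Z m ly0) bx1) (ipNr py2 bx1) (ipZr _ ly0 bx1).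
rewrite (ipBl (l2N mx1) (l2Z m lx3) by2) (ipNl mx1 by2) (ipZl _ lx3 by2).
rewrite (ipBr (l2N my1) (l2Z m ly3) bx2) (ipNr my1 bx2) (ipZr _ ly3 bx2).
rewrite (ipDl mx0 (l2Z m lx2) by3) (ipZl _ lx2 by3) (ipDr my0 (l2Z m ly2) bx3) (ipZr _ ly2 bx3).
have A (P P' Q Q' : R -> R) : H10 P P' -> H10 Q Q' -> ip (bop P P') Q = - ip P (bop Q Q').
  exact: bop_antisym.
rewrite (A _ _ _ _ x0 y1) (A _ _ _ _ x1 y0) (A _ _ _ _ x2 y3) (A _ _ _ _ x3 y2).
have G1 (P P' Q Q' : R -> R) : H10 P P' -> H10 Q Q' ->
    ip P (Gm Q Q') = ip (Lp P P') (bop Q Q') - ip (bop P P') (Lm Q Q').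
  move=> hP hQ; rewrite /ip -(g1_minus hP hQ) IB//; apply: l2M;
  by [exact: l2_Lp|exact: l2_bop|exact: l2_Lm].
have G2 (P P' Q Q' : R -> R) : H10 P P' -> H10 Q Q' ->
    ip Q (Gp P P') = ip (Lp P P') (bop Q Q') - ip (bop P P') (Lm Q Q').
  move=> hP hQ; rewrite /ip -(g1_plus hP hQ) IB//; apply: l2M;
  by [exact: l2_Lp|exact: l2_bop|exact: l2_Lm].
rewrite /cform (G1 _ _ _ _ x3 y0) (G2 _ _ _ _ y3 x0) (G1 _ _ _ _ x2 y1) (G2 _ _ _ _ y2 x1).
rewrite (ipC (Lp (Y 3%N) _)) (ipC (bop (Y 3%N) _) (Lm _ _)) (ipC (Lp (Y 2%N) _)).
rewrite (ipC (bop (Y 2%N) _) (Lm _ _)).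
by ring.
Qed.

(** The commutator form is skew. This allows an increment X - Y to replace X, and
    makes h^-1 times the form converge. *)
Lemma cform_self Y Y' : H10v Y Y' -> cform Y Y Y' = 0.
Proof.
move=> hY; rewrite -(cform_lin hY hY) big1// => k _.
by rewrite (ipC (bopv _ _ _)) subrr.
Qed.

Definition l2v (X : nat -> R -> R) := forall k, (k < 4)%N -> l2 (X k).

Lemma H10v_l2 Y Y' : H10v Y Y' -> l2v Y.
Proof. by move=> hY k /hY[]. Qed.

Lemma cformD X1 X2 Y Y' : l2v X1 -> l2v X2 -> H10v Y Y' ->
  cform (fun k x => X1 k x + X2 k x) Y Y' = cform X1 Y Y' + cform X2 Y Y'.
Proof.
move=> h1 h2 hY; rewrite /cform.
rewrite !ipDl; do ?[exact: h1|exact: h2|exact/l2_Gm/hY|exact/l2_Gp/hY].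
by ring.
Qed.

Lemma cformZ c X Y Y' : l2v X -> H10v Y Y' ->
  cform (fun k x => c * X k x) Y Y' = c * cform X Y Y'.
Proof.
move=> h1 hY; rewrite /cform.
rewrite !ipZl; do ?[exact: h1|exact/l2_Gm/hY|exact/l2_Gp/hY].
by ring.
Qed.

Lemma cform_ae X1 X2 Y Y' : l2v X1 -> l2v X2 -> H10v Y Y' ->
  (forall k, (k < 4)%N -> aeH (fun x => X1 k x = X2 k x)) ->
  cform X1 Y Y' = cform X2 Y Y'.
Proof.
move=> h1 h2 hY E; rewrite /cform.
have e (k : nat) (f : R -> R) : (k < 4)%N -> l2 f -> ip (X1 k) f = ip (X2 k) f.
  by move=> k4 lf; apply: ip_ael => //; [exact: h1|exact: h2|exact: E].
by rewrite !e//; do ?[exact/l2_Gm/hY|exact/l2_Gp/hY].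
Qed.

(** The constant is 1/3 = 1 - (3/2) (4/9): the term of lower order in the virial
    identities is absorbed by [hardy_rho]. The mass terms cancel in pairs because
    [Gm] and [Gp] are adjoint. *)
Lemma cform_virial Y Y' : H10v Y Y' ->
  cform (Lin Y Y') Y Y' <= - (3^-1 * \sum_(k < 4) Mw (Y' k)).
Proof.
move=> hY; rewrite (sum4 (fun k => Mw (Y' k))).
have [y0 y1 y2 y3] := And4 (hY 0%N isT) (hY 1%N isT) (hY 2%N isT) (hY 3%N isT).
have [[_ ly0 _ _] [_ ly1 _ _] [_ ly2 _ _] [_ ly3 _ _]] := And4 y0 y1 y2 y3.
have [py3 py2 my1 my0] := And4 (l2_Lp y3) (l2_Lp y2) (l2_Lm y1) (l2_Lm y0).
have [gp3 gp2 gm1 gm0] := And4 (l2_Gp y3) (l2_Gp y2) (l2_Gm y1) (l2_Gm y0).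
rewrite /cform /Lin.
rewrite (ipDl my0 (l2Z m ly2) gm0) (ipZl _ ly2 gm0).
rewrite (ipDl py3 (l2Z m ly1) gp3) (ipZl _ ly1 gp3).
rewrite (ipBl (l2N my1) (l2Z m ly3) gm1) (ipNl my1 gm1) (ipZl _ ly3 gm1).
rewrite (ipBl (l2N py2) (l2Z m ly0) gp2) (ipNl py2 gp2) (ipZl _ ly0 gp2).
have G (P P' Q Q' : R -> R) : H10 P P' -> H10 Q Q' -> ip P (Gm Q Q') = ip Q (Gp P P').
  by move=> hP hQ; rewrite /ip -(g1_minus hP hQ) (g1_plus hP hQ).
rewrite (G _ _ _ _ y2 y0) (G _ _ _ _ y3 y1).
have := virial_minus y0; have := virial_minus y1.
have := virial_plus y2; have := virial_plus y3.
have := hardy_rho y0; have := hardy_rho y1; have := hardy_rho y2; have := hardy_rho y3.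
rewrite -!/(ip _ _).
by move=> *; lra.
Qed.

End FixedTime.

(** * Nonlinearities vanishing to third order *)

Section Nonlinear.
Context (R : realType).
Local Notation H := (H R).
Implicit Types (f g h P Q : R -> R) (c x : R) (i j k : nat).
Local Notation vec := (nat -> R -> R).

Definition abs4 (z : nat -> R) : R := \sum_(k < 4) `|z k|.

Lemma abs4_ge0 z : 0 <= abs4 z.
Proof. by apply: sumr_ge0. Qed.

Lemma abs4_le z k : (k < 4)%N -> `|z k| <= abs4 z.
Proof.
by move=> k4; rewrite /abs4 (bigD1 (Ordinal k4))//= lerDl sumr_ge0.
Qed.

(** What the virial argument uses of a nonlinearity of third order. The chain
    rule is required along absolutely continuous curves, with a bound for the
    derivative, since the nonlinearity is evaluated on such profiles. *)
Record cubic (w : nat -> (nat -> R) -> R) (C : R) : Prop := Cubic {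
  cubic_ge0 : 0 <= C;
  cubic0 : forall k, (k < 4)%N -> w k (fun=> 0) = 0;
  cubic_lip : forall k (z z' : nat -> R), (k < 4)%N ->
    (forall j, (j < 4)%N -> `|z j| <= 1) -> (forall j, (j < 4)%N -> `|z' j| <= 1) ->
    `|w k z - w k z'| <= C * (abs4 z ^+ 2 + abs4 z' ^+ 2) * abs4 (fun j => z j - z' j);
  cubic_chain : forall k (z z' : vec), (k < 4)%N ->
    (forall j, (j < 4)%N -> abscont (z j) (z' j)) ->
    (forall j x, (j < 4)%N -> 0 < x -> `|z j x| <= 1) ->
    exists2 g', abscont (fun x => w k (z^~ x)) g' &
      forall x, 0 < x -> `|g' x| <= C * abs4 (z^~ x) ^+ 2 * abs4 (z'^~ x) }.

Variables (m : R) (w : nat -> (nat -> R) -> R) (C : R).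
Hypothesis hw : cubic w C.

(** The nonlinearity in the unknown Y = x phi. *)
Definition nl (Y : vec) k x : R := x * w k (fun j => Y j x / x).

(** A bound for phi in H^1 and in the supremum norm, expressed by Y = x phi. *)
Record small (d : R) (Y Y' : vec) : Prop := Small {
  small_H10 : H10v Y Y';
  small_sup : forall k x, (k < 4)%N -> 0 < x -> `|Y k x| <= d * x;
  small_nm : forall k, (k < 4)%N -> nm (Y k) <= d;
  small_nm' : forall k, (k < 4)%N -> nm (Y' k) <= d }.

(** In terms of phi = Y / x, these are the size of the derivatives, of phi and of
    x phi. The first dominates the multiplier and the commutators
    pointwise. *)
Definition en (Y Y' : vec) x : R := abs4 (fun k => Y' k x) + abs4 (fun k => Y k x / x).
Definition zn (Y : vec) x : R := abs4 (fun k => Y k x / x).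
Definition nn (Y : vec) x : R := abs4 (fun k => Y k x).
Definition Msum (Y' : vec) : R := \sum_(k < 4) Mw (Y' k).

Lemma Msum_ge0 Y' : 0 <= Msum Y'.
Proof. by apply: sumr_ge0 => k _; exact: Mw_ge0. Qed.

Lemma zn_ge0 Y x : 0 <= zn Y x. Proof. exact: abs4_ge0. Qed.
Lemma nn_ge0 Y x : 0 <= nn Y x. Proof. exact: abs4_ge0. Qed.
Lemma en_ge0 Y Y' x : 0 <= en Y Y' x. Proof. by rewrite addr_ge0 ?abs4_ge0. Qed.
Lemma zn_le_en Y Y' x : zn Y x <= en Y Y' x. Proof. by rewrite lerDr abs4_ge0. Qed.

Lemma zn_nn Y x : 0 < x -> x * zn Y x = nn Y x.
Proof.
move=> x0; rewrite /zn /nn /abs4 mulr_sumr; apply: eq_bigr => k _.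
by rewrite normrM normfV (gtr0_norm x0) mulrC divfK// gt_eqF.
Qed.

Lemma l2_abs4 (X : vec) : l2v X -> l2 (fun x => abs4 (fun k => X k x)).
Proof.
move=> h; have s := sum4 (fun k => `|X k _|); rewrite /abs4.
apply: (@l2_eq _ (fun x => `|X 0%N x| + `|X 1%N x| + `|X 2%N x| + `|X 3%N x|)).
  by move=> x _; rewrite (sum4 (fun k => `|X k x|)).
by apply: l2D; [apply: l2D; [apply: l2D|]|]; apply: l2_norm; exact: h.
Qed.

Lemma sqr_abs4_le z : abs4 z ^+ 2 <= 4 * \sum_(k < 4) z k ^+ 2.
Proof.
rewrite /abs4 (sum4 (fun k => `|z k|)) (sum4 (fun k => z k ^+ 2)).
rewrite -(real_normK (num_real (z 0%N))) -(real_normK (num_real (z 1%N))).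
rewrite -(real_normK (num_real (z 2%N))) -(real_normK (num_real (z 3%N))).
move: `|z 0%N| `|z 1%N| `|z 2%N| `|z 3%N| => a b c d.
rewrite (_ : 4 * _ = (a + b + c + d) ^+ 2 + ((a - b) ^+ 2 + (a - c) ^+ 2 + (a - d) ^+ 2 +
  (b - c) ^+ 2 + (b - d) ^+ 2 + (c - d) ^+ 2)); last by ring.
by rewrite lerDl !addr_ge0 ?sqr_ge0.
Qed.

Section OneState.
Variables (d : R) (d0 : 0 < d) (d1 : 4 * d <= 1) (Y Y' : vec).
Hypothesis hY : small d Y Y'.

Let hH := small_H10 hY.

Lemma quot_le k x : (k < 4)%N -> 0 < x -> `|Y k x / x| <= d.
Proof.
move=> k4 x0; rewrite normrM normfV (gtr0_norm x0) ler_pdivrMr//.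
exact: (small_sup hY k4 x0).
Qed.

Lemma zn_le4 x : 0 < x -> zn Y x <= 4 * d.
Proof.
move=> x0; rewrite /zn /abs4 (@le_trans _ _ (\sum_(k < 4) d))//.
  by apply: ler_sum => k _; exact: quot_le.
by rewrite sumr_const card_ord mulr_natl.
Qed.

Lemma zn_le1 x : 0 < x -> zn Y x <= 1.
Proof. by move=> x0; apply: le_trans (zn_le4 x0) d1. Qed.

Lemma quot_le1 k x : (k < 4)%N -> 0 < x -> `|Y k x / x| <= 1.
Proof. by move=> k4 x0; apply: le_trans (quot_le k4 x0) _; move: d0 d1 => *; lra. Qed.

Lemma nl_le k x : (k < 4)%N -> 0 < x -> `|nl Y k x| <= C * zn Y x ^+ 2 * nn Y x.
Proof.
move=> k4 x0; rewrite /nl normrM (gtr0_norm x0) -(zn_nn Y x0) mulrCA.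
rewrite ler_wpM2l ?(ltW x0)//.
have := cubic_lip hw k4 (z := fun j => Y j x / x) (z' := fun=> 0).
rewrite (cubic0 hw k4) subr0 => h; apply: le_trans (h _ _) _.
- by move=> j j4; exact: quot_le1.
- by move=> j _; rewrite normr0.
- rewrite (_ : abs4 (fun=> 0) = 0) ?expr0n ?addr0; last first.
    by rewrite /abs4 big1// => i _; rewrite normr0.
  rewrite /zn le_eqVlt; apply/orP; left; apply/eqP; congr (_ * _).
  by congr abs4; apply/funext => j; rewrite subr0.
Qed.

Lemma quot_AC j : (j < 4)%N ->
  abscont (fun x => Y j x / x) (fun x => Y' j x / x - Y j x / x / x).
Proof.
move=> /hH[a _ _ _]; apply: abscont_eq (abscontM a (@abscont_invx R)) => x x0 //.
by rewrite expr2 invfM; ring.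
Qed.

Lemma l2_quot : l2v (fun k x => Y k x / x).
Proof. by move=> k /hH; exact: H10_divx. Qed.

Lemma l2_deriv : l2v Y'. Proof. by move=> k /hH[]. Qed.

Lemma l2_en : l2 (en Y Y').
Proof. by apply: l2D; apply: l2_abs4; [exact: l2_deriv|exact: l2_quot]. Qed.

Lemma l2_zn : l2 (zn Y). Proof. by apply: l2_abs4; exact: l2_quot. Qed.

Lemma l2_nn : l2 (nn Y). Proof. by apply: l2_abs4; exact: H10v_l2 hH. Qed.

Lemma Czn_ge0 x : 0 <= C * zn Y x ^+ 2.
Proof. exact: mulr_ge0 (cubic_ge0 hw) (sqr_ge0 _). Qed.

(** The nonlinearity again lies in the domain of the multiplier, which can
    therefore be moved onto it by antisymmetry. *)
Lemma nl_H10 : exists2 N', H10v (nl Y) N' & forall k x, (k < 4)%N -> 0 < x ->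
  `|N' k x| <= 2 * C * zn Y x ^+ 2 * en Y Y' x.
Proof.
have C0 := cubic_ge0 hw.
have E k : exists N', (k < 4)%N -> abscont (nl Y k) N' /\
    forall x, 0 < x -> `|N' x| <= 2 * C * zn Y x ^+ 2 * en Y Y' x.
  have [k4|] := boolP (k < 4)%N; last by move=> ?; exists (fun=> 0).
  have [g' ag hg] := cubic_chain hw (z := fun j x => Y j x / x)
    (z' := fun j x => Y' j x / x - Y j x / x / x) k4 quot_AC quot_le1.
  have ax : abscont (fun x : R => x) (fun=> 1).
    by apply: abscont_C1 => x _; exact: cst_continuous.
  exists (fun x => 1 * w k (fun j => Y j x / x) + x * g' x) => _; split.
    exact: abscontM ax ag.
  move=> x x0; rewrite mul1r (le_trans (ler_normD _ _))//.
  have -> : 2 * C * zn Y x ^+ 2 * en Y Y' x =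
    C * zn Y x ^+ 2 * en Y Y' x + C * zn Y x ^+ 2 * en Y Y' x by ring.
  apply: lerD.
    have := nl_le k4 x0; rewrite /nl normrM (gtr0_norm x0) -(zn_nn Y x0) mulrCA.
    rewrite ler_pM2l// => h; apply: le_trans h _.
    by rewrite ler_wpM2l ?Czn_ge0 ?zn_le_en.
  rewrite normrM (gtr0_norm x0) (le_trans (ler_wpM2l (ltW x0) (hg x x0)))//.
  rewrite mulrCA ler_wpM2l ?Czn_ge0//.
  rewrite /en /abs4 mulr_sumr -big_split/=; apply: ler_sum => j _.
  rewrite -{1}(gtr0_norm x0) -normrM (_ : x * _ = Y' j x - Y j x / x); last by field; rewrite gt_eqF.
  exact: ler_normB.
have [N' hN] := choice E.
have sq x : 0 < x -> zn Y x ^+ 2 <= 1.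
  by move=> x0; rewrite exprn_ile1 ?zn_ge0 ?zn_le1.
exists N'; last by move=> k x k4; exact: (hN k k4).2.
move=> k k4; have [a b] := hN k k4; split => //.
- apply: (@l2_le _ (fun x => C * nn Y x)); [exact: abscont_meas a|exact: l2Z l2_nn|].
  move=> x x0; rewrite (le_trans (nl_le k4 x0))// ger0_norm ?mulr_ge0 ?nn_ge0//.
  by rewrite ler_wpM2r ?nn_ge0// ler_piMr// sq.
- apply: (@l2_le _ (fun x => 2 * C * en Y Y' x)); [exact: abscont_meas' a|exact: l2Z l2_en|].
  move=> x x0; rewrite (le_trans (b x x0))// ger0_norm ?mulr_ge0 ?en_ge0//.
  by rewrite ler_wpM2r ?en_ge0// ler_piMr ?mulr_ge0// sq.
- exists (C * (4 * d)) => x x0; rewrite (le_trans (nl_le k4 x0))//.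
  apply: (@le_trans _ _ (C * nn Y x)).
    by rewrite ler_wpM2r ?nn_ge0// ler_piMr// sq.
  by rewrite -mulrA ler_wpM2l// -zn_nn// mulrC ler_wpM2r ?(ltW x0)// zn_le4.
Qed.

Lemma bop_le P P' x : 0 < x -> `|bop P P' x| <= `|P' x| + `|P x / x|.
Proof.
move=> x0; rewrite (le_trans (ler_normD _ _))// lerD//.
  rewrite normrM ler_piMl// ger0_norm ?subr_ge0 ?rho_le1//.
  by rewrite lerBlDr lerDl ltW// rho_gt0.
rewrite [leRHS]normrM normfV (gtr0_norm x0).
rewrite [leLHS]normrM [leLHS]mulrC ler_wpM2l//.
have r0 := rho_gt0 x0; have r1 := rho_le1 x0.
rewrite ger0_norm; last by rewrite mulr_ge0 ?sqr_ge0.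
have rx : rho x <= x^-1 by rewrite lef_pV2 ?posrE ?addr_gt0// lerDr.
by move: r0 r1 rx; move: (rho x) x^-1 => r i; nra.
Qed.

Lemma G_aux P P' x : 0 < x ->
  `|rho x ^+ 2 * P' x| + `|rho x ^+ 3 * P x| + `|rho x * (P x / x)| <=
  2 * (`|P' x| + `|P x / x|).
Proof.
move=> x0; have r0 := rho_gt0 x0; have r1 := rho_le1 x0.
have rx : rho x * x <= 1.
  by rewrite mulrC /rho ler_pdivrMr ?addr_gt0// mul1r lerDr.
have -> : rho x ^+ 3 * P x = (rho x ^+ 2 * (rho x * x)) * (P x / x).
  by field; rewrite gt_eqF.
have a (u v : R) : 0 <= u <= 1 -> `|u * v| <= `|v|.
  by move=> /andP[u0 u1]; rewrite normrM ger0_norm// ler_piMl.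
have /andP[s0 s1] := rhoX_le1 2 x0.
have h1 := a (rho x ^+ 2) (P' x); have h2 := a (rho x ^+ 2 * (rho x * x)) (P x / x).
have h3 := a (rho x) (P x / x); have n1 := normr_ge0 (P' x); have n2 := normr_ge0 (P x / x).
have j1 := h1 (rhoX_le1 2 x0).
have j2 : `|rho x ^+ 2 * (rho x * x) * (P x / x)| <= `|P x / x|.
  by apply: h2; rewrite !mulr_ge0 ?(ltW r0) ?(ltW x0)// mulr_ile1// mulr_ge0// ltW.
have j3 : `|rho x * (P x / x)| <= `|P x / x| by apply: h3; rewrite ltW.
lra.
Qed.

Lemma Gm_le P P' x : 0 < x -> `|Gm P P' x| <= 2 * (`|P' x| + `|P x / x|).
Proof.
move=> x0; apply: le_trans (G_aux P P' x0).
by rewrite /Gm (le_trans (ler_normD _ _))// lerD2r (le_trans (ler_normD _ _))// lerD2r mulNr normrN.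
Qed.

Lemma Gp_le P P' x : 0 < x -> `|Gp P P' x| <= 2 * (`|P' x| + `|P x / x|).
Proof.
move=> x0; apply: le_trans (G_aux P P' x0).
by rewrite /Gp (le_trans (ler_normD _ _))// lerD2r (le_trans (ler_normB _ _)).
Qed.

Lemma comp_le_en k x : (k < 4)%N -> `|Y' k x| + `|Y k x / x| <= en Y Y' x.
Proof.
by move=> k4; apply: lerD; [apply: (@abs4_le (fun k => Y' k x))|apply: (@abs4_le (fun k => Y k x / x))].
Qed.

Lemma Lin_le k x : 0 < x -> `|Lin m Y Y' k x| <= en Y Y' x + `|m| * nn Y x.
Proof.
move=> x0.
have a j : (j < 4)%N -> `|Lp (Y j) (Y' j) x| <= en Y Y' x.
  by move=> j4; apply: le_trans (comp_le_en x j4); exact: ler_normD.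
have b j : (j < 4)%N -> `|Lm (Y j) (Y' j) x| <= en Y Y' x.
  by move=> j4; apply: le_trans (comp_le_en x j4); exact: ler_normB.
have c j : (j < 4)%N -> `|m * Y j x| <= `|m| * nn Y x.
  by move=> j4; rewrite normrM ler_wpM2l//; exact: (@abs4_le (fun k => Y k x)).
case: k => [|[|[|k]]] /=.
- by rewrite (le_trans (ler_normD _ _))// lerD ?a ?c.
- by rewrite (le_trans (ler_normB _ _))// normrN lerD ?a ?c.
- by rewrite (le_trans (ler_normB _ _))// normrN lerD ?b ?c.
- by rewrite (le_trans (ler_normD _ _))// lerD ?b ?c.
Qed.

(** Below 1 from the supremum norm, with rho >= 1/2; beyond 1 from [sup_sqr], which
    bounds Y and hence gives the decay 1/x of Y / x. *)
Lemma quot_rho_le k x : (k < 4)%N -> 0 < x -> `|Y k x / x| <= 3 * d * rho x.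
Proof.
move=> k4 x0; have r0 := rho_gt0 x0.
have [x1|x1] := leP x 1.
  apply: le_trans (quot_le k4 x0) _.
  have : 2^-1 <= rho x by rewrite lef_pV2 ?posrE ?addr_gt0//; lra.
  by move: d0 (rho x) => dp r; nra.
rewrite normrM normfV (gtr0_norm x0).
have y : `|Y k x| <= 3 / 2 * d.
  rewrite -(@ler_pXn2r _ 2) ?nnegrE ?mulr_ge0 ?(ltW d0)// real_normK ?num_real//.
  apply: le_trans (sup_sqr (hH k4) x0) _.
  have := small_nm hY k4; have := small_nm' hY k4; have := nm_ge0 (Y k); have := nm_ge0 (Y' k).
  by move: d0 (nm _) (nm (Y k)) => dp a b a0 b0 ad bd; have := ler_pM a0 b0 ad bd; nra.
have i2 : x^-1 <= 2 * rho x.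
  rewrite /rho -[leLHS]mul1r ler_pdivrMr// mulrAC ler_pdivlMr ?addr_gt0//; lra.
have := ler_pM (normr_ge0 _) (ltW _) y i2; rewrite invr_gt0 => /(_ x0) h.
by apply: le_trans h _; rewrite le_eqVlt; apply/orP; left; apply/eqP; field.
Qed.

Lemma zn_rho_le x : 0 < x -> zn Y x <= 12 * d * rho x.
Proof.
move=> x0; rewrite /zn /abs4 (@le_trans _ _ (\sum_(k < 4) (3 * d * rho x)))//.
  by apply: ler_sum => k _; exact: quot_rho_le.
by rewrite sumr_const card_ord -mulr_natl le_eqVlt; apply/orP; left; apply/eqP; ring.
Qed.

(** The fourth power gains a factor [Msum Y'], which [I_qne] needs because it
    contains a factor without weight. *)
Lemma quot4_le k x : (k < 4)%N -> 0 < x ->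
  `|Y k x / x| ^+ 4 <= rho x ^+ 2 * (64 * d ^+ 4 * rho x ^+ 4 + 64 * d ^+ 2 * Msum Y').
Proof.
move=> k4 x0; have r0 := rho_gt0 x0.
have M0 : 0 <= d ^+ 2 * Msum Y' by rewrite mulr_ge0 ?sqr_ge0 ?Msum_ge0.
have d4 : 0 <= d ^+ 4 by rewrite exprn_ge0// ltW.
have [x1|x1] := leP x 1.
  apply: (@le_trans _ _ (d ^+ 4)); first by rewrite lerXn2r ?nnegrE ?quot_le// ltW.
  have h : 2^-1 <= rho x by rewrite lef_pV2 ?posrE ?addr_gt0//; lra.
  have h2 : 4^-1 <= rho x ^+ 2.
    by rewrite (_ : 4^-1 = 2^-1 ^+ 2) ?lerXn2r ?nnegrE ?(ltW r0)//; field.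
  have h6 : 64^-1 <= rho x ^+ 6.
    by rewrite (_ : 64^-1 = 2^-1 ^+ 6) ?lerXn2r ?nnegrE ?(ltW r0)//; field.
  rewrite mulrDr (_ : rho x ^+ 2 * (64 * d ^+ 4 * rho x ^+ 4) = 64 * d ^+ 4 * rho x ^+ 6); last by ring.
  have : 0 <= rho x ^+ 2 * (64 * d ^+ 2 * Msum Y').
    by rewrite mulr_ge0 ?sqr_ge0// -mulrA mulr_ge0.
  by move: (rho x ^+ 6) h6 (rho x ^+ 2 * (64 * _ * _)) (d ^+ 4) d4 => s h6 t D D0 t0; nra.
have i2 : x^-1 <= 2 * rho x.
  rewrite /rho -[leLHS]mul1r ler_pdivrMr// mulrAC ler_pdivlMr ?addr_gt0//; lra.
have i4 : x^-1 ^+ 4 <= 16 * rho x ^+ 4.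
  rewrite (_ : 16 * _ = (2 * rho x) ^+ 4); last by ring.
  by rewrite lerXn2r ?nnegrE ?invr_ge0 ?mulr_ge0// ltW.
have s := sup_rho_sqr (hH k4) x0.
have Mk : Mw (Y' k) <= Msum Y'.
  by rewrite /Msum (bigD1 (Ordinal k4))//= lerDl sumr_ge0// => *; exact: Mw_ge0.
have n2 : nm (Y k) ^+ 2 <= d ^+ 2.
  by rewrite lerXn2r ?nnegrE ?nm_ge0 ?(ltW d0)//; exact: (small_nm hY k4).
have s2 : rho x ^+ 2 * Y k x ^+ 4 <= 4 * (d ^+ 2 * Msum Y').
  by apply: le_trans s _; rewrite ler_pM2l// ler_pM ?sqr_ge0 ?Mw_ge0.
have -> : `|Y k x / x| ^+ 4 = Y k x ^+ 4 * x^-1 ^+ 4.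
  rewrite -normrX exprMn ger0_norm// mulr_ge0// ?exprn_even_ge0//.
apply: (@le_trans _ _ (Y k x ^+ 4 * (16 * rho x ^+ 4))).
  by rewrite ler_wpM2l// exprn_even_ge0.
rewrite (_ : Y k x ^+ 4 * (16 * rho x ^+ 4) = rho x ^+ 2 * (16 * (rho x ^+ 2 * Y k x ^+ 4))); last by ring.
rewrite ler_wpM2l ?sqr_ge0//.
have : 0 <= 64 * d ^+ 4 * rho x ^+ 4.
  by apply: mulr_ge0; [exact: mulr_ge0|rewrite exprn_ge0 ?ltW].
by move: s2; move: (rho x ^+ 2 * _) (64 * d ^+ 4 * _) => u v; rewrite -mulrA; nra.
Qed.

Lemma zn4_le x : 0 < x ->
  zn Y x ^+ 4 <= rho x ^+ 2 * (4 ^+ 7 * (d ^+ 4 * rho x ^+ 4 + d ^+ 2 * Msum Y')).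
Proof.
move=> x0.
have h1 := sqr_abs4_le (fun k => Y k x / x).
have h2 := sqr_abs4_le (fun k => (Y k x / x) ^+ 2).
have E : abs4 (fun k => (Y k x / x) ^+ 2) = \sum_(k < 4) (Y k x / x) ^+ 2.
  by apply: eq_bigr => k _; rewrite ger0_norm ?sqr_ge0.
rewrite E in h2.
have h3 : \sum_(k < 4) ((Y k x / x) ^+ 2) ^+ 2 <=
    4 * (rho x ^+ 2 * (64 * d ^+ 4 * rho x ^+ 4 + 64 * d ^+ 2 * Msum Y')).
  apply: (@le_trans _ _ (\sum_(k < 4) (rho x ^+ 2 * (64 * d ^+ 4 * rho x ^+ 4 + 64 * d ^+ 2 * Msum Y')))).
    apply: ler_sum => k _; apply: le_trans (quot4_le (ltn_ord k) x0).
    rewrite (_ : _ ^+ 2 ^+ 2 = (Y k x / x) ^+ 4); last by rewrite -exprM.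
    by rewrite -normrX ler_norm.
  by rewrite sumr_const card_ord -[leLHS]mulr_natl.
have s0 : 0 <= \sum_(k < 4) (Y k x / x) ^+ 2 by apply: sumr_ge0 => k _; exact: sqr_ge0.
rewrite (_ : zn Y x ^+ 4 = (zn Y x ^+ 2) ^+ 2); last by rewrite -exprM.
apply: (@le_trans _ _ ((4 * \sum_(k < 4) (Y k x / x) ^+ 2) ^+ 2)).
  by apply: lerXn2r; [rewrite nnegrE sqr_ge0|rewrite nnegrE mulr_ge0|exact: h1].
rewrite exprMn; apply: (@le_trans _ _ (4 ^+ 2 * (4 * (4 * (rho x ^+ 2 * (64 * d ^+ 4 * rho x ^+ 4 + 64 * d ^+ 2 * Msum Y')))))).
  rewrite ler_pM2l// (le_trans h2)// ler_pM2l//.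
by rewrite le_eqVlt; apply/orP; left; apply/eqP; ring.
Qed.

Lemma nm_abs4 (X : vec) : l2v X -> nm (fun x => abs4 (fun k => X k x)) <= \sum_(k < 4) nm (X k).
Proof.
move=> h; have n k : nm (fun x => `|X k x|) = nm (X k).
  by congr Num.sqrt; apply: I_eq => x _; rewrite real_normK ?num_real.
have l k : (k < 4)%N -> l2 (fun x => `|X k x|) by move=> k4; exact/l2_norm/h.
rewrite (sum4 (fun k => nm (X k))) -!n.
rewrite (eq_nm (g := fun x => `|X 0%N x| + `|X 1%N x| + `|X 2%N x| + `|X 3%N x|)); last first.
  by move=> x _; rewrite /abs4 (sum4 (fun k => `|X k x|)).
have l01 := l2D (l 0%N isT) (l 1%N isT); have l012 := l2D l01 (l 2%N isT).
apply: le_trans (nmD l012 (l 3%N isT)) _; rewrite lerD2r.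
apply: le_trans (nmD l01 (l 2%N isT)) _; rewrite lerD2r.
exact: nmD (l 0%N isT) (l 1%N isT).
Qed.

Lemma nm_en : nm (en Y Y') <= 12 * d.
Proof.
apply: le_trans (nmD (l2_abs4 l2_deriv) (l2_abs4 l2_quot)) _.
apply: (@le_trans _ _ (\sum_(k < 4) d + \sum_(k < 4) (2 * d))); last first.
  rewrite !sumr_const card_ord -[X in X + _]mulr_natl -[X in _ + X]mulr_natl.
  by rewrite le_eqVlt; apply/orP; left; apply/eqP; ring.
apply: lerD; (apply: le_trans; first apply: nm_abs4).
- exact: l2_deriv.
- by apply: ler_sum => k _; exact: (small_nm' hY (ltn_ord k)).
- exact: l2_quot.
- apply: ler_sum => k _; apply: le_trans (hardy (hH (ltn_ord k))) _.
  by rewrite ler_pM2l//; exact: (small_nm' hY (ltn_ord k)).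
Qed.

Lemma I_sum4 (F : vec) : (forall k, (k < 4)%N -> ih (F k)) ->
  ih (fun x => \sum_(k < 4) F k x) /\ I (fun x => \sum_(k < 4) F k x) = \sum_(k < 4) I (F k).
Proof.
move=> h; have i01 := ihD (h 0%N isT) (h 1%N isT); have i012 := ihD i01 (h 2%N isT).
have E x : 0 < x -> F 0%N x + F 1%N x + F 2%N x + F 3%N x = \sum_(k < 4) F k x.
  by move=> _; rewrite (sum4 (fun k => F k x)).
split; first exact: ih_eq E (ihD i012 (h 3%N isT)).
rewrite -(I_eq E) (ID i012 (h 3%N isT)) (ID i01 (h 2%N isT)) (ID (h 0%N isT) (h 1%N isT)).
by rewrite (sum4 (fun k => I (F k))).
Qed.

Lemma ih_rho2_en : ih (fun x => rho x ^+ 2 * en Y Y' x ^+ 2).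
Proof. exact: ih_rhoX_sqr l2_en. Qed.

(** The constant is 8 (1 + 4), with the 4 of [hardy_rhox]. *)
Lemma I_rho2_en : I (fun x => rho x ^+ 2 * en Y Y' x ^+ 2) <= 40 * Msum Y'.
Proof.
have iA k : (k < 4)%N -> ih (fun x => rho x ^+ 2 * Y' k x ^+ 2).
  by move=> k4; exact: ih_rhoX_sqr (l2_deriv k4).
have iB k : (k < 4)%N -> ih (fun x => rho x ^+ 2 * (Y k x / x) ^+ 2).
  by move=> k4; exact: ih_rhoX_sqr (l2_quot k4).
have [iA1 eA] := I_sum4 iA; have [iB1 eB] := I_sum4 iB.
have iAB := ihZ 8 (ihD iA1 iB1).
apply: (@le_trans _ _ (8 * (Msum Y' + \sum_(k < 4) (4 * Mw (Y' k))))); last first.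
  by rewrite -mulr_sumr -/(Msum Y') le_eqVlt; apply/orP; left; apply/eqP; ring.
apply: le_trans (I_le ih_rho2_en iAB _) _.
  move=> x x0 /=; rewrite -!mulr_sumr [leRHS](_ : _ = rho x ^+ 2 *
    (8 * (\sum_(k < 4) Y' k x ^+ 2 + \sum_(k < 4) (Y k x / x) ^+ 2))); last by ring.
  rewrite ler_wpM2l ?sqr_ge0//.
  have := sqr_abs4_le (fun k => Y' k x); have := sqr_abs4_le (fun k => Y k x / x).
  rewrite /en; move: (\sum_(k < 4) _) (\sum_(k < 4) _) (abs4 _) (abs4 _) => s t u v.
  by have := sqr_ge0 (u - v); nra.
rewrite (IZ _ (ihD iA1 iB1)) (ID iA1 iB1) eA eB ler_pM2l// lerD2l.
by apply: ler_sum => k _; exact: hardy_rhox (hH (ltn_ord k)).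
Qed.

Lemma I_nn : I (fun x => nn Y x ^+ 2) <= 16 * d ^+ 2.
Proof.
rewrite -nm_sqr (_ : 16 * d ^+ 2 = (4 * d) ^+ 2); last by ring.
have d00 := ltW d0.
apply: lerXn2r; [by rewrite nnegrE nm_ge0|by rewrite nnegrE mulr_ge0|].
apply: le_trans (nm_abs4 (H10v_l2 hH)) _.
rewrite (@le_trans _ _ (\sum_(k < 4) d))//; last by rewrite sumr_const card_ord mulr_natl.
by apply: ler_sum => k _; exact: (small_nm hY (ltn_ord k)).
Qed.

Lemma I_rho4_nn : I (fun x => rho x ^+ 4 * nn Y x ^+ 2) <= 2 * Msum Y'.
Proof.
have iA k : (k < 4)%N -> ih (fun x => rho x ^+ 4 * Y k x ^+ 2).
  by move=> k4; exact: ih_rhoX_sqr (H10v_l2 hH k4).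
have [iA1 eA] := I_sum4 iA.
apply: (@le_trans _ _ (4 * \sum_(k < 4) (4 / 9 * Mw (Y' k)))); last first.
  by rewrite -mulr_sumr -/(Msum Y'); have := Msum_ge0 Y'; lra.
apply: le_trans (I_le (ih_rhoX_sqr 4 l2_nn) (ihZ 4 iA1) _) _.
  move=> x x0 /=; rewrite -!mulr_sumr [leRHS](_ : _ = rho x ^+ 4 *
    (4 * \sum_(k < 4) Y k x ^+ 2)); last by ring.
  rewrite ler_wpM2l ?exprn_even_ge0//.
  exact: (sqr_abs4_le (fun k => Y k x)).
rewrite (IZ _ iA1) eA ler_pM2l//.
by apply: ler_sum => k _; exact: hardy_rho (hH (ltn_ord k)).
Qed.

Lemma cform_le (V : vec) : l2v V -> cform V Y Y' <= 2 * I (fun x => abs4 (fun k => V k x) * en Y Y' x).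
Proof.
move=> hV; have lV := l2_abs4 hV.
have iV k : (k < 4)%N -> ih (fun x => `|V k x| * en Y Y' x).
  by move=> k4; apply: l2M l2_en; exact/l2_norm/hV.
have b k j G : (k < 4)%N -> (j < 4)%N -> l2 G ->
    (forall x, 0 < x -> `|G x| <= 2 * (`|Y' j x| + `|Y j x / x|)) ->
    `|ip (V k) G| <= 2 * I (fun x => `|V k x| * en Y Y' x).
  move=> k4 j4 lG hG; rewrite -IZ; last exact: iV.
  apply: le_trans (ip_abs_le (hV k k4) lG) _; apply: I_le.
  - by apply: l2M; apply: l2_norm => //; exact: hV.
  - by apply: ihZ; exact: iV.
  - move=> x x0; rewrite mulrCA ler_wpM2l// (le_trans (hG x x0))// ler_pM2l//.
    exact: comp_le_en.
have [h0 h1 h2 h3] := And4 (hH (isT : (0 < 4)%N)) (hH (isT : (1 < 4)%N)) (hH (isT : (2 < 4)%N)) (hH (isT : (3 < 4)%N)).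
have b3 := b 3%N 0%N _ isT isT (l2_Gm h0) (fun x px => Gm_le (Y 0%N) (Y' 0%N) px).
have b0 := b 0%N 3%N _ isT isT (l2_Gp h3) (fun x px => Gp_le (Y 3%N) (Y' 3%N) px).
have b2 := b 2%N 1%N _ isT isT (l2_Gm h1) (fun x px => Gm_le (Y 1%N) (Y' 1%N) px).
have b1 := b 1%N 2%N _ isT isT (l2_Gp h2) (fun x px => Gp_le (Y 2%N) (Y' 2%N) px).
have [_ e] := I_sum4 iV.
rewrite (I_eq (g := fun x => \sum_(k < 4) (`|V k x| * en Y Y' x))); last first.
  by move=> x _; rewrite /abs4 mulr_suml.
rewrite e (sum4 (fun k => I (fun x => `|V k x| * en Y Y' x))) /cform.
move: b0 b1 b2 b3; rewrite !ler_norml => /andP[? ?] /andP[? ?] /andP[? ?] /andP[? ?].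
lra.
Qed.

End OneState.
End Nonlinear.

(** * The virial inequality for one time increment *)

Section Core.
Context (R : realType).
Local Notation H := (H R).
Implicit Types (f g h P Q : R -> R) (c x : R) (i j k : nat).
Local Notation vec := (nat -> R -> R).
Variables (m : R) (w : nat -> (nat -> R) -> R) (C : R).
Hypothesis hw : cubic w C.
Local Notation nl := (nl w).

Definition evol (Y Y' Th : vec) : Prop := l2v Th /\
  forall k, (k < 4)%N -> aeH (fun x => Th k x = Lin m Y Y' k x + nl Y k x).

(** The time derivative of the sum of the pairings of X_k with B Y_k, when X and Y
    have time derivatives ThX and ThY; see [Kf_derive]. *)
Definition Sform (X X' ThX Y Y' ThY : vec) : R :=
  \sum_(k < 4) (ip (ThX k) (bopv Y Y' k) - ip (bopv X X' k) (ThY k)).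

Variables (d : R) (d0 : 0 < d) (d1 : 4 * d <= 1).
Variables (X X' ThX Y Y' ThY : vec).
Hypothesis (hX : small d X X') (hY : small d Y Y').
Hypothesis (eX : evol X X' ThX) (eY : evol Y Y' ThY).

Let HX := small_H10 hX.
Let HY := small_H10 hY.

Lemma l2_bopv (Z Z' : vec) k : H10v Z Z' -> (k < 4)%N -> l2 (bopv Z Z' k).
Proof. by move=> h k4; exact/l2_bop/h. Qed.

Lemma bopv_antisym (Z Z' U U' : vec) k : H10v Z Z' -> H10v U U' -> (k < 4)%N ->
  ip (bopv Z Z' k) (U k) = - ip (Z k) (bopv U U' k).
Proof. by move=> hZ hU k4; exact: bop_antisym (hZ k k4) (hU k k4). Qed.

(** The nonlinear terms are arranged so that each contains the difference of the
    two states, which survives the division by the time increment. *)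
Lemma Sform_split (NX' N' : vec) : H10v (nl X) NX' -> H10v (nl Y) N' ->
  Sform X X' ThX Y Y' ThY = cform X Y Y' +
  \sum_(k < 4) (ip (fun x => nl X k x - nl Y k x) (bopv Y Y' k) +
                ip (fun x => X k x - Y k x) (bopv (nl Y) N' k)).
Proof.
move=> hNX hN; rewrite -(cform_lin m HX HY) -big_split/=.
apply: eq_bigr => -[k k4] _ /=.
have [lX lY] := (H10v_l2 HX k4, H10v_l2 HY k4).
have [lNX lN] := (H10v_l2 hNX k4, H10v_l2 hN k4).
have [bX bY] := (l2_bopv HX k4, l2_bopv HY k4).
have bN := l2_bopv hN k4.
have [LX LY] := (l2_Lin m k HX, l2_Lin m k HY).
rewrite (ip_ael (eX.1 k k4) (l2D LX lNX) bY (eX.2 k k4)).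
rewrite (ipC (bopv X X' k)) (ip_ael (eY.1 k k4) (l2D LY lN) bX (eY.2 k k4)).
rewrite (ipDl LX lNX bY) (ipDl LY lN bX) (ipBl lNX lN bY) (ipBl lX lY bN).
rewrite (ipC _ (bopv X X' k)) (ipC _ (bopv X X' k)) (bopv_antisym HX hN k4).
have := bopv_antisym HY hN k4; rewrite (ipC (bopv Y Y' k)) => ->.
by ring.
Qed.

(** The square of the size of phi that a nonlinearity of third order contributes. *)
Let q x : R := zn X x ^+ 2 + zn Y x ^+ 2.

Lemma q_ge0 x : 0 <= q x. Proof. by rewrite addr_ge0 ?sqr_ge0. Qed.

Lemma q_le2 x : 0 < x -> q x <= 2.
Proof.
move=> x0; have a := zn_le1 d1 hX x0; have b := zn_le1 d1 hY x0.
have a0 := zn_ge0 X x; have b0 := zn_ge0 Y x.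
by rewrite /q (_ : 2 = 1 + 1) ?lerD ?exprn_ile1//; ring.
Qed.

Lemma q_rho x : 0 < x -> q x <= 288 * d ^+ 2 * rho x ^+ 2.
Proof.
move=> x0; have a := zn_rho_le d0 hX x0; have b := zn_rho_le d0 hY x0.
have a0 := zn_ge0 X x; have b0 := zn_ge0 Y x.
have -> : 288 * d ^+ 2 * rho x ^+ 2 = (12 * d * rho x) ^+ 2 + (12 * d * rho x) ^+ 2 by ring.
have r0 : 0 <= 12 * d * rho x by apply: le_trans a.
by apply: lerD; apply: lerXn2r; rewrite ?nnegrE.
Qed.

Lemma q_meas : measurable_fun H q.
Proof.
by apply: measurable_funD; apply: measurable_funX; apply: l2_meas; [exact: l2_zn hX|exact: l2_zn hY].
Qed.

Lemma l2_q f : l2 f -> l2 (fun x => q x * f x).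
Proof.
move=> lf; apply: (@l2_bnd _ q f 2 q_meas _ lf) => x x0.
by rewrite ger0_norm ?q_ge0// q_le2.
Qed.

Let e := en Y Y'.
Let n := nn Y.
Let MM := Msum X' + Msum Y'.

Lemma I_qee : I (fun x => q x * e x * e x) <= 11520 * d ^+ 2 * MM.
Proof.
have le := l2_en hY; have i := ih_rhoX_sqr 2 le.
apply: (@le_trans _ _ (I (fun x => 288 * d ^+ 2 * (rho x ^+ 2 * e x ^+ 2)))).
  apply: I_le; [exact: l2M (l2_q le) le|exact: ihZ|].
  move=> x x0 /=; have := q_rho x0; have := q_ge0 x; have := sqr_ge0 (e x).
  move=> e0 _ h; rewrite [leLHS](_ : _ = q x * e x ^+ 2); last by ring.
  by rewrite mulrA ler_wpM2r.
have dd := sqr_ge0 d; have MX0 := Msum_ge0 X'.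
have c0 : 0 <= 288 * d ^+ 2 := mulr_ge0 (ler0n _ _) dd.
rewrite (IZ _ i); apply: le_trans (ler_wpM2l c0 (I_rho2_en hY)) _.
rewrite (_ : 11520 * d ^+ 2 * MM = 288 * d ^+ 2 * (40 * MM)); last by ring.
by apply: (ler_wpM2l c0); rewrite ler_pM2l ?lerDr ?ltr0n.
Qed.

(** The unweighted square integral of n is bounded by a multiple of d^2 only, not by
    the dissipation, so in this part of the estimate the factor MM comes from q,
    through [zn4_le]. *)
Lemma I_qne : I (fun x => q x * n x * e x) <= 4 ^+ 10 * d ^+ 2 * MM.
Proof.
have le := l2_en hY; have ln := l2_nn hY.
have i1 := ih_rhoX_sqr 2 le; have i2 := ih_rhoX_sqr 4 ln; have i3 := l2_sqr ln.
have M0 : 0 <= MM by rewrite addr_ge0 ?Msum_ge0.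
have MX0 := Msum_ge0 X'.
pose a := 2^-1 * d ^+ 2; pose b := 4 ^+ 7 * (2 * d ^+ 2); pose c := 4 ^+ 7 * MM.
have j := ihD (ihZ a i1) (ihD (ihZ b i2) (ihZ c i3)).
apply: (@le_trans _ _ (I (fun x => a * (rho x ^+ 2 * e x ^+ 2) +
    (b * (rho x ^+ 4 * n x ^+ 2) + c * n x ^+ 2)))).
  apply: I_le => //; first exact: l2M (l2_q ln) le.
  move=> x x0 /=; have r0 := rho_gt0 x0.
  have zX := zn4_le d0 hX x0; have zY := zn4_le d0 hY x0.
  have q2 : q x ^+ 2 <= rho x ^+ 2 * (4 ^+ 7 * 2 * (2 * d ^+ 4 * rho x ^+ 4 + d ^+ 2 * MM)).
    apply: (@le_trans _ _ (2 * (zn X x ^+ 4 + zn Y x ^+ 4))).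
      have E4 (t : R) : t ^+ 4 = (t ^+ 2) ^+ 2 by rewrite -exprM.
      rewrite /q (E4 (zn X x)) (E4 (zn Y x)).
      move: (zn X x ^+ 2) (zn Y x ^+ 2) => u v.
      rewrite (_ : 2 * _ = (u + v) ^+ 2 + (u - v) ^+ 2); last by ring.
      by rewrite lerDl sqr_ge0.
    apply: (@le_trans _ _ (2 * (rho x ^+ 2 * (4 ^+ 7 * (d ^+ 4 * rho x ^+ 4 + d ^+ 2 * Msum X')) +
       rho x ^+ 2 * (4 ^+ 7 * (d ^+ 4 * rho x ^+ 4 + d ^+ 2 * Msum Y'))))).
      by rewrite ler_pM2l//; exact: lerD.
    by rewrite /MM le_eqVlt; apply/orP; left; apply/eqP; ring.
  have dr : 0 < d * rho x by rewrite mulr_gt0.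
  (* The weight d rho balances the two factors: u^2 has the weight of the
     dissipation and v^2 is controlled by q^2 / (d rho)^2. *)
  pose u := d * rho x * e x; pose v := q x * n x / (d * rho x).
  have -> : q x * n x * e x = u * v by rewrite /u /v; field; rewrite !gt_eqF.
  have v2 : v ^+ 2 <= 4 ^+ 7 * 2 * (2 * d ^+ 2 * rho x ^+ 4 + MM) * n x ^+ 2.
    rewrite /v exprMn exprVn ler_pdivrMr ?exprn_gt0// exprMn.
    apply: le_trans (ler_wpM2r (sqr_ge0 (n x)) q2) _.
    by rewrite le_eqVlt; apply/orP; left; apply/eqP; ring.
  have u2 : u ^+ 2 = d ^+ 2 * (rho x ^+ 2 * e x ^+ 2) by rewrite /u; ring.
  have := sqr_ge0 (u - v); rewrite /a /b /c sqrrB -[X in u ^+ 2 - X]mulr_natl u2.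
  move=> h; have {}h : u * v <= 2^-1 * (d ^+ 2 * (rho x ^+ 2 * e x ^+ 2)) + 2^-1 * v ^+ 2 by move: h; lra.
  apply: le_trans h _; rewrite -[2^-1 * d ^+ 2 * _]mulrA lerD2l.
  apply: le_trans (ler_wpM2l _ v2) _ => //.
  by rewrite le_eqVlt; apply/orP; left; apply/eqP; field.
rewrite (ID (ihZ a i1) (ihD (ihZ b i2) (ihZ c i3))) (ID (ihZ b i2) (ihZ c i3)) !IZ//.
have h1 := I_rho2_en hY; have h2 := I_rho4_nn hY; have h3 := I_nn d0 hY.
have dd := sqr_ge0 d.
have a0 : 0 <= a by apply: mulr_ge0 => //; rewrite invr_ge0.
have s0 : 0 <= 4 ^+ 7 :> R by rewrite exprn_ge0.
have b0 : 0 <= b by apply: mulr_ge0 s0 (mulr_ge0 (ler0n _ _) dd).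
have c0 : 0 <= c by exact: mulr_ge0 s0 M0.
have l1 : a * I (fun x => rho x ^+ 2 * e x ^+ 2) <= a * (40 * MM).
  by apply: ler_wpM2l => //; apply: le_trans h1 _; rewrite ler_pM2l ?lerDr// ltr0n.
have l2 : b * I (fun x => rho x ^+ 4 * n x ^+ 2) <= b * (2 * MM).
  by apply: ler_wpM2l => //; apply: le_trans h2 _; rewrite ler_pM2l ?lerDr// ltr0n.
have l3 : c * I (fun x => n x ^+ 2) <= c * (16 * d ^+ 2).
  exact: ler_wpM2l.
apply: le_trans (lerD l1 (lerD l2 l3)) _; rewrite /a /b /c.
have : 0 <= d ^+ 2 * MM by rewrite mulr_ge0.
rewrite (_ : _ + _ = (20 + 4 ^+ 7 * 20) * (d ^+ 2 * MM)); last by field.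
rewrite (_ : 4 ^+ 10 * d ^+ 2 * MM = 4 ^+ 10 * (d ^+ 2 * MM)); last by ring.
move=> h; apply: (ler_wpM2r h).
have : 1 <= 4 ^+ 7 :> R by rewrite exprn_ege1// ler1n.
by rewrite (_ : 4 ^+ 10 = 64 * 4 ^+ 7); [move: (4 ^+ 7) => s; lra|ring].
Qed.

(** The three terms come from the nonlinearity inside the commutator form and from
    the two integrals bounded by [I_qee] and [I_qne]. *)
Definition Kc : R := 8 * C * 4 ^+ 10 + 64 * C * 11520 + 64 * C * (`|m| + C) * 4 ^+ 10.
Definition Kd : R := 3 * (2 + 32 * C).

(** The virial inequality for two states X and Y, thought of as the solution at
    times t + h and t. The last term measures how far the difference quotient is
    from the time derivative; dividing by h is harmless because every term of
    [Sform] can be written with a factor X - Y. *)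
Lemma core (h : R) : h != 0 ->
  h^-1 * Sform X X' ThX Y Y' ThY <= - (3^-1 * Msum Y') + Kc * (d ^+ 2 * MM) +
    Kd * \sum_(k < 4) nm (fun x => h^-1 * (X k x - Y k x) - ThY k x).
Proof.
move=> h0.
have C0 := cubic_ge0 hw.
have [NX' hNX _] := nl_H10 hw d0 d1 hX; have [N' hN bN'] := nl_H10 hw d0 d1 hY.
have [lX lY] := (H10v_l2 HX, H10v_l2 HY).
have [lNX lN] := (H10v_l2 hNX, H10v_l2 hN).
have lT := eY.1; have le := l2_en hY; have ln := l2_nn hY.
pose Dl : vec := fun k x => h^-1 * (X k x - Y k x).
pose Df : vec := fun k x => Dl k x - ThY k x.
have lDl : l2v Dl by move=> k k4; apply: l2Z; exact: l2B (lX k k4) (lY k k4).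
have lDf : l2v Df by move=> k k4; exact: l2B (lDl k k4) (lT k k4).
pose Dl1 x := abs4 (fun k => Dl k x); pose Df1 x := abs4 (fun k => Df k x).
have lDl1 : l2 Dl1 := l2_abs4 lDl. have lDf1 : l2 Df1 := l2_abs4 lDf.
pose J := I (fun x => q x * e x * Dl1 x).
have iJ : ih (fun x => q x * e x * Dl1 x) by apply: l2M => //; exact: l2_q.
have zYq x : zn Y x ^+ 2 <= q x by rewrite /q lerDr sqr_ge0.
have iDe : ih (fun x => Df1 x * e x) by exact: l2M.
have iqne : ih (fun x => q x * n x * e x) by apply: l2M => //; exact: l2_q.
have iqee : ih (fun x => q x * e x * e x) by apply: l2M => //; exact: l2_q.
(* By skewness the commutator form sees only the difference quotient, which is
   replaced by the time derivative and then, by the equation, by the linear part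
   and the nonlinearity; Df is the error. *)
have c1 : h^-1 * cform X Y Y' = cform Dl Y Y'.
  have lhX : l2v (fun k x => h^-1 * X k x) by move=> k k4; apply: l2Z; exact: lX.
  have lhY : l2v (fun k x => - h^-1 * Y k x) by move=> k k4; apply: l2Z; exact: lY.
  have -> : cform Dl Y Y' = cform (fun k x => h^-1 * X k x + - h^-1 * Y k x) Y Y'.
    apply: cform_ae => //; first by move=> k k4; exact: l2D (lhX k k4) (lhY k k4).
    by move=> k k4; apply: aeHW => x _; rewrite /Dl; ring.
  by rewrite (cformD lhX lhY HY) (cformZ _ lX HY) (cformZ _ lY HY) (cform_self m HY) mulr0 addr0.
have c2 : cform Dl Y Y' = cform (Lin m Y Y') Y Y' + cform (nl Y) Y Y' + cform Df Y Y'.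
  have lL : l2v (Lin m Y Y') by move=> k _; exact: l2_Lin.
  rewrite -(cformD lL lN HY).
  have lLN : l2v (fun k x => Lin m Y Y' k x + nl Y k x).
    by move=> k k4; exact: l2D (lL k k4) (lN k k4).
  rewrite -(cform_ae lT lLN HY eY.2) -(cformD lT lDf HY).
  apply: cform_ae => //; first by move=> k k4; exact: l2D (lT k k4) (lDf k k4).
  by move=> k k4; apply: aeHW => x _; rewrite /Df; ring.
have c3 : cform (nl Y) Y Y' <= 8 * C * I (fun x => q x * n x * e x).
  apply: le_trans (cform_le hY lN) _.
  have i := ihZ (4 * C) iqne.
  rewrite (_ : 8 * C * _ = 2 * I (fun x => 4 * C * (q x * n x * e x))); last first.
    by rewrite (IZ _ iqne); ring.
  rewrite ler_pM2l//; apply: I_le => //; first by apply: l2M => //; exact: l2_abs4.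
  move=> x x0 /=; rewrite !mulrA ler_wpM2r ?en_ge0//.
  rewrite (@le_trans _ _ (\sum_(k < 4) (C * (q x * n x))))//.
    apply: ler_sum => k _; apply: le_trans (nl_le hw d0 d1 hY (ltn_ord k) x0) _.
    by rewrite mulrA ler_wpM2r ?nn_ge0// ler_wpM2l.
  rewrite sumr_const card_ord -[leLHS]mulr_natl le_eqVlt; apply/orP; left; apply/eqP; ring.
(* Both nonlinear contributions are bounded by the integral J of q e times the
   difference quotient. *)
have t1 k : (k < 4)%N -> h^-1 * ip (fun x => nl X k x - nl Y k x) (bopv Y Y' k) <= C * J.
  move=> k4; have lb := l2_bopv HY k4; have lD := l2B (lNX k k4) (lN k k4).
  rewrite -(ipZl _ lD lb) -(IZ _ iJ); apply: le_trans (ler_norm _) _.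
  apply: le_trans (ip_abs_le (l2Z _ lD) lb) _; apply: I_le.
  - by apply: l2M; apply: l2_norm => //; exact: l2Z.
  - exact: ihZ.
  - move=> x x0 /=.
    have b : `|bopv Y Y' k x| <= e x.
      exact: le_trans (bop_le _ _ x0) (comp_le_en _ _ _ k4).
    rewrite (_ : C * (q x * e x * Dl1 x) = (C * q x * Dl1 x) * e x); last by ring.
    apply: ler_pM => //; rewrite normrM /nl -mulrBr normrM (gtr0_norm x0).
    have := cubic_lip hw k4 (fun j (j4 : (j < 4)%N) => quot_le1 d0 d1 hX j4 x0)
      (fun j (j4 : (j < 4)%N) => quot_le1 d0 d1 hY j4 x0).
    rewrite -/(zn X x) -/(zn Y x) -/(q x) => hl.
    have hx : 0 <= `|h^-1| * x by rewrite mulr_ge0// ltW.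
    rewrite mulrA; apply: le_trans (ler_wpM2l hx hl) _.
    rewrite mulrCA ler_wpM2l ?mulr_ge0 ?q_ge0//.
    rewrite /Dl1 /abs4 mulr_sumr; apply: ler_sum => j _.
    rewrite /Dl normrM -mulrA ler_wpM2l// -[X in X * _](gtr0_norm x0) -normrM.
    by rewrite (_ : x * _ = X j x - Y j x)//; field; rewrite gt_eqF.
have t2 k : (k < 4)%N -> h^-1 * ip (fun x => X k x - Y k x) (bopv (nl Y) N' k) <= 3 * C * J.
  move=> k4; have lb := l2_bopv hN k4; have lD := l2B (lX k k4) (lY k k4).
  rewrite -(ipZl _ lD lb) -(IZ _ iJ); apply: le_trans (ler_norm _) _.
  apply: le_trans (ip_abs_le (l2Z _ lD) lb) _; apply: I_le.
  - by apply: l2M; apply: l2_norm => //; exact: l2Z.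
  - exact: ihZ.
  - move=> x x0 /=.
    rewrite (_ : 3 * C * (q x * e x * Dl1 x) = Dl1 x * (3 * C * q x * e x)); last by ring.
    apply: ler_pM => //; first exact: (@abs4_le _ (fun k => Dl k x)).
    apply: le_trans (bop_le _ _ x0) _.
    apply: (@le_trans _ _ (2 * C * zn Y x ^+ 2 * e x + C * zn Y x ^+ 2 * e x)).
      apply: lerD; first exact: bN'.
      rewrite normrM normfV (gtr0_norm x0) ler_pdivrMr//.
      apply: le_trans (nl_le hw d0 d1 hY k4 x0) _.
      rewrite -(zn_nn Y x0) [x * _]mulrC mulrA ler_wpM2r ?(ltW x0)//.
      by rewrite ler_wpM2l ?(Czn_ge0 hw)// zn_le_en.
    rewrite (_ : _ + _ = 3 * C * e x * zn Y x ^+ 2); last by ring.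
    rewrite (_ : 3 * C * q x * e x = 3 * C * e x * q x); last by ring.
    apply: ler_wpM2l (zYq x); apply: mulr_ge0; [exact: mulr_ge0|exact: en_ge0].
(* The difference quotient in J is the time derivative up to Df, and the equation
   bounds the time derivative by e and n. *)
have t3 : J <= 2 * I (fun x => Df1 x * e x) + (4 * I (fun x => q x * e x * e x) +
    4 * (`|m| + C) * I (fun x => q x * n x * e x)).
  have i := ihD (ihZ 2 iDe) (ihD (ihZ 4 iqee) (ihZ (4 * (`|m| + C)) iqne)).
  rewrite -!IZ// -(ID (ihZ 4 iqee) (ihZ (4 * (`|m| + C)) iqne)) -ID//; [|exact: ihZ|by apply: ihD; exact: ihZ].
  apply: I_le_ae => //.
  have A := aeH_and (aeH_and (eY.2 0%N isT) (eY.2 1%N isT)) (aeH_and (eY.2 2%N isT) (eY.2 3%N isT)).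
  apply: aeH_imp A => x x0 [[E0 E1] [E2 E3]].
  have Tk k : (k < 4)%N -> `|ThY k x| <= e x + (`|m| + C) * n x.
    move=> k4.
    have -> : ThY k x = Lin m Y Y' k x + nl Y k x by case: k k4 => [|[|[|[|//]]]] _.
    rewrite mulrDl addrA (le_trans (ler_normD _ _))// lerD ?Lin_le//.
    apply: le_trans (nl_le hw d0 d1 hY k4 x0) _.
    rewrite ler_wpM2r ?nn_ge0// ler_piMr//.
    by rewrite exprn_ile1 ?zn_ge0// (zn_le1 d1 hY).
  have B : Dl1 x <= Df1 x + 4 * (e x + (`|m| + C) * n x).
    apply: (@le_trans _ _ (\sum_(k < 4) (`|Df k x| + (e x + (`|m| + C) * n x)))).
      apply: ler_sum => k _; rewrite (_ : Dl k x = Df k x + ThY k x); last by rewrite /Df subrK.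
      by rewrite (le_trans (ler_normD _ _))// lerD2l Tk.
    by rewrite big_split/= lerD2l sumr_const card_ord -[leLHS]mulr_natl.
  have qe : 0 <= q x * e x by rewrite mulr_ge0 ?q_ge0 ?en_ge0.
  apply: le_trans (ler_wpM2l qe B) _.
  rewrite [leLHS](_ : _ = q x * (Df1 x * e x) +
     (4 * (q x * e x * e x) + 4 * (`|m| + C) * (q x * n x * e x))); last by ring.
  rewrite lerD2r ler_wpM2r ?q_le2// mulr_ge0 ?abs4_ge0 ?en_ge0//.
have t4 : I (fun x => Df1 x * e x) <= 3 * \sum_(k < 4) nm (Df k).
  apply: le_trans (CSle lDf1 le) _.
  have a1 := nm_abs4 lDf; have a2 := nm_en hY.
  have a3 : nm e <= 3 by apply: le_trans a2 _; move: d1 => ?; lra.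
  by rewrite mulrC; apply: ler_pM => //; exact: nm_ge0.
have t5 := I_qee; have t6 := I_qne.
have vir := cform_virial m HY.
rewrite (Sform_split hNX hN) mulrDr c1 c2 mulr_sumr.
have t7 : \sum_(k < 4) h^-1 * (ip (fun x => nl X k x - nl Y k x) (bopv Y Y' k) +
   ip (fun x => X k x - Y k x) (bopv (nl Y) N' k)) <= 16 * C * J.
  apply: (@le_trans _ _ (\sum_(k < 4) (4 * C * J))).
    apply: ler_sum => k _; rewrite mulrDr (_ : 4 * C * J = C * J + 3 * C * J); last by ring.
    by apply: lerD; [exact: t1|exact: t2].
  by rewrite sumr_const card_ord -[leLHS]mulr_natl le_eqVlt; apply/orP; left; apply/eqP; ring.
have t8 := cform_le hY lDf.
rewrite -/(Msum Y') in vir.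
have CJ := ler_wpM2l (mulr_ge0 (ler0n _ 16) C0) t3.
have C64 : 0 <= 64 * C by exact: mulr_ge0.
have mC : 0 <= `|m| + C by rewrite addr_ge0.
have u1 := ler_wpM2l C64 t5.
have u2 := ler_wpM2l (mulr_ge0 C64 mC) t6.
have u3 := ler_wpM2l (mulr_ge0 (ler0n _ 8) C0) t6.
have u4 := ler_wpM2l (addr_ge0 (ler0n _ 2) (mulr_ge0 (ler0n _ 32) C0)) t4.
rewrite /Kc /Kd.
move: vir c3 t7 t8 CJ u1 u2 u3 u4.
set a1 := cform _ _ _; set a2 := cform _ _ _; set a3 := cform _ _ _.
set a4 := \sum_(k < 4) _; set a5 := I _; set a6 := I _; set a7 := I _.
set a8 := \sum_(k < 4) nm (Df k).
change (\sum_(k < 4) nm (fun x => h^-1 * (X k x - Y k x) - ThY k x)) with a8.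
clear t1 t2 t3 t4 t5 t6.
move: (4 ^+ 10) (d ^+ 2) a1 a2 a3 a4 a5 a6 a7 a8 (Msum Y') `|m| => *.
lra.
Qed.

End Core.

(** * Evolution in time and local decay *)

Section Calculus.
Context (R : realType).
Implicit Types (f : R -> R) (t h : R).

Lemma is_derive_quot f t l :
  h^-1 * (f (t + h) - f t) @[h --> 0^'] --> l -> is_derive t 1 f l.
Proof.
move=> H.
have H' : h^-1 *: ((f \o shift t) (h *: 1) - f t) @[h --> 0^'] --> l.
  apply: cvg_trans H; apply: near_eq_cvg; near=> h.
  by rewrite /= /GRing.scale/= mulr1 [h + t]addrC.
apply: DeriveDef; first by apply/cvg_ex; exists l.
exact/cvg_lim.
Unshelve. all: by end_near. Qed.

Lemma mvt_pos f f' a b : (forall t, 0 < t -> is_derive t 1 f (f' t)) -> 0 < a -> a <= b ->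
  exists2 c, a <= c <= b & f b - f a = f' c * (b - a).
Proof.
move=> df a0 ab.
have [] := @MVT_segment R f f' a b ab.
- by move=> x; rewrite in_itv/= => /andP[ax _]; apply: df; exact: lt_trans ax.
- apply: derivable_within_continuous => x; rewrite in_itv/= => /andP[ax _].
  have h := df x (lt_le_trans a0 ax); exact: ex_derive.
- by move=> c; rewrite in_itv/= => hc e; exists c.
Qed.

End Calculus.

Section Time.
Context (R : realType).
Local Notation H := (H R).
Implicit Types (f g P Q : R -> R) (c x t s h : R) (i j k : nat).
Local Notation vec := (nat -> R -> R).
Variables (m : R) (w : nat -> (nat -> R) -> R) (C : R).
Hypothesis hw : cubic w C.
Variables (d : R) (d0 : 0 < d) (d1 : 4 * d <= 1) (dK : 24 * (Kc m C * d ^+ 2) <= 1).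
Variables (Y Y' Th : R -> vec).
Hypothesis hS : forall t, 0 < t -> small d (Y t) (Y' t).
Hypothesis hE : forall t, 0 < t -> evol m w (Y t) (Y' t) (Th t).
Hypothesis hD : forall t k, 0 < t -> (k < 4)%N ->
  nm (fun x => h^-1 * (Y (t + h) k x - Y t k x) - Th t k x) @[h --> 0^'] --> 0.
Hypothesis hC : forall t k, 0 < t -> (k < 4)%N ->
  nm (fun x => Th s k x - Th t k x) @[s --> t] --> 0.

Let hH t (t0 : 0 < t) : H10v (Y t) (Y' t) := small_H10 (hS t0).
Let lY t k (t0 : 0 < t) (k4 : (k < 4)%N) : l2 (Y t k) := H10v_l2 (hH t0) k4.
Let lY' t k (t0 : 0 < t) (k4 : (k < 4)%N) : l2 (Y' t k) := l2_deriv (hS t0) k4.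
Let lT t k (t0 : 0 < t) (k4 : (k < 4)%N) : l2 (Th t k) := (hE t0).1 k k4.

Let bY t k := bopv (Y t) (Y' t) k.
Let lb t k (t0 : 0 < t) (k4 : (k < 4)%N) : l2 (bY t k) := l2_bopv (hH t0) k4.

Lemma Y_derive t k Z : 0 < t -> (k < 4)%N -> l2 Z ->
  is_derive t 1 (fun s => ip (Y s k) Z) (ip (Th t k) Z).
Proof.
move=> t0 k4 lZ; apply: is_derive_quot; apply/cvgrPdist_le => e e0.
have e1 : 0 < e / (nm Z + 1) by rewrite divr_gt0// ltr_wpDl ?nm_ge0.
have := hD t0 k4; move/cvgrPdist_le => /(_ _ e1) hd.
near=> h.
have th : 0 < t + h.
  rewrite -ltrBlDl sub0r; near: h; apply: nbhs_dnbhs.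
  by apply: (@lt_nbhsr R (- t) 0); rewrite oppr_lt0.
have lq : l2 (fun x => h^-1 * (Y (t + h) k x - Y t k x)).
  by apply: l2Z; apply: l2B; exact: lY.
have -> : ip (Th t k) Z - h^-1 * (ip (Y (t + h) k) Z - ip (Y t k) Z) =
  - ip (fun x => h^-1 * (Y (t + h) k x - Y t k x) - Th t k x) Z.
  by rewrite ipBl ?ipZl ?ipBl//; do ?[exact: lY|exact: lT|apply: l2B]; ring.
rewrite normrN; apply: le_trans (CS (l2B lq (lT t0 k4)) lZ) _.
have : `|0 - nm (fun x => h^-1 * (Y (t + h) k x - Y t k x) - Th t k x)| <= e / (nm Z + 1).
  by near: h.
rewrite sub0r normrN ger0_norm ?nm_ge0// => hb.
apply: le_trans (ler_wpM2r (nm_ge0 _) hb) _.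
by rewrite mulrAC ler_pdivrMr ?ltr_wpDl ?nm_ge0// ler_wpM2l ?lerDl// ltW.
Unshelve. all: by end_near. Qed.

(** A bound for the norm of the time derivative. *)
Definition LT : R := 3 + `|m| + C.

Lemma LT_gt0 : 0 < LT.
Proof. by rewrite /LT -addrA ltr_wpDr ?addr_ge0//; exact: cubic_ge0 hw. Qed.

Lemma nm_nn Z Z' : small d Z Z' -> nm (nn Z) <= 4 * d.
Proof.
move=> hZ; apply: le_trans (nm_abs4 (H10v_l2 (small_H10 hZ))) _.
rewrite (@le_trans _ _ (\sum_(k < 4) d))//; last by rewrite sumr_const card_ord mulr_natl.
by apply: ler_sum => k _; exact: (small_nm hZ (ltn_ord k)).
Qed.

Lemma Th_bnd t k : 0 < t -> (k < 4)%N -> nm (Th t k) <= LT.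
Proof.
move=> t0 k4; have C0 := cubic_ge0 hw.
have le := l2_en (hS t0); have ln := l2_nn (hS t0).
have [N' hN _] := nl_H10 hw d0 d1 (hS t0).
have lL := l2_Lin m k (hH t0); have lN := H10v_l2 hN k4.
have -> : nm (Th t k) = nm (fun x => Lin m (Y t) (Y' t) k x + nl w (Y t) k x).
  by apply: nm_ae; [exact: l2_meas (lT t0 k4)|exact: l2_meas (l2D lL lN)|exact: (hE t0).2].
have lg := l2D le (l2Z (`|m| + C) ln).
apply: (@le_trans _ _ (nm (fun x => en (Y t) (Y' t) x + (`|m| + C) * nn (Y t) x))).
  apply: nm_le => //; first exact: l2D.
  move=> x x0; rewrite [leRHS]ger0_norm; last first.
    by rewrite addr_ge0 ?en_ge0// mulr_ge0 ?nn_ge0// addr_ge0.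
  rewrite mulrDl addrA (le_trans (ler_normD _ _))// lerD ?Lin_le//.
  apply: le_trans (nl_le hw d0 d1 (hS t0) k4 x0) _.
  rewrite ler_wpM2r ?nn_ge0// ler_piMr//.
  by rewrite exprn_ile1 ?zn_ge0// (zn_le1 d1 (hS t0)).
apply: le_trans (nmD le (l2Z _ ln)) _; rewrite nmZ// ger0_norm ?addr_ge0//.
rewrite /LT -addrA lerD//.
  by apply: le_trans (nm_en (hS t0)) _; move: d1 => ?; lra.
rewrite -[leRHS]mulr1 ler_wpM2l ?addr_ge0//.
by apply: le_trans (nm_nn (hS t0)) d1.
Qed.

(** The increment is paired with itself, which makes the mean value theorem for
    real functions applicable. *)
Lemma Y_lip s t k : 0 < s -> s <= t -> (k < 4)%N ->
  nm (fun x => Y t k x - Y s k x) <= LT * (t - s).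
Proof.
move=> s0 st k4; have t0 := lt_le_trans s0 st.
pose Z x := Y t k x - Y s k x.
have lZ : l2 Z by apply: l2B; exact: lY.
have [c /andP[sc ct]] := mvt_pos (fun u u0 => Y_derive u0 k4 lZ) s0 st.
have c0 := lt_le_trans s0 sc.
rewrite -(ipBl (lY t0 k4) (lY s0 k4) lZ) => e.
have e1 : nm Z ^+ 2 <= LT * (t - s) * nm Z.
  rewrite nm_sqr (_ : I _ = ip Z Z); last by apply: I_eq => x _; rewrite expr2.
  rewrite e mulrAC ler_wpM2r ?subr_ge0//.
  by apply: le_trans (CSle (lT c0 k4) lZ) _; rewrite ler_wpM2r ?nm_ge0// Th_bnd.
have := nm_ge0 Z; rewrite -/(Z) le_eqVlt => /predU1P[<-|z0].
  by rewrite mulr_ge0 ?(ltW LT_gt0)// subr_ge0.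
by rewrite -(ler_pM2r z0) -expr2.
Qed.

Lemma pos_near t : 0 < t -> \forall s \near t, 0 < s.
Proof. by move=> t0; exact: lt_nbhsr. Qed.

Lemma Y_cont t k : 0 < t -> (k < 4)%N ->
  nm (fun x => Y s k x - Y t k x) @[s --> t] --> 0.
Proof.
move=> t0 k4; apply/cvgrPdist_le => e e0.
have e1 : 0 < e / LT by rewrite divr_gt0// LT_gt0.
near=> s.
have s0 : 0 < s by near: s; exact: pos_near.
have st : `|t - s| <= e / LT by near: s; apply: cvgr_dist_le e1; exact: cvg_id.
rewrite sub0r normrN ger0_norm ?nm_ge0//.
suff : nm (fun x => Y s k x - Y t k x) <= LT * `|t - s|.
  by move/le_trans; apply; rewrite mulrC -ler_pdivlMr ?LT_gt0.
have [ts|ts] := leP t s; first by rewrite distrC ger0_norm ?subr_ge0// Y_lip.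
rewrite ger0_norm ?subr_ge0 ?(ltW ts)//.
rewrite -nmN (eq_nm (g := fun x => Y t k x - Y s k x)); first by rewrite Y_lip// ltW.
by move=> x _; rewrite opprB.
Unshelve. all: by end_near. Qed.

(** The evolution equation bounds the spatial derivative of a difference by
    the time derivative, so continuity in time of the latter is enough. *)
Lemma deriv_diff_le s t k : 0 < s -> 0 < t -> (k < 4)%N ->
  nm (fun x => Y' s k x - Y' t k x) <=
  \sum_(j < 4) nm (fun x => Th s j x - Th t j x) +
  (`|m| + 2 * C) * \sum_(j < 4) nm (fun x => Y s j x - Y t j x).
Proof.
move=> s0 t0 k4; have C0 := cubic_ge0 hw.
pose Z : vec := fun j x => Y s j x - Y t j x.
pose Z' : vec := fun j x => Y' s j x - Y' t j x.
have hZ : H10v Z Z' by move=> j j4; exact: H10B (hH s0 j4) (hH t0 j4).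
have lZ := H10v_l2 hZ.
have lTd j : (j < 4)%N -> l2 (fun x => Th s j x - Th t j x).
  by move=> j4; apply: l2B; exact: lT.
have [NS' hNS _] := nl_H10 hw d0 d1 (hS s0); have [NT' hNT _] := nl_H10 hw d0 d1 (hS t0).
have lNS := H10v_l2 hNS; have lNT := H10v_l2 hNT.
have lNd j : (j < 4)%N -> l2 (fun x => nl w (Y s) j x - nl w (Y t) j x).
  by move=> j4; apply: l2B; [exact: lNS|exact: lNT].
have nN j : (j < 4)%N -> nm (fun x => nl w (Y s) j x - nl w (Y t) j x) <=
    2 * C * \sum_(j < 4) nm (Z j).
  move=> j4; have C2 : 0 <= 2 * C by exact: mulr_ge0.
  apply: (@le_trans _ _ (nm (fun x => 2 * C * nn Z x))).
    have lnZ := l2_abs4 lZ.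
    apply: nm_le; [exact: lNd|exact: l2Z|].
    move=> x x0; rewrite [leRHS]ger0_norm; last exact: mulr_ge0 C2 (nn_ge0 _ _).
    rewrite /nl -mulrBr normrM (gtr0_norm x0).
    have := cubic_lip hw j4 (fun j (j4 : (j < 4)%N) => quot_le1 d0 d1 (hS s0) j4 x0)
      (fun j (j4 : (j < 4)%N) => quot_le1 d0 d1 (hS t0) j4 x0).
    move=> hl; apply: le_trans (ler_wpM2l (ltW x0) hl) _.
    have E : x * abs4 (fun i => Y s i x / x - Y t i x / x) = nn Z x.
      rewrite -zn_nn// /zn; congr (_ * abs4 _); apply/funext => i.
      by rewrite /Z mulrBl.
    rewrite mulrCA E ler_wpM2r ?nn_ge0// mulrC ler_wpM2r//.
    have a := q_le2 d1 (hS s0) (hS t0) x0; exact: a.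
  rewrite nmZ; last exact: l2_abs4.
  by rewrite ger0_norm// ler_wpM2l//; exact: nm_abs4.
have nT j : (j < 4)%N -> nm (fun x => Th s j x - Th t j x) <=
    \sum_(j < 4) nm (fun x => Th s j x - Th t j x).
  by move=> j4; rewrite (bigD1 (Ordinal j4))//= lerDl sumr_ge0// => *; exact: nm_ge0.
have nZ j : (j < 4)%N -> nm (Z j) <= \sum_(j < 4) nm (Z j).
  by move=> j4; rewrite (bigD1 (Ordinal j4))//= lerDl sumr_ge0// => *; exact: nm_ge0.
have key F j i (c : R) : (j < 4)%N -> (i < 4)%N -> l2 F -> `|c| = `|m| ->
  aeH (fun x => `|F x| = `|(Th s j x - Th t j x) - (nl w (Y s) j x - nl w (Y t) j x) - c * Z i x|) ->
  nm F <= \sum_(j < 4) nm (fun x => Th s j x - Th t j x) + (`|m| + 2 * C) * \sum_(j < 4) nm (Z j).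
  move=> j4 i4 lF cm FE.
  pose G x := (Th s j x - Th t j x) - (nl w (Y s) j x - nl w (Y t) j x) - c * Z i x.
  have lG : l2 G by apply: l2B; [apply: l2B; [exact: lTd|exact: lNd]|apply: l2Z; exact: lZ].
  have -> : nm F = nm G.
    rewrite /nm /nrm; congr Num.sqrt; apply: I_ae.
    - by apply: measurable_funX; exact: l2_meas.
    - by apply: measurable_funX; exact: l2_meas.
    - apply: aeH_imp FE => x _ E.
      by rewrite -(real_normK (num_real (F x))) E real_normK ?num_real.
  apply: le_trans (nmB (l2B (lTd j j4) (lNd j j4)) (l2Z _ (lZ i i4))) _.
  apply: le_trans (lerD (nmB (lTd j j4) (lNd j j4)) (lexx _)) _.
  rewrite nmZ; last exact: lZ.
  have h1 := nT j j4; have h2 := nN j j4; have h3 := nZ i i4.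
  rewrite cm mulrDl -addrA lerD// addrC lerD// ler_wpM2l//.
have ev j (j4 : (j < 4)%N) := aeH_and ((hE s0).2 j j4) ((hE t0).2 j j4).
case: k k4 => [|[|[|[|//]]]] k4.
- rewrite (Lm_coercive (hZ 0%N isT)).
  apply: (key _ 3%N 2%N m isT isT (l2_Lm (hZ 0%N isT)) erefl).
  by apply: aeH_imp (ev 3%N isT) => x x0 [-> ->]; congr `|_|; rewrite /Lin /Lm /Z /Z'; ring.
- rewrite (Lm_coercive (hZ 1%N isT)).
  apply: (key _ 2%N 3%N (- m) isT isT (l2_Lm (hZ 1%N isT)) (normrN _)).
  apply: aeH_imp (ev 2%N isT) => x x0 [-> ->]; rewrite -normrN; congr `|_|.
  by rewrite /Lin /Lm /Z /Z'; ring.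
- apply: le_trans (Lp_coercive (hZ 2%N isT)) _.
  apply: (key _ 1%N 0%N (- m) isT isT (l2_Lp (hZ 2%N isT)) (normrN _)).
  apply: aeH_imp (ev 1%N isT) => x x0 [-> ->]; rewrite -normrN; congr `|_|.
  by rewrite /Lin /Lp /Z /Z'; ring.
- apply: le_trans (Lp_coercive (hZ 3%N isT)) _.
  apply: (key _ 0%N 1%N m isT isT (l2_Lp (hZ 3%N isT)) erefl).
  by apply: aeH_imp (ev 0%N isT) => x x0 [-> ->]; congr `|_|; rewrite /Lin /Lp /Z /Z'; ring.
Qed.

Lemma cvg0_sum4 (F : R -> nat -> R) t :
  (forall k, (k < 4)%N -> F s k @[s --> t] --> 0) ->
  \sum_(k < 4) F s k @[s --> t] --> 0.
Proof.
move=> h; under eq_fun do rewrite (sum4 (F _)).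
rewrite (_ : 0 = 0 + 0 + 0 + 0 :> R); last by rewrite !addr0.
exact: (cvgD (cvgD (cvgD (h 0%N isT) (h 1%N isT)) (h 2%N isT)) (h 3%N isT)).
Qed.

Lemma Y'_cont t k : 0 < t -> (k < 4)%N ->
  nm (fun x => Y' s k x - Y' t k x) @[s --> t] --> 0.
Proof.
move=> t0 k4.
pose G s := \sum_(j < 4) nm (fun x => Th s j x - Th t j x) +
  (`|m| + 2 * C) * \sum_(j < 4) nm (fun x => Y s j x - Y t j x).
have GG : G s @[s --> t] --> 0.
  have S1 := @cvg0_sum4 (fun s j => nm (fun x => Th s j x - Th t j x)) t
    (fun j lj => hC t0 lj).
  have S2 := @cvg0_sum4 (fun s j => nm (fun x => Y s j x - Y t j x)) t
    (fun j lj => Y_cont t0 lj).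
  have S3 : (`|m| + 2 * C) * \sum_(j < 4) nm (fun x => Y s j x - Y t j x) @[s --> t] -->
      (`|m| + 2 * C) * 0 by apply: cvgMr; exact: S2.
  by have := cvgD S1 S3; rewrite mulr0 addr0; apply.
apply: (squeeze_cvgr _ (cvg_cst 0) GG).
near=> s; rewrite nm_ge0/=; apply: deriv_diff_le => //.
by near: s; exact: pos_near.
Unshelve. all: by end_near. Qed.

(** The difference quotients converge locally uniformly in time: pairing the error
    with itself and applying the mean value theorem replaces the quotient by the
    continuous function Th at an intermediate time. *)
Lemma strict_diff t e : 0 < t -> 0 < e -> \forall s \near t & h \near 0^'+,
  forall k, (k < 4)%N -> nm (fun x => h^-1 * (Y (s + h) k x - Y s k x) - Th s k x) <= e.
Proof.
move=> t0 e0.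
have : \forall s \near t, forall k, (k < 4)%N -> nm (fun x => Th s k x - Th t k x) <= e / 2.
  have e2 : 0 < e / 2 by rewrite divr_gt0.
  have S : \sum_(k < 4) nm (fun x => Th s k x - Th t k x) @[s --> t] --> 0.
    exact: (@cvg0_sum4 (fun s j => nm (fun x => Th s j x - Th t j x)) t
      (fun j lj => hC t0 lj)).
  move/cvgrPdist_le : S => /(_ _ e2); apply: filterS => s + k k4.
  rewrite sub0r normrN ger0_norm; last by apply: sumr_ge0 => *; exact: nm_ge0.
  apply: le_trans; rewrite (bigD1 (Ordinal k4))//= lerDl sumr_ge0// => *; exact: nm_ge0.
move=> /nbhs_ballP[r0 /= r00 hr].
pose r := Num.min r0 t; have r_gt0 : 0 < r by rewrite lt_min r00.
have hr2 s : `|t - s| < r -> 0 < s /\ forall k, (k < 4)%N ->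
    nm (fun x => Th s k x - Th t k x) <= e / 2.
  rewrite lt_min => /andP[h1 h2]; split; last exact: hr.
  by move: h2; rewrite ltr_norml => /andP[_]; rewrite ltrBlDl -ltrBlDr subrr.
have r2 : 0 < r / 2 by rewrite divr_gt0.
exists (ball t (r / 2), [set h | 0 < h /\ h < r / 2]).
  split => /=; first exact: nbhsx_ballx.
  by near=> h; split; near: h; [exact: nbhs_right_gt|exact: nbhs_right_lt].
move=> [s h] /= [hs [h0 hr3]] k k4.
have near_s u : s <= u <= s + h -> `|t - u| < r.
  move=> /andP[su uh]; have -> : t - u = (t - s) - (u - s) by ring.
  rewrite (le_lt_trans (ler_normB _ _))// (ger0_norm (x := u - s)) ?subr_ge0//.
  have : `|t - s| < r / 2 by [].
  by move: `|t - s| => v; lra.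
have ssh : s <= s + h by rewrite lerDl ltW.
have ns : `|t - s| < r by apply: near_s; rewrite lexx.
have [s0 hs1] := hr2 s ns.
have sh0 : 0 < s + h by rewrite addr_gt0.
pose Z x := h^-1 * (Y (s + h) k x - Y s k x) - Th s k x.
have lq : l2 (fun x => h^-1 * (Y (s + h) k x - Y s k x)).
  by apply: l2Z; apply: l2B; exact: lY.
have lZ : l2 Z by exact: l2B lq (lT s0 k4).
have [c hc] := mvt_pos (fun u u0 => Y_derive u0 k4 lZ) s0 ssh.
have [c0 hc1] := hr2 c (near_s c hc).
rewrite [s + h - s]addrC addKr => E.
have E2 : nm Z ^+ 2 = ip (fun x => Th c k x - Th s k x) Z.
  rewrite nm_sqr (_ : I _ = ip Z Z); last by apply: I_eq => x _; rewrite expr2.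
  rewrite {1}/Z (ipBl lq (lT s0 k4) lZ) (ipZl _ (l2B (lY sh0 k4) (lY s0 k4)) lZ).
  rewrite (ipBl (lY sh0 k4) (lY s0 k4) lZ) (ipBl (lT c0 k4) (lT s0 k4) lZ) E.
  by congr (_ - _); field; rewrite gt_eqF.
have lTc := l2B (lT c0 k4) (lT s0 k4).
have b : nm (fun x => Th c k x - Th s k x) <= e.
  rewrite (eq_nm (g := fun x => (Th c k x - Th t k x) - (Th s k x - Th t k x))); last first.
    by move=> x _; ring.
  have lct := l2B (lT c0 k4) (lT t0 k4); have lst := l2B (lT s0 k4) (lT t0 k4).
  apply: le_trans (nmB lct lst) _.
  by have := hc1 k k4; have := hs1 k k4; lra.
have : nm Z ^+ 2 <= e * nm Z.
  by rewrite E2; apply: le_trans (CSle lTc lZ) _; rewrite ler_wpM2r ?nm_ge0.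
have := nm_ge0 Z; rewrite -/(Z) le_eqVlt => /predU1P[<- _|z0]; first exact: ltW.
by rewrite expr2 ler_pM2r.
Unshelve. all: by end_near. Qed.

Lemma nm_bop P P' : H10 P P' -> nm (bop P P') <= 3 * nm P'.
Proof.
move=> hP; have lx := H10_divx hP; have [_ lP lP' _] := hP.
have ln := l2_norm lx; have ln' := l2_norm lP'.
apply: (@le_trans _ _ (nm (fun x => `|P' x| + `|P x / x|))).
  apply: nm_le; [exact: l2_bop|exact: l2D|] => x x0.
  by rewrite [leRHS]ger0_norm ?addr_ge0//; exact: bop_le.
apply: le_trans (nmD ln' ln) _.
have n f : nm (fun x => `|f x|) = nm f.
  by congr Num.sqrt; apply: I_eq => x _; rewrite real_normK ?num_real.
by rewrite !n; have := hardy hP; move: (nm _) (nm P') => u v; lra.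
Qed.

Lemma bY_bnd t k : 0 < t -> (k < 4)%N -> nm (bY t k) <= 3 * d.
Proof.
move=> t0 k4; apply: le_trans (nm_bop (hH t0 k4)) _.
by rewrite ler_pM2l//; exact: (small_nm' (hS t0) k4).
Qed.

Lemma ball_of_near (P : R -> Prop) t : 0 < t -> (\forall s \near t, P s) ->
  exists2 r, 0 < r & forall s, `|t - s| < r -> 0 < s /\ P s.
Proof.
move=> t0 /nbhs_ballP[r0 /= r00 hr]; exists (Num.min r0 t); first by rewrite lt_min r00.
move=> s; rewrite lt_min => /andP[h1 h2]; split; last exact: hr.
by move: h2; rewrite ltr_norml => /andP[_]; rewrite ltrBlDl -ltrBlDr subrr.
Qed.

Lemma Y'_near t e : 0 < t -> 0 < e ->
  \forall s \near t, forall k, (k < 4)%N -> nm (fun x => Y' s k x - Y' t k x) <= e.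
Proof.
move=> t0 e0.
have S := @cvg0_sum4 (fun s j => nm (fun x => Y' s j x - Y' t j x)) t
  (fun j lj => Y'_cont t0 lj).
move/cvgrPdist_le : S => /(_ _ e0); apply: filterS => s + k k4.
rewrite sub0r normrN ger0_norm; last by apply: sumr_ge0 => *; exact: nm_ge0.
apply: le_trans; rewrite (bigD1 (Ordinal k4))//= lerDl sumr_ge0// => *; exact: nm_ge0.
Qed.

(** The second factor contains a spatial derivative and is not differentiable in
    time with values in L^2; by antisymmetry its increment is tested with the
    multiplier on the other factor. *)
Lemma pair_derive t h k : 0 < t -> 0 < h -> (k < 4)%N ->
  is_derive t 1 (fun s => ip (Y (s + h) k) (bY s k))
    (ip (Th (t + h) k) (bY t k) - ip (bY (t + h) k) (Th t k)).
Proof.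
move=> t0 h0 k4; have th : 0 < t + h by rewrite addr_gt0.
apply: is_derive_quot; apply/cvgrPdist_le => e e0.
pose KK := 6 * d + 3 * LT.
have KK0 : 0 < KK by rewrite addr_gt0 ?mulr_gt0 ?LT_gt0.
have e1 : 0 < e / KK by rewrite divr_gt0.
have [r r0 hr] := ball_of_near t0 (Y'_near t0 e1).
have := hD t0 k4; move/cvgrPdist_le => /(_ _ e1) hd1.
have := hD th k4; move/cvgrPdist_le => /(_ _ e1) hd2.
near=> u.
have u0 : u != 0 by near: u; exact: nbhs_dnbhs_neq.
have ur : `|u| < r by near: u; exact: dnbhs0_lt.
have tur : `|t - (t + u)| < r by rewrite opprD addrA subrr sub0r normrN.
have [tu hb] := hr (t + u) tur.
have tuh : 0 < t + u + h by rewrite addr_gt0.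
have a1 : nm (fun x => u^-1 * (Y (t + u) k x - Y t k x) - Th t k x) <= e / KK.
  by rewrite -[leLHS]ger0_norm ?nm_ge0// -normrN -sub0r; near: u.
have a2 : nm (fun x => u^-1 * (Y (t + h + u) k x - Y (t + h) k x) - Th (t + h) k x) <= e / KK.
  by rewrite -[leLHS]ger0_norm ?nm_ge0// -normrN -sub0r; near: u.
have {}hb := hb k k4.
rewrite [t + h + u]addrAC in a2.
have lq1 : l2 (fun x => Y (t + u) k x - Y t k x) by apply: l2B; exact: lY.
have lq2 : l2 (fun x => Y (t + u + h) k x - Y (t + h) k x) by apply: l2B; exact: lY.
have [b1 b2 b3] := And3 (lb tu k4) (lb t0 k4) (lb th k4).
have [T1 T2] := (lT t0 k4, lT th k4).
have hZ := H10B (hH tu k4) (hH t0 k4).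
have bE : (fun x => bY (t + u) k x - bY t k x) =
    bop (fun x => Y (t + u) k x - Y t k x) (fun x => Y' (t + u) k x - Y' t k x).
  by apply/funext => x; rewrite /bY /bopv /bop; ring.
have anti : ip (Y (t + h) k) (bY (t + u) k) - ip (Y (t + h) k) (bY t k) =
    - ip (bY (t + h) k) (fun x => Y (t + u) k x - Y t k x).
  rewrite -(ipBr b1 b2 (lY th k4)) bE.
  by have := bop_antisym (hH th k4) hZ; rewrite -/(ip _ _) => ->; rewrite opprK.
pose A1 := ip (fun x => u^-1 * (Y (t + u + h) k x - Y (t + h) k x) - Th (t + h) k x) (bY (t + u) k).
pose A2 := ip (Th (t + h) k) (fun x => bY (t + u) k x - bY t k x).
pose A3 := ip (bY (t + h) k) (fun x => u^-1 * (Y (t + u) k x - Y t k x) - Th t k x).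
have -> : ip (Th (t + h) k) (bY t k) - ip (bY (t + h) k) (Th t k) -
    u^-1 * (ip (Y (t + u + h) k) (bY (t + u) k) - ip (Y (t + h) k) (bY t k)) =
    A3 - A1 - A2.
  rewrite /A1 /A2 /A3 (ipBl (l2Z _ lq2) T2 b1) (ipZl _ lq2 b1).
  rewrite (ipBl (lY tuh k4) (lY th k4) b1) (ipBr b1 b2 T2).
  rewrite (ipBr (l2Z _ lq1) T1 b3) (ipZr _ lq1 b3).
  have -> : ip (bY (t + h) k) (fun x => Y (t + u) k x - Y t k x) =
    - (ip (Y (t + h) k) (bY (t + u) k) - ip (Y (t + h) k) (bY t k)) by rewrite anti opprK.
  by ring.
have B1 : `|A1| <= e / KK * (3 * d).
  apply: le_trans (CS (l2B (l2Z _ lq2) T2) b1) _.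
  by apply: ler_pM; rewrite ?nm_ge0//; exact: bY_bnd.
have B2 : `|A2| <= LT * (3 * (e / KK)).
  rewrite /A2 bE; apply: le_trans (CS T2 (l2_bop hZ)) _.
  apply: ler_pM; rewrite ?nm_ge0 ?Th_bnd//.
  by apply: le_trans (nm_bop hZ) _; rewrite ler_pM2l.
have B3 : `|A3| <= 3 * d * (e / KK).
  apply: le_trans (CS b3 (l2B (l2Z _ lq1) T1)) _.
  by apply: ler_pM; rewrite ?nm_ge0//; exact: bY_bnd.
apply: le_trans (ler_normB _ _) _; apply: le_trans (lerD (ler_normB _ _) (lexx _)) _.
apply: le_trans (lerD (lerD B3 B1) B2) _.
rewrite le_eqVlt; apply/orP; left; apply/eqP; rewrite (_ : _ + _ + _ = e / KK * KK); first by rewrite divfK// gt_eqF.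
by rewrite [in X in _ = _ * X]/KK; ring.
Unshelve. all: by end_near. Qed.

(** The virial functional. As Y is orthogonal to its image under the antisymmetric
    multiplier, it tends to the pairing of dY/dt with the multiplier of Y when h
    tends to 0. *)
Definition Kf h t : R := h^-1 * \sum_(k < 4) ip (Y (t + h) k) (bY t k).

Definition Kf' h t : R := h^-1 * Sform (Y (t + h)) (Y' (t + h)) (Th (t + h)) (Y t) (Y' t) (Th t).

Lemma Kf_derive h t : 0 < t -> 0 < h -> is_derive t 1 (Kf h) (Kf' h t).
Proof.
move=> t0 h0; have D k (k4 : (k < 4)%N) := pair_derive t0 h0 k4.
have E : Kf h = (fun s => h^-1 * (ip (Y (s + h) 0%N) (bY s 0%N) + ip (Y (s + h) 1%N) (bY s 1%N) +
  ip (Y (s + h) 2%N) (bY s 2%N) + ip (Y (s + h) 3%N) (bY s 3%N))).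
  by apply/funext => s; rewrite /Kf (sum4 (fun k => ip (Y (s + h) k) (bY s k))).
rewrite E /Kf' /Sform (sum4 (fun k => ip (Th (t + h) k) (bopv (Y t) (Y' t) k) -
  ip (bopv (Y (t + h)) (Y' (t + h)) k) (Th t k))).
have := is_deriveZ h^-1 (is_deriveD (is_deriveD (is_deriveD (D 0%N isT) (D 1%N isT)) (D 2%N isT)) (D 3%N isT)).
by [].
Qed.

(** The quotient by h is compensated by the Lipschitz bound for Y, since subtracting
    Y (t) from the first factor does not change the pairing. *)
Lemma Kf_bnd h t : 0 < t -> 0 < h -> `|Kf h t| <= 12 * LT * d.
Proof.
move=> t0 h0; have th : 0 < t + h by rewrite addr_gt0.
rewrite /Kf mulr_sumr (le_trans (ler_norm_sum _ _ _))//.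
apply: (@le_trans _ _ (\sum_(k < 4) (LT * (3 * d)))); last first.
  rewrite sumr_const card_ord -[leLHS]mulr_natl le_eqVlt; apply/orP; left; apply/eqP; ring.
apply: ler_sum => -[k k4] _ /=.
have [l1 l2' b] := And3 (lY th k4) (lY t0 k4) (lb t0 k4).
have a : ip (Y t k) (bY t k) = 0.
  have := bop_antisym (hH t0 k4) (hH t0 k4); rewrite -!/(ip _ _) ipC => /eqP.
  by rewrite -addr_eq0 -mulr2n mulrn_eq0/= => /eqP.
rewrite -[ip _ _]subr0 -{1}a -(ipBl l1 l2' b) -(ipZl _ (l2B l1 l2') b).
apply: le_trans (CS (l2Z _ (l2B l1 l2')) b) _.
apply: ler_pM; rewrite ?nm_ge0 ?bY_bnd// nmZ; last exact: l2B.
rewrite ger0_norm ?invr_ge0 ?(ltW h0)// mulrC ler_pdivrMr//.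
have := Y_lip t0 (_ : t <= t + h) k4; rewrite lerDl (ltW h0) => /(_ isT).
by rewrite [t + h - t]addrC addKr.
Qed.

Lemma Kc_ge0 : 0 <= Kc m C.
Proof.
have C0 := cubic_ge0 hw; rewrite /Kc.
have s0 : 0 <= 4 ^+ 10 :> R by rewrite exprn_ge0.
have c (n : nat) : 0 <= n%:R * C := mulr_ge0 (ler0n R n) C0.
have a1 := mulr_ge0 (c 8%N) s0; have a2 := mulr_ge0 (c 64%N) (ler0n R 11520).
have a3 := mulr_ge0 (mulr_ge0 (c 64%N) (addr_ge0 (normr_ge0 m) C0)) s0.
exact: addr_ge0 (addr_ge0 a1 a2) a3.
Qed.

Lemma Msum_diff s t : 0 < s -> 0 < t ->
  Msum (Y' s) <= Msum (Y' t) + 2 * d * \sum_(k < 4) nm (fun x => Y' s k x - Y' t k x).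
Proof.
move=> s0 t0; rewrite mulr_sumr /Msum -big_split/=; apply: ler_sum => -[k k4] _ /=.
have [l1 l2'] := (lY' s0 k4, lY' t0 k4); have [r1 r2] := (l2_rho l1, l2_rho l2').
have rle f : l2 f -> nm (fun x => rho x * f x) <= nm f.
  move=> lf; apply: nm_le => //; first exact: l2_rho.
  by move=> x x0; rewrite normrM ler_piMl// ger0_norm ?rho_le1// ltW// rho_gt0.
have lB := l2B l1 l2'.
have tri : nm (fun x => rho x * Y' s k x) <= nm (fun x => rho x * Y' t k x) +
    nm (fun x => Y' s k x - Y' t k x).
  rewrite (eq_nm (g := fun x => rho x * Y' t k x + rho x * (Y' s k x - Y' t k x))); last first.
    by move=> x _; ring.
  apply: le_trans (nmD r2 (l2_rho lB)) _; rewrite lerD2l; exact: rle.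
have b1 : nm (fun x => rho x * Y' s k x) <= d := le_trans (rle _ l1) (small_nm' (hS s0) k4).
have b2 : nm (fun x => rho x * Y' t k x) <= d := le_trans (rle _ l2') (small_nm' (hS t0) k4).
rewrite -!nm_rho; have := nm_ge0 (fun x => rho x * Y' s k x).
have := nm_ge0 (fun x => rho x * Y' t k x).
have := nm_ge0 (fun x => Y' s k x - Y' t k x).
move: tri b1 b2; set p := nm _; set q := nm _; set r := nm _ => tri b1 b2 r0 q0 p0.
have h1 : p ^+ 2 <= (q + r) * p by rewrite expr2 ler_wpM2r.
have h2 : q * p <= q * (q + r) by rewrite ler_wpM2l.
have h3 : r * p <= r * d by rewrite ler_wpM2l.
have h4 : q * r <= d * r by rewrite ler_wpM2r.
by move: h1 h2 h3 h4; rewrite !mulrDl !mulrDr !expr2; lra.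
Qed.

(** From [core], where 24 Kc d^2 <= 1 leaves - 1/3 + 2/24 = - 1/4. *)
Lemma Kf'_local t e : 0 < t -> 0 < e -> \forall s \near t & h \near 0^'+,
  Kf' h s <= - (4^-1 * Msum (Y' s)) + e.
Proof.
move=> t0 e0.
have Kd0 : 0 <= Kd C by rewrite mulr_ge0// addr_ge0// mulr_ge0// (cubic_ge0 hw).
pose e1 := e / (2 * (4 * Kd C + 1)).
have K1 : 0 < 4 * Kd C + 1 by rewrite ltr_wpDl// mulr_ge0.
have e10 : 0 < e1 by rewrite divr_gt0// mulr_gt0.
have e8 : 0 < e / 8 by rewrite divr_gt0.
have [r r0 hr] := ball_of_near t0 (Y'_near t0 e8).
have [[A B] /= [hA hB] hAB] := strict_diff t0 e10.
exists (A `&` ball t (r / 2), B `&` [set h | 0 < h /\ h < r / 2]).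
  split => /=; first by apply: filterI => //; apply: nbhsx_ballx; rewrite divr_gt0.
  apply: filterI => //; near=> h; split; near: h; first exact: nbhs_right_gt.
  by apply: nbhs_right_lt; rewrite divr_gt0.
move=> [s h] /= [[As ts] [Bh [h0 hr2]]].
have ts' : `|t - s| < r / 2 by [].
have ns : `|t - s| < r.
  by apply: lt_le_trans ts' _; rewrite ler_pdivrMr// ler_peMr ?(ltW r0)// ler1n.
have nsh : `|t - (s + h)| < r.
  have -> : t - (s + h) = (t - s) - h by ring.
  rewrite (le_lt_trans (ler_normB _ _))// (gtr0_norm h0).
  by move: ts' hr2; move: `|t - s| => v; lra.
have [s0 hs] := hr s ns; have [sh0 hsh] := hr (s + h) nsh.
have hn0 : h != 0 by rewrite gt_eqF.
have co := core hw d0 d1 (hS sh0) (hS s0) (hE sh0) (hE s0) hn0.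
rewrite -/(Kf' h s) in co; apply: le_trans co _.
have sd : \sum_(k < 4) nm (fun x => h^-1 * (Y (s + h) k x - Y s k x) - Th s k x) <= 4 * e1.
  rewrite (@le_trans _ _ (\sum_(k < 4) e1))//; last by rewrite sumr_const card_ord mulr_natl.
  by apply: ler_sum => k _; apply: (hAB (s, h)) => //; split.
have md := Msum_diff sh0 s0.
have sY : \sum_(k < 4) nm (fun x => Y' (s + h) k x - Y' s k x) <= e.
  rewrite (@le_trans _ _ (\sum_(k < 4) (e / 8 + e / 8)))//; last first.
    by rewrite sumr_const card_ord -[leLHS]mulr_natl le_eqVlt; apply/orP; left; apply/eqP; field.
  apply: ler_sum => -[k k4] _ /=.
  rewrite (eq_nm (g := fun x => (Y' (s + h) k x - Y' t k x) - (Y' s k x - Y' t k x))); last first.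
    by move=> x _; ring.
  apply: le_trans (nmB (l2B (lY' sh0 k4) (lY' t0 k4)) (l2B (lY' s0 k4) (lY' t0 k4))) _.
  by apply: lerD; [exact: hsh|exact: hs].
have M0 := Msum_ge0 (Y' s).
have dY : 2 * d * \sum_(k < 4) nm (fun x => Y' (s + h) k x - Y' s k x) <= e.
  apply: le_trans (_ : 1 * e <= e); last by rewrite mul1r.
  apply: ler_pM => //; first by rewrite mulr_ge0// ltW.
    by apply: sumr_ge0 => *; exact: nm_ge0.
  by move: d1 d0 => *; lra.
have KdE : Kd C * \sum_(k < 4) nm (fun x => h^-1 * (Y (s + h) k x - Y s k x) - Th s k x) <= e / 2.
  apply: le_trans (ler_wpM2l Kd0 sd) _.
  rewrite /e1 (_ : e / 2 = e / (2 * (4 * Kd C + 1)) * (4 * Kd C + 1)); last by field; rewrite gt_eqF.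
  by rewrite mulrC -[4 * _ * _]mulrA [4 * _]mulrC -mulrA ler_wpM2l ?(ltW e10)// mulrC lerDl.
have KcE : Kc m C * (d ^+ 2 * (Msum (Y' (s + h)) + Msum (Y' s))) <= 24^-1 * (2 * Msum (Y' s) + e).
  rewrite mulrA; apply: ler_pM.
  - by rewrite mulr_ge0 ?Kc_ge0 ?sqr_ge0.
  - by rewrite addr_ge0 ?Msum_ge0.
  - by move: dK; set u := Kc m C * _; lra.
  - by move: md dY; set u := Msum (Y' (s + h)); set v := 2 * d * _; lra.
move: KdE KcE; set u := Kd C * _; set v := Kc m C * _; move: (Msum (Y' s)) M0 => M M0.
by lra.
Unshelve. all: by end_near. Qed.

(** The increment h depends on the accuracy locally in time; compactness of [1, T]
    gives a common one. *)
Lemma Kf'_uniform T e : 0 < e -> exists2 h, 0 < h &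
  forall t, 1 <= t <= T -> Kf' h t <= - (4^-1 * Msum (Y' t)) + e.
Proof.
move=> e0.
have cov : near_covering `[1, T]%classic by apply/compact_near_coveringP; exact: segment_compact.
have loc t : `[1, T]%classic t -> \forall s \near t & h \near 0^'+,
    Kf' h s <= - (4^-1 * Msum (Y' s)) + e.
  by rewrite /= in_itv/= => /andP[t1 _]; apply: Kf'_local => //; exact: lt_le_trans t1.
have F0 : Filter (0 : R)^'+ by exact: at_right_proper_filter.
have hu := @cov R 0^'+ (fun h t => Kf' h t <= - (4^-1 * Msum (Y' t)) + e) F0 loc.
have : \forall h \near 0^'+, 0 < h /\ `[1, T]%classic `<=` (fun t => Kf' h t <= - (4^-1 * Msum (Y' t)) + e).
  by near=> h; split; near: h; [exact: nbhs_right_gt|exact: hu].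
move=> /filter_ex[h [h0 hh]]; exists h => // t tT; exact: hh.
Unshelve. all: by end_near. Qed.

(** The weighted mass whose decay is the goal. *)
Definition En t : R := \sum_(k < 4) I (fun x => rho x ^+ 4 * Y t k x ^+ 2).

Lemma En_Msum t : 0 < t -> 2 * En t <= Msum (Y' t).
Proof.
move=> t0; have a : En t <= \sum_(k < 4) (4 / 9 * Mw (Y' t k)).
  by apply: ler_sum => -[k k4] _ /=; exact: hardy_rho (hH t0 k4).
have := Msum_ge0 (Y' t); move: a; rewrite -mulr_sumr -/(Msum (Y' t)).
by move: (En t) (Msum _) => u v; lra.
Qed.

Lemma En_lip s t : 0 < s -> s <= t -> En s - En t <= 8 * d * LT * (t - s).
Proof.
move=> s0 st; have t0 := lt_le_trans s0 st.
rewrite /En -sumrB; apply: (@le_trans _ _ (\sum_(k < 4) (LT * (t - s) * (2 * d)))); last first.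
  rewrite sumr_const card_ord -[leLHS]mulr_natl le_eqVlt; apply/orP; left; apply/eqP; ring.
apply: ler_sum => -[k k4] _ /=.
have [l1 l2'] := (lY s0 k4, lY t0 k4).
have [lB lD] := (l2B l1 l2', l2D l1 l2').
rewrite -(IB (ih_rhoX_sqr 4 l1) (ih_rhoX_sqr 4 l2')).
rewrite (I_eq (g := fun x => (rho x ^+ 4 * (Y s k x - Y t k x)) * (Y s k x + Y t k x))); last first.
  by move=> x _; ring.
apply: le_trans (CSle (l2_rhoX 4 lB) lD) _.
apply: ler_pM; rewrite ?nm_ge0//.
  apply: (@le_trans _ _ (nm (fun x => Y s k x - Y t k x))).
    apply: nm_le => //; first exact: l2_rhoX.
    move=> x x0; have /andP[r0 r1] := rhoX_le1 4 x0.
    by rewrite normrM ler_piMl// ger0_norm.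
  rewrite -nmN (eq_nm (g := fun x => Y t k x - Y s k x)); first exact: Y_lip.
  by move=> x _; rewrite opprB.
apply: le_trans (nmD l1 l2') _.
by rewrite mulr_natl mulr2n lerD//; [exact: (small_nm (hS s0) k4)|exact: (small_nm (hS t0) k4)].
Qed.

Lemma En_ge0 t : 0 <= En t.
Proof.
apply: sumr_ge0 => k _; apply: I_ge0 => x x0.
by rewrite mulr_ge0 ?sqr_ge0//; case/andP: (rhoX_le1 4 x0).
Qed.

(** If the local mass returned to the level [e] infinitely often, each visit
    would last a fixed time and cost the bounded functional [Kf] a fixed
    amount. *)
Lemma En_descent e n : 0 < e -> (forall T, exists2 t, T <= t & e < En t) ->
  exists2 T, 1 <= T & forall h eps, 0 < h -> 0 <= eps ->
    (forall t, 1 <= t <= T -> Kf' h t <= - (4^-1 * Msum (Y' t)) + eps) ->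
    Kf h T - Kf h 1 <= - (n%:R * (e / 4 * (e / (2 * (8 * d * LT))))) + eps * (T - 1).
Proof.
move=> e0 he; pose L := 8 * d * LT; have L0 : 0 < L by rewrite !mulr_gt0// LT_gt0.
pose tau := e / (2 * L); have tau0 : 0 < tau by rewrite divr_gt0// mulr_gt0.
have Ltau : L * tau = e / 2 by rewrite /tau; field; rewrite gt_eqF.
rewrite -/L -/tau.
elim: n => [|n [T T1 IH]].
  by exists 1 => // h eps _ _ _; rewrite !subrr mul0r oppr0 mulr0 addr0.
have [t Tt et] := he T; have t1 := le_trans T1 Tt.
have ttau : t <= t + tau by rewrite lerDl ltW.
exists (t + tau); first exact: le_trans ttau.
move=> h eps h0 eps0 hK.
have T0 := lt_le_trans ltr01 T1; have t0 := lt_le_trans ltr01 t1.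
have k1 := IH h eps h0 eps0 _.
have {}k1 : Kf h T - Kf h 1 <= - (n%:R * (e / 4 * tau)) + eps * (T - 1).
  apply: k1 => s /andP[s1 sT]; apply: hK; rewrite s1/=.
  by apply: le_trans sT _; exact: le_trans Tt ttau.
have [c /andP[Tc ct] k2] := mvt_pos (fun u u0 => Kf_derive u0 h0) T0 Tt.
have [c' /andP[tc' ct'] k3] := mvt_pos (fun u u0 => Kf_derive u0 h0) t0 ttau.
have c1 := le_trans T1 Tc; have c1' := le_trans t1 tc'.
have hc : Kf' h c <= eps.
  apply: le_trans (hK c _) _; first by rewrite c1 (le_trans ct).
  by rewrite gerDr oppr_le0 mulr_ge0// Msum_ge0.
have hc' : Kf' h c' <= - (e / 4) + eps.
  apply: le_trans (hK c' _) _; first by rewrite c1'.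
  rewrite lerD2r lerN2.
  have E1 := En_Msum (lt_le_trans t0 tc'); have E2 := En_lip t0 tc'.
  have E3 : L * (c' - t) <= e / 2 by rewrite -Ltau ler_pM2l// lerBlDl.
  move: E1 E2; rewrite -/L; move: (En c') (En t) et (Msum _) => u v et M E1 E2; lra.
have h2 : Kf h t - Kf h T <= eps * (t - T) by rewrite k2 ler_wpM2r ?subr_ge0.
have h3 : Kf h (t + tau) - Kf h t <= (- (e / 4) + eps) * tau.
  by rewrite k3 [t + tau - t]addrC addKr ler_wpM2r// ltW.
rewrite -natr1 mulrDl mul1r.
have -> : Kf h (t + tau) - Kf h 1 = (Kf h (t + tau) - Kf h t) + (Kf h t - Kf h T) + (Kf h T - Kf h 1) by ring.
apply: le_trans (lerD (lerD h3 h2) k1) _.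
rewrite le_eqVlt; apply/orP; left; apply/eqP; ring.
Qed.

Lemma En_cvg : En t @[t --> +oo] --> 0.
Proof.
apply/cvgrPdist_le => e e0.
suff [T hT] : exists T, forall t, T <= t -> En t <= e.
  near=> t; rewrite sub0r normrN ger0_norm ?En_ge0//; apply: hT.
  by near: t; apply: nbhs_pinfty_ge; exact: num_real.
apply: contrapT => hne.
have he T : exists2 t, T <= t & e < En t.
  apply: contrapT => hT; apply: hne; exists T => t Tt.
  by rewrite leNgt; apply/negP => et; apply: hT; exists t.
pose c := e / 4 * (e / (2 * (8 * d * LT))).
have c0 : 0 < c by rewrite mulr_gt0// divr_gt0// !mulr_gt0// LT_gt0.
pose B := 12 * LT * d; have B0 : 0 < B by rewrite !mulr_gt0// LT_gt0.
(* With this number of visits the decrease n c exceeds the oscillation 2 B of the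
   functional plus the total error, which is at most 1 for accuracy 1 / T. *)
pose n := Num.bound ((2 * B + 2) / c).
have hn : (2 * B + 2) / c < n%:R by rewrite archi_boundP// divr_ge0// ?ltW// addr_gt0// mulr_gt0.
have [T T1 hT] := En_descent n e0 he.
have T0 := lt_le_trans ltr01 T1.
have iT : 0 < T^-1 by rewrite invr_gt0.
have [h h0 hh] := Kf'_uniform T iT.
have := hT h T^-1 h0 (ltW iT) hh.
have := Kf_bnd T0 h0; have := Kf_bnd ltr01 h0; rewrite -/B !ler_norml.
have e1 : T^-1 * (T - 1) <= 1 by rewrite ler_pdivrMl// mulr1 gerBl.
rewrite ltr_pdivrMr// in hn; rewrite -/c.
move: (T^-1 * _) e1 (Kf h T) (Kf h 1) (n%:R * c) hn => u e1 v w' z hn /andP[a1 a2] /andP[a3 a4].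
by lra.
Unshelve. all: by end_near. Qed.

Lemma local_decay k : (k < 4)%N -> I (fun x => rho x ^+ 4 * Y t k x ^+ 2) @[t --> +oo] --> 0.
Proof.
move=> k4; apply: (squeeze_cvgr _ (cvg_cst 0) En_cvg).
near=> t; apply/andP; split.
  by apply: I_ge0 => x x0; rewrite mulr_ge0 ?sqr_ge0//; case/andP: (rhoX_le1 4 x0).
rewrite /En (bigD1 (Ordinal k4))//= lerDl sumr_ge0// => j _; apply: I_ge0 => x x0.
by rewrite mulr_ge0 ?sqr_ge0//; case/andP: (rhoX_le1 4 x0).
Unshelve. all: by end_near. Qed.

End Time.

(** * Pure power nonlinearities *)

Section Polynomials.
Context (R : realType).
Implicit Types (z : nat -> R) (n p : nat) (c x : R).
Local Notation vec := (nat -> R -> R).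

(** The bounds satisfied by a homogeneous polynomial of degree n, in a form that is
    stable under sums and products, so that they follow from those of the
    coordinates. For n = 0 the factor n annihilates the truncated exponent. *)
Definition homog n (v : (nat -> R) -> R) : Prop := exists2 C, 0 <= C &
  [/\ forall z, `|v z| <= C * abs4 z ^+ n,
      forall z z', `|v z - v z'| <=
        C * (n%:R * (abs4 z + abs4 z') ^+ n.-1) * abs4 (fun j => z j - z' j) &
      forall y y' : vec, (forall j, (j < 4)%N -> abscont (y j) (y' j)) ->
        exists2 g', abscont (fun x => v (y^~ x)) g' & forall x, 0 < x ->
          `|g' x| <= C * (n%:R * abs4 (y^~ x) ^+ n.-1) * abs4 (y'^~ x)].

Lemma homog_eq n v u : (forall z, v z = u z) -> homog n v -> homog n u.
Proof. by move=> /funext ->. Qed.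

Lemma homog_coord j : (j < 4)%N -> homog 1 (fun z => z j).
Proof.
move=> j4; exists 1 => //; split.
- by move=> z; rewrite mul1r expr1; exact: abs4_le.
- by move=> z z'; rewrite !mul1r; exact: (abs4_le (fun j => z j - z' j)).
- move=> y y' h; exists (y' j); first exact: h.
  by move=> x _; rewrite !mul1r; exact: (abs4_le (fun j => y' j x)).
Qed.

Lemma homog_cst c : homog 0 (fun=> c).
Proof.
exists `|c| => //; split.
- by move=> z; rewrite expr0 mulr1.
- by move=> z z'; rewrite subrr normr0 mul0r mulr0 mul0r.
- move=> y y' _; exists (fun=> 0); first exact: abscont_cst.
  by move=> x _; rewrite normr0 mul0r mulr0 mul0r.
Qed.

Lemma homogD n v u : homog n v -> homog n u -> homog n (fun z => v z + u z).
Proof.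
move=> [C C0 [s1 l1 c1]] [D D0 [s2 l2 c2]]; exists (C + D); first exact: addr_ge0.
split.
- by move=> z; rewrite mulrDl (le_trans (ler_normD _ _))// lerD.
- move=> z z'; rewrite !mulrDl (_ : _ - _ = (v z - v z') + (u z - u z')); last by ring.
  by rewrite (le_trans (ler_normD _ _))// lerD.
- move=> y y' h; have [f af hf] := c1 y y' h; have [g ag hg] := c2 y y' h.
  exists (fun x => f x + g x); first exact: abscontD.
  by move=> x x0; rewrite !mulrDl (le_trans (ler_normD _ _))// lerD ?hf ?hg.
Qed.

Lemma homog0 n : homog n (fun=> 0).
Proof.
exists 0 => //; split.
- by move=> z; rewrite normr0 mul0r.
- by move=> z z'; rewrite subrr normr0 !mul0r.
- move=> y y' _; exists (fun=> 0); first exact: abscont_cst.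
  by move=> x _; rewrite normr0 !mul0r.
Qed.

Let powE n p (s : R) : s ^+ n * (p%:R * s ^+ p.-1) + n%:R * s ^+ n.-1 * s ^+ p =
  (n + p)%:R * s ^+ (n + p).-1.
Proof.
case: p => [|p]; first by rewrite mul0r mulr0 add0r addn0 expr0 mulr1.
case: n => [|n]; first by rewrite !mul0r addr0 expr0 mul1r add0n.
rewrite natrD (_ : (n.+1 + p.+1).-1 = (n + p.+1)%N)// exprD !exprS /=.
by move: (n.+1%:R) (p.+1%:R) (s ^+ n) (s ^+ p) => a b c e; ring.
Qed.

Lemma homogM n p v u : homog n v -> homog p u -> homog (n + p) (fun z => v z * u z).
Proof.
move=> [C C0 [s1 l1 c1]] [D D0 [s2 l2 c2]]; exists (C * D); first exact: mulr_ge0.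
split.
- move=> z; rewrite normrM exprD mulrACA; exact: ler_pM.
- move=> z z'; set s := abs4 z + abs4 z'; set e := abs4 (fun j => z j - z' j).
  have s0 : 0 <= s by rewrite addr_ge0 ?abs4_ge0.
  have v1 : `|v z| <= C * s ^+ n.
    apply: le_trans (s1 z) _; rewrite ler_wpM2l// lerXn2r ?nnegrE ?abs4_ge0//.
    by rewrite lerDl abs4_ge0.
  have u1 : `|u z'| <= D * s ^+ p.
    apply: le_trans (s2 z') _; rewrite ler_wpM2l// lerXn2r ?nnegrE ?abs4_ge0//.
    by rewrite lerDr abs4_ge0.
  rewrite (_ : _ - _ = v z * (u z - u z') + (v z - v z') * u z'); last by ring.
  apply: le_trans (ler_normD _ _) _; rewrite !normrM -powE.
  rewrite (_ : C * D * _ * e = (C * s ^+ n) * (D * (p%:R * s ^+ p.-1) * e) +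
    (C * (n%:R * s ^+ n.-1) * e) * (D * s ^+ p)); last by ring.
  by apply: lerD; apply: ler_pM.
- move=> y y' h; have [f af hf] := c1 y y' h; have [g ag hg] := c2 y y' h.
  exists (fun x => f x * u (y^~ x) + v (y^~ x) * g x); first exact: abscontM.
  move=> x x0; apply: le_trans (ler_normD _ _) _; rewrite !normrM -powE.
  set s := abs4 (y^~ x); set e := abs4 (y'^~ x).
  rewrite (_ : C * D * _ * e = (C * (n%:R * s ^+ n.-1) * e) * (D * s ^+ p) +
    (C * s ^+ n) * (D * (p%:R * s ^+ p.-1) * e)); last by ring.
  by apply: lerD; apply: ler_pM => //; do ?[exact: hf|exact: hg].
Qed.

Lemma homogN n v : homog n v -> homog n (fun z => - v z).
Proof.
move=> h; apply: homog_eq (homogM (homog_cst (-1)) h) => z.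
by rewrite mulN1r.
Qed.

Lemma homogB n v u : homog n v -> homog n u -> homog n (fun z => v z - u z).
Proof. by move=> h1 h2; exact: homogD h1 (homogN h2). Qed.

Definition chomog n (V : (nat -> R) -> R[i]) : Prop :=
  homog n (fun z => complex.Re (V z)) /\ homog n (fun z => complex.Im (V z)).

Lemma chomogM n p V U : chomog n V -> chomog p U -> chomog (n + p) (fun z => V z * U z).
Proof.
move=> [a b] [c d]; split.
- apply: homog_eq (homogB (homogM a c) (homogM b d)) => z.
  by case: (V z) (U z) => [? ?] [? ?].
- apply: homog_eq (homogD (homogM a d) (homogM b c)) => z.
  by case: (V z) (U z) => [? ?] [? ?].
Qed.

Lemma chomogX n V i : chomog n V -> chomog (n * i) (fun z => V z ^+ i).
Proof.
move=> h; elim: i => [|i IH].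
  by rewrite muln0; split; [apply: homog_eq (homog_cst 1)|apply: homog_eq (homog_cst 0)].
rewrite mulnS; have [a b] := chomogM h IH.
by split; [apply: homog_eq a|apply: homog_eq b] => z; rewrite exprS.
Qed.

Lemma chomog_sum n (I : Type) (r : seq I) (P : pred I) (F : I -> (nat -> R) -> R[i]) :
  (forall i, P i -> chomog n (F i)) -> chomog n (fun z => \sum_(i <- r | P i) F i z).
Proof.
move=> h; elim: r => [|i r [a b]].
  by split; apply: homog_eq (homog0 n) => z; rewrite big_nil.
have [Pi|Pi] := boolP (P i); last first.
  by split; [apply: homog_eq a|apply: homog_eq b] => z; rewrite big_cons (negbTE Pi).
have [c d] := h i Pi.
split; [apply: homog_eq (homogD c a)|apply: homog_eq (homogD d b)] => z;
  by rewrite big_cons Pi; case: (F i z) (\sum_(_ <- _ | _) _) => [? ?] [? ?].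
Qed.

(** The complex number with coordinates number j and j + 1: phi_1 for j = 0 and
    phi_2 for j = 2. *)
Definition zc (j : nat) z : R[i] := (z j +i* z j.+1)%C.

Lemma chomog_coord j : (j.+1 < 4)%N -> chomog 1 (zc j).
Proof. by move=> j4; split; apply: homog_coord => //; exact: ltnW. Qed.

Lemma chomog_conj n V : chomog n V -> chomog n (fun z => (V z)^*%C).
Proof.
move=> [a b]; split.
- by apply: homog_eq a => z; case: (V z).
- by apply: homog_eq (homogN b) => z; case: (V z).
Qed.

Lemma pure_power_homog (W : R[i] -> R[i] -> R[i]) : pure_power_poly W ->
  exists d, chomog d (fun z => W (zc 0 z) (zc 2 z)) /\
    forall (t : R) u v, W (t%:C%C * u) (t%:C%C * v) = (t ^+ d)%:C%C * W u v.
Proof.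
move=> [d [c hW]]; exists d; split.
  have h : chomog d (fun z => \sum_(i < d.+1) \sum_(j < d.+1) \sum_(k < d.+1)
              \sum_(l < d.+1 | (i + j + k + l == d)%N)
                c i j k l * zc 0 z ^+ i * ((zc 0 z)^*%C) ^+ j * zc 2 z ^+ k * ((zc 2 z)^*%C) ^+ l).
    apply: chomog_sum => i _; apply: chomog_sum => j _; apply: chomog_sum => k _.
    apply: chomog_sum => l /eqP E.
    have h1 := @chomog_coord 0 isT; have h2 := @chomog_coord 2 isT.
    have hc : chomog 0 (fun=> c i j k l) by split; exact: homog_cst.
    have := chomogM (chomogM (chomogM (chomogM hc (chomogX i h1)) (chomogX j (chomog_conj h1)))
      (chomogX k h2)) (chomogX l (chomog_conj h2)).
    by rewrite !mul1n add0n E.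
  case: h => a b; split; [apply: homog_eq a|apply: homog_eq b] => z; by rewrite hW.
move=> t u v; rewrite !hW mulr_sumr; apply: eq_bigr => i _.
rewrite mulr_sumr; apply: eq_bigr => j _; rewrite mulr_sumr; apply: eq_bigr => k _.
rewrite mulr_sumr; apply: eq_bigr => l /eqP E.
have cE (a : R[i]) : ((t%:C%C * a)^*)%C = t%:C%C * (a^*)%C.
  by case: a => a1 a2; apply/eqP; rewrite eq_complex /=; apply/andP; split; apply/eqP; ring.
rewrite !cE rmorphXn/= !exprMn; move: (t%:C)%C => T.
have -> : T ^+ d = T ^+ i * T ^+ j * T ^+ k * T ^+ l by rewrite -!exprD E.
by ring.
Qed.

(** The real and imaginary parts of i W_1 and - i W_2, the nonlinear terms after
    solving the equations for the time derivatives. *)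
Definition wfun (W1 W2 : R[i] -> R[i] -> R[i]) (k : nat) z : R :=
  match k with
  | 0%N => - complex.Im (W1 (zc 0 z) (zc 2 z))
  | 1%N => complex.Re (W1 (zc 0 z) (zc 2 z))
  | 2%N => complex.Im (W2 (zc 0 z) (zc 2 z))
  | _ => - complex.Re (W2 (zc 0 z) (zc 2 z))
  end.

(** On the unit cube the size is at most 4, so the powers beyond the second are
    bounded by powers of 8. *)
Lemma homog_cubic d v : homog d v -> (2 < d)%N -> exists2 C, 0 <= C &
  [/\ v (fun=> 0) = 0,
    forall z z', (forall j, (j < 4)%N -> `|z j| <= 1) -> (forall j, (j < 4)%N -> `|z' j| <= 1) ->
      `|v z - v z'| <= C * (abs4 z ^+ 2 + abs4 z' ^+ 2) * abs4 (fun j => z j - z' j) &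
    forall y y' : vec, (forall j, (j < 4)%N -> abscont (y j) (y' j)) ->
      (forall j x, (j < 4)%N -> 0 < x -> `|y j x| <= 1) ->
      exists2 g', abscont (fun x => v (y^~ x)) g' &
        forall x, 0 < x -> `|g' x| <= C * abs4 (y^~ x) ^+ 2 * abs4 (y'^~ x)].
Proof.
move=> [C C0 [s l c]] d3.
have a4 z : (forall j, (j < 4)%N -> `|z j| <= 1) -> abs4 z <= 4.
  move=> h; rewrite /abs4 (@le_trans _ _ (\sum_(k < 4) 1))//.
    by apply: ler_sum => k _; exact: h.
  by rewrite sumr_const card_ord.
pose K := C * (d%:R * 8 ^+ (d - 3)) * 2.
have K0 : 0 <= K by rewrite !mulr_ge0 ?exprn_ge0.
have pw (t : R) : 0 <= t -> t <= 8 -> t ^+ d.-1 <= 8 ^+ (d - 3) * t ^+ 2.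
  move=> t0 t8; rewrite (_ : d.-1 = (d - 3) + 2)%N; last by rewrite -{1}(subnK d3) addn3 addn2.
  by rewrite exprD ler_wpM2r ?sqr_ge0// lerXn2r ?nnegrE.
exists K => //; split.
- have := s (fun=> 0); rewrite (_ : abs4 (fun=> 0) = 0); last first.
    by rewrite /abs4 big1// => i _; rewrite normr0.
  by rewrite expr0n (gtn_eqF (ltn_trans _ d3))// mulr0 normr_le0 => /eqP.
- move=> z z' h h'; apply: le_trans (l z z') _; rewrite ler_wpM2r ?abs4_ge0//.
  have t0 : 0 <= abs4 z + abs4 z' by rewrite addr_ge0 ?abs4_ge0.
  have t8 : abs4 z + abs4 z' <= 8.
    by have := a4 z h; have := a4 z' h'; move: (abs4 z) (abs4 z') => a b; lra.
  rewrite /K -!mulrA ler_wpM2l// ler_wpM2l//; apply: le_trans (pw _ t0 t8) _.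
  rewrite ler_wpM2l ?exprn_ge0//.
  have := sqr_ge0 (abs4 z - abs4 z'); move: (abs4 z) (abs4 z') => a b; nra.
- move=> y y' h h'; have [g ag hg] := c y y' h; exists g => // x x0.
  apply: le_trans (hg x x0) _; rewrite ler_wpM2r ?abs4_ge0//.
  have t4 := a4 (y^~ x) (fun j lj => h' j x lj x0).
  have t0 : 0 <= abs4 (y^~ x) by exact: abs4_ge0.
  have t8 : abs4 (y^~ x) <= 8 by move: t4; move: (abs4 _) => a; lra.
  rewrite /K -!mulrA ler_wpM2l// ler_wpM2l//; apply: le_trans (pw _ t0 t8) _.
  rewrite ler_wpM2l ?exprn_ge0//.
  by have := sqr_ge0 (abs4 (y^~ x)); move: (_ ^+ 2) => a; lra.
Qed.

(** Scaling the argument by t turns the bound into t^d |W| <= C t^p S with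
    p >= d + 1, and t tends to 0. *)
Lemma low_degree_zero (W : R[i] -> R[i] -> R[i]) d (C p : R) : 3 <= p -> (d <= 2)%N ->
  (forall (t : R) u v, W (t%:C%C * u) (t%:C%C * v) = (t ^+ d)%:C%C * W u v) ->
  (forall u v, Normc.normc (W u v) <= C * spnorm (u, v) `^ p) ->
  forall u v, W u v = 0.
Proof.
move=> p3 d2 hom bnd u v.
pose S := spnorm (u, v) `^ p.
have nW0 : 0 <= Normc.normc (W u v) by case: (W u v) => a b; exact: sqrtr_ge0.
have key (t : R) : 0 < t -> t <= 1 -> Normc.normc (W u v) <= t * (C * S).
  move=> t0 t1; have := bnd (t%:C%C * u) (t%:C%C * v); rewrite hom.
  have nt (s : R) (a : R[i]) : 0 <= s -> Normc.normc (s%:C%C * a) = s * Normc.normc a.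
    move=> s0; rewrite Normc.normcM; congr (_ * _).
    by rewrite /Normc.normc /= expr0n/= addr0 sqrtr_sqr ger0_norm.
  have -> : spnorm (t%:C%C * u, t%:C%C * v) = t * spnorm (u, v).
    rewrite /spnorm/= !nt ?(ltW t0)// !exprMn -mulrDr sqrtrM ?sqr_ge0// sqrtr_sqr.
    by rewrite ger0_norm// ltW.
  have td : 0 <= t ^+ d by rewrite exprn_ge0// ltW.
  rewrite nt// powRM ?(ltW t0) ?sqrtr_ge0// -/S.
  have tp : t `^ p <= t ^+ d.+1.
    rewrite -powR_mulrn ?(ltW t0)//.
    apply: ger_powR; first by rewrite t0.
    by apply: le_trans p3; rewrite ler_nat.
  have CS0 : 0 <= C * S by apply: le_trans nW0 (bnd u v).
  move=> h; rewrite -(ler_pM2l (x := t ^+ d)) ?exprn_gt0//.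
  apply: le_trans h _; rewrite mulrCA.
  by rewrite [leRHS]mulrA -exprSr ler_wpM2r.
have z : Normc.normc (W u v) <= 0.
  apply/ler_addgt0Pr => e e0; rewrite add0r.
  have CS0 : 0 <= C * S by apply: le_trans nW0 (bnd u v).
  pose t := Num.min 1 (e / (C * S + 1)).
  have CS1 : 0 < C * S + 1 by rewrite ltr_wpDl.
  have t0 : 0 < t by rewrite lt_min ltr01 divr_gt0.
  apply: le_trans (key t t0 _) _; first by rewrite ge_min lexx.
  apply: (@le_trans _ _ (e / (C * S + 1) * (C * S + 1))); last by rewrite divfK// gt_eqF.
  apply: ler_pM => //; [exact: ltW|by rewrite ge_min lexx orbT|by rewrite lerDl].
by apply: Normc.eq0_normc; apply/le_anti; rewrite z nW0.
Qed.

Lemma wfun_cubic (W1 W2 : R[i] -> R[i] -> R[i]) (C p : R) :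
  pure_power_poly W1 -> pure_power_poly W2 -> 3 <= p ->
  (forall u v, Normc.normc (W1 u v) + Normc.normc (W2 u v) <= C * spnorm (u, v) `^ p) ->
  exists K, cubic (wfun W1 W2) K.
Proof.
move=> h1 h2 p3 hb.
have n0 (a : R[i]) : 0 <= Normc.normc a by case: a => a b; exact: sqrtr_ge0.
have part (W : R[i] -> R[i] -> R[i]) : pure_power_poly W ->
   (forall u v, Normc.normc (W u v) <= C * spnorm (u, v) `^ p) ->
   exists2 d, (2 < d)%N & chomog d (fun z => W (zc 0 z) (zc 2 z)).
  move=> hW bW; have [d [hd hom]] := pure_power_homog hW.
  have [d3|] := ltnP 2 d; first by exists d.
  move=> d2; exists 3%N => //; have W0 := low_degree_zero p3 d2 hom bW.
  by split; apply: homog_eq (homog0 3) => z; rewrite W0.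
have [d1 hd1 [a1 b1]] : exists2 d, (2 < d)%N & chomog d (fun z => W1 (zc 0 z) (zc 2 z)).
  by apply: part => // u v; apply: le_trans (hb u v); rewrite lerDl.
have [d2 hd2 [a2 b2]] : exists2 d, (2 < d)%N & chomog d (fun z => W2 (zc 0 z) (zc 2 z)).
  by apply: part => // u v; apply: le_trans (hb u v); rewrite lerDr.
have [C0 C00 [z0 l0 c0]] := homog_cubic (homogN b1) hd1.
have [C1 C10 [z1 l1 c1]] := homog_cubic a1 hd1.
have [C2 C20 [z2 l2 c2]] := homog_cubic b2 hd2.
have [C3 C30 [z3 l3 c3]] := homog_cubic (homogN a2) hd2.
pose K := C0 + C1 + C2 + C3.
have le_mul (c s : R) : 0 <= s -> c <= K -> c * s <= K * s by move=> s0 cK; exact: ler_wpM2r.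
have [k0 k1 k2 k3] : [/\ C0 <= K, C1 <= K, C2 <= K & C3 <= K].
  by rewrite /K; split; lra.
exists K; split.
- by rewrite /K !addr_ge0.
- by case=> [|[|[|[|//]]]] _.
- move=> k z z' k4 h h'; have s0 : 0 <= (abs4 z ^+ 2 + abs4 z' ^+ 2) * abs4 (fun j => z j - z' j).
    by apply: mulr_ge0; [apply: addr_ge0; exact: sqr_ge0|exact: abs4_ge0].
  rewrite -mulrA; case: k k4 => [|[|[|[|//]]]] _.
  + by apply: le_trans (le_mul C0 _ s0 k0); rewrite mulrA; exact: l0.
  + by apply: le_trans (le_mul C1 _ s0 k1); rewrite mulrA; exact: l1.
  + by apply: le_trans (le_mul C2 _ s0 k2); rewrite mulrA; exact: l2.
  + by apply: le_trans (le_mul C3 _ s0 k3); rewrite mulrA; exact: l3.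
- move=> k y y' k4 h h'.
  have s0 x : 0 <= abs4 (y^~ x) ^+ 2 * abs4 (y'^~ x) by apply: mulr_ge0; [exact: sqr_ge0|exact: abs4_ge0].
  case: k k4 => [|[|[|[|//]]]] _.
  + have [g ag hg] := c0 y y' h h'; exists g => // x x0; rewrite -mulrA.
    by apply: le_trans (le_mul C0 _ (s0 x) k0); rewrite mulrA; exact: hg.
  + have [g ag hg] := c1 y y' h h'; exists g => // x x0; rewrite -mulrA.
    by apply: le_trans (le_mul C1 _ (s0 x) k1); rewrite mulrA; exact: hg.
  + have [g ag hg] := c2 y y' h h'; exists g => // x x0; rewrite -mulrA.
    by apply: le_trans (le_mul C2 _ (s0 x) k2); rewrite mulrA; exact: hg.
  + have [g ag hg] := c3 y y' h h'; exists g => // x x0; rewrite -mulrA.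
    by apply: le_trans (le_mul C3 _ (s0 x) k3); rewrite mulrA; exact: hg.
Qed.

End Polynomials.

(** * Polar coordinates *)

Section Polar.
Context (R : realType).
Local Notation T := (measurableTypeR R).
Local Notation mu := (leb R).
Implicit Types (s a b r x y : R).

(** Dilations are all that is needed of a change of variables: they determine the
    volume of balls up to the volume of the unit ball. *)
Lemma leb_dilation s (F : T -> \bar R) : 0 < s -> measurable_fun setT F ->
  (forall x, (0 <= F x)%E) ->
  (\int[@lebesgue_measure R]_x F x = s%:E * \int[@lebesgue_measure R]_x F (s * x)%R)%E.
Proof.
move=> s0 mF F0.
have ms : measurable_fun [set: T] (fun x : T => s * x : T).
  exact: mulrl_measurable.
pose nu := mscale (NngNum (ltW s0)) (pushforward (@lebesgue_measure R) (fun x : T => s * x : T)).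
rewrite -(@ge0_integral_pushforward _ _ _ _ _ _ ms _ setT)//.
rewrite -[s%:E]/((NngNum (ltW s0))%:num%:E) -ge0_integral_mscale//.
apply: eq_measure_integral => A mA _ /=.
apply: lebesgue_measure_unique => // _ [[a b]] _ <- /=.
rewrite /mscale/= /pushforward.
have -> : (fun x : T => s * x) @^-1` `]a, b]%classic = `]a / s, b / s]%classic.
  apply/seteqP; split => x /=; rewrite !in_itv/= ltr_pdivrMr// ler_pdivlMr//;
    by rewrite ![x * s]mulrC.
rewrite !lebesgue_measure_itv/= !lte_fin ltr_pM2r ?invr_gt0//.
case: ifP => _; last by rewrite mule0.
by rewrite -!EFinB -EFinM -mulrBl mulrCA divff ?mulr1// gt_eqF.
Qed.

Lemma sigma_finite_leb2 :
  sigma_finite [set: T * T] (@lebesgue_measure R \x @lebesgue_measure R)%E.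
Proof.
pose B (n : nat) : set T := `[- n%:R, n%:R]%classic.
have mB n : measurable (B n) by exact: measurable_itv.
exists (fun n => B n `*` B n).
  apply/esym/seteqP; split=> // -[x y] _.
  exists (Num.truncn (Num.max `|x| `|y|)).+1 => //.
  have := truncnS_gt (Num.max `|x| `|y|); rewrite gt_max => /andP[hx hy].
  by split; rewrite /B /= in_itv/= -ler_norml ltW.
move=> n; split; first exact: measurableX.
have fB : (@lebesgue_measure R (B n) < +oo)%E.
  by rewrite /B lebesgue_measure_itv/=; case: ifP => // _; rewrite -EFinB ltry.
by rewrite product_measure1E// lte_mul_pinfty// ge0_fin_numE.
Qed.

(** The plane measure, packed with its sigma-finiteness so that the product with a
    third line is again covered by Fubini's theorem. *)
Definition leb2 : {sigma_finite_measure set (T * T)%type -> \bar R} :=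
  HB.pack_for {sigma_finite_measure set (T * T)%type -> \bar R}
    (@lebesgue_measure R \x @lebesgue_measure R)%E
    (Measure_isSigmaFinite.Build _ _ _ (@lebesgue_measure R \x @lebesgue_measure R)%E sigma_finite_leb2).

Lemma product_dilation d1 d2 (T1 : measurableType d1) (T2 : measurableType d2)
    (m1 : {sigma_finite_measure set T1 -> \bar R})
    (m2 : {sigma_finite_measure set T2 -> \bar R})
    (f1 : T1 -> T1) (f2 : T2 -> T2) (k1 k2 : R) :
  measurable_fun setT f1 -> measurable_fun setT f2 -> 0 <= k1 -> 0 <= k2 ->
  (forall F : T1 -> \bar R, measurable_fun setT F -> (forall z, 0 <= F z)%E ->
     \int[m1]_x F x = k1%:E * \int[m1]_x F (f1 x))%E ->
  (forall F : T2 -> \bar R, measurable_fun setT F -> (forall z, 0 <= F z)%E ->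
     \int[m2]_x F x = k2%:E * \int[m2]_x F (f2 x))%E ->
  forall F : T1 * T2 -> \bar R, measurable_fun setT F -> (forall z, 0 <= F z)%E ->
    (\int[m1 \x m2]_x F x = (k1 * k2)%:E * \int[m1 \x m2]_x F (f1 x.1, f2 x.2))%E.
Proof.
move=> mf1 mf2 k10 k20 h1 h2 F mF F0.
have mp : measurable_fun [set: T1 * T2] (fun z => (f1 z.1, f2 z.2)).
  by apply: measurable_fun_pair; apply: measurableT_comp => //; (exact: measurable_fst || exact: measurable_snd).
have mG : measurable_fun setT (fun z => F (f1 z.1, f2 z.2)).
  exact: measurableT_comp mF mp.
have mA : measurable_fun setT (fubini_F m2 F).
  by apply: (@measurable_fun_fubini_tonelli_F _ _ _ _ _ m2).
have mB : measurable_fun setT (fubini_F m2 (fun z => F (f1 z.1, f2 z.2))).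
  by apply: (@measurable_fun_fubini_tonelli_F _ _ _ _ _ m2).
rewrite !fubini_tonelli1// (h1 _ mA); last by move=> x; apply: integral_ge0.
rewrite EFinM -muleA; congr (_ * _)%E.
rewrite -ge0_integralZl//; last by move=> x _; apply: integral_ge0.
apply: eq_integral => x _; rewrite /fubini_F/= h2//.
exact: measurable_fun_pair2.
Qed.

Local Notation T3 := (T * T * T)%type.

Lemma leb3_dilation s (F : T3 -> \bar R) : 0 < s -> measurable_fun setT F ->
  (forall z, (0 <= F z)%E) ->
  (\int[leb3 R]_z F z =
   (s ^+ 3)%:E * \int[leb3 R]_z F ((s * z.1.1, s * z.1.2), s * z.2)%R)%E.
Proof.
move=> s0 mF F0.
have ms : measurable_fun [set: T] (fun x : T => s * x : T) by exact: mulrl_measurable.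
have s0' := ltW s0.
pose l : {sigma_finite_measure set T -> \bar R} := @lebesgue_measure R.
have h1 := @leb_dilation s ^~ s0.
have h2 := @product_dilation _ _ _ _ l l _ _ _ _ ms ms s0' s0' h1 h1.
have mp : measurable_fun [set: T * T] (fun z : T * T => (s * z.1, s * z.2) : T * T).
  by apply: measurable_fun_pair; apply: measurableT_comp => //; (exact: measurable_fst || exact: measurable_snd).
have h3 := @product_dilation _ _ _ _ leb2 l _ _ _ _ mp ms (mulr_ge0 s0' s0') s0' h2 h1.
by rewrite (h3 F)// exprSr expr2.
Qed.

Lemma enorm_ge0 (z : E3 R) : 0 <= enorm z. Proof. exact: sqrtr_ge0. Qed.

Lemma enorm_sqr (z : E3 R) :
  enorm z ^+ 2 = z.1.1 ^+ 2 + z.1.2 ^+ 2 + z.2 ^+ 2.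
Proof.
rewrite /enorm sqr_sqrtr; last by rewrite sumr_ge0// => i _; rewrite sqr_ge0.
by rewrite !big_ord_recl big_ord0 /coord3/= addr0 addrA.
Qed.

Lemma coord3_le (z : E3 R) i : `|coord3 i z| <= enorm z.
Proof.
rewrite -sqrtr_sqr /enorm ler_wsqrtr// (bigD1 i)//= lerDl sumr_ge0// => j _.
by rewrite sqr_ge0.
Qed.

Lemma enorm_dilation s (z : T3) : 0 <= s ->
  enorm ((s * z.1.1, s * z.1.2), s * z.2) = s * enorm z.
Proof.
move=> s0; apply/eqP; rewrite -(@eqrXn2 _ 2)//; last first.
- by rewrite mulr_ge0// enorm_ge0.
- exact: enorm_ge0.
by apply/eqP; rewrite exprMn !enorm_sqr/=; ring.
Qed.

Lemma measurable_coord3 i : measurable_fun [set: T3] (coord3 i : T3 -> T).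
Proof.
have m1 : measurable_fun [set: T3] (fun z : T3 => z.1 : T * T) by exact: measurable_fst.
case: i => -[|[|[|//]]] Hi; rewrite /coord3/=.
- by apply: measurableT_comp m1; exact: measurable_fst.
- by apply: measurableT_comp m1; exact: measurable_snd.
- exact: measurable_snd.
Qed.

Lemma measurable_enorm : measurable_fun [set: T3] (@enorm R : T3 -> T).
Proof.
apply: (@measurableT_comp _ _ _ _ _ _ (Num.sqrt : T -> T)).
  by apply: continuous_measurable_fun; exact: sqrt_continuous.
by apply: measurable_sum => i; apply: measurable_funX; exact: measurable_coord3.
Qed.

Definition unit_ball_volume : \bar R := leb3 R (eball 1).
Local Notation kap := unit_ball_volume.

Lemma measurable_eball a : measurable (eball a : set T3).
Proof.
rewrite (_ : eball a = (@enorm R : T3 -> T) @^-1` `]-oo, a[%classic).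
  by rewrite -[X in measurable X]setTI; apply: measurable_enorm.
by apply/seteqP; split => z /=; rewrite in_itv.
Qed.

Lemma leb3_set_dilation s (A : set T3) : 0 < s -> measurable A ->
  leb3 R A = ((s ^+ 3)%:E *
    leb3 R [set z | A ((s * z.1.1, s * z.1.2), s * z.2)%R])%E.
Proof.
move=> s0 mA; set B := [set z | _].
have mB : measurable B.
  have ms : measurable_fun [set: T] (fun x : T => s * x : T) by exact: mulrl_measurable.
  have -> : B = (fun z : T3 => ((s * z.1.1, s * z.1.2), s * z.2) : T3) @^-1` A by [].
  rewrite -[X in measurable X]setTI; apply: (_ : measurable_fun _ _) => //.
  have m1 : measurable_fun [set: T3] (fun z : T3 => z.1 : T * T) by exact: measurable_fst.
  apply: measurable_fun_pair; first apply: measurable_fun_pair.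
  - apply: (measurableT_comp ms).
    by apply: (measurableT_comp _ m1); exact: measurable_fst.
  - apply: (measurableT_comp ms).
    by apply: (measurableT_comp _ m1); exact: measurable_snd.
  - by apply: (measurableT_comp ms); exact: measurable_snd.
have := @leb3_dilation s (fun z => (\1_A z)%:E) s0 _ _.
rewrite !integral_indic//= !setIT; apply=> [|z]; last by rewrite lee_fin.
by apply: measurableT_comp => //; exact: measurable_indic.
Qed.

Lemma leb3_eball a : 0 < a -> leb3 R (eball a) = ((a ^+ 3)%:E * kap)%E.
Proof.
move=> a0; rewrite (@leb3_set_dilation a _ a0 (measurable_eball a)).
congr (_ * leb3 R _)%E; apply/seteqP; split => z;
  by rewrite /eball/= enorm_dilation ?(ltW a0)// -ltr_pdivlMl// mulVf// gt_eqF.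
Qed.

Lemma leb3_cube (B : set T) : measurable B ->
  leb3 R ((B `*` B) `*` B) =
  (@lebesgue_measure R B * @lebesgue_measure R B * @lebesgue_measure R B)%E.
Proof.
move=> mB; transitivity (leb2 (B `*` B) * @lebesgue_measure R B)%E.
  by apply: (@product_measure1E _ _ _ _ _ leb2 (@lebesgue_measure R)) => //; exact: measurableX.
by congr (_ * _)%E; exact: (@product_measure1E _ _ _ _ _ (@lebesgue_measure R)).
Qed.

Lemma unit_ball_volume_fin : kap \is a fin_num.
Proof.
pose B : set T := `[- 1, 1]%classic.
have mB : measurable B by exact: measurable_itv.
rewrite ge0_fin_numE ?measure_ge0//.
apply: (@le_lt_trans _ _ (leb3 R ((B `*` B) `*` B))).
  apply: le_measure; rewrite ?inE; [exact: measurable_eball| |].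
    by apply: measurableX => //; exact: measurableX.
  move=> z /= /ltW z1; have h (i : 'I_3) := le_trans (coord3_le z i) z1.
  have := h (@Ordinal 3 0 isT); have := h (@Ordinal 3 1 isT); have := h (@Ordinal 3 2 isT).
  rewrite /coord3/= !ler_norml => /andP[? ?] /andP[? ?] /andP[? ?].
  by rewrite /B/= !in_itv/=; split; [split|]; apply/andP.
rewrite (leb3_cube mB).
by rewrite /B lebesgue_measure_itv/=; case: ifP => _; rewrite -?EFinB -!EFinM ltry.
Qed.

Lemma unit_ball_volume_gt0 : (0 < kap)%E.
Proof.
pose B : set T := `[0, 2^-1]%classic.
have mB : measurable B by exact: measurable_itv.
apply: (@lt_le_trans _ _ (leb3 R ((B `*` B) `*` B))).
  rewrite (leb3_cube mB).
  have h : (0 : R) < 2^-1 by rewrite invr_gt0 ltr0n.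
  rewrite /B lebesgue_measure_itv/= lte_fin h -!EFinB -!EFinM lte_fin subr0.
  by rewrite !mulr_gt0.
apply: le_measure; rewrite ?inE; [|exact: measurable_eball|].
  by apply: measurableX => //; exact: measurableX.
move=> z [[]]; rewrite /B/= !in_itv/= => /andP[p1 q1] /andP[p2 q2] /andP[p3 q3].
rewrite /eball/= -(@ltr_pXn2r _ 2)// ?nnegrE ?enorm_ge0// expr1n enorm_sqr.
have e : 2 * 2^-1 = 1 :> R by rewrite divff.
by nra.
Qed.

(** The area of the unit sphere. *)
Definition pc : R := 3 * fine kap.

Lemma pc_gt0 : 0 < pc.
Proof.
rewrite /pc mulr_gt0// fine_gt0// unit_ball_volume_gt0/=.
by rewrite -ge0_fin_numE ?measure_ge0// unit_ball_volume_fin.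
Qed.

Let hyp : set (T * T) := [set z | 0 < z.1 /\ 0 <= z.2 <= pc * z.1 ^+ 2].

Let mhyp : measurable hyp.
Proof.
have m1 : measurable_fun [set: T * T] (fst : _ -> T) by exact: measurable_fst.
have m2 : measurable_fun [set: T * T] (snd : _ -> T) by exact: measurable_snd.
have m3 : measurable_fun [set: T * T] (fun z : T * T => pc * z.1 ^+ 2 - z.2 : T).
  by apply: measurable_funB => //; apply: measurable_funM => //; apply: measurable_funX.
rewrite (_ : hyp = (fst @^-1` `]0, +oo[ `&` (snd @^-1` `[0, +oo[ `&`
    (fun z : T * T => pc * z.1 ^+ 2 - z.2 : T) @^-1` `[0, +oo[))).
  by apply: measurableI; [|apply: measurableI];
     rewrite -[X in measurable X]setTI; (apply: m1||apply: m2||apply: m3).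
apply/seteqP; split => z; rewrite /hyp /= !in_itv/= !andbT subr_ge0.
  by move=> [-> /andP[-> ->]].
by move=> [-> [-> ->]].
Qed.

(** The measure with density pc x^2 is realized as the image of plane Lebesgue
    measure on the region below the graph of the density; all other points are
    sent outside the half-line. *)
Let phi (z : T * T) : T := if `[< hyp z >] then z.1 else -1.

Let mphi : measurable_fun [set: T * T] phi.
Proof.
have mh : measurable_fun [set: T * T] (fun z => `[< hyp z >]).
  apply: (@measurable_fun_bool _ _ _ _ true); rewrite setTI.
  rewrite (_ : _ @^-1` _ = hyp)//.
  by apply/seteqP; split => z /= /asboolP.
by apply: (measurable_fun_ifT mh) => //; exact: measurable_fst.
Qed.

Let phiH : phi @^-1` H R = hyp.
Proof.
apply/seteqP; split => z /=; rewrite /phi /=; case: asboolP => //.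
  by move=> _ /inH; rewrite ltr0N1.
by move=> [z0 _] _; apply/inH.
Qed.

Lemma density_integral (F : T -> \bar R) : measurable_fun setT F ->
  (forall x, (0 <= F x)%E) ->
  (\int[pushforward (@leb2) phi]_(x in H R) F x =
   \int[@lebesgue_measure R]_(x in H R) (F x * (pc * x ^+ 2)%:E))%E.
Proof.
move=> mF F0.
rewrite ge0_integral_pushforward//; last exact: measurable_funTS.
rewrite phiH.
rewrite (eq_integral (fun z : T * T => F z.1)); last first.
  by move=> z /set_mem hz; rewrite /phi/= asboolT.
have m1 : measurable_fun [set: T * T] (fun z : T * T => F z.1).
  by apply: (measurableT_comp mF); exact: measurable_fst.
rewrite integral_mkcond [RHS]integral_mkcond.
transitivity (\int[@lebesgue_measure R \x @lebesgue_measure R]_z ((fun z => F z.1) \_ hyp) z)%E => //.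
rewrite fubini_tonelli1; last 2 first.
- by apply/(measurable_restrictT _ mhyp); exact: measurable_funTS.
- by move=> z; rewrite patchE; case: ifP.
apply: eq_integral => x _; rewrite /fubini_F patchE.
have [/set_mem/inH x0|] := boolP (x \in _); last first.
  move=> /negP xH; apply: integral0_eq => y _; rewrite patchE ifF//.
  apply/negP => /set_mem [/= x0 _]; apply: xH; apply/mem_set/inH; exact: x0.
have px : 0 <= pc * x ^+ 2 by rewrite mulr_ge0 ?sqr_ge0// ltW// pc_gt0.
transitivity (\int[@lebesgue_measure R]_(y in `[0%R, (pc * x ^+ 2)%R]) (cst (F x)) y)%E.
  rewrite [RHS]integral_mkcond; apply: eq_integral => y _; rewrite !patchE.
  congr (if _ then _ else _); apply/idP/idP => /set_mem h; apply/mem_set.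
    by have [_] := h; rewrite /= in_itv.
  by split => //; move: h; rewrite /= in_itv.
have -> : ((pc * x ^+ 2)%:E = @lebesgue_measure R `[0%R, (pc * x ^+ 2)%R])%E.
  by rewrite lebesgue_measure_itv/= lte_fin sube0; case: ltgtP px => // <-.
by apply: integral_cst.
Qed.

Let cone_mass (x : R) : 0 < x ->
  (\int[@lebesgue_measure R]_(y in `]0%R, x[) (pc * y ^+ 2)%:E = (x ^+ 3)%:E * kap)%E.
Proof.
move=> x0.
have cf y : {for y, continuous (fun y : R => pc * y ^+ 2)}.
  by apply: cvgM; [exact: cvg_cst|exact: exprn_continuous].
have dF (y : R) : is_derive y 1 (fun y : R => fine kap * y ^+ 3) (pc * y ^+ 2).
  apply: is_derive_eq; rewrite /pc /GRing.scale/=.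
  by ring.
have cF y : {for y, continuous (fun y : R => fine kap * y ^+ 3)}.
  by apply: cvgM; [exact: cvg_cst|exact: exprn_continuous].
rewrite -(@integral_itv_bndoo R 0 x (fun y => (pc * y ^+ 2)%:E) true false); last first.
  apply: measurableT_comp => //; apply: measurable_funTS.
  by apply: measurable_funM => //; apply: measurable_funX.
rewrite (continuous_FTC2 (F := fun y : R => fine kap * y ^+ 3) x0) //.
- rewrite expr0n/= mulr0 sube0 -[in RHS](fineK unit_ball_volume_fin) -EFinM.
  by rewrite mulrC.
- by apply: continuous_subspaceT.
- split; first by move=> y _; exact: ex_derive.
  + by apply: cvg_at_right_filter; exact: cF.
  + by apply: cvg_at_left_filter; exact: cF.
- by move=> y _; rewrite derive1E derive_val.
Qed.

Lemma leb3_origin : leb3 R [set z | enorm z = 0] = 0%E.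
Proof.
have -> : [set z : T3 | enorm z = 0] = ([set 0] `*` [set 0]) `*` [set 0].
  apply/seteqP; split => [z z0|[[a b] c] [[/= -> ->] ->]].
    have h (i : 'I_3) : coord3 i z = 0.
      by apply/eqP; rewrite -normr_le0 -z0; exact: coord3_le.
    by split; [split; [exact: (h (@Ordinal 3 0 isT))|exact: (h (@Ordinal 3 1 isT))]|
               exact: (h (@Ordinal 3 2 isT))].
  rewrite /=; apply/eqP; rewrite -sqrf_eq0 enorm_sqr/= expr0n/= !addr0//.
have m0 : measurable ([set 0] : set T) by exact: measurable_set1.
by rewrite (leb3_cube m0) lebesgue_measure_set1 !mul0e.
Qed.

Let ball_mass (x : T) :
  pushforward leb2 phi (`]-oo, x[ `&` H R) = leb3 R (@enorm R @^-1` (`]-oo, x[ `&` H R)).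
Proof.
pose nu : {measure set T -> \bar R} := pushforward leb2 phi.
have mX : measurable (`]-oo, x[%classic : set T) by exact: measurable_itv.
have -> : pushforward leb2 phi (`]-oo, x[ `&` H R) =
    (\int[nu mphi]_(y in H R) (\1_(`]-oo, x[) y)%:E)%E.
  by rewrite integral_indic//; exact: mH.
rewrite density_integral; last 2 first.
- by apply: measurableT_comp => //; exact: measurable_indic.
- by move=> y; rewrite lee_fin.
have [x0|x0] := leP x 0.
  have E0 : `]-oo, x[ `&` H R = set0.
    apply/seteqP; split => // y [/=]; rewrite in_itv/= => yx /inH y0.
    by have := lt_le_trans (lt_trans y0 yx) x0; rewrite ltxx.
  rewrite E0 preimage_set0 measure0; apply: integral0_eq => y /inH y0.
  rewrite indicE memNset ?mul0e// /= in_itv/= => yx.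
  by have := lt_le_trans (lt_trans y0 yx) x0; rewrite ltxx.
have mE : measurable ((@enorm R : T3 -> T) @^-1` (`]-oo, x[ `&` H R)).
  by rewrite -[X in measurable X]setTI; apply: measurable_enorm => //;
     apply: measurableI => //; exact: mH.
transitivity (leb3 R (eball x)); last first.
  have mZ : measurable ([set z | enorm z = 0] : set T3).
    by rewrite -[X in measurable X]setTI; exact: (measurable_enorm _ (measurable_set1 0)).
  rewrite -(measureU0 mE mZ leb3_origin); congr (leb3 R _).
  apply/seteqP; split => z; rewrite /eball/=.
    move=> zx; have := enorm_ge0 z; rewrite le_eqVlt => /predU1P[<-|z0]; first by right.
    by left; split; rewrite ?in_itv//; apply/inH.
  by move=> [[]|->]; rewrite ?in_itv.
rewrite (leb3_eball x0) -cone_mass// integral_mkcond [RHS]integral_mkcond.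
apply: eq_integral => y _; rewrite !patchE.
have [/set_mem/inH y0|/negP yH] := boolP (y \in H R); last first.
  rewrite ifF//; apply/negP => /set_mem; rewrite /= in_itv/= => /andP[y0 _].
  by apply/yH/mem_set/inH.
rewrite indicE; have [yx|yx] := ltP y x.
  by rewrite mem_set/= ?mul1e ?ifT// ?inE/= in_itv/= ?y0.
rewrite memNset/= ?mul0e ?ifF//; last by rewrite in_itv/= ltNge yx.
by apply/negP => /set_mem; rewrite /= in_itv/= [X in _ && X]ltNge yx andbF.
Qed.

(** Both measures give the same mass to initial intervals ([ball_mass]), and these
    generate the measurable sets and are stable under intersection. *)
Lemma radius_law (A : set T) : measurable A -> A `<=` H R ->
  pushforward (leb3 R) (@enorm R : T3 -> T) A = pushforward leb2 phi A.
Proof.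
move=> mA AH.
pose nu1 : {measure set T -> \bar R} := pushforward (leb3 R) (@enorm R : T3 -> T).
pose nu2 : {measure set T -> \bar R} := pushforward leb2 phi.
pose m1 : {measure set T -> \bar R} := mrestr (nu1 measurable_enorm) (@mH R).
pose m2 : {measure set T -> \bar R} := mrestr (nu2 mphi) (@mH R).
suff /(_ A mA) : forall B, measurable B -> m1 B = m2 B.
  by rewrite /m1 /m2 /= /mrestr (setIidl AH).
move=> B0 mB0; have key := @measure_unique _ R T (@RGenInftyO.G R)
  (fun k => `]-oo, k%:R[%classic) (@RGenInftyO.measurableE R).
apply: (key _ _ _ m1 m2 _ _ B0 mB0).
- move=> B1 B2 [x ->] [y ->]; exists (Num.min x y).
  by apply/seteqP; split => z /=; rewrite !in_itv/= lt_min => /andP.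
- by move=> k; exists k%:R.
- apply/seteqP; split => // z _; exists (Num.truncn z).+1 => //=.
  by rewrite in_itv/= truncnS_gt.
- by move=> B [x ->]; rewrite /m1 /m2 /= /mrestr ball_mass.
- move=> k; rewrite /m1/= /mrestr/= /pushforward.
  apply: (@le_lt_trans _ _ (leb3 R (eball k.+1%:R))); last first.
    by rewrite leb3_eball// -(fineK unit_ball_volume_fin) -EFinM ltry.
  apply: le_measure; rewrite ?inE; last first.
  + by move=> z [/=]; rewrite in_itv/= /eball/= => h _; apply: lt_trans h _; rewrite ltr_nat.
  + exact: measurable_eball.
  + rewrite -[X in measurable X]setTI; apply: measurable_enorm => //.
    by apply: measurableI; [exact: measurable_itv|exact: mH].
Qed.

Lemma off_origin : {ae leb3 R, forall z : T3, 0 < enorm z}.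
Proof.
exists [set z | enorm z = 0]; split.
- by rewrite -[X in measurable X]setTI; exact: (measurable_enorm _ (measurable_set1 0)).
- exact: leb3_origin.
- move=> z /= h; apply/eqP; rewrite eq_le enorm_ge0 andbT leNgt; exact/negP.
Qed.

Lemma measurable_radial d (X : measurableType d) (F : T -> X) :
  measurable_fun (H R) F -> measurable_fun setT (fun z : T3 => F (enorm z)).
Proof.
move=> mF; rewrite (_ : (fun _ => _) = (fun z : T3 =>
    if (enorm z : T) \in H R then (if (enorm z : T) \in H R then F (enorm z) else F 0) else F 0)).
  have mH1 : measurable_fun [set: T3] (fun z : T3 => (enorm z : T) \in H R).
    apply: (@measurable_fun_bool _ _ _ _ true); rewrite setTI.
    rewrite (_ : _ @^-1` _ = (@enorm R : T3 -> T) @^-1` H R).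
      by rewrite -[X in measurable X]setTI; apply: measurable_enorm => //; exact: mH.
    by apply/seteqP; split => z /= => [/set_mem|/mem_set].
  have mG : measurable_fun setT (fun x : T => if x \in H R then F x else F 0).
    have mX : measurable_fun [set: T] (fun x : T => x \in H R).
      apply: (@measurable_fun_bool _ _ _ _ true); rewrite setTI.
      rewrite (_ : _ @^-1` _ = H R); first exact: mH.
      by apply/seteqP; split => z /= => [/set_mem|/mem_set].
    apply: (measurable_fun_if measurableT mX) => //.
    rewrite setTI (_ : _ @^-1` _ = H R)//.
    by apply/seteqP; split => z /= => [/set_mem|/mem_set].
  apply: (measurable_fun_ifT mH1) => //.
  exact: (measurableT_comp mG measurable_enorm).
apply/funext => z; have [h|/negP h] := boolP ((enorm z : T) \in H R); first by [].
congr (F _); apply/eqP; rewrite eq_le enorm_ge0 andbT leNgt; apply/negP => z0.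
exact/h/mem_set/inH.
Qed.

(** The origin is a null set, so only the values of [F] on the half-line enter. *)
Lemma polar_integral (F : T -> \bar R) : measurable_fun (H R) F ->
  (forall x, (0 <= F x)%E) ->
  (\int[leb3 R]_z F (enorm z) =
   \int[@lebesgue_measure R]_(x in H R) (F x * (pc * x ^+ 2)%:E))%E.
Proof.
move=> mF F0; pose G := F \_ (H R).
have mG : measurable_fun setT G by exact/(measurable_restrictT _ (@mH R)).
have G0 x : (0 <= G x)%E by rewrite /G patchE; case: ifP.
have GF x : 0 < x -> G x = F x by move=> x0; rewrite /G patchE mem_set//; exact/inH.
transitivity (\int[leb3 R]_z G (enorm z))%E.
  apply: ae_eq_integral => //.
  - exact: measurable_radial.
  - by apply: measurable_radial; exact: measurable_funTS.
  - by apply: filterS off_origin => z z0 _; rewrite GF.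
transitivity (\int[leb3 R]_(z in (@enorm R : T3 -> T) @^-1` H R) G (enorm z))%E.
  rewrite [RHS]integral_mkcond; apply: eq_integral => z _; rewrite patchE.
  case: ifP => // /negP h; rewrite /G patchE ifF//.
  by apply/negP => /set_mem h1; apply: h; apply/mem_set.
rewrite -(ge0_integral_pushforward measurable_enorm _ (@mH R))//; last exact: measurable_funTS.
transitivity (\int[pushforward leb2 phi]_(x in H R) G x)%E.
  pose nu1 : {measure set T -> \bar R} := pushforward (leb3 R) (@enorm R : T3 -> T).
  pose nu2 : {measure set T -> \bar R} := pushforward leb2 phi.
  apply: (@eq_measure_integral _ _ _ _ (nu2 mphi) (nu1 measurable_enorm)) => A mA AH.
  exact: radius_law.
rewrite density_integral//; apply: eq_integral => x /set_mem/inH x0.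
by rewrite GF.
Qed.

Lemma polar_Rintegral (f : T -> R) : measurable_fun (H R) f ->
  (\int[leb3 R]_z f (enorm z) = I (fun x => f x * (pc * x ^+ 2)))%R.
Proof.
move=> mf; rewrite /I /Int /Rintegral; congr fine.
have mf' : measurable_fun (H R) (EFin \o f) by exact/measurable_EFinP.
rewrite [LHS]integralE [RHS]integralE.
rewrite (_ : ((fun z => (f (enorm z))%:E)^\+ = fun z => ((EFin \o f)^\+ (enorm z)))%E); last by apply/funext => z; rewrite !funeposE.
rewrite (_ : ((fun z => (f (enorm z))%:E)^\- = fun z => ((EFin \o f)^\- (enorm z)))%E); last by apply/funext => z; rewrite !funenegE.
rewrite !polar_integral//.
- congr (_ - _)%E; apply: eq_integral => x /set_mem/inH x0.
    rewrite !funeposE /= -!EFin_max -EFinM maxr_pMl ?mul0r//.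
    by rewrite mulr_ge0 ?sqr_ge0// ltW// pc_gt0.
  rewrite !funenegE /= -?EFinN -!EFin_max -EFinM maxr_pMl ?mul0r ?mulNr//.
  by rewrite mulr_ge0 ?sqr_ge0// ltW// pc_gt0.
- exact: measurable_funeneg.
- exact: measurable_funepos.
Qed.

Lemma polar_integrable (f : T -> R) : measurable_fun (H R) f ->
  intg (leb3 R) setT (fun z => f (enorm z)) -> ih (fun x => f x * (pc * x ^+ 2)).
Proof.
move=> mf /integrableP[_ fin]; apply/integrableP; split.
  apply/measurable_EFinP; apply: measurable_funM => //; apply: measurable_funM => //.
move: fin; rewrite (polar_integral (F := fun x => `|(f x)%:E|%E))//; last first.
  by do 2 apply: measurableT_comp => //.
apply: le_lt_trans; rewrite le_eqVlt; apply/orP; left; apply/eqP.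
apply: eq_integral => x _ /=; rewrite -EFinM; congr (_%:E).
by rewrite normrM [X in _ * X]ger0_norm// mulr_ge0 ?sqr_ge0// ltW// pc_gt0.
Qed.

(** The density vanishes only at the origin, so no set of positive length becomes
    negligible in space. *)
Lemma polar_ae (A : set T) : measurable A ->
  {ae leb3 R, forall z, A (enorm z)} -> aeH A.
Proof.
move=> mA hA.
pose F (x : T) : \bar R := (\1_(~` A) x)%:E.
have mF : measurable_fun setT F.
  by apply: measurableT_comp => //; apply: measurable_indic; exact: measurableC.
have F0 x : (0 <= F x)%E by rewrite lee_fin.
have := polar_integral (measurable_funTS mF) F0.
rewrite [LHS](_ : _ = 0%E); last first.
  rewrite -(integral0 (leb3 R) setT); apply: ae_eq_integral => //.
    by apply: measurable_radial; exact: measurable_funTS.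
  apply: (@filterS _ (nbhs (almost_everywhere (leb3 R))) (ae_filter_ringOfSetsType _) _ _ _ hA) => z Az _.
  by rewrite /F indicE memNset//; exact.
move=> E0.
have mG : measurable_fun (H R) (fun x : T => (F x * (pc * x ^+ 2)%:E)%E).
  apply: emeasurable_funM; first exact: measurable_funTS.
  apply: measurableT_comp => //; apply: measurable_funM => //; apply: measurable_funX.
have : (\int[@lebesgue_measure R]_(x in H R) `|F x * (pc * x ^+ 2)%:E| = 0)%E.
  rewrite [RHS]E0; apply: eq_integral => x _; rewrite gee0_abs//.
  by rewrite mule_ge0// lee_fin mulr_ge0 ?sqr_ge0// ltW// pc_gt0.
move=> /(ae_eq_integral_abs (@lebesgue_measure R) (@mH R) mG).
apply: filterS => x h Hx; apply: contrapT => nA.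
have /inH x0 := Hx; have := h Hx; rewrite /F indicE mem_set// mul1e => /eqP.
by rewrite eqe mulf_eq0 expf_eq0/= !gt_eqF ?pc_gt0.
Qed.

End Polar.

(** * Radial functions in the mean *)

Section Transfer.
Context (R : realType).
Local Notation T := (measurableTypeR R).
Local Notation T3 := (T * T * T)%type.
Local Notation H := (H R).
Local Notation L3 := (leb3 R).
Implicit Types (u v w : E3 R -> C2 R) (k n : nat).

(** The real components, with natural indices so that they can be shifted and
    matched without casts. *)
Definition rc k (z : C2 R) : R :=
  [:: complex.Re z.1; complex.Im z.1; complex.Re z.2; complex.Im z.2]`_k.

Definition ae3 (P : E3 R -> Prop) : Prop := {ae L3, forall z, P z}.

Lemma ae3_imp (P Q : E3 R -> Prop) : (forall z, P z -> Q z) -> ae3 P -> ae3 Q.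
Proof.
move=> PQ.
exact: (@filterS _ (nbhs (almost_everywhere L3)) (ae_filter_ringOfSetsType L3)).
Qed.

Lemma ae3_and (P Q : E3 R -> Prop) : ae3 P -> ae3 Q -> ae3 (fun z => P z /\ Q z).
Proof.
move=> hP hQ; have F := ae_filter_ringOfSetsType L3.
by apply: (@filterS2 _ (nbhs (almost_everywhere L3)) F _ _ _ _ hP hQ).
Qed.

Lemma ae3_enorm : ae3 (fun z => 0 < enorm z).
Proof. exact: off_origin. Qed.

Lemma spnorm_ge0 (z : C2 R) : 0 <= spnorm z. Proof. exact: sqrtr_ge0. Qed.

Lemma normc_sqr (z : R[i]) : Normc.normc z ^+ 2 = complex.Re z ^+ 2 + complex.Im z ^+ 2.
Proof. by case: z => a b /=; rewrite sqr_sqrtr// addr_ge0 ?sqr_ge0. Qed.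

Lemma spnorm_sqr (z : C2 R) : spnorm z ^+ 2 = \sum_(k < 4) rc k z ^+ 2.
Proof.
rewrite /spnorm sqr_sqrtr; last by rewrite addr_ge0// sqr_ge0.
by rewrite !normc_sqr !big_ord_recr big_ord0/= /rc/= add0r !addrA.
Qed.

Lemma rc_le k (z : C2 R) : (k < 4)%N -> `|rc k z| <= spnorm z.
Proof.
move=> k4; rewrite -(@ler_pXn2r _ 2)// ?nnegrE ?spnorm_ge0//.
rewrite real_normK ?num_real// spnorm_sqr (bigD1 (Ordinal k4))//= lerDl.
by apply: sumr_ge0 => i _; rewrite sqr_ge0.
Qed.

Definition meas4 u : Prop := forall k, (k < 4)%N -> measurable_fun [set: T3] (fun z => rc k (u z)).
Definition sq4 u : Prop := forall k, (k < 4)%N -> L2 L3 setT (fun z => rc k (u z)).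

Lemma inL2_sq4 u : inL2 u -> sq4 u.
Proof.
move=> hu k k4; have := hu (Ordinal k4); split; last first.
  exact: (Lfun2_integrable_sqr (hu (Ordinal k4))).
by have := sub_Lfun_mfun (hu (Ordinal k4)); rewrite inE.
Qed.

Lemma sq4_meas u : sq4 u -> meas4 u. Proof. by move=> h k /h[]. Qed.

Lemma measurable_spnorm_sqr u : meas4 u ->
  measurable_fun [set: T3] (fun z => (spnorm (u z) ^+ 2)%:E).
Proof.
move=> mu; apply/measurable_EFinP.
rewrite (_ : (fun _ => _) = fun z => \sum_(k < 4) rc k (u z) ^+ 2); last first.
  by apply/funext => z; rewrite spnorm_sqr.
apply: measurable_sum => k; apply: measurable_funX; exact: mu.
Qed.

Lemma L2norm_on_sqr D u : (L2norm_on D u `^ 2 =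
  \int[L3]_(z in D) (spnorm (u z) ^+ 2)%:E)%E.
Proof.
rewrite /L2norm_on poweR_Lnorm// [RHS]integral_mkcond; apply: eq_integral => z _.
rewrite /= !patchE; case: ifP => _; last by rewrite abse0 poweR_EFin powR0.
rewrite gee0_abs ?lee_fin ?spnorm_ge0// poweR_EFin.
by rewrite powR_mulrn// spnorm_ge0.
Qed.

Lemma L2norm_on_ge0 D u : (0 <= L2norm_on D u)%E. Proof. exact: Lnorm_ge0. Qed.

Lemma radial_integral_le (g : R -> R) k u : (k < 4)%N -> measurable_fun H g -> meas4 u ->
  ae3 (fun z => g (enorm z) = rc k (u z)) ->
  (\int[L3]_z ((g (enorm z)) ^+ 2)%:E <= L2norm u `^ 2)%E.
Proof.
move=> k4 mg mu hg; rewrite L2norm_on_sqr.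
apply: ae_ge0_le_integral => //.
- by move=> z _; rewrite lee_fin sqr_ge0.
- apply: (@measurable_radial R _ _ (fun x : T => ((g x) ^+ 2)%:E)).
  by apply/measurable_EFinP; apply: measurable_funX.
- by move=> z _; rewrite lee_fin sqr_ge0.
- exact: measurable_spnorm_sqr.
- apply: (ae3_imp _ hg) => z -> _; rewrite lee_fin -[leLHS]real_normK ?num_real//.
  by rewrite ler_sqr ?nnegrE ?spnorm_ge0//; exact: rc_le.
Qed.

Lemma comp_integral_le k u : (k < 4)%N -> meas4 u ->
  (\int[L3]_z ((rc k (u z)) ^+ 2)%:E <= L2norm u `^ 2)%E.
Proof.
move=> k4 mu; rewrite L2norm_on_sqr; apply: ge0_le_integral => //.
- by move=> z _; rewrite lee_fin sqr_ge0.
- by apply/measurable_EFinP; apply: measurable_funX; exact: mu.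
- exact: measurable_spnorm_sqr.
- move=> z _; rewrite lee_fin -[leLHS]real_normK ?num_real//.
  by rewrite ler_sqr ?nnegrE ?spnorm_ge0//; exact: rc_le.
Qed.

Lemma radial_nm_le (g : R -> R) (E : R) : measurable_fun H g ->
  (\int[L3]_z ((g (enorm z)) ^+ 2)%:E <= E%:E)%E ->
  l2 (fun x => x * g x) /\ pc R * nm (fun x => x * g x) ^+ 2 <= E.
Proof.
move=> mg h2.
have p0 := pc_gt0 R; have mg2 : measurable_fun H (fun x : T => g x ^+ 2) by exact: measurable_funX.
have i3 : intg L3 setT (fun z : T3 => g (enorm z) ^+ 2).
  apply/integrableP; split.
    apply: (@measurable_radial R _ _ (fun x : T => ((g x) ^+ 2)%:E)).
    exact/measurable_EFinP.
  apply: le_lt_trans (ltry E); apply: le_trans h2.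
  by rewrite le_eqVlt; apply/orP; left; apply/eqP/eq_integral => z _ /=;
     rewrite ger0_norm// sqr_ge0.
have i1 := polar_integrable mg2 i3.
have EE x : (pc R)^-1 * (g x ^+ 2 * (pc R * x ^+ 2)) = (x * g x) ^+ 2.
  by rewrite exprMn; field; rewrite gt_eqF.
have l : l2 (fun x => x * g x).
  split; first exact: measurable_funM.
  by apply: (ih_eq _ (ihZ (pc R)^-1 i1)) => x _; rewrite EE.
split => //; rewrite nm_sqr -IZ; last by case: l.
rewrite (@I_eq _ _ (fun x => g x ^+ 2 * (pc R * x ^+ 2))); last first.
  by move=> x _; rewrite exprMn; ring.
rewrite -polar_Rintegral// /Rintegral -lee_fin fineK//.
by rewrite ge0_fin_numE ?integral_ge0//; [exact: le_lt_trans h2 (ltry _)|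
   move=> z _; rewrite lee_fin sqr_ge0].
Qed.

(** The profile is the restriction of the radial function to a coordinate axis. *)
Lemma profile_meas (f : R -> C2 R) k : (k < 4)%N -> meas4 (radial_ext f) ->
  measurable_fun H (fun x => rc k (f x)).
Proof.
move=> k4 mf.
have me : measurable_fun [set: T] (fun x : T => (x, 0, 0) : T3).
  by apply: measurable_fun_pair => //; apply: measurable_fun_pair.
have h : measurable_fun [set: T] (fun x : T => rc k (radial_ext f (x, 0, 0))).
  exact: (measurableT_comp (mf k k4) me).
apply: (@eq_measurable_fun _ _ _ _ _ (fun x : T => rc k (radial_ext f (x, 0, 0)))); last first.
  exact: measurable_funTS.
move=> x /set_mem/inH x0; rewrite /radial_ext; congr (rc k (f _)).
apply/eqP; rewrite -(@eqrXn2 _ 2) ?enorm_ge0 ?ltW//.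
by rewrite enorm_sqr/= expr0n/= !addr0.
Qed.

(** A limit in the mean of radial functions is radial, since a rapidly
    converging sequence converges almost everywhere. *)
Lemma radial_limit (g : nat -> R -> R) (w : E3 R -> R) :
  (forall n, measurable_fun H (g n)) -> measurable_fun [set: T3] w ->
  (forall n, \int[L3]_z ((g n (enorm z) - w z) ^+ 2)%:E <= (1 / (2 ^ (n + 1))%:R)%:E)%E ->
  exists2 d : R -> R, measurable_fun H d & ae3 (fun z => w z = d (enorm z)).
Proof.
(* The upper limit is defined for every radius and is measurable, whether or not
   the sequence converges there. *)
move=> mg mw hI.
pose f n (z : T3) := ((g n (enorm z) - w z) ^+ 2)%:E.
have mf n : measurable_fun setT (f n).
  apply/measurable_EFinP; apply: measurable_funX; apply: measurable_funB => //.
  by apply: measurable_radial; exact: mg.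
have f0 n z : (0 <= f n z)%E by rewrite lee_fin sqr_ge0.
have fin : (\int[L3]_z (\sum_(n <oo) f n z) < +oo)%E.
  rewrite integral_nneseries//.
  apply: (@le_lt_trans _ _ (\sum_(n <oo) (1 / (2 ^ (n + 1))%:R)%:E)%E).
    by apply: lee_nneseries => [n _ _|n _]; [exact: integral_ge0|exact: hI].
  by rewrite (cvg_lim _ (@cvg_geometric_eseries_half R 1 0))//= ltry.
have mS : measurable_fun setT (fun z => \sum_(n <oo) f n z)%E.
  by apply: ge0_emeasurable_sum => // n z _ _; exact: f0.
have S0 z : (0 <= \sum_(n <oo) f n z)%E by exact: nneseries_ge0.
have iS : L3.-integrable setT (fun z => \sum_(n <oo) f n z)%E.
  apply/integrableP; split => //; under eq_integral do rewrite gee0_abs//.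
  exact: fin.
pose d x := fine (limn_esup (fun n => (g n x)%:E)).
have md : measurable_fun H d.
  apply: (measurableT_comp (fine_measurable measurableT)).
  by apply: measurable_fun_limn_esup => n; exact/measurable_EFinP.
exists d => //.
have := integrable_ae measurableT iS; apply: ae3_imp => z /(_ Logic.I).
rewrite ge0_fin_numE// => Sz.
have tz := nneseries_tail_cvg Sz (fun n _ => f0 n z).
have fz : f n z @[n --> \oo] --> 0%E.
  apply: (squeeze_cvge _ (cvg_cst 0%E) tz); apply: nearW => n.
  rewrite f0/= (@nneseries_split R (f ^~ z) n 1) => [|j _]; last exact: f0.
  by rewrite addn1 big_nat1 leeDl// nneseries_ge0.
have gz : g n (enorm z) @[n --> \oo] --> w z.
  have h1 : (g n (enorm z) - w z) ^+ 2 @[n --> \oo] --> 0 by have /fine_cvgP[_ h1] := fz; exact: h1.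
  have h2 : Num.sqrt ((g n (enorm z) - w z) ^+ 2) @[n --> \oo] --> Num.sqrt 0.
    by apply: continuous_cvg h1; exact: sqrt_continuous.
  rewrite sqrtr0 in h2.
  apply/subr_cvg0/norm_cvg0P; apply: cvg_trans h2; apply: near_eq_cvg.
  by apply: nearW => n; rewrite sqrtr_sqr.
have gE : (g n (enorm z))%:E @[n --> \oo] --> (w z)%:E by apply: cvg_EFin => //; exact: nearW.
by rewrite /d (cvg_limn_einf_sup gE).
Qed.

End Transfer.

(** * Smooth step functions *)

Section Smooth.
Context (R : realType).

Section Directions.
Context (V : normedModType R) (J : Type) (e : J -> V).
Implicit Types (f g : V -> R) (n : nat).

(** Differentiability of order n along a family of directions; one definition
    serves the line and the coordinate directions of space. *)
Fixpoint Cn n f : Prop :=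
  continuous f /\
  if n is n'.+1 then
    forall i, (forall x, derivable f x (e i)) /\ Cn n' (fun x => 'D_(e i) f x)
  else True.

Lemma Cn_cont n f : Cn n f -> continuous f. Proof. by case: n => [|n] []. Qed.

Lemma CnS n f (g : J -> V -> R) : continuous f ->
  (forall i x, is_derive x (e i) f (g i x)) -> (forall i, Cn n (g i)) -> Cn n.+1 f.
Proof.
move=> cf df hg; split=> // i; split=> [x|]; first by have [] := df i x.
rewrite (_ : (fun x => _) = g i)//.
by apply/funext => x; have [_ ->] := df i x.
Qed.

Lemma Cn_derive n f i x : Cn n.+1 f -> is_derive x (e i) f ('D_(e i) f x).
Proof. by move=> [_ /(_ i)[df _]]; split. Qed.

Lemma Cn_D n f i : Cn n.+1 f -> Cn n (fun x => 'D_(e i) f x).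
Proof. by move=> [_ /(_ i)[]]. Qed.

Lemma CnW n f : Cn n.+1 f -> Cn n f.
Proof.
elim: n f => [|n IH] f; first by move=> [cf _].
move=> hf; apply: (@CnS _ _ (fun i x => 'D_(e i) f x)).
- exact: Cn_cont hf.
- by move=> i x; exact: Cn_derive hf.
- by move=> i; apply: IH; exact: Cn_D.
Qed.

Lemma Cn_cst n (c : R) : Cn n (fun=> c).
Proof.
elim: n c => [|n IH] c; first by split => // x; exact: cst_continuous.
have cc : continuous (fun _ : V => c) by move=> x; exact: cst_continuous.
have dc i x : is_derive x (e i) (fun _ : V => c) 0 by exact: is_derive_cst.
exact: (@CnS n _ (fun _ _ => 0) cc dc (fun=> IH 0)).
Qed.

Lemma CnD n f g : Cn n f -> Cn n g -> Cn n (fun x => f x + g x).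
Proof.
elim: n f g => [|n IH] f g hf hg.
  by split => // x; apply: cvgD; [exact: (Cn_cont hf)|exact: (Cn_cont hg)].
apply: (@CnS _ _ (fun i x => 'D_(e i) f x + 'D_(e i) g x)) => [x|i x|i].
- by apply: cvgD; [exact: (Cn_cont hf)|exact: (Cn_cont hg)].
- have h1 := Cn_derive i x hf; have h2 := Cn_derive i x hg.
  exact: (@is_deriveD _ _ _ f g).
- by apply: IH; exact: Cn_D.
Qed.

Lemma CnM n f g : Cn n f -> Cn n g -> Cn n (fun x => f x * g x).
Proof.
elim: n f g => [|n IH] f g hf hg.
  by split => // x; apply: cvgM; [exact: (Cn_cont hf)|exact: (Cn_cont hg)].
apply: (@CnS _ _ (fun i x => f x * 'D_(e i) g x + g x * 'D_(e i) f x)) => [x|i x|i].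
- by apply: cvgM; [exact: (Cn_cont hf)|exact: (Cn_cont hg)].
- have h1 := Cn_derive i x hf; have h2 := Cn_derive i x hg.
  exact: (@is_deriveM _ _ f g).
- by apply: CnD; apply: IH; (exact: Cn_D || exact: CnW).
Qed.

(** Directional derivatives are derivatives on a line, for which the chain rule with
    a real outer function is at hand. *)
Lemma is_derive_line f (x v : V) (df : R) :
  is_derive x v f df <-> is_derive (0 : R) 1 (fun t : R => f (t *: v + x)) df.
Proof.
have E : (fun h : R => h^-1 *: ((f \o shift x) (h *: v) - f x)) =
  (fun h : R => h^-1 *: (((fun t : R => f (t *: v + x)) \o shift 0) (h *: 1) -
     f (0 *: v + x))).
  by apply/funext => h /=; rewrite !addr0 scale0r add0r [h *: 1]mulr1.
by split => -[h1 h2]; split; move: h1 h2; rewrite /derivable /derive E.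
Qed.

Lemma is_derive_scalar_comp (h : R -> R) f (x v : V) (dh df : R) :
  is_derive (f x) 1 h dh -> is_derive x v f df ->
  is_derive x v (fun y => h (f y)) (dh * df).
Proof.
move=> hh /is_derive_line hf; apply/is_derive_line.
have hh' : is_derive (f (0 *: v + x)) 1 h dh by rewrite scale0r add0r.
by have := @is_derive1_comp R h (fun t : R => f (t *: v + x)) 0 dh df hh' hf.
Qed.

End Directions.

Local Notation C1 := (@Cn R unit (fun=> 1)).

Lemma Cn_comp (V : normedModType R) (J : Type) (e : J -> V) n (h : R -> R) (f : V -> R) :
  C1 n h -> Cn e n f -> Cn e n (fun x => h (f x)).
Proof.
elim: n h f => [|n IH] h f hh hf.
  by split => // x; apply: continuous_comp; [exact: (Cn_cont hf)|exact: (Cn_cont hh)].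
apply: (@CnS _ _ _ _ _ (fun i x => 'D_1 h (f x) * 'D_(e i) f x)) => [x|i x|i].
- by apply: continuous_comp; [exact: (Cn_cont hf)|exact: (Cn_cont hh)].
- apply: is_derive_scalar_comp; last exact: Cn_derive hf.
  exact: (Cn_derive tt (f x) hh).
- apply: CnM; last exact: Cn_D hf.
  apply: (IH ('D_1 h)); [exact: (Cn_D tt hh)|exact: CnW hf].
Qed.

Lemma C1_id n : C1 n (fun x : R => x).
Proof.
case: n => [|n]; first by split => // x; exact: cvg_id.
have cc : continuous (fun x : R => x) by move=> x; exact: cvg_id.
have dc (i : unit) (x : R) : is_derive x ((fun=> 1) i) (fun x : R => x) 1.
  exact: is_derive_id.
exact: (CnS cc dc (fun=> @Cn_cst _ _ _ _ _)).
Qed.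

(** The functions that vanish to infinite order at the origin; differentiating
    one of them produces a combination of two others. *)
Definition flat (j : nat) (x : R) : R :=
  if 0 < x then x^-1 ^+ j * expR (- x^-1) else 0.

(** The exponential at 1/x exceeds the term of order j + 2 of its series. *)
Lemma flat_le j (x : R) : `|flat j x| <= (j.+2)`!%:R * x ^+ 2.
Proof.
rewrite /flat; case: ltP => [x0|_]; last by rewrite normr0 mulr_ge0// sqr_ge0.
have y0 : 0 < x^-1 by rewrite invr_gt0.
have h : x^-1 ^+ j.+2 / (j.+2)`!%:R <= expR (x^-1).
  by apply: le_trans (expR_ge1Dxn j.+1 (ltW y0)); rewrite lerDr.
have f0 : 0 < (j.+2)`!%:R :> R by rewrite ltr0n fact_gt0.
rewrite ger0_norm; last by rewrite mulr_ge0 ?expR_ge0// exprn_ge0// ltW.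
rewrite expRN ler_pdivrMr ?expR_gt0//.
rewrite ler_pdivrMr// in h.
have -> : x^-1 ^+ j = x^-1 ^+ j.+2 * x ^+ 2.
  by rewrite -addn2 exprD -mulrA -exprMn mulVf ?gt_eqF// expr1n mulr1.
by rewrite [leRHS]mulrAC ler_pM2r ?exprn_gt0// mulrC.
Qed.

Lemma flat_neg j (x : R) : x <= 0 -> flat j x = 0.
Proof. by rewrite /flat leNgt; case: ltP. Qed.

Lemma is_derive_nearR (f g : R -> R) (x df : R) :
  (\forall y \near x, f y = g y) -> is_derive x 1 f df -> is_derive x 1 g df.
Proof. by move=> fg; apply: near_eq_is_derive. Qed.

Lemma is_derive_pos j (x : R) : 0 < x ->
  is_derive x 1 (fun x => x^-1 ^+ j * expR (- x^-1))
    (- j%:R * (x^-1 ^+ j.+1 * expR (- x^-1)) + x^-1 ^+ j.+2 * expR (- x^-1)).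
Proof.
move=> x0; have xn : x != 0 by rewrite gt_eqF.
have dV : is_derive x 1 (fun x : R => x^-1) (- x^-1 ^+ 2).
  have := @is_deriveV R id x 1 1 xn (is_derive_id x 1).
  by move=> h; apply: (is_derive_eq h); rewrite /GRing.scale/= mulr1 exprVn.
elim: j => [|j IH].
  have hN : is_derive x 1 (fun x : R => - x^-1) (x^-1 ^+ 2).
    by apply: (is_derive_eq (is_deriveN dV)); rewrite opprK.
  have := @is_derive1_comp R expR (fun x : R => - x^-1) x _ _ (is_derive_expR _) hN.
  rewrite /comp => h; rewrite (_ : (fun _ => _) = fun x0 : R => expR (- x0^-1)).
    by apply: (is_derive_eq h); rewrite oppr0 mul0r add0r mulrC.
  by apply/funext => y; rewrite expr0 mul1r.
have h := is_deriveM dV IH.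
rewrite (_ : (fun _ => _) = fun y : R => y^-1 * (y^-1 ^+ j * expR (- y^-1))); last first.
  by apply/funext => y; rewrite exprS mulrA.
apply: (is_derive_eq h); rewrite /GRing.scale/= -[j.+1%:R]natr1 !exprS; ring.
Qed.

Lemma is_derive_flat j (x : R) :
  is_derive x 1 (flat j) (- j%:R * flat j.+1 x + flat j.+2 x).
Proof.
have [x0|x0|x0] := ltgtP x 0.
- rewrite !flat_neg ?ltW// mulr0 addr0.
  have d0 : is_derive x 1 (fun _ : R => 0 : R) 0 by exact: is_derive_cst.
  apply: (@is_derive_nearR (fun=> 0) _ _ _ _ d0).
  near=> y; rewrite flat_neg// ltW//; near: y; exact: lt_nbhsl.
- apply: (@is_derive_nearR (fun x => x^-1 ^+ j * expR (- x^-1))); last first.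
    by rewrite /flat x0; exact: is_derive_pos.
  near=> y; rewrite /flat ifT//; near: y; exact: lt_nbhsr.
- rewrite x0 !flat_neg// mulr0 addr0.
  have c0 : h^-1 *: ((flat j \o shift 0) (h *: 1) - flat j 0) @[h --> (0 : R)^'] --> (0 : R).
    apply/norm_cvg0P.
    have lim0 : (j.+2)`!%:R * `|h| @[h --> (0 : R)^'] --> (0 : R).
      rewrite -[X in _ --> X](mulr0 ((j.+2)`!%:R : R)); apply: cvgM; first exact: cvg_cst.
      have nc : `|h| @[h --> (0 : R)^'] --> `|0 : R|.
        by apply: cvg_within_filter; exact: norm_continuous.
      by rewrite normr0 in nc.
    apply: (squeeze_cvgr _ (cvg_cst 0) lim0); near=> h.
    have hn : h != 0 by near: h; exact: nbhs_dnbhs_neq.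
    rewrite normr_ge0/= addr0 [h *: 1]mulr1 (@flat_neg j 0)// subr0 normrZ normfV.
    rewrite ler_pdivrMl ?normr_gt0//.
    apply: (le_trans (flat_le j h)); rewrite -(@real_normK _ h) ?num_real// expr2.
    by rewrite mulrCA.
  by split; [exact: cvgP c0|exact: cvg_lim c0].
Unshelve. all: by end_near. Qed.

Lemma Cn_flat n j : C1 n (flat j).
Proof.
have cf i : continuous (flat i).
  move=> x; have h := is_derive_flat i x.
  by apply: differentiable_continuous; apply/derivable1_diffP; exact: ex_derive.
elim: n j => [|n IH] j; first by split.
apply: (@CnS _ _ _ _ _ (fun _ x => - j%:R * flat j.+1 x + flat j.+2 x)) => //.
  by move=> _ x; exact: is_derive_flat.
by move=> _; apply: CnD => //; apply: CnM => //; exact: Cn_cst.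
Qed.

(** A smooth monotone passage from 0 to 1, obtained by composing the flat
    function with itself: the inner one exceeds the threshold of the outer one
    exactly beyond 1. *)
Definition smoothstep (x : R) : R :=
  1 - expR 1 * flat 0 (1 - expR 1 * flat 0 x).

Lemma Cn_smoothstep n : C1 n smoothstep.
Proof.
have aff (a b : R) : C1 n (fun x : R => a + b * x).
  by apply: CnD; [exact: Cn_cst|apply: CnM; [exact: Cn_cst|exact: C1_id]].
have h := Cn_comp (aff 1 (- expR 1)) (Cn_comp (Cn_flat n 0)
  (Cn_comp (aff 1 (- expR 1)) (Cn_flat n 0))).
by rewrite (_ : smoothstep = fun x =>
  1 + - expR 1 * flat 0 (1 + - expR 1 * flat 0 x))//; apply/funext => x;
  rewrite /smoothstep !mulNr.
Qed.

Lemma smoothstep0 (x : R) : x <= 0 -> smoothstep x = 0.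
Proof.
move=> x0; rewrite /smoothstep (flat_neg _ x0) mulr0 subr0 /flat ltr01 expr0 mul1r invr1.
by rewrite -expRD subrr expR0 subrr.
Qed.

Lemma smoothstep1 (x : R) : 1 <= x -> smoothstep x = 1.
Proof.
move=> x1; rewrite /smoothstep [X in expR 1 * X]flat_neg ?mulr0 ?subr0//.
have x0 : 0 < x by exact: lt_le_trans ltr01 x1.
rewrite /flat x0 expr0 mul1r -expRD subr_le0 -[leLHS]expR0 ler_expR subr_ge0.
by rewrite invf_le1.
Qed.

Definition dsmoothstep (x : R) : R :=
  expR 1 ^+ 2 * (flat 2 (1 - expR 1 * flat 0 x) * flat 2 x).

Lemma is_derive_smoothstep (x : R) : is_derive x 1 smoothstep (dsmoothstep x).
Proof.
have d0 (y : R) : is_derive y 1 (flat 0) (flat 2 y).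
  by apply: (is_derive_eq (is_derive_flat 0 y)); rewrite oppr0 mul0r add0r.
have d1 (g : R -> R) (y dg : R) : is_derive y 1 g dg ->
    is_derive y 1 (fun z => 1 - expR 1 * g z) (- expR 1 * dg).
  move=> h; apply: is_derive_eq; rewrite /GRing.scale/=; ring.
have d2 := @is_derive1_comp R (flat 0) (fun z => 1 - expR 1 * flat 0 z) x _ _
  (d0 (1 - expR 1 * flat 0 x)) (d1 _ _ _ (d0 x)).
apply: (is_derive_eq (d1 _ _ _ d2)); rewrite /dsmoothstep; ring.
Qed.

Lemma dsmoothstep0 (x : R) : x <= 0 -> dsmoothstep x = 0.
Proof. by move=> x0; rewrite /dsmoothstep (flat_neg 2 x0) !mulr0. Qed.

Lemma dsmoothstep1 (x : R) : 1 <= x -> dsmoothstep x = 0.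
Proof.
move=> x1; rewrite /dsmoothstep [flat 2 (1 - _)]flat_neg ?mul0r ?mulr0//.
have x0 : 0 < x by exact: lt_le_trans ltr01 x1.
rewrite /flat x0 expr0 mul1r -expRD subr_le0 -[leLHS]expR0 ler_expR subr_ge0.
by rewrite invf_le1.
Qed.

Lemma smoothstep_bounded : exists2 M : R, 0 < M &
  forall x, `|smoothstep x| <= M /\ `|dsmoothstep x| <= M.
Proof.
have e0 : 0 < expR 1 :> R by exact: expR_gt0.
have fb j (x : R) : x <= 1 -> `|flat j x| <= (j.+2)`!%:R.
  move=> x1; have [x0|x0] := leP x 0; first by rewrite flat_neg// normr0.
  apply: (le_trans (flat_le j x)); rewrite ler_piMr//.
  by rewrite expr_le1// ltW.
have y1 (x : R) : 1 - expR 1 * flat 0 x <= 1.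
  rewrite gerBl mulr_ge0 ?(ltW e0)// /flat; case: ifP => // x0.
  by rewrite mulr_ge0 ?expR_ge0// exprn_ge0// invr_ge0 ltW.
exists (1 + expR 1 * 2 + expR 1 ^+ 2 * (24 * 24)).
  by rewrite !addr_gt0 ?mulr_gt0 ?exprn_gt0.
move=> x; split.
  apply: (@le_trans _ _ (1 + expR 1 * 2)); last by rewrite lerDl !mulr_ge0// sqr_ge0.
  apply: (le_trans (ler_normB _ _)); rewrite normr1 lerD2l normrM gtr0_norm//.
  by rewrite ler_pM2l//; apply: (le_trans (fb 0 _ (y1 x))).
apply: (@le_trans _ _ (expR 1 ^+ 2 * (24 * 24))); last first.
  by rewrite lerDr !addr_ge0// mulr_ge0// ltW.
have [x1|x1] := leP 1 x; first by rewrite dsmoothstep1// normr0 !mulr_ge0// sqr_ge0.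
rewrite /dsmoothstep !normrM ger0_norm ?sqr_ge0// ler_pM2l ?exprn_gt0//.
by apply: ler_pM => //; [apply: (le_trans (fb 2 _ (y1 x)))|apply: (le_trans (fb 2 _ (ltW x1)))].
Qed.

Lemma dsmoothstep_continuous : continuous dsmoothstep.
Proof.
have h := Cn_D tt (Cn_smoothstep 1).
rewrite (_ : dsmoothstep = fun x => 'D_1 smoothstep x); first exact: Cn_cont h.
by apply/funext => x; have [_ ->] := is_derive_smoothstep x.
Qed.

End Smooth.

(** * Mollification at Lebesgue points *)

Section Primitive.
Context (R : realType).
Local Notation mu := (leb R).
Local Notation H := (H R).
Implicit Types (a b x y r : R).

Lemma abscont_primitive (px c : R) (G : R -> R) : 0 < px ->
  (forall a b, 0 < a -> a <= b -> intg mu `[a, b] G) ->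
  exists2 V, abscont V G &
    forall r, 0 < r -> V r = if px <= r then c + Int mu `[px, r] G else c - Int mu `[r, px] G.
Proof.
move=> px0 iG; pose V r := if px <= r then c + Int mu `[px, r] G else c - Int mu `[r, px] G.
exists V => // a b a0 ab; have b0 := lt_le_trans a0 ab; split; first exact: iG.
rewrite /V; have [ra|ra] := leP px a.
  rewrite (le_trans ra ab) (Int_split ra ab); last exact: iG (le_trans ra ab).
  by ring.
have [rb|rb] := leP px b.
  rewrite [RHS](Int_split (ltW ra) rb); last exact: iG.
  by ring.
rewrite [Int mu `[a, px] G](Int_split ab (ltW rb)); last exact: iG (ltW ra).
by ring.
Qed.

Lemma I_dominated (f : nat -> R -> R) (h g : R -> R) :
  (forall n, measurable_fun H (f n)) -> measurable_fun H h -> ih g ->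
  (forall n x, 0 < x -> `|f n x| <= g x) ->
  (forall x, 0 < x -> f n x @[n --> \oo] --> h x) ->
  I (f n) @[n --> \oo] --> I h.
Proof.
move=> mf mh ig fg fh.
have m1 n : measurable_fun H (EFin \o f n) by exact/measurable_EFinP.
have m2 : measurable_fun H (EFin \o h) by exact/measurable_EFinP.
have c1 : {ae mu, forall x, H x -> (EFin \o f n) x @[n --> \oo] --> (EFin \o h) x}.
  by apply: aeW => x /inH x0; apply: cvg_EFin; [exact: nearW|exact: fh].
have c2 : {ae mu, forall x n, H x -> `|(EFin \o f n) x| <= (EFin \o g) x}%E.
  by apply: aeW => x n /inH x0; rewrite lee_fin; exact: fg.
have [ih1 _ c] := @dominated_convergence _ _ _ mu H (@mH R) (fun n => EFin \o f n)
  (EFin \o h) (EFin \o g) m1 m2 c1 ig c2.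
have fin : (\int[mu]_(x in H) (EFin \o h) x)%E \is a fin_num.
  exact: integrable_fin_num.
by rewrite /I /Int /Rintegral; apply: fine_cvg; rewrite fineK.
Qed.

End Primitive.

Lemma I_support (R : realType) (S : set (measurableTypeR R)) (f : R -> R) :
  measurable S -> S `<=` H R ->
  (forall x, 0 < x -> ~ S x -> f x = 0) -> intg (leb R) S f ->
  ih f /\ I f = Int (leb R) S f.
Proof.
move=> mS SH f0 iS.
have E x : H R x -> (EFin \o f) x = ((EFin \o f) \_ S) x.
  move=> /inH x0; rewrite patchE; case: ifPn => // /negP h /=.
  by rewrite f0// => Sx; apply: h; exact/mem_set.
have SE : H R `&` S = S by exact: setIidr.
split.
  apply: (@eq_integrable _ _ _ _ _ (@mH R) ((EFin \o f) \_ S)).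
    by move=> x /set_mem/E.
  by apply/(@integrable_restrict _ _ _ (leb R) S mS (H R) (@mH R)); rewrite SE.
rewrite /I /Int /Rintegral -[in RHS]SE integral_mkcondr; congr fine.
by apply: eq_integral => x /set_mem/E.
Qed.

Section Mollify.
Context (R : realType).
Local Notation mu := (leb R).
Local Notation H := (H R).
Implicit Types (a b x y : R).
Variables (sg dsg : R -> R) (M : R).
Hypothesis sgD : forall x, is_derive x 1 sg (dsg x).
Hypothesis cdsg : continuous dsg.
Hypothesis sg0 : forall x, x <= 0 -> sg x = 0.
Hypothesis sg1 : forall x, 1 <= x -> sg x = 1.
Hypothesis dsg0 : forall x, x <= 0 -> dsg x = 0.
Hypothesis dsg1 : forall x, 1 <= x -> dsg x = 0.
Hypothesis M0 : 0 < M.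
Hypothesis dsgM : forall x, `|dsg x| <= M.
Hypothesis sgM : forall x, `|sg x| <= M.

(** The derivative in x of the step sg ((n + 1) (x^2 - a^2)); it has integral 1 and
    lives on [a, a + del n a]. *)
Definition ker (n : nat) a x : R := 2 * x * (n.+1%:R * dsg (n.+1%:R * (x ^+ 2 - a ^+ 2))).
Let del (n : nat) a : R := (2 * a * n.+1%:R)^-1.

Let del_gt0 n a : 0 < a -> 0 < del n a.
Proof. by move=> a0; rewrite invr_gt0 mulr_gt0 ?mulr_gt0. Qed.

Let ker_left n a x : 0 < x -> x <= a -> ker n a x = 0.
Proof.
move=> x0 xa; rewrite /ker dsg0 ?mulr0// mulr_ge0_le0// subr_le0.
have a0 := lt_le_trans x0 xa.
by rewrite ler_pXn2r ?nnegrE ?(ltW x0) ?(ltW a0).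
Qed.

Let past n a x : 0 < a -> a + del n a <= x -> 1 <= n.+1%:R * (x ^+ 2 - a ^+ 2).
Proof.
move=> a0 ax; have d0 := del_gt0 n a0.
have e : n.+1%:R * (2 * a * del n a) = 1.
  by rewrite mulrA [n.+1%:R * _]mulrC /del mulfV// gt_eqF// !mulr_gt0.
rewrite -[leLHS]e ler_pM2l ?ltr0n//.
by move: (del n a) d0 ax => d d0 ax; nra.
Qed.

Let ker_right n a x : 0 < a -> a + del n a <= x -> ker n a x = 0.
Proof. by move=> a0 ax; rewrite /ker dsg1 ?mulr0//; exact: past. Qed.

Lemma ker_continuous n a : continuous (ker n a).
Proof.
move=> x; apply: cvgM; first by apply: cvgM; [exact: cvg_cst|exact: cvg_id].
apply: cvgM; first exact: cvg_cst.
apply: (continuous_comp (f := fun x => n.+1%:R * (x ^+ 2 - a ^+ 2)) (g := dsg)); last exact: cdsg.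
apply: cvgM; first exact: cvg_cst.
by apply: cvgB; [exact: exprn_continuous|exact: cvg_cst].
Qed.

Let ker_mass n a : 0 < a ->
  intg mu `[a, a + del n a] (ker n a) /\ Int mu `[a, a + del n a] (ker n a) = 1.
Proof.
move=> a0; have d0 := del_gt0 n a0.
have h : abscont (fun x => sg (n.+1%:R * (x ^+ 2 - a ^+ 2))) (ker n a).
  apply: abscont_C1 => x x0; last exact: ker_continuous.
  have d1 : is_derive x 1 (fun x : R => n.+1%:R * (x ^+ 2 - a ^+ 2)) (n.+1%:R * (2 * x)).
    by apply: is_derive_eq; rewrite /GRing.scale/=; ring.
  have h := is_derive1_comp (sgD _) d1.
  by apply: (is_derive_eq h); rewrite /ker; ring.
have ad : a <= a + del n a by rewrite lerDl ltW.
have [i e] := h a (a + del n a) a0 ad.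
by split; rewrite // -e (sg1 (past a0 (lexx _))) subrr mulr0 sg0// subr0.
Qed.

Let ker_bnd n a x : 0 < a -> a <= x -> x <= a + del n a ->
  `|ker n a x| <= 2 * (a + a^-1) * n.+1%:R * M.
Proof.
move=> a0 ax xa; have x0 := lt_le_trans a0 ax.
have da : del n a <= a^-1.
  rewrite lef_pV2 ?posrE ?mulr_gt0//; rewrite mulrAC ler_peMl// ?(ltW a0)//.
  by rewrite -natrM ler1n.
rewrite /ker normrM (ger0_norm (mulr_ge0 (ler0n _ 2) (ltW x0))) normrM.
rewrite (ger0_norm (ler0n _ n.+1)) -mulrA -!mulrA.
rewrite ler_pM2l// ler_pM// ?(ltW x0)// ?mulr_ge0//.
  by apply: (le_trans xa); rewrite lerD2l.
by rewrite ler_pM2l ?ltr0n.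
Qed.

(** The kernels concentrate at the right of a, so at a Lebesgue point they
    recover the value there. *)
Lemma ker_lebesgue (q Q : R -> R) a : 0 < a ->
  (forall x, 0 < x -> Q x = q x) -> measurable_fun setT Q ->
  (forall b c, 0 < b -> b <= c -> intg mu `[b, c] q) ->
  lebesgue_pt Q a ->
  (forall n, ih (fun x => q x * ker n a x)) /\
  I (fun x => q x * ker n a x) @[n --> \oo] --> q a.
Proof.
move=> a0 Qq mQ iq La.
pose S n := `[a, a + del n a]%classic : set R.
have SH n : S n `<=` H by exact: subH.
have supp n x : 0 < x -> ~ S n x -> q x * ker n a x = 0.
  move=> x0 Sx; have [xa|ax] := leP x a; first by rewrite ker_left// mulr0.
  rewrite (@ker_right n a x)// ?mulr0// leNgt; apply/negP => xd; apply: Sx.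
  by rewrite /S/= in_itv/= !ltW.
have ad n : a <= a + del n a by rewrite lerDl ltW// del_gt0.
have iq1 n : intg mu (S n) q by exact: iq.
have mk n : measurable_fun (S n) (ker n a).
  by apply: measurable_funTS; apply: continuous_measurable_fun; exact: ker_continuous.
have Sx n x : S n x -> a <= x /\ x <= a + del n a.
  by rewrite /S/= in_itv/= => /andP[].
have iS n : intg mu (S n) (fun x => q x * ker n a x).
  pose K := 2 * (a + a^-1) * n.+1%:R * M.
  apply: (@intg_le _ _ _ mu (S n) (mItv _ _) (fun x => K * `|q x|)).
  - by apply: measurable_funM (mk n); exact: (@intg_meas _ _ _ mu _ _ (iq1 n)).
  - by apply: intgZ; [exact: mItv|exact: intg_norm].
  - by move=> x /Sx[x1 x2]; rewrite normrM mulrC ler_wpM2r// ker_bnd.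
have iq2 n : intg mu (S n) (fun x => q x - q a).
  apply: (@intgB _ _ _ mu _ (mItv _ _)); first exact: iq1.
  apply: continuous_compact_integrable; first exact: segment_compact.
  by apply: continuous_subspaceT => x; exact: cvg_cst.
have sup n := I_support (mItv _ _) (@SH n) (supp n) (iS n).
split => [n|]; first by have [] := sup n.
(* The kernel is of size n on an interval of length 1/n, so the error is at most a
   constant times the mean deviation from q a on a ball around a. *)
pose K' := 4 * (a + a^-1) * M / a.
have est n : (`|I (fun x => q x * ker n a x) - q a|%:E <=
    K'%:E * davg Q a (2 * del n a))%E.
  have [_ ->] := sup n; have [ik k1] := ker_mass n a0; have d0 := del_gt0 n a0.
  have E1 : Int mu (S n) (fun x => q x * ker n a x) - q a =
      Int mu (S n) (fun x => (q x - q a) * ker n a x).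
    rewrite -[X in _ - X]mulr1 -[X in _ - _ * X]k1 -(IntZ (mItv _ _))//.
    rewrite -(IntB (mItv _ _) (iS n) (@intgZ _ _ _ mu _ (mItv _ _) (q a) _ ik)).
    by apply: Int_eq => x _; rewrite mulrBl.
  pose K := 2 * (a + a^-1) * n.+1%:R * M.
  have K0 : 0 <= K by rewrite !mulr_ge0 ?addr_ge0 ?invr_ge0 ?(ltW a0) ?(ltW M0).
  have i4 : intg mu (S n) (fun x => `|q x - q a|).
    exact: (@intg_norm _ _ _ mu _ _ (iq2 n)).
  have i5 : intg mu (S n) (fun x => K * `|q x - q a|).
    exact: (@intgZ _ _ _ mu _ (mItv _ _) K _ i4).
  have i3 : intg mu (S n) (fun x => (q x - q a) * ker n a x).
    apply: (@intg_le _ _ _ mu (S n) (mItv _ _) (fun x => K * `|q x - q a|)).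
    - by apply: measurable_funM (mk n); exact: (@intg_meas _ _ _ mu _ _ (iq2 n)).
    - exact: i5.
    - by move=> x /Sx[x1 x2]; rewrite normrM mulrC ler_wpM2r// ker_bnd.
  have le1 : `|Int mu (S n) (fun x => (q x - q a) * ker n a x)| <=
      K * Int mu (S n) (fun x => `|q x - q a|).
    apply: (le_trans (Int_norm (mItv _ _) i3)); rewrite -(IntZ (mItv _ _))//.
    apply: (Int_le (mItv _ _)); [exact: (@intg_norm _ _ _ mu _ _ i3)|exact: i5|].
    by move=> x /Sx[x1 x2]; rewrite normrM mulrC ler_wpM2r// ker_bnd.
  rewrite E1; apply: (@le_trans _ _ (K * Int mu (S n) (fun x => `|q x - q a|))%:E).
    by rewrite lee_fin.
  have fin : (\int[mu]_(x in S n) (`|q x - q a|)%:E)%E \is a fin_num.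
    exact: (@integrable_fin_num _ _ _ mu _ (mItv _ _) _ i4).
  rewrite EFinM /Int /Rintegral fineK//.
  have le2 : (\int[mu]_(x in S n) (`|q x - q a|)%:E <=
     (4 * del n a)%:E * davg Q a (2 * del n a))%E.
    rewrite /davg /iavg lebesgue_measure_ball; last by rewrite mulr_ge0// ltW.
    rewrite inver gt_eqF; last by rewrite pmulrn_lgt0// mulr_gt0.
    rewrite muleA -EFinM [(4 * _ * _)%R](_ : _ = 1); last first.
      by rewrite -mulr_natr; field; rewrite gt_eqF.
    rewrite mul1e.
    rewrite (_ : (\int[mu]_(x in S n) _)%E = (\int[mu]_(x in S n) `|(Q x - Q a)%:E|)%E); last first.
      by apply: eq_integral => x /set_mem/SH/inH x0; rewrite !Qq.
    apply: ge0_subset_integral => //.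
    - exact: mItv.
    - exact: measurable_ball.
    - apply: measurableT_comp => //; apply/measurable_EFinP; apply: measurable_funTS.
      exact: measurable_funB.
    - move=> x /Sx[x1 x2]; rewrite /ball/= distrC ger0_norm ?subr_ge0// ltrBlDl.
      by apply: (le_lt_trans x2); rewrite ltrD2l ltr_pMl// ltr1n.
  apply: (le_trans (lee_wpmul2l _ le2)); first by rewrite lee_fin.
  rewrite muleA -EFinM; apply: lee_wpmul2r; first exact: davg_ge0.
  rewrite lee_fin /K /K' /del le_eqVlt; apply/orP; left; apply/eqP.
  by field; rewrite gt_eqF//= pnatr_eq0.
have dav : davg Q a (2 * del n a) @[n --> \oo] --> 0%E.
  have dl : 2 * del n a @[n --> \oo] --> (0 : R)^'+.
    have E n : 2 * del n a = a^-1 * n.+1%:R^-1.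
      by rewrite /del !invfM !mulrA mulfV// mul1r.
    have c0 : 2 * del n a @[n --> \oo] --> (0 : R).
      rewrite (_ : (fun n => _) = (fun n => a^-1 * n.+1%:R^-1)); last exact/funext.
      rewrite -[X in _ --> X](mulr0 a^-1); apply: cvgM; first exact: cvg_cst.
      exact: cvg_harmonic.
    move=> P hP.
    have h : \forall n \near \oo, 0 < 2 * del n a -> P (2 * del n a) by exact: (c0 _ hP).
    have h2 : \forall n \near \oo, P (2 * del n a).
      by apply: filterS h => n; apply; rewrite mulr_gt0// del_gt0.
    exact: h2.
  exact: (cvg_comp _ _ dl La).
apply/subr_cvg0/norm_cvg0P.
have lim : (K'%:E * davg Q a (2 * del n a))%E @[n --> \oo] --> 0%E.
  by rewrite -[X in _ --> X](mule0 K'%:E); apply: cvgeZl.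
have lim2 : (`|I (fun x => q x * ker n a x) - q a|)%:E @[n --> \oo] --> 0%E.
  apply: (squeeze_cvge _ (cvg_cst 0%E) lim); apply: nearW => n.
  by rewrite est lee_fin normr_ge0.
by have /fine_cvgP[_ h] := lim2; exact: h.
Qed.
End Mollify.

(** * Test functions and the weak radial derivative *)

Section TestFunctions.
Context (R : realType).
Local Notation V := (E3 R).
Local Notation T := (measurableTypeR R).
Local Notation T3 := (T * T * T)%type.
Local Notation L3 := (leb3 R).
Local Notation H := (H R).
Local Notation C1 := (@Cn R R unit (fun=> 1)).
Implicit Types (n : nat) (i j : 'I_3).

Lemma Cn_Ck n (f : V -> R) : Cn (@basis3 R) n f -> Ck n f.
Proof.
elim: n f => [|n IH] f [cf h]; split => // i; have [d c] := h i.
by split => //; exact: IH.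
Qed.

Lemma coord3_continuous i : continuous (coord3 i : V -> R).
Proof.
have c1 : continuous (fst : V -> R * R) by move=> x; exact: cvg_fst.
case: i => -[|[|[|//]]] Hi x; rewrite /coord3/=.
- by apply: (continuous_comp (c1 x)); exact: cvg_fst.
- by apply: (continuous_comp (c1 x)); exact: cvg_snd.
- exact: cvg_snd.
Qed.

Lemma is_derive_coord3 i j (x : V) : is_derive x (basis3 R j) (coord3 i) (i == j)%:R.
Proof.
apply/is_derive_line.
have -> : (fun t : R => coord3 i (t *: basis3 R j + x)) =
    (fun t : R => t * (i == j)%:R + coord3 i x).
  apply/funext => t; case: i => -[|[|[|//]]] Hi; rewrite /coord3/= -val_eqE /=;
    by rewrite eq_sym.
by apply: is_derive_eq; rewrite /GRing.scale/=; ring.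
Qed.

Lemma Cn_coord3 i n : Cn (@basis3 R) n (coord3 i).
Proof.
case: n => [|n]; first by split => //; exact: coord3_continuous.
apply: (CnS (@coord3_continuous i) (fun j x => is_derive_coord3 i j x)) => j.
exact: Cn_cst.
Qed.

Let c k : 'I_3 := inord k.

Definition sqdist (x : V) : R :=
  coord3 (c 0) x * coord3 (c 0) x + coord3 (c 1) x * coord3 (c 1) x +
  coord3 (c 2) x * coord3 (c 2) x.

Lemma sqdistE (x : V) : sqdist x = enorm x ^+ 2.
Proof. by rewrite enorm_sqr /sqdist /coord3 /c !inordK// !expr2. Qed.

Lemma Cn_sqdist n : Cn (@basis3 R) n sqdist.
Proof. by apply: CnD; [apply: CnD|]; apply: CnM; exact: Cn_coord3. Qed.

Lemma is_derive_sqdist i (x : V) : is_derive x (basis3 R i) sqdist (2 * coord3 i x).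
Proof.
have d k := is_derive_coord3 (c k) i x.
have dd k := is_deriveM (d k) (d k).
apply: (is_derive_eq (is_deriveD (is_deriveD (dd 0%N) (dd 1%N)) (dd 2%N))).
rewrite /GRing.scale/= -!val_eqE /= !inordK//.
by case: i {d dd} => -[|[|[|//]]] Hi; rewrite /coord3 /c/= ?inordK//=; ring.
Qed.

Variables (th dth : R -> R) (B K : R).
Hypothesis smooth_th : forall n, C1 n th.
Hypothesis thD : forall s : R, is_derive s 1 th (dth s).
Hypothesis th0 : forall s, B <= s -> th s = 0.
Hypothesis dth0 : forall s, B <= s -> dth s = 0.
Hypothesis B0 : 0 < B.
Hypothesis thK : forall s, `|th s| <= K.
Hypothesis dthK : forall s, `|dth s| <= K.

(** The components of a radial field, whose divergence is radial. *)
Definition testf i (x : V) : R := coord3 i x * th (sqdist x).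

Lemma is_derive_testf i (x : V) : is_derive x (basis3 R i) (testf i)
  (th (enorm x ^+ 2) + 2 * coord3 i x ^+ 2 * dth (enorm x ^+ 2)).
Proof.
have d1 := is_derive_coord3 i i x; rewrite eqxx in d1.
have d2 := is_derive_scalar_comp (thD (sqdist x)) (is_derive_sqdist i x).
apply: (is_derive_eq (is_deriveM d1 d2)).
rewrite /GRing.scale/= sqdistE; ring.
Qed.

Lemma test_function_testf i : test_function (testf i).
Proof.
split=> [n|].
  by apply: Cn_Ck; apply: CnM; [exact: Cn_coord3|apply: Cn_comp => //; exact: Cn_sqdist].
pose b := B + 1; have b0 : 0 <= b by rewrite addr_ge0 ?(ltW B0).
pose J : set R := `[- b, b]%classic.
have cJ : compact ((J `*` J) `*` J) by do 2 (apply: compact_setX; last exact: segment_compact); exact: segment_compact.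
apply: (subclosed_compact (@closed_closure _ _) cJ).
have hV : hausdorff_space V by exact: norm_hausdorff.
have clJ := compact_closed hV cJ.
rewrite ((closure_id (J `*` J `*` J)).1 clJ); apply: closureS => z /= zn.
have zb : enorm z <= b.
  rewrite leNgt; apply: contra zn => bz; rewrite /testf sqdistE th0 ?mulr0//.
  have : b ^+ 2 <= enorm z ^+ 2 by rewrite ler_pXn2r ?nnegrE ?enorm_ge0 ?(ltW bz).
  by apply: le_trans; rewrite /b; move: B0 => *; nra.
have h i0 : - b <= coord3 i0 z <= b by rewrite -ler_norml (le_trans (coord3_le z i0)).
have := h (@Ordinal 3 0 isT); have := h (@Ordinal 3 1 isT); have := h (@Ordinal 3 2 isT).
by rewrite /coord3/= => h2 h1 h0; split; [split|]; rewrite /J/= in_itv.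
Qed.

(** A bounded function of bounded support is square-integrable. *)
Lemma intg3_compact (u g : T3 -> R) (a N : R) : L2 L3 setT u ->
  measurable_fun setT g -> 0 < a -> (forall z, `|g z| <= N) ->
  (forall z, a <= enorm z -> g z = 0) -> intg L3 setT (fun z => u z * g z).
Proof.
move=> hu mg a0 gN g0; apply: (L2_mulr _ hu) => //.
have N0 : 0 <= N by exact: le_trans (normr_ge0 _) (gN (0, 0, 0)).
split => //; pose h z := N ^+ 2 * \1_(eball a) z : R.
have ih1 : intg L3 setT h.
  apply: (intgZ measurableT); apply/integrableP; split.
    by apply/measurable_EFinP; apply: measurable_indic; exact: measurable_eball.
  under eq_integral do rewrite /= ger0_norm//.
  rewrite integral_indic ?setIT//; last exact: measurable_eball.
  by rewrite leb3_eball// -(fineK (unit_ball_volume_fin R)) -EFinM ltry.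
apply: (intg_le measurableT _ ih1); first exact: measurable_funX.
move=> z _; rewrite ger0_norm ?sqr_ge0// /h indicE.
have [za|za] := ltP (enorm z) a.
  rewrite mem_set// mulr1 -[leLHS]real_normK ?num_real//.
  by rewrite ler_pXn2r ?nnegrE.
by rewrite g0// expr0n mulr_ge0// sqr_ge0.
Qed.

(** Testing the weak derivatives against x_i th(|x|^2) and summing over i gives
    the weak form of the radial derivative. *)
Lemma weak_radial (f : R -> C2 R) (v : 'I_3 -> E3 R -> C2 R) (w : R -> R) (k : 'I_4) :
  sq4 (radial_ext f) -> (forall i, sq4 (v i)) ->
  (forall i, weak_partial i (radial_ext f) (v i)) -> measurable_fun H w ->
  ae3 (fun z => \sum_(i < 3) coord3 i z / enorm z * rc k (v i z) = w (enorm z)) ->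
  I (fun x => rc k (f x) * (3 * th (x ^+ 2) + 2 * x ^+ 2 * dth (x ^+ 2)) * (pc R * x ^+ 2)) =
  - I (fun x => x * w x * th (x ^+ 2) * (pc R * x ^+ 2)).
Proof.
move=> su sv wv mw hw; have k4 := ltn_ord k.
have mth : measurable_fun setT th by apply: continuous_measurable_fun; exact: Cn_cont (smooth_th 0).
have mdth : measurable_fun setT dth.
  apply: continuous_measurable_fun; rewrite (_ : dth = fun x => 'D_1 th x).
    exact: Cn_cont (Cn_D tt (smooth_th 1)).
  by apply/funext => s; have [_ ->] := thD s.
have mf := profile_meas k4 (sq4_meas su).
have m2 : measurable_fun setT (fun x : T => x ^+ 2 : T) by exact: measurable_funX.
have ms : measurable_fun [set: T3] (fun z : T3 => enorm z ^+ 2 : T).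
  exact: (measurableT_comp m2 (@measurable_enorm R)).
have mths := measurableT_comp mth ms; have mdths := measurableT_comp mdth ms.
have sB z : B + 1 <= enorm z -> B <= enorm z ^+ 2.
  move=> h; have : (B + 1) ^+ 2 <= enorm z ^+ 2.
    by rewrite ler_pXn2r ?nnegrE ?enorm_ge0 ?addr_ge0 ?(ltW B0).
  by apply: le_trans; move: B0 => *; nra.
have K0 : 0 <= K by exact: le_trans (normr_ge0 _) (thK 0).
pose g i (z : V) := th (enorm z ^+ 2) + 2 * coord3 i z ^+ 2 * dth (enorm z ^+ 2).
have B1 : 0 < B + 1 by rewrite addr_gt0.
have i1 i : intg L3 setT (fun z => rc k (radial_ext f z) * g i z).
  apply: (@intg3_compact _ _ (B + 1) (K + 2 * (B + 1) ^+ 2 * K) (su k k4)) => //.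
  - apply: measurable_funD => //; apply: measurable_funM => //; apply: measurable_funM => //.
    by apply: measurable_funX; exact: measurable_coord3.
  - move=> z; have [zB|zB] := leP (B + 1) (enorm z).
      rewrite /g th0 ?sB// dth0 ?sB// mulr0 addr0 normr0.
      by rewrite addr_ge0// mulr_ge0// mulr_ge0// sqr_ge0.
    apply: (le_trans (ler_normD _ _)); apply: lerD; first exact: thK.
    rewrite normrM; apply: ler_pM => //; rewrite normrM ger0_norm// ler_pM2l//.
    rewrite normrX ler_pXn2r ?nnegrE ?(ltW B1)//.
    exact: le_trans (coord3_le z i) (ltW zB).
  - by move=> z zB; rewrite /g th0 ?sB// dth0 ?sB// mulr0 addr0.
pose tf i (z : V) := coord3 i z * th (enorm z ^+ 2).
have i2 i : intg L3 setT (fun z => rc k (v i z) * tf i z).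
  apply: (@intg3_compact _ _ (B + 1) ((B + 1) * K) (sv i k k4)) => //.
  - by apply: measurable_funM => //; exact: measurable_coord3.
  - move=> z; have [zB|zB] := leP (B + 1) (enorm z).
      by rewrite /tf th0 ?sB// mulr0 normr0 mulr_ge0// ltW.
    rewrite normrM; apply: ler_pM => //.
    exact: le_trans (coord3_le z i) (ltW zB).
  - by move=> z zB; rewrite /tf th0 ?sB// mulr0.
have wk i : Int L3 setT (fun z => rc k (radial_ext f z) * g i z) =
    - Int L3 setT (fun z => rc k (v i z) * tf i z).
  have := wv i k (testf i) (test_function_testf i).
  rewrite (_ : (fun z => recomp k (radial_ext f z) * 'D_(basis3 R i) (testf i) z) =
    (fun z => rc k (radial_ext f z) * g i z)); last first.
    by apply/funext => z; have [_ ->] := is_derive_testf i z.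
  rewrite (_ : (fun z => recomp k (v i z) * testf i z) = (fun z => rc k (v i z) * tf i z))//.
  by apply/funext => z; rewrite /testf sqdistE.
have S : Int L3 setT (fun z => \sum_(i < 3) rc k (radial_ext f z) * g i z) =
    - Int L3 setT (fun z => \sum_(i < 3) rc k (v i z) * tf i z).
  rewrite !Int_sum//; rewrite -sumrN; apply: eq_bigr => i _; exact: wk.
transitivity (Int L3 setT (fun z => \sum_(i < 3) rc k (radial_ext f z) * g i z)).
  rewrite -(@polar_Rintegral R (fun x => rc k (f x) * (3 * th (x ^+ 2) + 2 * x ^+ 2 * dth (x ^+ 2)))); last first.
    apply: measurable_funM => //; apply: measurable_funTS; apply: measurable_funD.
      by apply: measurable_funM => //; exact: measurableT_comp.
    by apply: measurable_funM; [exact: measurable_funM|exact: measurableT_comp].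
  apply: eq_Rintegral => z _; rewrite -mulr_sumr; congr (_ * _).
  by rewrite !big_ord_recl big_ord0 /g enorm_sqr /coord3/=; ring.
rewrite S; congr (- _).
rewrite -(@polar_Rintegral R (fun x => x * w x * th (x ^+ 2))); last first.
  apply: measurable_funM; first exact: measurable_funM.
  by apply: measurable_funTS; exact: measurableT_comp.
apply: (Int_ae measurableT).
- apply: measurable_sum => i; apply: measurable_funM; first by have [] := sv i k k4.
  by apply: measurable_funM => //; exact: measurable_coord3.
- apply: (@measurable_radial R _ _ (fun x => x * w x * th (x ^+ 2))).
  apply: measurable_funM; first exact: measurable_funM.
  by apply: measurable_funTS; exact: measurableT_comp.
apply: (ae3_imp _ (ae3_and hw (@ae3_enorm R))) => z [<- z0] _.
rewrite mulr_sumr mulr_suml; apply: eq_bigr => i _; rewrite /tf.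
by field; rewrite gt_eqF.
Qed.

End TestFunctions.

(** * Absolutely continuous representatives of radial profiles *)

Section Representative.
Context (R : realType).
Local Notation mu := (leb R).
Local Notation T := (measurableTypeR R).
Local Notation H := (H R).
Implicit Types (a b c x y : R) (n : nat).

Lemma intg_mul_bnd (S : set T) (g h : R -> R) (N : R) : measurable S ->
  intg mu S g -> measurable_fun S h -> (forall x, S x -> `|h x| <= N) ->
  intg mu S (fun x => g x * h x).
Proof.
move=> mS ig mh hN.
apply: (@intg_le _ _ _ mu S mS (fun x => N * `|g x|)).
- by apply: measurable_funM mh; exact: (@intg_meas _ _ _ mu _ _ ig).
- by apply: (@intgZ _ _ _ mu _ mS); exact: (@intg_norm _ _ _ mu _ _ ig).
- by move=> x Sx; rewrite normrM mulrC ler_wpM2r// hN.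
Qed.

Lemma intg_cst_itv a b c : intg mu `[a, b] (fun=> c).
Proof.
apply: continuous_compact_integrable; first exact: segment_compact.
by apply: continuous_subspaceT => x; exact: cvg_cst.
Qed.

Lemma l2_intg (g : R -> R) a b : 0 < a -> l2 g -> intg mu `[a, b] g.
Proof.
move=> a0 [mg ig].
apply: (@intg_le _ _ _ mu _ (mItv a b) (fun x => 1 + g x ^+ 2)).
- by apply: measurable_funS mg; [exact: mH|exact: subH].
- apply: (@intgD _ _ _ mu _ (mItv a b)); first exact: intg_cst_itv.
  by apply: (intg_sub (mItv a b) (@mH R)) ig; exact: subH.
- by move=> x _; rewrite ler_norml; apply/andP; split; nra.
Qed.

Lemma aeH_ex (P : R -> Prop) a b : 0 < a -> a < b -> aeH P ->
  exists2 x, a <= x <= b & P x.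
Proof.
move=> a0 ab [N [mN N0 hN]]; apply: contrapT => nP.
pose J : set T := `[a, b]%classic.
have sub : J `<=` N.
  move=> x; rewrite /J /= in_itv/= => xab; apply: hN => /= h; apply: nP.
  exists x => //; apply: h; apply/inH; apply: (lt_le_trans a0).
  by have /andP[] := xab.
have : (mu J <= mu N)%E by apply: le_measure; rewrite ?inE//; exact: mItv.
rewrite N0 (_ : mu J = @lebesgue_measure R `[a, b]%classic)// lebesgue_measure_itv/=.
by rewrite lte_fin ab -EFinB lee_fin subr_le0 leNgt ab.
Qed.

Variables (f : R -> C2 R) (w : R -> R) (k : nat).
Let p x : R := rc k (f x).
Hypothesis lp : l2 (fun x => x * p x).
Hypothesis lw : l2 (fun x => x * w x).
Hypothesis mp : measurable_fun H p.
Hypothesis mw : measurable_fun H w.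
Hypothesis weak : forall (th dth : R -> R) (B K : R),
  (forall n, @Cn R R unit (fun=> 1) n th) -> (forall s : R, is_derive s 1 th (dth s)) ->
  (forall s, B <= s -> th s = 0) -> (forall s, B <= s -> dth s = 0) -> 0 < B ->
  (forall s, `|th s| <= K) -> (forall s, `|dth s| <= K) ->
  I (fun x => p x * (3 * th (x ^+ 2) + 2 * x ^+ 2 * dth (x ^+ 2)) * (pc R * x ^+ 2)) =
  - I (fun x => x * w x * th (x ^+ 2) * (pc R * x ^+ 2)).

(** The power x^3 collects the density x^2 and the factor x of the test field; G is
    the derivative of q if w is that of p. *)
Let q x : R := x ^+ 3 * p x.
Let G x : R := 3 * x ^+ 2 * p x + x ^+ 3 * w x.
Let Q x : R := if 0 < x then q x else 0.

Let iq a b : 0 < a -> a <= b -> intg mu `[a, b] q.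
Proof.
move=> a0 ab.
apply: (@intg_eq _ _ _ mu _ (mItv a b) (fun x => (x * p x) * x ^+ 2)).
  by move=> x _; rewrite /q; ring.
apply: (@intg_mul_bnd _ _ _ (b ^+ 2) (mItv a b)); first exact: l2_intg lp.
  by apply: measurable_funTS; apply: measurable_funX.
move=> x /=; rewrite in_itv/= => /andP[ax xb]; have x0 := lt_le_trans a0 ax.
by rewrite ger0_norm ?sqr_ge0// ler_pXn2r ?nnegrE ?(ltW x0)// (le_trans (ltW x0)).
Qed.

Let bd a b x : 0 < a -> `[a, b]%classic x -> 0 < x /\ x <= b.
Proof.
by move=> a0; rewrite /= in_itv/= => /andP[ax xb]; split => //; exact: lt_le_trans a0 ax.
Qed.

Let iG1 a b : 0 < a -> a <= b -> intg mu `[a, b] (fun x => 3 * x ^+ 2 * p x).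
Proof.
move=> a0 ab.
apply: (@intg_eq _ _ _ mu _ (mItv a b) (fun x => (x * p x) * (3 * x))).
  by move=> x _; ring.
apply: (@intg_mul_bnd _ _ _ (3 * b) (mItv a b)); first exact: l2_intg lp.
  by apply: measurable_funTS; apply: measurable_funM.
by move=> x /(bd a0)[x0 xb]; rewrite normrM !gtr0_norm// ler_pM2l.
Qed.

Let iG2 a b : 0 < a -> a <= b -> intg mu `[a, b] (fun x => x ^+ 3 * w x).
Proof.
move=> a0 ab.
apply: (@intg_eq _ _ _ mu _ (mItv a b) (fun x => (x * w x) * x ^+ 2)).
  by move=> x _; ring.
apply: (@intg_mul_bnd _ _ _ (b ^+ 2) (mItv a b)); first exact: l2_intg lw.
  by apply: measurable_funTS; apply: measurable_funX.
move=> x /(bd a0)[x0 xb].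
by rewrite ger0_norm ?sqr_ge0// ler_pXn2r ?nnegrE ?(ltW x0)// (le_trans (ltW x0)).
Qed.

Let iG a b : 0 < a -> a <= b -> intg mu `[a, b] G.
Proof. by move=> a0 ab; apply: (intgD (mItv a b) (iG1 a0 ab) (iG2 a0 ab)). Qed.

Let mQ : measurable_fun setT Q.
Proof.
rewrite (_ : Q = q \_ H); last first.
  apply/funext => x; rewrite /Q patchE; case: ifPn => x0.
    by rewrite mem_set//; exact/inH.
  by rewrite ifF//; apply/negP => /set_mem/inH; apply/negP.
by apply/(measurable_restrictT _ (@mH R)); apply: measurable_funM.
Qed.

Let locQ : locally_integrable setT Q.
Proof.
split; [exact: mQ|exact: openT|move=> C _ cC]; have [N0 [_ hN]] := compact_bounded cC.
pose N := N0 + 1; have NC x : C x -> `|x| <= N by move=> Cx; apply: hN => //; rewrite ltrDl.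
have [xC|nC] := pselect (exists x, C x); last first.
  have -> : C = set0 by apply/seteqP; split => // x Cx; apply: nC; exists x.
  by rewrite integral_set0.
have Nge : 0 <= N by case: xC => x /NC; exact: le_trans.
pose h x : R := if 0 < x then x * p x else 0.
have hE : h = (fun x => x * p x) \_ H.
  apply/funext => x; rewrite /h patchE; case: ifPn => x0.
    by rewrite mem_set//; exact/inH.
  by rewrite ifF//; apply/negP => /set_mem/inH; apply/negP.
have ih2 : mu.-integrable setT (EFin \o (fun x => h x ^+ 2)).
  rewrite (_ : EFin \o _ = (EFin \o (fun x => (x * p x) ^+ 2)) \_ H).
    by apply/(@integrable_restrict _ _ _ mu H (@mH R) setT measurableT); rewrite setTI; exact: lp.2.
  apply/funext => x /=; rewrite /h patchE; case: ifPn => x0.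
    by rewrite mem_set//; exact/inH.
  rewrite ifF ?expr0n//; apply/negP => /set_mem/inH; exact/negP.
have iQ : intg mu `[- N, N] Q.
  apply: (@intg_le _ _ _ mu _ (mItv _ _) (fun x => N ^+ 2 * (1 + h x ^+ 2))).
  - exact: measurable_funTS.
  - apply: (@intgZ _ _ _ mu _ (mItv _ _)); apply: (@intgD _ _ _ mu _ (mItv _ _)).
      exact: intg_cst_itv.
    by apply: (intg_sub (mItv _ _) measurableT) ih2.
  - move=> x /=; rewrite in_itv/= => /andP[_ xN]; rewrite /Q /h.
    case: ifP => x0; last by rewrite normr0 mulr_ge0 ?sqr_ge0// addr_ge0// sqr_ge0.
    rewrite (_ : q x = x ^+ 2 * (x * p x)); last by rewrite /q; ring.
    rewrite normrM; apply: ler_pM => //.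
      by rewrite ger0_norm ?sqr_ge0// ler_pXn2r ?nnegrE ?(ltW x0).
    by rewrite ler_norml; apply/andP; split; nra.
move/integrableP : iQ => [_]; apply: le_lt_trans.
apply: ge0_subset_integral => //.
- exact: compact_measurable.
- by apply/measurable_EFinP; apply: measurableT_comp => //; exact: measurable_funTS.
- by move=> x /NC; rewrite /= in_itv/= ler_norml.
Qed.

Let sg := @smoothstep R.
Let dsg := @dsmoothstep R.

Let step_cvg a x : 0 < a -> 0 < x ->
  sg (n.+1%:R * (x ^+ 2 - a ^+ 2)) @[n --> \oo] --> (((a < x)%R)%:R : R).
Proof.
move=> a0 x0; have [ax|xa] := ltP a x; last first.
  rewrite (_ : (fun n : nat => _) = (fun=> 0)); first exact: cvg_cst.
  apply/funext => n; apply: smoothstep0; rewrite mulr_ge0_le0// subr_le0.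
  by rewrite ler_pXn2r ?nnegrE ?(ltW x0) ?(ltW a0).
have e0 : 0 < x ^+ 2 - a ^+ 2 by rewrite subr_gt0 ltr_pXn2r ?nnegrE ?(ltW x0) ?(ltW a0).
apply: cvg_near_cst; exists (Num.truncn (x ^+ 2 - a ^+ 2)^-1) => // n /= Nn.
apply: smoothstep1; rewrite -ler_pdivrMr// mul1r.
apply: ltW; apply: (lt_le_trans (truncnS_gt _)); by rewrite ler_nat.
Qed.

(** The weak identity is tested with a smoothed indicator of [a, b]. When it is
    sharpened, its derivative concentrates at the end points and recovers the
    values of q there ([ker_lebesgue]). *)
Lemma lebesgue_increment a b : 0 < a -> a <= b -> lebesgue_pt Q a -> lebesgue_pt Q b ->
  q b - q a = Int mu `[a, b] G.
Proof.
move=> a0 ab La Lb; have b0 := lt_le_trans a0 ab.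
have [M M0 hM] := @smoothstep_bounded R.
have sgM x : `|sg x| <= M by have [] := hM x.
have dsgM x : `|dsg x| <= M by have [] := hM x.
have Qq x : 0 < x -> Q x = q x by rewrite /Q => ->.
have KL c := @ker_lebesgue R sg dsg M (@is_derive_smoothstep R) (@dsmoothstep_continuous R)
  (@smoothstep0 R) (@smoothstep1 R) (@dsmoothstep0 R) (@dsmoothstep1 R) M0 dsgM q Q c.
have [ia ca] := KL a a0 Qq mQ iq La; have [ib cb] := KL b b0 Qq mQ iq Lb.
pose st c n s := sg (n.+1%:R * (s - c ^+ 2)).
pose th n s := st a n s - st b n s.
pose dth n s := n.+1%:R * dsg (n.+1%:R * (s - a ^+ 2)) - n.+1%:R * dsg (n.+1%:R * (s - b ^+ 2)).
have Csg c n m : @Cn R R unit (fun=> 1) m (st c n).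
  apply: (@Cn_comp R R unit (fun=> 1) m sg); first exact: Cn_smoothstep.
  by apply: CnM; [exact: Cn_cst|apply: CnD; [exact: C1_id|exact: Cn_cst]].
have Cth n m : @Cn R R unit (fun=> 1) m (th n).
  rewrite (_ : th n = fun s => st a n s + (-1) * st b n s); last first.
    by apply/funext => s; rewrite mulN1r.
  by apply: CnD => //; apply: CnM => //; exact: Cn_cst.
have Dst c n (s : R) : is_derive s 1 (st c n) (n.+1%:R * dsg (n.+1%:R * (s - c ^+ 2))).
  have d1 : is_derive s 1 (fun s : R => n.+1%:R * (s - c ^+ 2)) n.+1%:R.
    by apply: is_derive_eq; rewrite /GRing.scale/=; ring.
  have d2 := @is_derive1_comp R sg (fun s : R => n.+1%:R * (s - c ^+ 2)) s _ _
    (is_derive_smoothstep _) d1.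
  by apply: (is_derive_eq d2); rewrite mulrC.
have Dth n (s : R) : is_derive s 1 (th n) (dth n s).
  exact: (is_deriveB (Dst a n s) (Dst b n s)).
have big c n s : c ^+ 2 + 1 <= s -> 1 <= n.+1%:R * (s - c ^+ 2).
  move=> h; have h1 : 1 <= s - c ^+ 2 by lra.
  by rewrite -[leLHS]mul1r ler_pM// ler1n.
have ab2 : a ^+ 2 <= b ^+ 2 by rewrite ler_pXn2r ?nnegrE ?(ltW a0) ?(ltW b0).
have biga n s : b ^+ 2 + 1 <= s -> 1 <= n.+1%:R * (s - a ^+ 2).
  by move=> h; apply: big; apply: le_trans h; rewrite lerD2r.
have th0 n s : b ^+ 2 + 1 <= s -> th n s = 0.
  by move=> h; rewrite /th /st /sg (smoothstep1 (biga n s h)) (smoothstep1 (big b n s h)) subrr.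
have dth0 n s : b ^+ 2 + 1 <= s -> dth n s = 0.
  by move=> h; rewrite /dth /dsg (dsmoothstep1 (biga n s h)) (dsmoothstep1 (big b n s h)) subrr.
have thM n s : `|th n s| <= 2 * M.
  by rewrite mulr_natl mulr2n; apply: (le_trans (ler_normB _ _)); apply: lerD; exact: sgM.
have thK n s : `|th n s| <= 2 * (n.+1%:R * M).
  by apply: (le_trans (thM n s)); rewrite ler_pM2l// -[leLHS]mul1r ler_pM2r// ler1n.
have dthK n s : `|dth n s| <= 2 * (n.+1%:R * M).
  rewrite mulr_natl mulr2n; apply: (le_trans (ler_normB _ _)); apply: lerD;
    by rewrite normrM (ger0_norm (ler0n _ _)) ler_pM2l.
have B0 : 0 < b ^+ 2 + 1 by rewrite ltr_wpDl// sqr_ge0.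
(* The n-th indicator vanishes beyond b + 1, since (b + 1)^2 >= b^2 + 1 and the
   step is complete after an increase of 1 / (n + 1) of the square. *)
pose c := b + 1; have ac : a <= c by rewrite (le_trans ab)// lerDl.
pose S := `[a, c]%classic : set T.
have SH : S `<=` H by exact: subH.
have offS n x : 0 < x -> ~ S x -> th n (x ^+ 2) = 0.
  move=> x0 Sx; have [xa|ax] := leP x a.
    have h d : x <= d -> st d n (x ^+ 2) = 0.
      move=> xd; apply: smoothstep0; rewrite mulr_ge0_le0// subr_le0.
      by rewrite ler_pXn2r ?nnegrE ?(ltW x0)// (le_trans (ltW x0)).
    by rewrite /th !h ?subrr// (le_trans xa).
  apply: th0; have xc : c < x.
    by rewrite ltNge; apply/negP => xc; apply: Sx; rewrite /S/= in_itv/= (ltW ax).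
  by rewrite /c in xc; nra.
have mst n : measurable_fun setT (fun x : T => th n (x ^+ 2)).
  apply: (@measurableT_comp _ _ _ _ _ _ (th n)).
    by apply: continuous_measurable_fun; exact: Cn_cont (Cth n 0%N).
  exact: measurable_funX.
have mG : measurable_fun H G.
  have mx i : measurable_fun H (fun x : T => x ^+ i) by apply: measurable_funTS; apply: measurable_funX.
  by apply: measurable_funD; apply: measurable_funM => //; apply: measurable_funM.
have hS n (g : R -> R) : intg mu S g -> ih (fun x => g x * th n (x ^+ 2)).
  move=> ig.
  have h1 : intg mu S (fun x => g x * th n (x ^+ 2)).
    apply: (@intg_mul_bnd _ _ _ (2 * M) (mItv _ _)) => //.
    exact: measurable_funTS.
  have h2 x : 0 < x -> ~ S x -> g x * th n (x ^+ 2) = 0.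
    by move=> x0 Sx; rewrite offS// mulr0.
  by have [] := I_support (mItv _ _) SH h2 h1.
have id1 n : I (fun x => q x * ker dsg n a x) - I (fun x => q x * ker dsg n b x) =
    - I (fun x => G x * th n (x ^+ 2)).
  have := weak (Cth n) (Dth n) (th0 n) (dth0 n) B0 (thK n) (dthK n).
  have i3 : ih (fun x => 3 * x ^+ 2 * p x * th n (x ^+ 2)) by apply: hS; exact: iG1.
  have i4 : ih (fun x => x ^+ 3 * w x * th n (x ^+ 2)) by apply: hS; exact: iG2.
  have E1 : I (fun x => p x * (3 * th n (x ^+ 2) + 2 * x ^+ 2 * dth n (x ^+ 2)) * (pc R * x ^+ 2)) =
     pc R * (I (fun x => q x * ker dsg n a x) - I (fun x => q x * ker dsg n b x) +
       I (fun x => 3 * x ^+ 2 * p x * th n (x ^+ 2))).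
    rewrite -IB// -ID//; last exact: ihB.
    rewrite -IZ; last by apply: ihD => //; exact: ihB.
    by apply: I_eq => x x0; rewrite /q /ker /dth; ring.
  have E2 : I (fun x => x * w x * th n (x ^+ 2) * (pc R * x ^+ 2)) =
     pc R * I (fun x => x ^+ 3 * w x * th n (x ^+ 2)).
    by rewrite -IZ//; apply: I_eq => x x0; ring.
  rewrite E1 E2 -mulrN => /(mulfI (lt0r_neq0 (pc_gt0 R))) E3.
  have -> : I (fun x => G x * th n (x ^+ 2)) =
    I (fun x => 3 * x ^+ 2 * p x * th n (x ^+ 2)) + I (fun x => x ^+ 3 * w x * th n (x ^+ 2)).
    by rewrite -ID//; apply: I_eq => x x0; rewrite /G; ring.
  by move: E3; lra.
(* The smoothed indicators tend pointwise to that of ]a, b]. *)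
pose lim x := G x * ((a < x)%R%:R - (b < x)%R%:R).
have mlim : measurable_fun H lim.
  have ind d : measurable_fun H (fun x : T => (d < x)%R%:R : R).
    rewrite (_ : (fun _ => _) = \1_(`]d, +oo[%classic : set T)).
      by apply: measurable_funTS; apply: measurable_indic; exact: measurable_itv.
    by apply/funext => x; rewrite indicE mem_setE in_itv/= andbT.
  by apply: measurable_funM => //; exact: measurable_funB.
have cG : I (fun x => G x * th n (x ^+ 2)) @[n --> \oo] --> I lim.
  apply: (@I_dominated _ _ _ (fun x => 2 * M * `|G x| * \1_S x)) => //.
  - by move=> n; apply: measurable_funM => //; exact: measurable_funTS.
  - have h1 : intg mu S (fun x => 2 * M * `|G x| * \1_S x).
      apply: (@intg_eq _ _ _ mu _ (mItv _ _) (fun x => 2 * M * `|G x|)).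
        by move=> x Sx; rewrite indicE mem_set// mulr1.
      apply: (@intgZ _ _ _ mu _ (mItv _ _)).
      by apply: (@intg_norm _ _ _ mu _ G); exact: iG.
    have h2 x : 0 < x -> ~ S x -> 2 * M * `|G x| * \1_S x = 0.
      by move=> _ Sx; rewrite indicE memNset ?mulr0.
    by have [] := I_support (mItv _ _) SH h2 h1.
  - move=> n x x0; rewrite indicE; have [Sx|Sx] := pselect (S x).
      by rewrite mem_set// mulr1 normrM mulrC ler_wpM2r.
    by rewrite offS// mulr0 normr0 !mulr_ge0// ltW.
  - move=> x x0; apply: cvgM; first exact: cvg_cst.
    by apply: cvgB; exact: step_cvg.
have E : I lim = Int mu `[a, b] G.
  pose O := `]a, b]%classic : set T.
  have mO : measurable O by exact: measurable_itv.
  have Ox x : O x -> a < x /\ x <= b by rewrite /O/= in_itv/= => /andP[].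
  have iO : intg mu O G.
    apply: (intg_sub mO (mItv a b)); last exact: iG.
    by move=> x /Ox[h1 h2]; rewrite /= in_itv/= h2 ltW.
  have limO x : O x -> G x = lim x.
    by move=> /Ox[h1 h2]; rewrite /lim h1 ltNge h2 subr0 mulr1.
  have iO2 : intg mu O lim by apply: (@intg_eq _ _ _ mu _ mO G).
  have OH : O `<=` H by move=> x /Ox[h1 _]; apply/inH; exact: lt_trans a0 h1.
  have off x : 0 < x -> ~ O x -> lim x = 0.
    move=> x0 Onx; rewrite /lim; have [h1|h1] := ltP a x; last first.
      by rewrite ltNge (le_trans h1 ab) subrr mulr0.
    have [h2|h2] := ltP b x; first by rewrite subrr mulr0.
    by exfalso; apply: Onx; rewrite /O/= in_itv/= h1 h2.
  have [_ ->] := I_support mO OH off iO2.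
  rewrite -(@Int_eq _ _ _ mu O _ _ limO) /Int /O.
  rewrite -Rintegral_itv_obnd_cbnd//.
have l1 : I (fun x => q x * ker dsg n a x) - I (fun x => q x * ker dsg n b x) @[n --> \oo]
   --> q a - q b by exact: cvgB.
have l2' : - I (fun x => G x * th n (x ^+ 2)) @[n --> \oo] --> - Int mu `[a, b] G.
  by rewrite -E; exact: cvgN.
have l3 : (fun n => I (fun x => q x * ker dsg n a x) - I (fun x => q x * ker dsg n b x)) =
   (fun n => - I (fun x => G x * th n (x ^+ 2))) by apply/funext => n; exact: id1.
rewrite l3 in l1; have := cvg_unique _ l1 l2' => /(_ (@Rhausdorff R)) e.
by rewrite -[RHS]opprK -e opprB.
Qed.

(** Almost every point is a Lebesgue point of q. Starting from one of them, the
    primitive of G agrees with q at all the others, and division by x^3 gives the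
    representative of p. *)
Lemma radial_representative : exists P P', [/\ abscont P P',
  aeH (fun x => P x = p x) & aeH (fun x => P' x = w x)].
Proof.
have ae0 := lebesgue_differentiation locQ.
have ae1 : aeH (fun x => lebesgue_pt Q x).
  exact: (@filterS _ (nbhs (almost_everywhere mu)) (ae_filter_ringOfSetsType mu)
    _ _ (fun x h _ => h) ae0).
have [px /andP[px1 _] Lp] := aeH_ex ltr01 (ltr1n R 2) ae1.
have px0 : 0 < px by exact: lt_le_trans ltr01 px1.
have [V aV VE] := @abscont_primitive R px (q px) G px0 iG.
have Vq x : 0 < x -> lebesgue_pt Q x -> V x = q x.
  move=> x0 Lx; rewrite VE//; have [h|h] := leP px x.
    by rewrite -(lebesgue_increment px0 h Lp Lx) addrC subrK.
  by rewrite -(lebesgue_increment x0 (ltW h) Lx Lp); ring.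
have aX : abscont (fun x : R => x^-1 ^+ 3) (fun x => - 3 * x^-1 ^+ 4).
  apply: abscont_C1 => x x0; have xn : x != 0 by rewrite gt_eqF.
    have dV : is_derive x 1 (fun x : R => x^-1) (- x^-1 ^+ 2).
      have := @is_deriveV R id x 1 1 xn (is_derive_id x 1).
      by move=> h; apply: (is_derive_eq h); rewrite /GRing.scale/= mulr1 exprVn.
    have h : is_derive x 1 (fun y : R => y^-1 * (y^-1 * y^-1))
      (x^-1 * (x^-1 * - x^-1 ^+ 2 + x^-1 * - x^-1 ^+ 2) + x^-1 * x^-1 * - x^-1 ^+ 2).
      exact: (is_deriveM dV (is_deriveM dV dV)).
    rewrite (_ : (fun y : R => y^-1 ^+ 3) = (fun y : R => y^-1 * (y^-1 * y^-1))).
      by apply: (is_derive_eq h); rewrite /GRing.scale/=; ring.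
    by apply/funext => y; rewrite !exprS expr0 mulr1.
  apply: cvgM; first exact: cvg_cst.
  apply: (@continuous_comp _ _ _ (fun y : R => y^-1) (fun y : R => y ^+ 4)); last exact: exprn_continuous.
  exact: inv_continuous.
exists (fun x => V x * x^-1 ^+ 3), (fun x => G x * x^-1 ^+ 3 + V x * (- 3 * x^-1 ^+ 4)).
split; first exact: abscontM.
- by apply: (aeH_imp _ ae1) => x x0 Lx; rewrite Vq// /q; field; rewrite gt_eqF.
- by apply: (aeH_imp _ ae1) => x x0 Lx; rewrite Vq// /q /G; field; rewrite gt_eqF.
Qed.

End Representative.

(** * Real components of the equation *)

Section ComplexMeasurable.
Context (R : realType).
Local Notation T := (measurableTypeR R).
Local Notation H := (H R).
Local Notation ReC := (@complex.Re R).
Local Notation ImC := (@complex.Im R).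

Definition cmeas (F : R -> R[i]) : Prop :=
  measurable_fun H (fun x : T => ReC (F x) : T) /\ measurable_fun H (fun x : T => ImC (F x) : T).

Lemma cmeas_eq (F G : R -> R[i]) : (forall x, F x = G x) -> cmeas F -> cmeas G.
Proof. by move=> h; rewrite (funext h). Qed.

Lemma cmeas_cst c : cmeas (fun=> c). Proof. by split. Qed.

Lemma cmeasD (F G : R -> R[i]) : cmeas F -> cmeas G -> cmeas (fun x => F x + G x).
Proof.
move=> [a b] [c d]; split.
  rewrite (_ : (fun x => _) = (fun x => ReC (F x) + ReC (G x))); first exact: measurable_funD.
  by apply/funext => x; case: (F x) (G x) => [? ?] [? ?].
rewrite (_ : (fun x => _) = (fun x => ImC (F x) + ImC (G x))); first exact: measurable_funD.
by apply/funext => x; case: (F x) (G x) => [? ?] [? ?].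
Qed.

Lemma cmeasM (F G : R -> R[i]) : cmeas F -> cmeas G -> cmeas (fun x => F x * G x).
Proof.
move=> [a b] [c d]; split.
  rewrite (_ : (fun x => _) = (fun x => ReC (F x) * ReC (G x) - ImC (F x) * ImC (G x))).
    by apply: measurable_funB; exact: measurable_funM.
  by apply/funext => x; case: (F x) (G x) => [? ?] [? ?].
rewrite (_ : (fun x => _) = (fun x => ReC (F x) * ImC (G x) + ImC (F x) * ReC (G x))).
  by apply: measurable_funD; exact: measurable_funM.
by apply/funext => x; case: (F x) (G x) => [? ?] [? ?].
Qed.

Lemma cmeasX (F : R -> R[i]) n : cmeas F -> cmeas (fun x => F x ^+ n).
Proof.
move=> hF; elim: n => [|n IH]; first by apply: cmeas_eq (cmeas_cst 1) => x; rewrite expr0.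
by apply: cmeas_eq (cmeasM hF IH) => x; rewrite exprS.
Qed.

Lemma cmeas_conj (F : R -> R[i]) : cmeas F -> cmeas (fun x => ((F x)^*)%C).
Proof.
move=> [a b]; split.
  by rewrite (_ : (fun x => _) = (fun x => ReC (F x)))//; apply/funext => x; case: (F x).
rewrite (_ : (fun x => _) = (fun x => - ImC (F x))); first exact: measurableT_comp.
by apply/funext => x; case: (F x).
Qed.

Lemma cmeas_sum (I : Type) (r : seq I) (P : pred I) (F : I -> R -> R[i]) :
  (forall i, P i -> cmeas (F i)) -> cmeas (fun x => \sum_(i <- r | P i) F i x).
Proof.
move=> h; elim: r => [|i r IH].
  by apply: cmeas_eq (cmeas_cst 0) => x; rewrite big_nil.
have [Pi|Pi] := boolP (P i).
  by apply: cmeas_eq (cmeasD (h i Pi) IH) => x; rewrite big_cons Pi.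
by apply: cmeas_eq IH => x; rewrite big_cons (negbTE Pi).
Qed.

Lemma cmeas_pure_power (W : R[i] -> R[i] -> R[i]) (F G : R -> R[i]) :
  pure_power_poly W -> cmeas F -> cmeas G -> cmeas (fun x => W (F x) (G x)).
Proof.
move=> [d [c hW]] hF hG; apply: (cmeas_eq (fun x => esym (hW (F x) (G x)))).
do 3 (apply: cmeas_sum => ? _); apply: cmeas_sum => ? _.
apply: cmeasM; last by apply: cmeasX; exact: cmeas_conj.
apply: cmeasM; last exact: cmeasX.
apply: cmeasM; last by apply: cmeasX; exact: cmeas_conj.
by apply: cmeasM; [exact: cmeas_cst|exact: cmeasX].
Qed.

Lemma zc_rc (z : C2 R) : zc 0 (fun j => rc j z) = z.1 /\ zc 2 (fun j => rc j z) = z.2.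
Proof. by case: z => [[a b] [c d]]. Qed.

Lemma wfun_meas (W1 W2 : R[i] -> R[i] -> R[i]) k (f : R -> C2 R) :
  pure_power_poly W1 -> pure_power_poly W2 ->
  (forall j, (j < 4)%N -> measurable_fun H (fun x : T => rc j (f x) : T)) ->
  measurable_fun H (fun x : T => wfun W1 W2 k (fun j => rc j (f x)) : T).
Proof.
move=> h1 h2 mf.
have c0 : cmeas (fun x => zc 0 (fun j => rc j (f x))).
  by split; [exact: (mf 0%N isT)|exact: (mf 1%N isT)].
have c2 : cmeas (fun x => zc 2 (fun j => rc j (f x))).
  by split; [exact: (mf 2%N isT)|exact: (mf 3%N isT)].
have [a1 b1] := cmeas_pure_power h1 c0 c2; have [a2 b2] := cmeas_pure_power h2 c0 c2.
case: k => [|[|[|k]]] /=; [exact: measurableT_comp|exact: a1|exact: b2|exact: measurableT_comp].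
Qed.

End ComplexMeasurable.

Section AtTime.
Context (R : realType).
Local Notation mu := (leb R).
Local Notation T := (measurableTypeR R).
Local Notation T3 := (T * T * T)%type.
Local Notation H := (H R).
Local Notation L3 := (leb3 R).

Lemma abscont_continuous (f f' : R -> R) x : abscont f f' -> 0 < x -> {for x, continuous f}.
Proof.
move=> hf x0; have x2 : x / 2 < x * 2 by lra.
have h := abscont_within hf (divr_gt0 x0 (ltr0n _ 2)) (ltW x2).
have [+ _ _] := (continuous_within_itvP f x2).1 h.
by apply; rewrite in_itv/=; apply/andP; split; lra.
Qed.

(** A continuous function cannot exceed its almost everywhere bound at a point. *)
Lemma abscont_ae_bound (f f' : R -> R) d : abscont f f' ->
  aeH (fun x => `|f x| <= d) -> forall x, 0 < x -> `|f x| <= d.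
Proof.
move=> hf hd x x0; rewrite leNgt; apply/negP => dx.
have cf : `|f y| @[y --> x] --> `|f x|.
  by apply: cvg_norm; exact: abscont_continuous hf x0.
have [e /= e0 he] := cvgr_gt _ cf _ dx.
have xe : x < x + e / 2 by lra.
have [y /andP[y1 y2] yd] := aeH_ex x0 xe hd.
have : d < `|f y|.
  by apply: he; rewrite /ball_/= distrC ger0_norm ?subr_ge0//; lra.
by rewrite ltNge yd.
Qed.

Lemma rc_radial_deriv k (u : E3 R -> C2 R) z :
  rc k (radial_deriv u z) = \sum_(i < 3) coord3 i z / enorm z * rc k (partial i u z).
Proof.
rewrite /radial_deriv !big_ord_recl !big_ord0.
case: (partial _ u z) => [[a1 a2] [a3 a4]]; case: (partial _ u z) => [[b1 b2] [b3 b4]].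
case: (partial _ u z) => [[c1 c2] [c3 c4]].
by case: k => [|[|[|[|k]]]]; rewrite /rc/= ?nth_nil; ring.
Qed.

Lemma dirac_components (W1 W2 : R[i] -> R[i] -> R[i]) (m c : R) (d rd z : C2 R) :
  ('i)%C * d.1 = rd.2 + (c%:C)%C * z.2 + (m%:C)%C * z.1 - W1 z.1 z.2 ->
  ('i)%C * d.2 = - rd.1 - (m%:C)%C * z.2 + W2 z.1 z.2 ->
  let wf k := wfun W1 W2 k (fun j => rc j z) in
  [/\ rc 0 rd = rc 3 d - m * rc 2 z - wf 3%N,
      rc 1 rd = - rc 2 d - m * rc 3 z + wf 2%N,
      rc 2 rd = - rc 1 d - c * rc 2 z - m * rc 0 z + wf 1%N &
      rc 3 rd = rc 0 d - c * rc 3 z - m * rc 1 z - wf 0%N].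
Proof.
move=> e1 e2 wf; have [z1 z2] := zc_rc z; move: e1 e2; rewrite {}/wf /wfun z1 z2 {z1 z2}.
case: (W1 z.1 z.2) (W2 z.1 z.2) => [p1 p2] [q1 q2].
case: d rd z => [[d0 d1] [d2 d3]] [[r0 r1] [r2 r3]] [[y0 y1] [y2 y3]].
move=> /eqP; rewrite eq_complex /= => /andP[/eqP h1 /eqP h2].
move=> /eqP; rewrite eq_complex /= => /andP[/eqP h3 /eqP h4].
by rewrite /rc /=; split; lra.
Qed.

(** The radial derivative, solved from the equation in terms of the profile f and
    the profile d of the time derivative. *)
Definition slope (W1 W2 : R[i] -> R[i] -> R[i]) (m : R) (f : R -> C2 R) (d : nat -> R -> R)
    (k : nat) (x : R) : R :=
  let z j := rc j (f x) in let wf k := wfun W1 W2 k z in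
  match k with
  | 0%N => d 3%N x - m * z 2%N - wf 3%N
  | 1%N => - d 2%N x - m * z 3%N + wf 2%N
  | 2%N => - d 1%N x - 2 / x * z 2%N - m * z 0%N + wf 1%N
  | _ => d 0%N x - 2 / x * z 3%N - m * z 1%N - wf 0%N
  end.

Lemma H1norm_le (u : E3 R -> C2 R) (e : R) : 0 <= e -> (H1norm u <= e%:E)%E ->
  (L2norm u `^ 2 <= (e ^+ 2)%:E)%E /\
  (\sum_(i < 3) L2norm (partial i u) `^ 2 <= (e ^+ 2)%:E)%E.
Proof.
move=> e0; rewrite /H1norm; set A := (_ + _)%E => hA.
have p0 (x : \bar R) : (0 <= x `^ 2)%E by exact: poweR_ge0.
have s0 : (0 <= \sum_(i < 3) L2norm (partial i u) `^ 2)%E by apply: sume_ge0 => i _.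
have A0 : (0 <= A)%E by rewrite adde_ge0.
have AE : (A <= (e ^+ 2)%:E)%E.
  have -> : A = ((A `^ 2^-1) `^ 2)%E by rewrite -poweRrM mulVf// poweRe1.
  rewrite -powR_mulrn// -poweR_EFin gt0_ler_poweR// in_itv/=.
    by rewrite leey poweR_ge0.
  by rewrite lee_fin e0 leey.
by split; apply: (le_trans _ AE); rewrite /A ?leeDl ?leeDr.
Qed.

Lemma Linfnorm_le (u : E3 R -> C2 R) (e : R) : (Linfnorm u <= e%:E)%E ->
  ae3 (fun z => spnorm (u z) <= e).
Proof.
rewrite /Linfnorm unlock /Lnorm.
have -> : (0 < leb3 R [set: T3])%E.
  apply: (@lt_le_trans _ _ (leb3 R (eball 1))); first exact: unit_ball_volume_gt0.
  by apply: le_measure; rewrite ?inE//; exact: measurable_eball.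
move=> /ess_sup_inf.ess_supP; apply: ae3_imp => z /=.
by rewrite lee_fin ger0_norm// sqrtr_ge0.
Qed.

End AtTime.

(** * The profile at a fixed time *)

Section Snapshot.
Context (R : realType).
Local Notation mu := (leb R).
Local Notation T := (measurableTypeR R).
Local Notation T3 := (T * T * T)%type.
Local Notation H := (H R).
Local Notation L3 := (leb3 R).
Variables (m : R) (W1 W2 : R[i] -> R[i] -> R[i]).
Hypothesis hW1 : pure_power_poly W1.
Hypothesis hW2 : pure_power_poly W2.
Variable Kw : R.
Hypothesis hKw : cubic (wfun W1 W2) Kw.

(** The factor 1 + 1/pc dominates the square root of 1/pc that comes from the area
    of the sphere; the 2 accounts for the two terms of (x P)' = P + x P'. *)
Definition polar_loss : R := 2 * (1 + (pc R)^-1).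
Local Notation Kp := polar_loss.

Let pc0 : 0 < pc R. Proof. exact: pc_gt0. Qed.

Lemma root_le (n e : R) : 0 <= n -> 0 <= e -> pc R * n ^+ 2 <= e ^+ 2 -> n <= (1 + (pc R)^-1) * e.
Proof.
move=> n0 e0 h; have i0 : 0 < (pc R)^-1 by rewrite invr_gt0.
rewrite -(@ler_pXn2r _ 2)// ?nnegrE ?mulr_ge0 ?addr_ge0 ?(ltW i0)//.
have h2 : n ^+ 2 <= (pc R)^-1 * e ^+ 2 by rewrite ler_pdivlMl.
apply: (le_trans h2); rewrite exprMn ler_wpM2r ?sqr_ge0//.
by move: (pc R)^-1 i0 => c c0; nra.
Qed.

Variables (f : R -> C2 R) (du : E3 R -> C2 R) (d : nat -> R -> R) (e : R).
Hypothesis e0 : 0 < e.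
Hypothesis hf : inH1 (radial_ext f).
Hypothesis hN : (H1Linfnorm (radial_ext f) <= e%:E)%E.
Hypothesis md : forall k, (k < 4)%N -> measurable_fun H (d k).
Hypothesis hd : forall k, (k < 4)%N -> ae3 (fun z => rc k (du z) = d k (enorm z)).
Hypothesis ldu : sq4 du.
Hypothesis heq : {ae leb3 R, forall x : E3 R,
      let z := radial_ext f x in
      ('i)%C * (du x).1 =
        (radial_deriv (radial_ext f) x).2 + ((2 / enorm x)%:C)%C * z.2
        + (m%:C)%C * z.1 - W1 z.1 z.2 /\
      ('i)%C * (du x).2 =
        - (radial_deriv (radial_ext f) x).1 - (m%:C)%C * z.2 + W2 z.1 z.2}.

Let p k x := rc k (f x).
Let v i := partial i (radial_ext f).
Let w := slope W1 W2 m f d.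

Let vP i : inL2 (v i) /\ weak_partial i (radial_ext f) (v i).
Proof.
apply: (@xgetPex _ (fun=> (0, 0)) [set g | inL2 g /\ weak_partial i (radial_ext f) g]).
by have [g h1 h2] := hf.2 i; exists g.
Qed.

Let su : sq4 (radial_ext f). Proof. exact: inL2_sq4 hf.1. Qed.
Let sv i : sq4 (v i). Proof. exact: inL2_sq4 (vP i).1. Qed.

Let mp k : (k < 4)%N -> measurable_fun H (p k).
Proof. by move=> k4; exact: profile_meas (sq4_meas su). Qed.

Let mw k : measurable_fun H (w k).
Proof.
have mf k0 : measurable_fun H (fun x : T => wfun W1 W2 k0 (fun j => rc j (f x)) : T).
  by apply: wfun_meas => // j; exact: mp.
have minv : measurable_fun H (fun x : T => x^-1 : T).
  exact: abscont_meas (@abscont_invx R).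
have m2 k0 : (k0 < 4)%N -> measurable_fun H (fun x : T => 2 / x * p k0 x : T).
  by move=> k4; apply: measurable_funM; [exact: measurable_funM|exact: mp].
have mm k0 : (k0 < 4)%N -> measurable_fun H (fun x : T => m * p k0 x : T).
  by move=> k4; apply: measurable_funM => //; exact: mp.
have mN k0 : (k0 < 4)%N -> measurable_fun H (fun x : T => - d k0 x : T).
  by move=> k4; apply: measurableT_comp => //; exact: md.
have mB (g h : T -> R) : measurable_fun H (g : T -> T) -> measurable_fun H (h : T -> T) ->
    measurable_fun H (fun x : T => g x - h x : T) by exact: measurable_funB.
have mD (g h : T -> R) : measurable_fun H (g : T -> T) -> measurable_fun H (h : T -> T) ->
    measurable_fun H (fun x : T => g x + h x : T) by exact: measurable_funD.
have m0 := md (isT : (0 < 4)%N); have m3 := md (isT : (3 < 4)%N).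
rewrite /w; case: k => [|[|[|k]]]; rewrite /slope.
- exact: (mB _ _ (mB _ _ m3 (mm 2%N isT)) (mf 3%N)).
- exact: (mD _ _ (mB _ _ (mN 2%N isT) (mm 3%N isT)) (mf 2%N)).
- exact: (mD _ _ (mB _ _ (mB _ _ (mN 1%N isT) (m2 2%N isT)) (mm 0%N isT)) (mf 1%N)).
- exact: (mB _ _ (mB _ _ (mB _ _ m0 (m2 3%N isT)) (mm 1%N isT)) (mf 0%N)).
Qed.

Let hw k : (k < 4)%N ->
  ae3 (fun z => \sum_(i < 3) coord3 i z / enorm z * rc k (v i z) = w k (enorm z)).
Proof.
move=> k4.
apply: (ae3_imp _ (ae3_and heq (ae3_and (ae3_and (hd (isT : (0 < 4)%N)) (hd (isT : (1 < 4)%N)))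
   (ae3_and (hd (isT : (2 < 4)%N)) (hd (isT : (3 < 4)%N)))))).
move=> z [[q1 q2] [[d0 d1] [d2 d3]]].
rewrite -rc_radial_deriv.
have [r0 r1 r2 r3] := dirac_components q1 q2.
rewrite /w /slope -d0 -d1 -d2 -d3.
by case: k k4 => [|[|[|[|k]]]] // _.
Qed.

Let hNN : (H1norm (radial_ext f) <= e%:E)%E /\ (Linfnorm (radial_ext f) <= e%:E)%E.
Proof. by move: hN; rewrite /H1Linfnorm ge_max => /andP. Qed.

Let lp k : (k < 4)%N -> l2 (fun x => x * p k x) /\ pc R * nm (fun x => x * p k x) ^+ 2 <= e ^+ 2.
Proof.
move=> k4; apply: radial_nm_le; first exact: mp.
apply: (le_trans (comp_integral_le k4 (sq4_meas su))).
by have [] := H1norm_le (ltW e0) hNN.1.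
Qed.

Let cs3 (a b : 'I_3 -> R) : \sum_i a i ^+ 2 = 1 ->
  (\sum_i a i * b i) ^+ 2 <= \sum_i b i ^+ 2.
Proof.
rewrite !big_ord_recl !big_ord0 !addr0.
move: (a _) (a _) (a _) (b _) (b _) (b _) => a0 a1 a2 b0 b1 b2 E.
rewrite -[leRHS]mul1r -E -subr_ge0.
have -> : (a2 ^+ 2 + (a1 ^+ 2 + a0 ^+ 2)) * (b2 ^+ 2 + (b1 ^+ 2 + b0 ^+ 2)) -
   (a2 * b2 + (a1 * b1 + a0 * b0)) ^+ 2 =
   (a0 * b1 - a1 * b0) ^+ 2 + (a0 * b2 - a2 * b0) ^+ 2 + (a1 * b2 - a2 * b1) ^+ 2 by ring.
by rewrite !addr_ge0// sqr_ge0.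
Qed.

(** The radial derivative is the component of the gradient in the direction of the
    unit vector x / |x|, so the inequality of Cauchy and Schwarz in R^3 bounds
    it. *)
Let lw k : (k < 4)%N -> l2 (fun x => x * w k x) /\ pc R * nm (fun x => x * w k x) ^+ 2 <= e ^+ 2.
Proof.
move=> k4; apply: radial_nm_le; first exact: mw.
have [_ hs] := H1norm_le (ltW e0) hNN.1; apply: le_trans hs.
have -> : (\sum_(i < 3) L2norm (partial i (radial_ext f)) `^ 2 =
    \int[L3]_z \sum_(i < 3) (spnorm (v i z) ^+ 2)%:E)%E.
  rewrite ge0_integral_sum//.
  - by apply: eq_bigr => i _; rewrite L2norm_on_sqr.
  - by move=> i; apply: measurable_spnorm_sqr; exact: sq4_meas (sv i).
  - by move=> i z _; rewrite lee_fin sqr_ge0.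
apply: ae_ge0_le_integral => //.
- by move=> z _; rewrite lee_fin sqr_ge0.
- apply: (@measurable_radial R _ _ (fun x : T => ((w k x) ^+ 2)%:E)).
  by apply/measurable_EFinP; apply: measurable_funX; exact: mw.
- by move=> z _; apply: sume_ge0 => i _; rewrite lee_fin sqr_ge0.
- by apply: emeasurable_sum => i; apply: measurable_spnorm_sqr; exact: sq4_meas (sv i).
- apply: (ae3_imp _ (ae3_and (hw k4) (@ae3_enorm R))) => z [<- z0] _.
  rewrite sumEFin lee_fin.
  apply: (@le_trans _ _ (\sum_(i < 3) rc k (v i z) ^+ 2)).
    apply: cs3; rewrite -[RHS](@divff _ (enorm z ^+ 2)) ?expf_neq0 ?gt_eqF//.
    rewrite [X in _ = X / _]enorm_sqr !big_ord_recl big_ord0 /coord3/= !expr_div_n.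
    by rewrite addr0 -!mulrDl addrA.
  apply: ler_sum => i _; rewrite -[leLHS]real_normK ?num_real//.
  by rewrite ler_sqr ?nnegrE ?spnorm_ge0//; exact: rc_le.
Qed.

Let rep : exists P P' : nat -> R -> R, forall k, (k < 4)%N ->
  [/\ abscont (P k) (P' k), aeH (fun x => P k x = p k x) & aeH (fun x => P' k x = w k x)].
Proof.
have h k : exists PP : (R -> R) * (R -> R), (k < 4)%N ->
   [/\ abscont PP.1 PP.2, aeH (fun x => PP.1 x = p k x) & aeH (fun x => PP.2 x = w k x)].
  have [k4|k4] := ltnP k 4; last first.
    by exists (fun=> 0, fun=> 0).
  have [|P [P' [h1 h2 h3]]] := @radial_representative R f (w k) k (lp k4).1 (lw k4).1 (mp k4) (@mw k).
    move=> th dth B K s1 D z1 z2 B0 b1 b2.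
    exact: (@weak_radial R th dth B K s1 D z1 z2 B0 b1 b2 f v (w k) (Ordinal k4)
      su sv (fun i => (vP i).2) (@mw k) (hw k4)).
  by exists (P, P').
have [F hF] := choice h.
by exists (fun k => (F k).1), (fun k => (F k).2).
Qed.

Let sup_p k : (k < 4)%N -> aeH (fun x => `|p k x| <= e).
Proof.
move=> k4; pose q : T -> R := (p k) \_ H.
have mq : measurable_fun setT q by apply/(measurable_restrictT _ (@mH R)); exact: mp.
have qp x : 0 < x -> q x = p k x by move=> x0; rewrite /q patchE mem_set//; exact/inH.
have mA : measurable ([set x | `|q x| <= e] : set T).
  rewrite (_ : [set x | _] = (fun x => `|q x|) @^-1` `]-oo, e]); last first.
    by apply/seteqP; split => x /=; rewrite in_itv.
  rewrite -[X in measurable X]setTI; apply: (measurableT_comp _ mq) => //.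
have hA : aeH [set x | `|q x| <= e].
  apply: polar_ae => //; apply: (ae3_imp _ (ae3_and (Linfnorm_le hNN.2) (@ae3_enorm R))).
  by move=> z [h z0] /=; rewrite qp//; apply: le_trans h; exact: rc_le.
by apply: (aeH_imp _ hA) => x x0; rewrite /= qp.
Qed.

Let lth k : (k < 4)%N -> l2 (fun x => x * d k x).
Proof.
move=> k4; have [m1 i1] := ldu k4.
pose E := fine (\int[L3]_z ((rc k (du z)) ^+ 2)%:E)%E.
have fin : (\int[L3]_z ((rc k (du z)) ^+ 2)%:E)%E \is a fin_num.
  exact: (@integrable_fin_num _ _ _ L3 _ measurableT _ i1).
have [] // := @radial_nm_le R (d k) E (md k4) _.
rewrite /E fineK//; apply: ae_ge0_le_integral => //.
- by move=> z _; rewrite lee_fin sqr_ge0.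
- apply: (@measurable_radial R _ _ (fun x : T => ((d k x) ^+ 2)%:E)).
  by apply/measurable_EFinP; apply: measurable_funX; exact: md.
- by move=> z _; rewrite lee_fin sqr_ge0.
- by apply/measurable_EFinP; exact: measurable_funX.
- by apply: (ae3_imp _ (hd k4)) => z -> _.
Qed.

Let absid : abscont (fun x : R => x) (fun=> 1).
Proof. by apply: abscont_C1 => x _; exact: cst_continuous. Qed.

(** Multiplication by x is harmless beyond 1; below 1 the pointwise bound is used. *)
Let l2_low (P : R -> R) : measurable_fun H P -> (forall x, 0 < x -> `|P x| <= e) ->
  l2 (fun x => x * P x) -> l2 P /\ nm P ^+ 2 <= e ^+ 2 + nm (fun x => x * P x) ^+ 2.
Proof.
move=> mP hP lP; pose O : set T := `]0, 1]%classic.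
have mO : measurable O by exact: measurable_itv.
have OH : O `<=` H by move=> x; rewrite /O/= in_itv/= => /andP[x0 _]; exact/inH.
have iO : intg mu O (fun=> e ^+ 2).
  apply: (intg_sub mO (mItv 0 1)); last exact: intg_cst_itv.
  by move=> x; rewrite /O/= !in_itv/= => /andP[x0 ->]; rewrite ltW.
have muO : Int mu O (fun=> e ^+ 2) = e ^+ 2.
  rewrite /Int Rintegral_cst// (_ : mu O = 1%E) ?mulr1//.
  by rewrite (_ : mu O = @lebesgue_measure R `]0, 1]%classic)// lebesgue_measure_itv/= lte_fin ltr01 sube0.
pose g x := e ^+ 2 * \1_O x.
have off x : 0 < x -> ~ O x -> g x = 0 by move=> _ Ox; rewrite /g indicE memNset// mulr0.
have gO x : O x -> e ^+ 2 = g x by move=> Ox; rewrite /g indicE mem_set// mulr1.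
have iO2 : intg mu O g by apply: (@intg_eq _ _ _ mu _ mO (fun=> e ^+ 2)).
have [ig Ig] := I_support mO OH off iO2.
have bnd x : 0 < x -> P x ^+ 2 <= g x + (x * P x) ^+ 2.
  move=> x0; have [x1|x1] := leP x 1.
    rewrite -gO; last by rewrite /O/= in_itv/= x0.
    rewrite -[leLHS]real_normK ?num_real//.
    apply: (@le_trans _ _ (e ^+ 2)); last by rewrite lerDl sqr_ge0.
    by rewrite ler_pXn2r ?nnegrE ?(ltW e0)// hP.
  rewrite off// ?add0r; last by rewrite /O/= in_itv/= => /andP[_]; rewrite leNgt x1.
  rewrite exprMn -[leLHS]mul1r ler_wpM2r ?sqr_ge0//.
  by rewrite -[leLHS](expr1n _ 2) ler_pXn2r ?nnegrE ?(ltW x0)// ltW.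
have ib : ih (fun x => g x + (x * P x) ^+ 2) by apply: ihD => //; exact: l2_sqr.
have iP : ih (fun x => P x ^+ 2).
  apply: (ih_le _ ib); first exact: measurable_funX.
  by move=> x x0; rewrite ger0_norm ?sqr_ge0// bnd.
split; first by split.
rewrite !nm_sqr -[X in X + _]muO (@Int_eq _ _ _ mu O _ _ gO) -Ig -ID//; last exact: l2_sqr.
exact: I_le.
Qed.

(** A bounded radial H^1 function solving the equation at one time becomes a small
    state on the half-line: Y = x P with P the absolutely continuous
    representative of the profile. Multiplication by x turns d/dx + 2/x and d/dx
    into [Lp] and [Lm]. *)
Lemma snapshot : exists Y Y' : nat -> R -> R,
  [/\ small (Kp * e) Y Y', evol m (wfun W1 W2) Y Y' (fun k x => x * d k x) &
      forall k, (k < 4)%N -> aeH (fun x => Y k x = x * rc k (f x))].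
Proof.
have [P [P' hP]] := rep.
pose Y k x := x * P k x; pose Y' k x := P k x + x * P' k x.
exists Y, Y'.
have ip0 : 0 < (pc R)^-1 by rewrite invr_gt0.
have supP k x : (k < 4)%N -> 0 < x -> `|P k x| <= e.
  move=> k4; have [a1 a2 _] := hP k k4; move: x; apply: (abscont_ae_bound a1).
  by apply: (aeH_imp _ (aeH_and a2 (sup_p k4))) => x _ [->].
have mP k : (k < 4)%N -> measurable_fun H (P k).
  by move=> k4; have [a1 _ _] := hP k k4; exact: abscont_meas a1.
have mP' k : (k < 4)%N -> measurable_fun H (P' k).
  by move=> k4; have [a1 _ _] := hP k k4; exact: abscont_meas' a1.
have Yp k : (k < 4)%N -> aeH (fun x => Y k x = x * p k x).
  by move=> k4; have [_ a2 _] := hP k k4; apply: (aeH_imp _ a2) => x _; rewrite /Y => ->.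
have mY k : (k < 4)%N -> measurable_fun H (Y k).
  by move=> k4; apply: measurable_funM => //; exact: mP.
have lY k : (k < 4)%N -> l2 (Y k).
  move=> k4; exact: (@L2_ae _ _ _ mu H (@mH R) _ _ (mY k k4) (lp k4).1 (Yp k k4)).
have nY k : (k < 4)%N -> pc R * nm (Y k) ^+ 2 <= e ^+ 2.
  move=> k4; rewrite (nm_ae (mY k k4) (l2_meas (lp k4).1) (Yp k k4)); exact: (lp k4).2.
have mX k : (k < 4)%N -> measurable_fun H (fun x : T => x * P' k x : T).
  by move=> k4; apply: measurable_funM => //; exact: mP'.
have Xw k : (k < 4)%N -> aeH (fun x => x * P' k x = x * w k x).
  by move=> k4; have [_ _ a3] := hP k k4; apply: (aeH_imp _ a3) => x _ ->.
have lX k : (k < 4)%N -> l2 (fun x => x * P' k x).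
  move=> k4; exact: (@L2_ae _ _ _ mu H (@mH R) _ _ (mX k k4) (lw k4).1 (Xw k k4)).
have nX k : (k < 4)%N -> nm (fun x => x * P' k x) <= (1 + (pc R)^-1) * e.
  move=> k4; rewrite (nm_ae (mX k k4) (l2_meas (lw k4).1) (Xw k k4)).
  by apply: root_le; rewrite ?nm_ge0 ?(ltW e0)//; exact: (lw k4).2.
have lP k : (k < 4)%N -> l2 (P k) /\ nm (P k) ^+ 2 <= e ^+ 2 + nm (Y k) ^+ 2.
  move=> k4; apply: l2_low; [exact: mP|by move=> x x0; exact: supP|exact: lY].
have nP k : (k < 4)%N -> nm (P k) <= (1 + (pc R)^-1) * e.
  move=> k4; have [_ h] := lP k k4; have h2 := nY k k4.
  rewrite -(@ler_pXn2r _ 2)// ?nnegrE ?nm_ge0 ?mulr_ge0 ?addr_ge0 ?(ltW ip0) ?(ltW e0)//.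
  apply: (le_trans h); rewrite mulrC -ler_pdivlMr// mulrC in h2.
  apply: (@le_trans _ _ (e ^+ 2 + (pc R)^-1 * e ^+ 2)); first by rewrite lerD2l.
  have -> : e ^+ 2 + (pc R)^-1 * e ^+ 2 = (1 + (pc R)^-1) * e ^+ 2 by ring.
  rewrite exprMn ler_wpM2r ?sqr_ge0//.
  by move: (pc R)^-1 ip0 => c c0; nra.
have Kp1 : (1 + (pc R)^-1) * e <= Kp * e.
  rewrite ler_pM2r// /polar_loss; move: (pc R)^-1 ip0 => c c0; lra.
have aY k : (k < 4)%N -> abscont (Y k) (Y' k).
  move=> k4; have [a1 _ _] := hP k k4.
  by apply: abscont_eq (abscontM absid a1) => x _ //; rewrite /Y' ?mul1r.
have lY' k : (k < 4)%N -> l2 (Y' k) by move=> k4; apply: l2D; [have [] := lP k k4|exact: lX].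
have supY k x : (k < 4)%N -> 0 < x -> `|Y k x| <= Kp * e * x.
  move=> k4 x0; rewrite /Y normrM gtr0_norm// mulrC ler_pM2r//.
  apply: (le_trans (supP k x k4 x0)); apply: le_trans Kp1.
  by rewrite -[leLHS]mul1r ler_pM2r// lerDl ltW.
split => //.
- split => //.
  + by move=> k k4; split; [exact: aY|exact: lY|exact: lY'|exists (Kp * e) => x x0; exact: supY].
  + move=> k k4; apply: le_trans Kp1.
    by apply: root_le; rewrite ?nm_ge0 ?(ltW e0)//; exact: nY.
  + move=> k k4; apply: (le_trans (nmD (lP k k4).1 (lX k k4))).
    by rewrite /polar_loss mulr_natl mulr2n mulrDl; apply: lerD; [exact: nP|exact: nX].
- split; first by move=> k k4; exact: lth.
  move=> k k4.
  have aP j : (j < 4)%N -> aeH (fun x => P j x = p j x /\ P' j x = w j x).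
    by move=> j4; have [_ a2 a3] := hP j j4; exact: aeH_and.
  apply: (aeH_imp _ (aeH_and (aeH_and (aP 0%N isT) (aP 1%N isT)) (aeH_and (aP 2%N isT) (aP 3%N isT)))).
  move=> x x0 [[[a0 b0] [a1 b1]] [[a2 b2] [a3 b3]]].
  have xn : x != 0 by rewrite gt_eqF.
  have yd j : Y j x / x = P j x by rewrite /Y mulrAC divff// mul1r.
  have We k0 : wfun W1 W2 k0 (fun j => Y j x / x) = wfun W1 W2 k0 (fun j => rc j (f x)).
    have E j : (j.+1 < 4)%N -> (j == 0%N) || (j == 2%N) ->
        zc j (fun i => Y i x / x) = zc j (fun i => rc i (f x)).
      move=> _ /orP[] /eqP ->; rewrite /zc !yd; first by rewrite a0 a1.
      by rewrite a2 a3.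
    by rewrite /wfun (E 0%N)// (E 2%N).
  rewrite /nl We.
  case: k k4 => [|[|[|[|k]]]] // _; rewrite /Lin /Lp /Lm /Y' /Y ?a0 ?a1 ?a2 ?a3 ?b0 ?b1 ?b2 ?b3 /w /slope /p;
    by field.
Qed.

End Snapshot.

(** * From profiles back to the mass in a ball *)

Section Final.
Context (R : realType).
Local Notation mu := (leb R).
Local Notation T := (measurableTypeR R).
Local Notation T3 := (T * T * T)%type.
Local Notation H := (H R).
Local Notation L3 := (leb3 R).
Implicit Types (u U : E3 R -> C2 R) (k : nat).

Lemma rcB k (z z' : C2 R) : (k < 4)%N -> rc k (z - z') = rc k z - rc k z'.
Proof.
case: z z' => [[a b] [c d]] [[a' b'] [c' d']].
by case: k => [|[|[|[|k]]]].
Qed.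

Lemma rc_diff_quotient k (u : R -> E3 R -> C2 R) t h z : (k < 4)%N ->
  rc k (diff_quotient u t h z) = h^-1 * (rc k (u (t + h) z) - rc k (u t z)).
Proof.
rewrite /diff_quotient; case: (u (t + h) z) (u t z) => [[a b] [c d]] [[a' b'] [c' d']].
by case: k => [|[|[|[|k]]]] // _; rewrite /rc/=; ring.
Qed.

Lemma radial_nm_bound (g : R -> R) k U (e : R) : (k < 4)%N -> measurable_fun H g ->
  meas4 U -> 0 <= e -> ae3 (fun z => g (enorm z) = rc k (U z)) -> (L2norm U <= e%:E)%E ->
  nm (fun x => x * g x) <= (1 + (pc R)^-1) * e.
Proof.
move=> k4 mg mU e0 hg hU; apply: root_le; rewrite ?nm_ge0//.
apply: (radial_nm_le mg _).2; apply: (le_trans (radial_integral_le k4 mg mU hg)).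
rewrite -powR_mulrn// -poweR_EFin gt0_ler_poweR// in_itv/=.
  by rewrite leey L2norm_on_ge0.
by rewrite lee_fin e0 leey.
Qed.

Lemma radial_nm_cvg (F : set_system R) {FF : Filter F} (g : R -> R -> R) k (U : R -> E3 R -> C2 R)
    (n : R -> R) : (k < 4)%N ->
  (\forall h \near F, [/\ measurable_fun H (g h), meas4 (U h),
     ae3 (fun z => g h (enorm z) = rc k (U h z)) & n h = nm (fun x => x * g h x)]) ->
  L2norm (U h) @[h --> F] --> 0%E -> n h @[h --> F] --> (0 : R).
Proof.
move=> k4 hF hU.
have /fine_cvgP[fin lim] := hU.
have lim2 : (1 + (pc R)^-1) * fine (L2norm (U h)) @[h --> F] --> (0 : R).
  by rewrite -[X in _ --> X](mulr0 (1 + (pc R)^-1)); apply: cvgM lim; exact: cvg_cst.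
apply: (squeeze_cvgr _ (cvg_cst 0) lim2); near=> h.
have [m1 m2 m3 ->] : [/\ measurable_fun H (g h), meas4 (U h),
     ae3 (fun z => g h (enorm z) = rc k (U h z)) & n h = nm (fun x => x * g h x)] by near: h.
have fh : L2norm (U h) \is a fin_num by near: h.
rewrite nm_ge0/=; apply: (radial_nm_bound k4 m1 m2 _ m3); last by rewrite fineK.
by rewrite fine_ge0// L2norm_on_ge0.
Unshelve. all: by end_near. Qed.

Lemma L2norm_on_sqrt D u : L2norm_on D u = ((L2norm_on D u `^ 2) `^ 2^-1)%E.
Proof. by rewrite -poweRrM mulfV// poweRe1// L2norm_on_ge0. Qed.

Lemma L2norm_on_le D u (B : R) : 0 <= B -> (L2norm_on D u `^ 2 <= B%:E)%E ->
  (L2norm_on D u <= (Num.sqrt B)%:E)%E.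
Proof.
move=> B0 h; rewrite L2norm_on_sqrt -powR12_sqrt// -poweR_EFin gt0_ler_poweR// in_itv/=.
  by rewrite leey poweR_ge0.
by rewrite lee_fin B0 leey.
Qed.

(** In the ball of radius a the weight rho^4 is at least (1 + a)^-4. *)
Lemma local_mass_le (f : R -> C2 R) (Y : nat -> R -> R) (a : R) : 0 < a ->
  meas4 (radial_ext f) -> (forall k, (k < 4)%N -> l2 (Y k)) ->
  (forall k, (k < 4)%N -> aeH (fun x => Y k x = x * rc k (f x))) ->
  (L2norm_on (eball a) (radial_ext f) <=
   (Num.sqrt (pc R * (1 + a) ^+ 4 * \sum_(k < 4) I (fun x => rho x ^+ 4 * Y k x ^+ 2)))%:E)%E.
Proof.
move=> a0 mf lY hY; have p0 := pc_gt0 R.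
have a1 : 0 < 1 + a by rewrite addr_gt0.
pose c := pc R * (1 + a) ^+ 4; have c0 : 0 <= c by rewrite mulr_ge0 ?exprn_ge0 ?(ltW p0) ?(ltW a1).
have mrho : measurable_fun H (fun x : T => rho x ^+ 4 : T).
  by apply: measurable_funX; exact: abscont_meas (abscont_inv ler01).
have iY (k : 'I_4) : ih (fun x => rho x ^+ 4 * Y k x ^+ 2).
  have [mY i2] := lY k (ltn_ord k); apply: (ih_le _ i2).
    by apply: measurable_funM => //; exact: measurable_funX.
  move=> x x0; have /andP[r0 r1] := rhoX_le1 4 x0.
  by rewrite normrM ger0_norm// ger0_norm ?sqr_ge0// ler_piMl// sqr_ge0.
have isum : ih (fun x => c * \sum_(k < 4) rho x ^+ 4 * Y k x ^+ 2).
  by apply: ihZ; exact: intg_sum.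
apply: L2norm_on_le.
  rewrite -/c mulr_ge0// sumr_ge0// => k _; apply: I_ge0 => x x0.
  by rewrite mulr_ge0 ?sqr_ge0//; case/andP: (rhoX_le1 4 x0).
have mp k : (k < 4)%N -> measurable_fun H (fun x : T => rc k (f x) : T) by move=> k4; exact: profile_meas.
have ms : measurable_fun H (fun x : T => spnorm (f x) ^+ 2 : T).
  rewrite (_ : (fun _ => _) = fun x => \sum_(k < 4) rc k (f x) ^+ 2).
    by apply: measurable_sum => k; apply: measurable_funX; exact: mp.
  by apply/funext => x; rewrite spnorm_sqr.
pose F (x : T) := if x < a then (spnorm (f x) ^+ 2)%:E else 0%E.
have mF : measurable_fun H F.
  rewrite (_ : F = fun x : T => (\1_(`]-oo, a[%classic : set T) x * spnorm (f x) ^+ 2)%:E).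
    have mi : measurable_fun H (\1_(`]-oo, a[%classic : set T) : T -> T).
      by apply: measurable_funTS; apply: measurable_indic; exact: measurable_itv.
    by apply/measurable_EFinP; exact: measurable_funM.
  apply/funext => x; rewrite /F indicE mem_setE in_itv/=.
  by case: ifP => _; rewrite ?mul1r// mul0r.
have F0 x : (0 <= F x)%E by rewrite /F; case: ifP => _ //; rewrite lee_fin sqr_ge0.
rewrite L2norm_on_sqr integral_mkcond.
rewrite (_ : (\int[L3]_z _)%E = (\int[L3]_z F (enorm z))%E); last first.
  apply: eq_integral => z _; rewrite patchE /F.
  have [za|za] := boolP (enorm z < a); first by rewrite mem_set.
  by rewrite memNset// => h; move/negP: za; apply.
rewrite polar_integral//.
have -> : (pc R * (1 + a) ^+ 4 * \sum_(k < 4) I (fun x => rho x ^+ 4 * Y k x ^+ 2))%:E =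
   (\int[mu]_(x in H) (c * \sum_(k < 4) rho x ^+ 4 * Y k x ^+ 2)%:E)%E.
  have h := @Int_sum _ _ _ mu H (@mH R) 'I_4 _ iY.
  rewrite -/c /I -h -(IZ c (intg_sum (@mH R) iY)) /I /Int /Rintegral fineK//.
  exact: (@integrable_fin_num _ _ _ mu _ (@mH R) _ isum).
have aY k : (k < 4)%N -> aeH (fun x => Y k x = x * rc k (f x)) := hY k.
apply: ae_ge0_le_integral => //.
- by move=> x /inH x0; rewrite mule_ge0// lee_fin mulr_ge0 ?sqr_ge0// ltW.
- by apply: emeasurable_funM => //; apply/measurable_EFinP; apply: measurable_funM => //; apply: measurable_funX.
- move=> x /inH x0; rewrite lee_fin mulr_ge0// sumr_ge0// => k _.
  by rewrite mulr_ge0 ?sqr_ge0//; case/andP: (rhoX_le1 4 x0).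
- exact: (@measurable_int _ _ _ mu _ _ isum).
apply: (aeH_imp _ (aeH_and (aeH_and (hY 0%N isT) (hY 1%N isT)) (aeH_and (hY 2%N isT) (hY 3%N isT)))).
move=> x x0 [[y0 y1] [y2 y3]].
have yE (k : 'I_4) : Y k x = x * rc k (f x) by case: k => -[|[|[|[|//]]]] k4.
rewrite /F; case: ifP => xa; last first.
  rewrite mul0e lee_fin mulr_ge0// sumr_ge0// => k _.
  by rewrite mulr_ge0 ?sqr_ge0//; case/andP: (rhoX_le1 4 x0).
rewrite -EFinM lee_fin.
under eq_bigr do rewrite yE exprMn.
rewrite -mulr_sumr -mulr_sumr -spnorm_sqr.
have r1 : 1 <= (1 + a) * rho x.
  by rewrite /rho ler_pdivlMr ?addr_gt0// mul1r lerD2l ltW.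
have r4 : 1 <= ((1 + a) * rho x) ^+ 4 by rewrite exprn_ege1.
have -> : c * (rho x ^+ 4 * (x ^+ 2 * spnorm (f x) ^+ 2)) =
  ((1 + a) * rho x) ^+ 4 * (spnorm (f x) ^+ 2 * (pc R * x ^+ 2)).
  by rewrite /c exprMn; ring.
have hh : 0 <= spnorm (f x) ^+ 2 * (pc R * x ^+ 2).
  exact: mulr_ge0 (sqr_ge0 _) (mulr_ge0 (ltW p0) (sqr_ge0 _)).
by rewrite ler_peMl.
Qed.

Lemma L2norm_on_ae D u U : measurable D -> meas4 u -> meas4 U ->
  ae3 (fun z => spnorm (u z) = spnorm (U z)) -> L2norm_on D u = L2norm_on D U.
Proof.
move=> mD mu mU h; rewrite L2norm_on_sqrt [RHS]L2norm_on_sqrt; congr (_ `^ _)%E.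
rewrite !L2norm_on_sqr; apply: ae_eq_integral => //.
- by apply: measurable_funTS; exact: measurable_spnorm_sqr.
- by apply: measurable_funTS; exact: measurable_spnorm_sqr.
- by apply: (ae3_imp _ h) => z -> _.
Qed.

Lemma L2norm_on_eq0 D u : measurable D -> meas4 u -> L2norm_on D u = 0%E ->
  ae3 (fun z => D z -> u z = (0, 0)).
Proof.
move=> mD mu h.
have mS := measurable_funTS (D := D) (measurable_spnorm_sqr mu).
have : (\int[L3]_(z in D) `|(spnorm (u z) ^+ 2)%:E| = 0)%E.
  rewrite (_ : (\int[L3]_(z in D) _)%E = (L2norm_on D u `^ 2)%E); first by rewrite h poweR_EFin powR0.
  by rewrite L2norm_on_sqr; apply: eq_integral => z _; rewrite gee0_abs// lee_fin sqr_ge0.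
move=> /(ae_eq_integral_abs L3 mD mS); apply: ae3_imp => z hz Dz.
have /eqP := hz Dz; rewrite eqe sqrf_eq0 => /eqP z0.
have rz k : (k < 4)%N -> rc k (u z) = 0.
  by move=> k4; apply/eqP; rewrite -normr_le0 -z0; exact: rc_le.
case: (u z) rz => [[p q] [r s]] rz.
have /= := rz 0%N isT; have /= := rz 1%N isT; have /= := rz 2%N isT; have /= := rz 3%N isT.
by rewrite /rc/= => -> -> -> ->.
Qed.

Lemma spnorm_cis (b : R) (z1 z2 : R[i]) : spnorm (cis b * z1, cis b * z2) = spnorm (z1, z2).
Proof.
rewrite /spnorm /= !Normc.normcM.
have -> : Normc.normc (cis b) = 1 by rewrite /cis /= cos2Dsin2 sqrtr1.
by rewrite !mul1r.
Qed.

End Final.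

(** * Decay and the absence of solitons and breathers *)

Section Evolution.
Context (R : realType).
Local Notation T := (measurableTypeR R).
Local Notation H := (H R).
Implicit Types (k : nat) (a : R).
Variables (m : R) (W1 W2 : R[i] -> R[i] -> R[i]).
Hypothesis hW1 : pure_power_poly W1.
Hypothesis hW2 : pure_power_poly W2.
Variables (K dd : R).
Hypothesis hK : cubic (wfun W1 W2) K.
Hypothesis dd0 : 0 < dd.
Hypothesis dd1 : 4 * dd <= 1.
Hypothesis dd2 : 24 * (Kc m K * dd ^+ 2) <= 1.
Variables (phi : R -> R -> C2 R) (du : R -> E3 R -> C2 R).
Local Notation u := (fun t => radial_ext (phi t)).
Hypothesis hC : C_H1 u.
Hypothesis hdu : C1_L2 u du.
Hypothesis heq : forall t : R, {ae leb3 R, forall x : E3 R,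
      let z := radial_ext (phi t) x in
      ('i)%C * (du t x).1 =
        (radial_deriv (radial_ext (phi t)) x).2 + ((2 / enorm x)%:C)%C * z.2
        + (m%:C)%C * z.1 - W1 z.1 z.2 /\
      ('i)%C * (du t x).2 =
        - (radial_deriv (radial_ext (phi t)) x).1 - (m%:C)%C * z.2 + W2 z.1 z.2}.
Hypothesis hN : forall t, 0 <= t -> (H1Linfnorm (u t) <= (dd / polar_loss R)%:E)%E.

Let mu4 t : meas4 (u t). Proof. exact: sq4_meas (inL2_sq4 (hC t).1.1). Qed.
Let sdu t : sq4 (du t). Proof. by have [_ h _ _] := hdu t; exact: inL2_sq4. Qed.
Let mphi t k : (k < 4)%N -> measurable_fun H (fun x : T => rc k (phi t x) : T).
Proof. by move=> k4; exact: profile_meas (mu4 t). Qed.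

Let dq t h k x : R := h^-1 * (rc k (phi (t + h) x) - rc k (phi t x)).

Let mdq t h k : (k < 4)%N -> measurable_fun H (fun x : T => dq t h k x : T).
Proof. by move=> k4; apply: measurable_funM => //; apply: measurable_funB; exact: mphi. Qed.

Let dqE t h k z : (k < 4)%N -> rc k ((diff_quotient u t h - du t) z) =
  dq t h k (enorm z) - rc k (du t z).
Proof. by move=> k4; rewrite [LHS](@rcB R k (diff_quotient u t h z))// rc_diff_quotient. Qed.

Let mdiff t h : meas4 (diff_quotient u t h - du t).
Proof.
move=> k k4; rewrite (_ : (fun z => _) = (fun z => dq t h k (enorm z) - rc k (du t z))).
  apply: measurable_funB; last exact: sq4_meas (sdu t) k k4.
  by apply: (@measurable_radial R _ T (fun x => dq t h k x)); exact: mdq.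
by apply/funext => z; exact: dqE.
Qed.

(** The time derivative is radial as a limit of radial difference quotients. *)
Let profile t : exists d : nat -> R -> R, forall k, (k < 4)%N ->
  measurable_fun H (d k) /\ ae3 (fun z => rc k (du t z) = d k (enorm z)).
Proof.
have [_ _ lim _] := hdu t.
have hs n : exists h : R, (L2norm (diff_quotient u t h - du t)%R <= (2^-1 ^+ n.+1)%:E)%E.
  have /fine_cvgP[fin lim2] := lim.
  have e0 : 0 < (2^-1 : R) ^+ n.+1 by rewrite exprn_gt0// invr_gt0.
  have small_h : \forall h \near (0 : R)^',
      fine (L2norm (diff_quotient u t h - du t)%R) < 2^-1 ^+ n.+1 by exact: (cvgr_lt _ lim2).
  have [h [h1 h2]] : exists h : R, (L2norm (diff_quotient u t h - du t)%R \is a fin_num) /\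
      fine (L2norm (diff_quotient u t h - du t)%R) < 2^-1 ^+ n.+1.
    by apply: (@filter_ex _ ((0 : R)^')); exact: filterI fin small_h.
  by exists h; rewrite -(fineK h1) lee_fin ltW.
have [h hh] := choice hs.
have hk k : exists dk : R -> R, (k < 4)%N ->
    measurable_fun H dk /\ ae3 (fun z => rc k (du t z) = dk (enorm z)).
  have [k4|k4] := ltnP k 4; last by exists (fun=> 0).
  have [||n|dk m1 a1] := @radial_limit R (fun n => dq t (h n) k) (fun z => rc k (du t z)).
  - by move=> n; exact: mdq.
  - exact: sq4_meas (sdu t) k k4.
  - rewrite (_ : (\int[leb3 R]_z _)%E =
      (\int[leb3 R]_z ((rc k ((diff_quotient u t (h n) - du t) z)) ^+ 2)%:E)%E); last first.
      by apply: eq_integral => z _; rewrite dqE.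
    apply: (le_trans (comp_integral_le k4 (mdiff t (h n)))).
    apply: (@le_trans _ _ ((2^-1 ^+ n.+1)%:E `^ 2)%E).
      rewrite gt0_ler_poweR// in_itv/= ?leey ?andbT; first exact: L2norm_on_ge0.
      by rewrite lee_fin exprn_ge0// invr_ge0.
    rewrite poweR_EFin powR_mulrn ?exprn_ge0 ?invr_ge0// lee_fin addn1 div1r natrX exprVn.
    rewrite expr2 -[leRHS]mulr1 ler_pM2l ?invr_gt0 ?exprn_gt0//.
    by rewrite invf_le1 ?exprn_gt0// exprn_ege1// ler1n.
  - by exists dk.
have [d hd] := choice hk.
by exists d.
Qed.

(** Representatives are chosen at each time separately: continuity and
    differentiability in time concern classes in L^2, which do not depend on the
    choice. *)
Lemma mass_decay a : 0 < a -> L2norm_on (eball a) (u t) @[t --> +oo%R] --> 0%E.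
Proof.
move=> a0; have pl0 : 0 < polar_loss R.
  by rewrite /polar_loss mulr_gt0// addr_gt0// invr_gt0 pc_gt0.
have [d hd] := choice profile.
have md t k : (k < 4)%N -> measurable_fun H (d t k) by move=> k4; have [] := hd t k k4.
have ad t k : (k < 4)%N -> ae3 (fun z => rc k (du t z) = d t k (enorm z)).
  by move=> k4; have [] := hd t k k4.
have snap t : exists YY : (nat -> R -> R) * (nat -> R -> R), 0 <= t ->
  [/\ small dd YY.1 YY.2, evol m (wfun W1 W2) YY.1 YY.2 (fun k x => x * d t k x) &
      forall k, (k < 4)%N -> aeH (fun x => YY.1 k x = x * rc k (phi t x))].
  have [t0|t0] := leP 0 t; last by exists (fun _ _ => 0, fun _ _ => 0).
  have e0 : 0 < dd / polar_loss R by rewrite divr_gt0.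
  have [Y [Y' [h1 h2 h3]]] := @snapshot R m W1 W2 hW1 hW2 (phi t) (du t) (d t)
    (dd / polar_loss R) e0 (hC t).1 (hN t0) (md t) (ad t) (sdu t) (heq t).
  by exists (Y, Y') => _; split => //; rewrite mulrCA divff ?gt_eqF// mulr1 in h1.
have [S hS] := choice snap.
pose Y t := (S t).1; pose Y' t := (S t).2; pose Th t k x := x * d t k x.
have sm t : 0 <= t -> small dd (Y t) (Y' t) by move=> /hS[].
have ev t : 0 <= t -> evol m (wfun W1 W2) (Y t) (Y' t) (Th t) by move=> /hS[].
have aY t k : 0 <= t -> (k < 4)%N -> aeH (fun x => Y t k x = x * rc k (phi t x)).
  by move=> /hS[_ _ h]; exact: h.
have lY t k : 0 <= t -> (k < 4)%N -> l2 (Y t k).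
  by move=> /sm h k4; have [_ h2 _ _] := small_H10 h k4.
have mY t k : 0 <= t -> (k < 4)%N -> measurable_fun H (Y t k).
  by move=> t0 k4; exact: l2_meas (lY t k t0 k4).
have mTh t k : (k < 4)%N -> measurable_fun H (fun x : T => Th t k x : T).
  by move=> k4; apply: measurable_funM => //; exact: md.
have hD t k : 0 < t -> (k < 4)%N ->
    nm (fun x => h^-1 * (Y (t + h) k x - Y t k x) - Th t k x) @[h --> (0 : R)^'] --> 0.
  move=> t0 k4; have [_ _ lim _] := hdu t.
  apply: (radial_nm_cvg (g := fun h x => dq t h k x - d t k x)
    (U := fun h => diff_quotient u t h - du t) k4 _ lim).
  exists t => //= h; rewrite /ball_/= sub0r normrN => h1 _.
  have th0 : 0 <= t + h by have := ler_norm (- h); rewrite normrN; lra.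
  have mg : measurable_fun H (fun x : T => dq t h k x - d t k x : T).
    by apply: measurable_funB; [exact: mdq|exact: md].
  split => //.
    by apply: (ae3_imp _ (ad t k k4)) => z e; rewrite dqE// e.
  apply: nm_ae.
  - apply: measurable_funB; last exact: mTh.
    by apply: measurable_funM => //; apply: measurable_funB; apply: mY => //; exact: ltW.
  - by apply: measurable_funM.
  - apply: (aeH_imp _ (aeH_and (aY _ _ th0 k4) (aY _ _ (ltW t0) k4))) => x x0 [-> ->].
    by rewrite /dq /Th; ring.
have hCc t k : 0 < t -> (k < 4)%N ->
    nm (fun x => Th s k x - Th t k x) @[s --> t] --> 0.
  move=> t0 k4; have [_ _ _ lim] := hdu t.
  apply: (radial_nm_cvg (g := fun s x => d s k x - d t k x)
    (U := fun s => du s - du t) k4 _ lim).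
  apply: nearW => s; split.
  - by apply: measurable_funB; exact: md.
  - move=> j j4; rewrite (_ : (fun z => _) = (fun z => rc j (du s z) - rc j (du t z))).
      by apply: measurable_funB; [exact: sq4_meas (sdu s) j j4|exact: sq4_meas (sdu t) j j4].
    by apply/funext => z; exact: rcB.
  - apply: (ae3_imp _ (ae3_and (ad s k k4) (ad t k k4))) => z [e1 e2].
    by rewrite [RHS](@rcB R k (du s z) (du t z))// e1 e2.
  - by congr nm; apply/funext => x; rewrite /Th mulrBr.
have ld k : (k < 4)%N -> I (fun x => rho x ^+ 4 * Y t k x ^+ 2) @[t --> +oo] --> 0.
  apply: (local_decay hK dd0 dd1 dd2 (Y' := Y') (Th := Th)) => //.
  - by move=> t /ltW; exact: sm.
  - by move=> t /ltW; exact: ev.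
pose B t := Num.sqrt (pc R * (1 + a) ^+ 4 * \sum_(k < 4) I (fun x => rho x ^+ 4 * Y t k x ^+ 2)).
have Bl : B t @[t --> +oo] --> (0 : R).
  rewrite -[X in _ --> X](@sqrtr0 R); apply: continuous_cvg; first exact: sqrt_continuous.
  rewrite -[X in _ --> X](mulr0 (pc R * (1 + a) ^+ 4)); apply: cvgM; first exact: cvg_cst.
  rewrite (_ : (fun t => \sum_(k < 4) _) = (fun t => I (fun x => rho x ^+ 4 * Y t 0%N x ^+ 2) +
    I (fun x => rho x ^+ 4 * Y t 1%N x ^+ 2) + I (fun x => rho x ^+ 4 * Y t 2%N x ^+ 2) +
    I (fun x => rho x ^+ 4 * Y t 3%N x ^+ 2))); last first.
    by apply/funext => t; exact: (sum4 (fun k => I (fun x => rho x ^+ 4 * Y t k x ^+ 2))).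
  rewrite -[X in _ --> X]addr0 -[X in _ --> X + _]addr0 -[X in _ --> X + _ + _]addr0.
  by do 3 (apply: cvgD; last exact: ld); exact: ld.
have BE : (B t)%:E @[t --> +oo] --> 0%E by apply: cvg_EFin => //; exact: nearW.
apply: (squeeze_cvge _ (cvg_cst 0%E) BE); near=> t.
have t0 : 0 <= t by near: t; exact: nbhs_pinfty_ge.
rewrite L2norm_on_ge0/=; apply: (local_mass_le a0 (mu4 t)) => k k4.
- exact: lY.
- exact: aY.
Unshelve. all: by end_near. Qed.

(** A mass that returns to its value at times tending to infinity is equal to its
    limit. *)
Lemma mass_constant_zero a t : 0 < a ->
  (exists2 s : nat -> R, s n @[n --> \oo] --> +oo &
     forall n, L2norm_on (eball a) (u (s n)) = L2norm_on (eball a) (u t)) ->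
  {ae leb3 R, forall x : E3 R, eball a x -> u t x = (0, 0)}.
Proof.
move=> a0 [s sy hs]; apply: L2norm_on_eq0; [exact: measurable_eball|exact: mu4|].
have lim : L2norm_on (eball a) (u (s n)) @[n --> \oo] --> 0%E.
  exact: (cvg_comp _ _ sy (mass_decay a0)).
have lim2 : L2norm_on (eball a) (u (s n)) @[n --> \oo] --> L2norm_on (eball a) (u t).
  by rewrite (_ : (fun n => _) = (fun=> L2norm_on (eball a) (u t))); [exact: cvg_cst|exact/funext].
exact: (cvg_unique _ lim2 lim).
Qed.

Lemma no_soliton a : 0 < a -> ~ soliton_on (eball a) u.
Proof.
move=> a0 [[om [Phi hPhi]] [t nz]]; apply: nz; apply: mass_constant_zero => //.
exists (fun n => n%:R); first exact: cvgr_idn.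
move=> n; apply: L2norm_on_ae; [exact: measurable_eball|exact: mu4|exact: mu4|].
apply: (ae3_imp _ (ae3_and (hPhi n%:R) (hPhi t))) => z [-> ->].
by rewrite !spnorm_cis.
Qed.

Lemma no_breather a : 0 < a -> ~ breather_on (eball a) u.
Proof.
move=> a0 [[P P0 hP] _ [t nz]]; apply: nz; apply: mass_constant_zero => //.
exists (fun n => t + n%:R * P).
  apply/cvgryPge => A; near=> n.
  rewrite -lerBlDl -ler_pdivrMr//; near: n; exact: nbhs_infty_ger.
elim=> [|n <-]; first by rewrite mul0r addr0.
apply: L2norm_on_ae; [exact: measurable_eball|exact: mu4|exact: mu4|].
apply: (ae3_imp _ (hP (t + n%:R * P))) => z <-.
by rewrite -natr1 mulrDl mul1r addrA.
Unshelve. all: by end_near. Qed.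

End Evolution.

Unset Implicit Arguments.
Theorem theorem1p4 (R : realType) (m : R) (W1 W2 : R[i] -> R[i] -> R[i])
    (hW1 : pure_power_poly W1) (hW2 : pure_power_poly W2)
    (C p : R) (hC : 0 < C) (hp : 3 <= p)
    (hW : forall z w : R[i],
       Normc.normc (W1 z w) + Normc.normc (W2 z w) <= C * spnorm (z, w) `^ p) :
  exists2 delta : R, 0 < delta &
    forall phi : R -> R -> C2 R,
      radial_solution m W1 W2 phi ->
      (ereal_sup [set H1Linfnorm (radial_ext (phi t)) | t in [set t : R | (0 <= t)%R]]
         <= delta%:E)%E ->
      forall a : R, 0 < a ->
        [/\ L2norm_on (eball a) (radial_ext (phi t)) @[t --> +oo%R] --> 0%E,
            ~ soliton_on (eball a) (fun t => radial_ext (phi t)) &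
            ~ breather_on (eball a) (fun t => radial_ext (phi t))].
Proof.
have [K hK] := wfun_cubic hW1 hW2 hp hW.
have k0 : 0 <= Kc m K by exact: Kc_ge0 hK.
(* As dd <= 1, this value satisfies both 4 dd <= 1 and 24 Kc dd^2 <= 1. *)
pose dd := (4 + 24 * Kc m K)^-1.
have q0 : 0 < 4 + 24 * Kc m K by rewrite ltr_wpDr// mulr_ge0.
have dd0 : 0 < dd by rewrite invr_gt0.
have ddE : dd * (4 + 24 * Kc m K) = 1 by rewrite mulVf// gt_eqF.
have dd1 : 4 * dd <= 1 by move: (Kc m K) k0 ddE => c c0 e; nra.
have dd2 : 24 * (Kc m K * dd ^+ 2) <= 1.
  by move: (Kc m K) k0 ddE => c c0 e; have : dd <= 1 by [lra|nra]; nra.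
have pl0 : 0 < polar_loss R.
  by rewrite /polar_loss mulr_gt0// addr_gt0// invr_gt0 pc_gt0.
exists (dd / polar_loss R); first by rewrite divr_gt0.
move=> phi [hu [du hdu heq]] hsup a a0.
have hN t : 0 <= t -> (H1Linfnorm (radial_ext (phi t)) <= (dd / polar_loss R)%:E)%E.
  by move=> t0; apply: le_trans hsup; apply: ereal_sup_ubound; exists t.
split.
- exact: (mass_decay hW1 hW2 hK dd0 dd1 dd2 hu hdu heq hN).
- exact: (no_soliton hW1 hW2 hK dd0 dd1 dd2 hu hdu heq hN).
- exact: (no_breather hW1 hW2 hK dd0 dd1 dd2 hu hdu heq hN).
Qed.
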